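(* Let $n>2$ and let $\{\cdot,\dots,\cdot\}$ be an $n$-linear (over $\mathbb{R}$) skew-symmetric bracket on the space $C^\infty(M)$ of smooth functions on a smooth manifold $M$. Then $\{\cdot,\dots,\cdot\}$ is a Nambu-Jacobi bracket (of order $n$) if and only if for every $f\in C^\infty(M)$ the contraction $\{f,\cdot,\dots,\cdot\}$ is a Nambu-Jacobi bracket (of order $n-1$). Moreover, in this case $$\{f_1,\dots,f_n\}=\Delta_{f_1,\dots,f_n}+s(\Gamma)(f_1,\dots,f_n)\qquad\text{for all } f_1,\dots,f_n\in C^\infty(M)$$ for some $n$-vector field $\Delta$ and some $(n-1)$-vector field $\Gamma$ on $M$ such that: (i) around every point where both $\Delta$ and $\Gamma$ do not vanish there are local coordinates in which $\Delta=\partial_1\wedge\dots\wedge\partial_n$ and $\Gamma=\partial_1\wedge\dots\wedge\partial_{n-1}$, where $\partial_i=\partial/\partial x_i$; (ii) if, locally (on an open set), one of the tensors $\Delta,\Gamma$ vanishes, then there the other one is a Nambu-Poisson tensor (in the case where $n=3$ and $\Delta$ vanishes, $\Gamma$ is an ordinary Poisson tensor of rank $2$), and around each of its regular points it can be written in suitable local coordinates in the form $\Delta=\partial_1\wedge\dots\wedge\partial_n$, respectively $\Gamma=\partial_1\wedge\dots\wedge\partial_{n-1}$.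
   Context: $M$ is a smooth (finite-dimensional, real) manifold, and all functions and multivector fields are smooth. For a $k$-vector field $\Lambda$ and functions $f_1,\dots,f_j$, $j\le k$, write $\Lambda_{f_1,\dots,f_j}=i_{df_j}\cdots i_{df_1}\Lambda$ for the iterated contraction. For an $(n-1)$-vector field $\Gamma$, $$s(\Gamma)(f_1,\dots,f_n)=\sum_{i=1}^n(-1)^{i+1}f_i\,\Gamma_{f_1,\dots,f_{i-1},f_{i+1},\dots,f_n}.$$ The generalized Jacobi identity for a $k$-linear skew-symmetric bracket on $C^\infty(M)$ is $$\{f_1,\dots,f_{k-1},\{g_1,\dots,g_k\}\}=\sum_{i=1}^k\{g_1,\dots,g_{i-1},\{f_1,\dots,f_{k-1},g_i\},g_{i+1},\dots,g_k\}$$ for all $f_1,\dots,f_{k-1},g_1,\dots,g_k$. A Nambu-Jacobi bracket of order $k\ge 2$ on $M$ is an $\mathbb{R}$-$k$-linear skew-symmetric bracket on $C^\infty(M)$ which satisfies the generalized Jacobi identity and is given by a local operator (i.e. it is support-non-increasing in each argument); for $k=2$ these are the usual Jacobi brackets. A $k$-vector field $\Lambda$ ($k\ge2$) is a Nambu-Poisson tensor of order $k$ if the bracket $\{f_1,\dots,f_k\}=\Lambda_{f_1,\dots,f_k}$ satisfies the generalized Jacobi identity; for $k=2$ this is an ordinary Poisson tensor. A regular point of a multivector field is a point at which it does not vanish. A Poisson tensor is said here to be of rank $2$ if its rank is $2$ at each of its regular points (equivalently, it is decomposable there). *)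

(* Defs.v *)
From HB Require Import structures.
From mathcomp Require Import all_boot all_order all_algebra all_fingroup.
From mathcomp Require Import all_classical all_reals all_analysis.
Import Order.TTheory GRing.Theory Num.Theory.
Import numFieldNormedType.Exports.

Set Implicit Arguments.
Unset Strict Implicit.
Unset Printing Implicit Defensive.

Local Open Scope classical_set_scope.
Local Open Scope ring_scope.

(* [Ck r U f]: f is of class C^r on U.  U is meant to be open, so that the
   values of f outside U play no role. *)
Fixpoint Ck (R : realType) (m r : nat) (U : set 'rV[R]_m) (f : 'rV[R]_m -> R)
    : Prop :=
  match r with
  | 0 => forall x, U x -> {for x, continuous f}
  | r'.+1 => (forall x, U x -> differentiable f x) /\
             (forall i : 'I_m, Ck r' U (fun x => 'D_(delta_mx 0 i) f x))
  end.

Definition Cinfty (R : realType) (m : nat) (U : set 'rV[R]_m)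
  (f : 'rV[R]_m -> R) : Prop := forall r, Ck r U f.

(* The coordinate map and its inverse are total functions; they are only
   meaningful on [cdom] and on the image of [cdom] respectively. *)
Record chart (R : realType) (m : nat) (T : topologicalType) := Chart {
  cdom : set T;
  cfun : T -> 'rV[R]_m;
  cinv : 'rV[R]_m -> T;
  cdom_open : open cdom;
  cimg_open : open (cfun @` cdom);
  cfunK : forall p, cdom p -> cinv (cfun p) = p;
  cfun_continuous : forall p, cdom p -> {for p, continuous cfun};
  cinv_continuous : forall x, (cfun @` cdom) x -> {for x, continuous cinv} }.

Definition smooth_transition (R : realType) (m : nat) (T : topologicalType)
    (c c' : chart R m T) : Prop :=
  forall i : 'I_m, Cinfty (cfun c @` (cdom c `&` cdom c'))
                          (fun x => cfun c' (cinv c x) 0 i).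

Definition compatible (R : realType) (m : nat) (T : topologicalType)
    (c c' : chart R m T) : Prop :=
  smooth_transition c c' /\ smooth_transition c' c.

Record manifold (R : realType) (m : nat) := Manifold {
  carrier :> topologicalType;
  manifold_hausdorff : hausdorff_space carrier;
  manifold_second_countable : @second_countable carrier;
  atlas : set (chart R m carrier);
  atlas_cover : forall p : carrier, exists2 c, atlas c & cdom c p;
  atlas_compatible : forall c c', atlas c -> atlas c' -> compatible c c' }.

(* The local coordinate systems of M, i.e. its maximal atlas. *)
Definition coords (R : realType) (m : nat) (M : manifold R m)
    (c : chart R m M) : Prop :=
  forall c', atlas c' -> compatible c c'.

Definition chart_at (R : realType) (m : nat) (M : manifold R m) (p : M)
    : chart R m M :=
  sval (cid2 (@atlas_cover R m M p)).

(* f is smooth on the open subset U of M. *)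
Definition smooth_on (R : realType) (m : nat) (M : manifold R m) (U : set M)
    (f : M -> R) : Prop :=
  forall c : chart R m M, coords c ->
    Cinfty (cfun c @` (cdom c `&` U)) (fun x => f (cinv c x)).

Definition smooth (R : realType) (m : nat) (M : manifold R m) (f : M -> R)
    : Prop := smooth_on [set: M] f.

(* The differential d_p f as the row of partial derivatives of f in the
   coordinates c; rows represent covectors. *)
Definition dfun (R : realType) (m : nat) (M : manifold R m) (c : chart R m M)
    (f : M -> R) (p : M) : 'rV[R]_m :=
  \row_i 'D_(delta_mx 0 i) (fun x => f (cinv c x)) (cfun c p).

(* Entry (a, i) is dy_a/dx_i, with x the coordinates of c and y those of c'. *)
Definition transition_mx (R : realType) (m : nat) (M : manifold R m)
    (c c' : chart R m M) (p : M) : 'M[R]_m :=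
  \matrix_(a, i) dfun c (fun q => cfun c' q 0 a) p 0 i.

Definition multilinear_form (R : realType) (V : lmodType R) (k : nat)
    (L : ('I_k -> V) -> R) : Prop :=
  forall (i : 'I_k) (xi : 'I_k -> V) (a : R) (u v : V),
    L [eta xi with i |-> (a *: u + v)] =
    a * L [eta xi with i |-> u] + L [eta xi with i |-> v].

Definition skew_form (R : realType) (V : lmodType R) (k : nat)
    (L : ('I_k -> V) -> R) : Prop :=
  forall (s : 'S_k) (xi : 'I_k -> V),
    L (fun j => xi (s j)) = (-1) ^+ s * L xi.

(* A smooth k-vector field.  Its value at p is the skew k-linear form
   [mv c p] on the cotangent space at p, covectors being written in the
   coordinates c; a covector with components xi in the coordinates c' has
   components xi *m transition_mx c c' p in the coordinates c. *)
Record mvfield (R : realType) (m : nat) (M : manifold R m) (k : nat) := MvField {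
  mv :> chart R m M -> M -> ('I_k -> 'rV[R]_m) -> R;
  mv_linear : forall c p, coords c -> cdom c p -> multilinear_form (mv c p);
  mv_skew : forall c p, coords c -> cdom c p -> skew_form (mv c p);
  mv_change : forall c c' p, coords c -> coords c' -> cdom c p -> cdom c' p ->
    forall xi, mv c' p xi = mv c p (fun j => xi j *m transition_mx c c' p);
  mv_smooth : forall c, coords c -> forall xi : 'I_k -> 'rV[R]_m,
    smooth_on (cdom c) (fun p => mv c p xi) }.

(* L_{f_1,...,f_k} = i_{df_k} ... i_{df_1} L = L(df_1, ..., df_k). *)
Definition mv_contract (R : realType) (m : nat) (M : manifold R m) (k : nat)
    (L : mvfield M k) (f : 'I_k -> M -> R) : M -> R :=
  fun p => L (chart_at p) p (fun j => dfun (chart_at p) (f j) p).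

Definition vanishes_at (R : realType) (m : nat) (M : manifold R m) (k : nat)
    (L : mvfield M k) (p : M) : Prop :=
  forall xi, L (chart_at p) p xi = 0.

(* [@s_op _ _ _ n G] is s(G) for an n-vector field G; indices start at 0. *)
Definition s_op (R : realType) (m : nat) (M : manifold R m) (n : nat)
    (G : mvfield M n) (f : 'I_n.+1 -> M -> R) : M -> R :=
  fun p => \sum_(i < n.+1)
    (-1) ^+ i * f i p * mv_contract G (fun j => f (lift i j)) p.

(* The k-vector d/dx_1 /\ ... /\ d/dx_k as a form on covectors: the wedge of
   v_1, ..., v_k sends (xi_1, ..., xi_k) to det (xi_a (v_b)). *)
Definition coord_wedge (R : realType) (m k : nat) (hk : (k <= m)%N)
    (xi : 'I_k -> 'rV[R]_m) : R :=
  \det (\matrix_(a < k, b < k) xi a 0 (widen_ord hk b)).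

(* L = d/dx_1 /\ ... /\ d/dx_k on the domain of the coordinates c. *)
Definition equals_coord_wedge (R : realType) (m : nat) (M : manifold R m)
    (k : nat) (L : mvfield M k) (hk : (k <= m)%N) (c : chart R m M) : Prop :=
  forall p, cdom c p -> forall xi, L c p xi = coord_wedge hk xi.

(* A k-ary operation on functions; only its values on smooth functions
   matter (see [is_bracket]). *)
Definition bracket (R : realType) (m : nat) (M : manifold R m) (k : nat) :=
  ('I_k -> M -> R) -> M -> R.

(* (f_1, ..., f_{k-1}, h) *)
Definition snoc (T : Type) (k : nat) (f : 'I_k.-1 -> T) (h : T) : 'I_k -> T :=
  fun j => oapp f h (insub (j : nat)).

(* (h, f_1, ..., f_k) *)
Definition fcons (T : Type) (k : nat) (h : T) (f : 'I_k -> T) : 'I_k.+1 -> T :=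
  fun j => oapp f h (unlift ord0 j).

(* A skew-symmetric k-linear bracket on C^oo(M). *)
Record is_bracket (R : realType) (m : nat) (M : manifold R m) (k : nat)
    (B : bracket M k) : Prop := IsBracket {
  bracket_smooth : forall f, (forall i, smooth (f i)) -> smooth (B f);
  bracket_linear : forall (i : 'I_k) (f : 'I_k -> M -> R) (a : R) (g h : M -> R),
    (forall j, smooth (f j)) -> smooth g -> smooth h -> forall p,
    B [eta f with i |-> (fun q => a * g q + h q)] p =
    a * B [eta f with i |-> g] p + B [eta f with i |-> h] p;
  bracket_skew : forall (s : 'S_k) (f : 'I_k -> M -> R),
    (forall j, smooth (f j)) -> forall p,
    B (fun j => f (s j)) p = (-1) ^+ s * B f p }.

(* The generalized Jacobi identity for the functions on the open set U. *)
Definition jacobi_on (R : realType) (m : nat) (M : manifold R m) (k : nat)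
    (U : set M) (B : bracket M k) : Prop :=
  forall (f : 'I_k.-1 -> M -> R) (g : 'I_k -> M -> R),
    (forall i, smooth_on U (f i)) -> (forall i, smooth_on U (g i)) ->
    forall p, U p ->
    B (snoc f (B g)) p =
    \sum_(i < k) B [eta g with i |-> B (snoc f (g i))] p.

Definition supp (R : realType) (m : nat) (M : manifold R m) (f : M -> R)
    : set M := closure [set p | f p != 0].

Definition is_local (R : realType) (m : nat) (M : manifold R m) (k : nat)
    (B : bracket M k) : Prop :=
  forall f : 'I_k -> M -> R, (forall i, smooth (f i)) ->
  forall i, supp (B f) `<=` supp (f i).

Record nambu_jacobi (R : realType) (m : nat) (M : manifold R m) (k : nat)
    (B : bracket M k) : Prop := NambuJacobi {
  nj_order : (2 <= k)%N;
  nj_bracket : is_bracket B;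
  nj_jacobi : jacobi_on [set: M] B;
  nj_local : is_local B }.

(* L is, on the open set U, a Nambu-Poisson tensor of order k (a Poisson
   tensor when k = 2). *)
Definition nambu_poisson_on (R : realType) (m : nat) (M : manifold R m)
    (k : nat) (U : set M) (L : mvfield M k) : Prop :=
  (2 <= k)%N /\ jacobi_on U (mv_contract L).

(* For k = 2: the rank at p of the bivector L, i.e. of its matrix
   L(dx_i, dx_j). *)
Definition bivector_rank (R : realType) (m : nat) (M : manifold R m) (k : nat)
    (L : mvfield M k) (p : M) : nat :=
  \rank (\matrix_(i < m, j < m) L (chart_at p) p
    (fun a => if a == 0%N :> nat then delta_mx 0 i else delta_mx 0 j)).

(* Every regular point of L in the open set U has a neighbourhood with
   coordinates in which L = d/dx_1 /\ ... /\ d/dx_k. *)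
Definition locally_coord_wedge_on (R : realType) (m : nat) (M : manifold R m)
    (k : nat) (U : set M) (L : mvfield M k) : Prop :=
  forall p, U p -> ~ vanishes_at L p ->
  exists c : chart R m M, [/\ coords c, cdom c p, cdom c `<=` U &
    exists hk : (k <= m)%N, equals_coord_wedge L hk c].

(* Main.v *)
Require Import Defs.
From HB Require Import structures.
From mathcomp Require Import all_boot all_order all_algebra all_fingroup.
From mathcomp Require Import all_classical all_reals all_analysis.
From mathcomp Require Import ring lra zify.
Import Order.TTheory GRing.Theory Num.Theory.
Import numFieldNormedType.Exports.

Set Implicit Arguments.
Unset Strict Implicit.
Unset Printing Implicit Defensive.

Local Open Scope classical_set_scope.
Local Open Scope ring_scope.

(** A local bracket satisfying the identity for its contractions is a first-order operator in each
argument. Freezing all arguments but two gives a local Lie bracket, which has finite order near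
any given point, that point itself possibly excepted (Peetre); expanding the Jacobi identity on
powers of functions vanishing at a point lowers the order down to one. Evaluating the identity at
squares [u * u] with [u p = 0] then gives quadratic relations, from which the value of the bracket
at [p], as a form on functions, is decomposable (exchange relations of Pluecker type).
Decomposability in turn yields the full Jacobi identity, because the defect of that identity is
alternating in all its arguments.

Put [Gamma = B (1, .)] and let [Delta] be what remains of [B] after subtracting [s (Gamma)]; both
are decomposable multivector fields and [Gamma] satisfies the Jacobi identity. For a decomposable
[C] with [C (x_1, ..., x_k) <> 0], the Hamiltonian fields of [x] with one entry omitted, divided
by [C x], are dual to [x] and commute, and solving [D_i phi = g_i] for compatible [g_i]
straightens them. If neither tensor vanishes, the field [Z u = Delta (x_1, ..., x_n, u)] commutes
with the Hamiltonian fields of [Gamma] and is straightened together with them.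

The local analysis (inverse functions, Hadamard's lemma, potentials of commuting fields) rests on
one fact: the Euler scheme of a smooth vector field converges to a map which depends smoothly on
the initial value. *)

(** * Functions of class C^r *)

Section Calculus.
Variable R : realType.
Implicit Types (m : nat).

(** The Jacobi identity of a contraction by [f] is that of the bracket for two groups of arguments
    sharing the entry [f], because the one extra term repeats [f]. This restricted identity is all
    there is to work with until decomposability is known. An order of at least 3 is what makes it
    strong enough: two slots can vary while a common entry stays in both groups, and there is always
    a further slot in which to place a missing basis vector or a second kernel vector. The quadratic
    relations concern entries vanishing at a point, and they are exploited from a family of
    functions, all zero at the point, with non-zero bracket. Such a family may fail to exist on a
    whole neighbourhood. The bracket then has no principal part there, multiplying all [k] arguments
    by [a] multiplies it by [a ^+ k], and comparing the identity before and after this scaling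
    supplies the missing relations. The point left out by Peetre's argument is recovered by
    continuity, unless it is isolated; near an isolated point smooth functions are constant and the
    claim is immediate. *)

Definition pd m (i : 'I_m) (f : 'rV[R]_m -> R) : 'rV[R]_m -> R :=
  fun x => 'D_(delta_mx 0 i) f x.

Definition dotr m (a v : 'rV[R]_m) : R := \sum_i v 0 i * a 0 i.

Lemma dotr_linear m (a : 'rV[R]_m) : linear (dotr a).
Proof.
move=> k u v; rewrite /dotr scaler_sumr -big_split /=.
by apply: eq_bigr => i _; rewrite !mxE mulrDl -mulrA.
Qed.

Lemma rV_norm_le m (v : 'rV[R]_m) i : `|v 0 i| <= `|v|.
Proof.
by rewrite [leRHS]/Num.Def.normr/= mx_normrE (le_bigmax _ _ (ord0, i)).
Qed.

Lemma rV_norm_leP m (v : 'rV[R]_m) (e : R) : 0 <= e ->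
  (forall i, `|v 0 i| <= e) -> `|v| <= e.
Proof.
move=> e0 H; rewrite [leLHS]/Num.Def.normr/= mx_normrE.
by apply/bigmax_le => // -[i j] _; rewrite (ord1 i).
Qed.

Lemma rV_continuous (T : topologicalType) k (g : T -> 'rV[R]_k) (x : T) :
  (forall l, {for x, continuous (fun y => g y 0 l)}) -> {for x, continuous g}.
Proof.
move=> H; apply/cvgrPdist_le => e e0; near=> y.
apply: rV_norm_leP => [|l]; first exact: ltW.
rewrite !mxE; move: l; near: y; apply: filter_forall => l.
by have /cvgrPdist_le/(_ e e0) := H l.
Unshelve. all: by end_near. Qed.

Lemma dotr_continuous m (a : 'rV[R]_m) : continuous (dotr a).
Proof.
apply: continuous_big => [|i _ x]; first exact: add_continuous.
by apply: continuousM; [exact: coord_continuous | exact: cst_continuous].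
Qed.

(** An explicit estimate yields differentiability and every directional derivative at once. It
    serves equal germs, limits of schemes and glued functions, where the rules of calculus do not
    apply. *)
Lemma diff_row_eps m (f : 'rV[R]_m -> R) x (a : 'rV[R]_m) :
  (forall e, 0 < e -> \forall y \near x,
     `|f y - f x - dotr a (y - x)| <= e * `|y - x|) ->
  differentiable f x /\ forall v, 'D_v f x = dotr a v.
Proof.
move=> H.
pose lM := GRing.isLinear.Build _ _ _ _ _ (@dotr_linear m a).
pose L : {linear 'rV[R]_m -> R} := HB.pack (dotr a) lM.
have key : f \o shift x = cst (f x) + L +o_ (nbhs (0 : 'rV[R]_m)) id.
  apply/eqaddoP => e e0; move: (H e e0).
  rewrite [X in X -> _](near_shift 0 x) subr0; apply: filterS => y /=.
  by rewrite !fctE /= addrK opprD addrA.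
have dE := diff_unique (@dotr_continuous m a : continuous L) key.
have df : differentiable f x.
  by apply/diff_locallyP; rewrite dE; split => //; exact: dotr_continuous.
by split=> // v; rewrite deriveE // dE.
Unshelve. all: by end_near. Qed.

Lemma near_eq_differentiable m (f g : 'rV[R]_m -> R) x :
  (\near x, f x = g x) -> differentiable f x -> differentiable g x.
Proof.
move=> fg df.
have -> : g = f + (g - f) by apply/funext => y; rewrite !fctE addrC subrK.
apply: differentiableD => //.
have [|//] := @diff_row_eps m (g - f) x 0 _.
move=> e e0; near=> y.
have -> : (g - f) y = 0 by rewrite !fctE (near fg y) ?subrr //; near: y.
have -> : (g - f) x = 0 by rewrite !fctE (nbhs_singleton fg) subrr.
rewrite subr0 /dotr big1 ?subr0 ?normr0 ?mulr_ge0 ?(ltW e0) // => i _.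
by rewrite [X in _ * X]mxE mulr0.
Unshelve. all: by end_near. Qed.

Lemma derive_row m (f : 'rV[R]_m -> R) x v : differentiable f x ->
  'D_v f x = \sum_i v 0 i * pd i f x.
Proof.
move=> df; rewrite deriveE // {1}[v]row_sum_delta linear_sum /=.
by apply: eq_bigr => i _; rewrite linearZ /= /pd deriveE.
Qed.

Lemma near_open m (U : set 'rV[R]_m) (P : 'rV[R]_m -> Prop) x : open U -> U x ->
  (forall y, U y -> P y) -> \forall y \near x, P y.
Proof.
move=> oU Ux H; have : nbhs x U by apply: open_nbhs_nbhs.
by apply: filterS.
Qed.

Lemma Ck_germ m r (U : set 'rV[R]_m) f g :
  (forall x, U x -> \near x, f x = g x) -> Ck r U f -> Ck r U g.
Proof.
elim: r f g => [|r IH] f g fg /=.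
  move=> cf x Ux; have h := fg x Ux; rewrite /prop_for /continuous_at -(nbhs_singleton h).
  apply: cvg_trans (cf x Ux); exact: (@near_eq_cvg _ _ _ (nbhs_filter x)).
case=> df dk; split=> [x Ux|i].
  by apply: near_eq_differentiable (df x Ux); exact: fg.
apply: (IH _ _ _ (dk i)) => x Ux.
have /near_join := fg x Ux; apply: filterS => y hy.
exact: near_eq_derive.
Qed.

Lemma Ck_ext m r (U : set 'rV[R]_m) f g : open U ->
  (forall x, U x -> f x = g x) -> Ck r U f -> Ck r U g.
Proof.
by move=> oU fg; apply: Ck_germ => x Ux; apply: (@near_open _ U).
Qed.

Lemma Ck_sub m r (U V : set 'rV[R]_m) f : U `<=` V -> Ck r V f -> Ck r U f.
Proof.
move=> UV; elim: r f => [|r IH] f /= => [H x /UV|[df dk]]; first exact: H.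
by split=> [x /UV|i]; [exact: df | exact: IH].
Qed.

(** [Ck r V f] is a conjunction of conditions on the germs of [f] at the points of [V], so that a
    different set may be used around each point. *)
Lemma Ck_pointwise m r (U : set 'rV[R]_m) f :
  (forall x, U x -> exists2 V, V x & Ck r V f) -> Ck r U f.
Proof.
elim: r f => [|r IH] f H /=.
  by move=> x Ux; have [V Vx] := H x Ux; exact.
split=> [x Ux|i]; first by have [V Vx [/(_ x Vx)]] := H x Ux.
by apply: IH => x Ux; have [V Vx [_ h]] := H x Ux; exists V => //; exact: h.
Qed.

Lemma Ck_cont m r (U : set 'rV[R]_m) f : Ck r U f ->
  forall x, U x -> {for x, continuous f}.
Proof.
case: r => [//|r] [df _] x Ux; exact/differentiable_continuous/df.
Qed.

Lemma Ck_S m r (U : set 'rV[R]_m) f : Ck r.+1 U f -> Ck r U f.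
Proof.
elim: r f => [|r IH] f; first exact: (@Ck_cont _ 1).
by move=> [df dk]; split => // i; apply: IH; apply: dk.
Qed.

Lemma Ck_cst m r (U : set 'rV[R]_m) a : Ck r U (fun=> a).
Proof.
elim: r a => [|r IH] a /=; first by move=> x _; exact: cst_continuous.
split=> [x _|i]; first exact: differentiable_cst.
have -> : (fun x : 'rV[R]_m => 'D_(delta_mx 0 i) (fun=> a) x) = fun=> 0.
  by apply/funext => x; rewrite derive_cst.
exact: IH.
Qed.

Lemma Ck_add m r (U : set 'rV[R]_m) f g : open U ->
  Ck r U f -> Ck r U g -> Ck r U (fun x => f x + g x).
Proof.
move=> oU; elim: r f g => [|r IH] f g /=.
  by move=> cf cg x Ux; apply: continuousD; [exact: cf | exact: cg].
move=> [df fk] [dg gk]; split=> [x Ux|i].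
  by apply: (@differentiableD _ _ _ f g); [exact: df|exact: dg].
apply: (@Ck_ext _ _ _ (fun x => pd i f x + pd i g x)) => //; last first.
  by apply: IH; [exact: fk | exact: gk].
move=> x Ux; rewrite /pd (@deriveD _ _ _ f g) //; apply: diff_derivable;
  [exact: df|exact: dg].
Qed.

Lemma Ck_mul m r (U : set 'rV[R]_m) f g : open U ->
  Ck r U f -> Ck r U g -> Ck r U (fun x => f x * g x).
Proof.
move=> oU; elim: r f g => [|r IH] f g.
  by move=> cf cg x Ux; apply: continuousM; [exact: cf | exact: cg].
move=> hf hg; case: (hf) (hg) => df fk [dg gk]; split=> [x Ux|i].
  by apply: (@differentiableM _ _ f g); [exact: df|exact: dg].
apply: (@Ck_ext _ _ _ (fun x => f x * pd i g x + g x * pd i f x)) => //.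
  move=> x Ux; rewrite /pd (@deriveM _ _ f g) //; apply: diff_derivable;
  [exact: df|exact: dg].
by apply: Ck_add => //; apply: IH => //; try exact: Ck_S; [exact: gk|exact: fk].
Qed.

Lemma Ck_inv m r (U : set 'rV[R]_m) f : open U ->
  (forall x, U x -> f x != 0) -> Ck r U f -> Ck r U (fun x => (f x)^-1).
Proof.
move=> oU f0; elim: r f f0 => [|r IH] f f0 hf.
  by move=> x Ux; apply: continuousV; [exact: f0| exact: hf].
case: (hf) => df fk; split=> [x Ux|i].
  by apply: (@differentiableV _ _ f); [exact: df|exact: f0].
apply: (@Ck_ext _ _ _ (fun x => - 1 * ((f x)^-1 * (f x)^-1) * pd i f x)) => //.
  move=> x Ux; rewrite /pd (@deriveV _ _ f) ?f0 //; last first.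
    by apply: diff_derivable; exact: df.
  by rewrite /GRing.scale /= mulN1r expr2 invfM.
apply: Ck_mul => //; last exact: fk.
have fr := Ck_S hf.
by apply: Ck_mul => //; [exact: Ck_cst | apply: Ck_mul => //; exact: IH].
Qed.

Lemma Ck_sum m r (U : set 'rV[R]_m) (I : Type) (s : seq I) (P : pred I) f :
  open U -> (forall i, P i -> Ck r U (f i)) ->
  Ck r U (fun x => \sum_(i <- s | P i) f i x).
Proof.
move=> oU H; elim: s => [|j s IH].
  by under eq_fun do rewrite big_nil; exact: Ck_cst.
under eq_fun do rewrite big_cons; have [Pj|Pj] := boolP (P j) => //.
by apply: Ck_add => //; exact: H.
Qed.

Lemma Ck_prod m r (U : set 'rV[R]_m) (I : Type) (s : seq I) (P : pred I) f :
  open U -> (forall i, P i -> Ck r U (f i)) ->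
  Ck r U (fun x => \prod_(i <- s | P i) f i x).
Proof.
move=> oU H; elim: s => [|j s IH].
  by under eq_fun do rewrite big_nil; exact: Ck_cst.
under eq_fun do rewrite big_cons; have [Pj|Pj] := boolP (P j) => //.
by apply: Ck_mul => //; exact: H.
Qed.

Lemma derive_coord m (i : 'I_m) v x : 'D_v (fun x : 'rV[R]_m => x 0 i) x = v 0 i.
Proof.
have /= := @diff_row_eps m (fun x => x 0 i) x (delta_mx 0 i) _.
have dE u : dotr (delta_mx 0 i) u = u 0 i.
  rewrite /dotr (bigD1 i) //= big1 ?mxE ?eqxx ?mulr1 ?addr0 // => j ji.
  by rewrite mxE eqxx /= (negbTE ji) mulr0.
case=> [e e0|_ ->]; last exact: dE.
by near=> y; rewrite dE !mxE subrr normr0 mulr_ge0 // (ltW e0).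
Unshelve. all: by end_near. Qed.

Lemma Ck_coord m r (U : set 'rV[R]_m) (i : 'I_m) : Ck r U (fun x => x 0 i).
Proof.
case: r => [|r] /=; first by move=> x _; exact: coord_continuous.
split=> [x _|j]; first exact: differentiable_coord.
under eq_fun do rewrite derive_coord; exact: Ck_cst.
Qed.

Lemma differentiable_rV m k (g : 'rV[R]_m -> 'rV[R]_k) x :
  (forall l, differentiable (fun y => g y 0 l) x) -> differentiable g x.
Proof.
move=> H.
have -> : g = \sum_l (fun y => g y 0 l *: delta_mx 0 l).
  by apply/funext => y; rewrite fct_sumE [LHS]row_sum_delta.
by apply: differentiable_sum => l; apply: differentiableZl; exact: H.
Qed.

Lemma derive_rV m k (g : 'rV[R]_m -> 'rV[R]_k) x v l :
  differentiable g x -> ('D_v g x) 0 l = 'D_v (fun y => g y 0 l) x.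
Proof.
move=> dg; rewrite derive_mx ?mxE //; exact: diff_derivable.
Qed.

Lemma derive_comp m k (g : 'rV[R]_m -> 'rV[R]_k) (f : 'rV[R]_k -> R) x v :
  (forall l, differentiable (fun y => g y 0 l) x) -> differentiable f (g x) ->
  'D_v (fun y => f (g y)) x =
  \sum_l 'D_v (fun y => g y 0 l) x * pd l f (g x).
Proof.
move=> /differentiable_rV dg df.
rewrite (@deriveE _ _ _ (f \o g)); last exact: differentiable_comp.
rewrite diff_comp //= -deriveE // -deriveE // derive_row //.
by apply: eq_bigr => l _; rewrite derive_rV.
Qed.

Lemma Ck_comp m k r (U : set 'rV[R]_m) (W : set 'rV[R]_k) g f : open U ->
  (forall x, U x -> W (g x)) -> (forall l, Ck r U (fun x => g x 0 l)) ->
  Ck r W f -> Ck r U (fun x => f (g x)).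
Proof.
move=> oU UW; elim: r f => [|r IH] f hg hf.
  move=> x Ux; apply: (@continuous_comp _ _ _ g f); last first.
    exact: (hf _ (UW x Ux)).
  by apply: rV_continuous => l; exact: hg.
have hg' l : Ck r U (fun x => g x 0 l) by exact/Ck_S/hg.
case: hf => df fk; split=> [x Ux|i].
  apply: (@differentiable_comp _ _ _ _ g f); last exact/df/UW.
  by apply: differentiable_rV => l; case: (hg l) => h _; exact: h.
apply: (@Ck_ext _ _ _ (fun x => \sum_l pd i (fun y => g y 0 l) x * pd l f (g x))).
- exact: oU.
- move=> x Ux; rewrite derive_comp //; last exact/df/UW.
  by move=> l; case: (hg l) => h _; exact: h.
apply: Ck_sum => // l _; apply: Ck_mul => //; last exact: IH hg' (fk l).
by case: (hg l) => _; exact.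
Qed.

Lemma Cinfty_pd m (U : set 'rV[R]_m) i f : Cinfty U f -> Cinfty U (pd i f).
Proof. by move=> h r; case: (h r.+1) => _; exact. Qed.

Lemma Cinfty_diff m (U : set 'rV[R]_m) f : Cinfty U f ->
  forall x, U x -> differentiable f x.
Proof. by move=> /(_ 1%N)[]. Qed.

Lemma Cinfty_cont m (U : set 'rV[R]_m) f : Cinfty U f ->
  forall x, U x -> {for x, continuous f}.
Proof. by move=> /(_ 0%N). Qed.

End Calculus.

(** * Mean value, Lipschitz and Taylor bounds on balls *)

Section Bounds.
Variable R : realType.
Implicit Types m : nat.

Lemma rV_norm_lt m (v : 'rV[R]_m) (e : R) : 0 < e ->
  (forall i, `|v 0 i| < e) -> `|v| < e.
Proof.
move=> e0 H; rewrite [ltLHS]/Num.Def.normr/= mx_normrE.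
by apply/bigmax_ltP; split => // -[i j] _; rewrite (ord1 i).
Qed.

Lemma closed_ball_bounded m (f : 'rV[R]_m -> R) (r : R) :
  (forall x, `|x| <= r -> {for x, continuous f}) ->
  exists2 C, 0 <= C & forall x, `|x| <= r -> `|f x| <= C.
Proof.
move=> cf; have [r0|r0] := ltP r 0.
  exists 0 => // x xr; have := le_lt_trans (le_trans (normr_ge0 x) xr) r0.
  by rewrite ltxx.
pose A := [set x : 'rV[R]_m | `|x| <= r].
have cA : compact A.
  apply: bounded_closed_compact.
    by exists r; split; [exact: num_real | move=> M rM x /= xr; exact/ltW/(le_lt_trans xr)].
  have -> : A = (fun x => `|x|) @^-1` [set y | y <= r] by [].
  apply: preimage_closed; last exact: closed_le.
  by move=> x _; exact: norm_continuous.
have A0 : A !=set0 by exists 0; rewrite /A/= normr0.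
have cn : {within A, continuous (fun x => `|f x|)}.
  apply/continuous_in_subspaceT => x; rewrite inE => Ax.
  apply: (@continuous_comp _ _ _ f (fun u => `|u|)); first exact: (cf x Ax).
  exact: norm_continuous.
have [c _ hc] := EVT_max_rV A0 cA cn.
by exists `|f c| => // x xr; apply: hc; rewrite inE.
Qed.

Lemma mvt_rV m (f : 'rV[R]_m -> R) x y :
  (forall t, 0 <= t <= 1 -> differentiable f (x + t *: (y - x))) ->
  exists2 t, 0 <= t <= 1 &
    f y - f x = \sum_i (y - x) 0 i * pd i f (x + t *: (y - x)).
Proof.
move=> df; pose l (t : R) : 'rV[R]_m := x + t *: (y - x).
have dl (t : R) : is_derive t (1 : R) l (y - x).
  rewrite /l; have -> : (fun t : R => x + t *: (y - x)) =
    cst x + (fun t : R => t *: (y - x)) by [].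
  rewrite -[X in is_derive _ _ _ X]add0r; apply: is_deriveD.
  apply: DeriveDef; first exact/diff_derivable/differentiableZl.
  by rewrite deriveE; [rewrite diffZl // diff_val scale1r|exact: differentiableZl].
have dfl (t : R) : 0 <= t <= 1 -> is_derive t (1 : R) (f \o l)
    (\sum_i (y - x) 0 i * pd i f (l t)).
  move=> t01; have dlt : differentiable l t.
    by apply/derivable1_diffP; exact: ex_derive.
  have dft := df t t01.
  apply: DeriveDef.
    exact/diff_derivable/differentiable_comp.
  rewrite deriveE; last exact: differentiable_comp.
  by rewrite diff_comp //= -!deriveE // derive_row // derive_val.
have [||t t01 E] := @MVT_segment R (f \o l)
    (fun t => \sum_i (y - x) 0 i * pd i f (l t)) 0 1 ler01.
- by move=> t; rewrite in_itv /= => /andP[a b]; apply: dfl; rewrite !ltW.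
- apply/continuous_in_subspaceT => t; rewrite inE /= in_itv /= => t01.
  apply/differentiable_continuous/derivable1_diffP.
  by case: (dfl t t01).
exists t; first by move: t01; rewrite in_itv.
move: E; rewrite /= /l scale1r scale0r addr0 [x + (y - x)]addrC subrK => ->.
by rewrite subr0 mulr1.
Qed.

Lemma norm_segment m (x y : 'rV[R]_m) t r : 0 <= t <= 1 ->
  `|x| <= r -> `|y| <= r -> `|x + t *: (y - x)| <= r.
Proof.
move=> /andP[t0 t1] xr yr.
have -> : x + t *: (y - x) = (1 - t) *: x + t *: y.
  by rewrite scalerBr scalerBl scale1r addrA addrAC -addrA.
apply: le_trans (ler_normD _ _) _; rewrite !normrZ !ger0_norm ?subr_ge0 //.
by have := ler_wpM2l t0 yr; have : 0 <= 1 - t; [lra|move=> h; have := ler_wpM2l h xr; lra].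
Qed.

Lemma dot_le m (a v : 'I_m -> R) A B : 0 <= A -> 0 <= B ->
  (forall i, `|a i| <= A) -> (forall i, `|v i| <= B) ->
  `|\sum_i a i * v i| <= m%:R * (A * B).
Proof.
move=> A0 B0 hA hB; apply: le_trans (ler_norm_sum _ _ _) _.
rewrite -[m in m%:R]card_ord mulr_natl -sumr_const.
by apply: ler_sum => i _; rewrite normrM; apply: ler_pM.
Qed.

(** The sum of the individual constants is above each of them; this makes a bound uniform over
    coordinates. *)
Lemma finite_bound (I : finType) (P : I -> R -> Prop) :
  (forall i C C', P i C -> C <= C' -> P i C') ->
  (forall i, exists2 C, 0 <= C & P i C) ->
  exists2 C, 0 <= C & forall i, P i C.
Proof.
move=> mono /(_ _) H.
have [c hc] := @boolp.choice I R (fun i C => 0 <= C /\ P i C)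
  (fun i => let: ex_intro2 C C0 PC := H i in ex_intro _ C (conj C0 PC)).
exists (\sum_i c i); first by apply: sumr_ge0 => i _; case: (hc i).
move=> i; have [_ /mono] := hc i; apply.
by rewrite (bigD1 i) //= lerDl; apply: sumr_ge0 => j _; case: (hc j).
Qed.

Lemma lipschitz_ball m (f : 'rV[R]_m -> R) r :
  Cinfty [set x | `|x| <= r] f ->
  exists2 L, 0 <= L & forall x y, `|x| <= r -> `|y| <= r ->
    `|f y - f x| <= L * `|y - x|.
Proof.
move=> cf.
have [C C0 hC] : exists2 C, 0 <= C & forall i x, `|x| <= r -> `|pd i f x| <= C.
  apply: (@finite_bound _ (fun i C => forall x, `|x| <= r -> `|pd i f x| <= C)).
    by move=> i C C' h CC' x /h /le_trans; exact.
  move=> i; apply: closed_ball_bounded => x xr.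
  exact: (Cinfty_cont (Cinfty_pd i cf)).
exists (m%:R * C) => [|x y xr yr]; first exact: mulr_ge0.
have [t t01|t t01 ->] := @mvt_rV m f x y.
  by apply: (Cinfty_diff cf); exact: norm_segment.
rewrite mulrAC -mulrA; apply: dot_le => //.
  by move=> i; exact: rV_norm_le.
by move=> i; apply: hC; exact: norm_segment.
Qed.

Lemma taylor2_ball m (f : 'rV[R]_m -> R) r :
  Cinfty [set x | `|x| <= r] f ->
  exists2 C, 0 <= C & forall x y, `|x| <= r -> `|y| <= r ->
    `|f y - f x - \sum_i (y - x) 0 i * pd i f x| <= C * `|y - x| ^+ 2.
Proof.
move=> cf.
have [L L0 hL] : exists2 L, 0 <= L & forall i x y, `|x| <= r -> `|y| <= r ->
    `|pd i f y - pd i f x| <= L * `|y - x|.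
  apply: (@finite_bound _ (fun i L => forall x y, `|x| <= r -> `|y| <= r ->
    `|pd i f y - pd i f x| <= L * `|y - x|)).
    move=> i C C' h CC' x y xr yr; apply: le_trans (h x y xr yr) _.
    exact: ler_wpM2r.
  by move=> i; exact/lipschitz_ball/Cinfty_pd.
exists (m%:R * L) => [|x y xr yr]; first exact: mulr_ge0.
have [t t01|t t01 ->] := @mvt_rV m f x y.
  by apply: (Cinfty_diff cf); exact: norm_segment.
rewrite -sumrB; under eq_bigr do rewrite -mulrBr.
rewrite (_ : _ * _ ^+ 2 = m%:R * (`|y - x| * (L * `|y - x|))); last by ring.
apply: dot_le => //.
- by rewrite mulr_ge0.
- by move=> i; exact: rV_norm_le.
move=> i; apply: le_trans (hL i _ _ xr (norm_segment t01 xr yr)) _.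
rewrite addrC addKr normrZ; case/andP: t01 => t0 t1; rewrite ger0_norm //.
by apply: ler_wpM2l => //; rewrite ler_piMl.
Qed.

End Bounds.

(** * Smooth bump functions *)

Section Bump.
Variable R : realType.
Implicit Types m : nat.

Lemma is_derive_sq (f : R -> R) x C :
  (forall h, `|f (h + x) - f x| <= C * h ^+ 2) -> is_derive x 1 f 0.
Proof.
move=> H.
have C0 : 0 <= C.
  by have := H 1; rewrite expr1n mulr1; apply: le_trans.
have K : h^-1 *: (f (h *: 1 + x) - f x) @[h --> 0^'] --> (0 : R).
  apply/cvgrPdist_le => e e0; near=> h.
  have h0 : h != 0 by near: h; exact: nbhs_dnbhs_neq.
  rewrite sub0r normrN /GRing.scale /= mulr1 normrM normfV.
  rewrite ler_pdivrMl ?normr_gt0 // (le_trans (H h)) //.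
  rewrite -[h ^+ 2]ger0_norm ?sqr_ge0 // expr2 normrM mulrCA.
  suff h1 : `|h| <= (C + 1)^-1 * e.
    rewrite ler_wpM2l //; apply: le_trans (_ : (C + 1) * `|h| <= _).
      by rewrite ler_wpM2r // lerDl.
    by rewrite -ler_pdivlMl // ltr_wpDl.
  near: h; apply: dnbhs0_le; rewrite mulr_gt0 // invr_gt0 ltr_wpDl //.
apply: DeriveDef; first by apply/cvg_ex; exists 0.
exact: cvg_lim.
Unshelve. all: by end_near. Qed.

Definition eflat (P : {poly R}) (t : R) : R :=
  if 0 < t then P.[t^-1] * expR (- t^-1) else 0.

Lemma poly_expR_bound (P : {poly R}) :
  exists2 C, 0 <= C & forall s, 0 <= s -> `|P.[s]| * expR (- s) <= C.
Proof.
elim/poly_ind: P => [|P a _].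
  by exists 0 => // s _; rewrite horner0 normr0 mul0r.
pose Q := P * 'X + a%:P.
exists (\sum_(i < size Q) `|Q`_i| * (i`!%:R + 1)).
  by apply: sumr_ge0 => i _; rewrite mulr_ge0 // addr_ge0.
move=> s s0; rewrite -/Q horner_coef.
apply: le_trans (_ : (\sum_(i < size Q) `|Q`_i * s ^+ i|) * expR (- s) <= _).
  by rewrite ler_wpM2r ?expR_ge0 // ler_norm_sum.
rewrite mulr_suml; apply: ler_sum => i _.
rewrite normrM -mulrA ler_wpM2l // expRN ger0_norm ?exprn_ge0 //.
rewrite ler_pdivrMr ?expR_gt0 //; case: (i : nat) => [|n].
  rewrite expr0 fact0; have := expR_ge1Dx s; have := expR_ge0 s; nra.
have := expR_ge1Dxn n s0; set F := n.+1`!%:R; have F0 : 0 < F :> R.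
  by rewrite ltr0n fact_gt0.
move=> h; have : s ^+ n.+1 / F <= expR s by lra.
rewrite ler_pdivrMr // => /le_trans; apply.
by rewrite mulrDl mul1r mulrC lerDl expR_ge0.
Qed.

Lemma eflat_derive (P : {poly R}) (t : R) :
  is_derive t (1 : R) (eflat P) (eflat ('X^2 * (P - P^`())) t).
Proof.
have [t0|t0|<-] := ltgtP 0 t.
- have D : is_derive t (1 : R) (fun u => P.[u^-1] * expR (- u^-1))
      (('X^2 * (P - P^`())).[t^-1] * expR (- t^-1)).
    have tn0 : t != 0 by rewrite gt_eqF.
    have dV : is_derive t (1 : R) (fun u : R => u^-1) (- t ^- 2).
      apply: DeriveDef; first by apply: (@derivableV _ _ id) => //; exact: derivable_id.
      rewrite (@deriveV _ _ id) //.
      by rewrite derive_id /GRing.scale /= mulr1.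
    have dP : is_derive t (1 : R) (fun u => P.[u^-1]) (P^`().[t^-1] * (- t ^- 2)).
      exact: (@is_derive1_comp R (horner P) (fun u : R => u^-1)).
    have dE : is_derive t (1 : R) (fun u => expR (- u^-1)) (expR (- t^-1) * (t ^- 2)).
      apply: (@is_derive1_comp R expR (fun u : R => - u^-1)).
      by apply: is_derive_eq (is_deriveN _) _; rewrite opprK.
    have := @is_deriveM R R _ _ t 1 _ _ dP dE.
    move/is_derive_eq; apply.
    rewrite /GRing.scale /= !hornerE -!exprVn /=; move: (t^-1) (expR _) => s e; ring.
  rewrite {2}/eflat t0; apply: near_eq_is_derive D.
  near=> u; rewrite /eflat ifT //; near: u; exact: lt_nbhsr.
- rewrite {2}/eflat ltNge (ltW t0) /=; apply: near_eq_is_derive (is_derive_cst 0 t 1).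
  near=> u; rewrite /eflat /cst ifF //; apply/negbTE; rewrite -leNgt ltW //.
  by near: u; exact: lt_nbhsl.
rewrite {2}/eflat ltxx.
(* The factor ['X^2] turns the bound into [C * h ^+ 2], hence a zero derivative at the origin. *)
have [C C0 hC] := poly_expR_bound ('X^2 * P).
apply: (@is_derive_sq _ _ C) => h; rewrite addr0 /eflat ltxx subr0.
case: ltP => h0; last by rewrite normr0 mulr_ge0 // sqr_ge0.
have -> : C * h ^+ 2 = h * (h * C) by ring.
have hi : `|h^-1| = h^-1 by rewrite ger0_norm // invr_ge0 ltW.
have hi0 : 0 <= h^-1 by rewrite invr_ge0 ltW.
have h1 := hC h^-1 hi0; rewrite !hornerE !normrM hi -!mulrA in h1.
rewrite normrM [`|expR _|]ger0_norm ?expR_ge0 //.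
by rewrite -!ler_pdivrMl.
Unshelve. all: by end_near. Qed.

Fixpoint eflat_poly (n : nat) : {poly R} :=
  if n is n'.+1 then 'X^2 * (eflat_poly n' - (eflat_poly n')^`()) else 1.

(** [T] lists the successive derivatives of one function of a real variable, which is what the
    induction on [r] consumes. *)
Lemma Ck_comp1 (T : nat -> R -> R) m r (U : set 'rV[R]_m) f n : open U ->
  (forall n (t : R), is_derive t (1 : R) (T n) (T n.+1 t)) ->
  Ck r U f -> Ck r U (fun x => T n (f x)).
Proof.
move=> oU dT; elim: r n f => [|r IH] n f hf.
  move=> x Ux; apply: (@continuous_comp _ _ _ f (T n)); first exact: hf.
  apply/differentiable_continuous/derivable1_diffP.
  exact: ex_derive.
have dTd t k : differentiable (T k) t.
  by apply/derivable1_diffP; exact: ex_derive.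
have hf' := Ck_S hf; case: hf => df fk.
split=> [x Ux|i]; first by apply: (@differentiable_comp _ _ _ _ f (T n)); [exact: df|].
apply: (@Ck_ext _ _ _ _ (fun x => T n.+1 (f x) * pd i f x)) => //; last first.
  by apply: Ck_mul => //; [exact: IH | exact: fk].
move=> x Ux; have dfx := df x Ux.
rewrite [RHS](@deriveE _ _ _ (T n \o f)); last exact: differentiable_comp.
rewrite diff_comp //= /pd deriveE //.
have := deriveE (1 : R) (dTd (f x) n); rewrite derive_val => E.
have -> : 'd f x (delta_mx 0 i) = 'd f x (delta_mx 0 i) *: (1 : R).
  by rewrite /GRing.scale /= mulr1.
by rewrite linearZ /= -E /GRing.scale /= mulr1 mulrC.
Qed.

(** The quotient [E (q) / (E (q) + E (1 - q))], with [E] the flat function, is 1 where [1 <= q] and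
    0 where [q <= 0]. The Euclidean square norm inside [q] is smooth, unlike the maximum norm of the
    statement. *)
Lemma bump_exists m (rho : R) : 0 < rho ->
  exists chi : 'rV[R]_m -> R, [/\ Cinfty setT chi,
    exists2 e, 0 < e & forall x, `|x| < e -> chi x = 1 &
    forall x, rho <= `|x| -> chi x = 0].
Proof.
move=> r0; pose q (x : 'rV[R]_m) := 2 - 2 / rho ^+ 2 * \sum_i x 0 i * x 0 i.
pose E := eflat 1.
have Epos t : 0 < t -> 0 < E t.
  by move=> t0; rewrite /E /eflat t0 hornerE mul1r expR_gt0.
have E0 t : t <= 0 -> E t = 0 by rewrite /E /eflat ltNge => ->.
have Ege t : 0 <= E t.
  by have [/E0->//|/Epos/ltW] := leP t 0.
have den t : 0 < E t + E (1 - t).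
  have [t0|t0] := ltP 0 t; first by rewrite ltr_wpDr // Epos.
  by rewrite ltr_wpDl // Epos //; lra.
have qS : Cinfty setT q.
  move=> r; apply: Ck_add; [exact: openT|exact: Ck_cst|].
  under eq_fun do rewrite -mulNr.
  apply: Ck_mul; [exact: openT|exact: Ck_cst|].
  apply: Ck_sum => [|i _]; first exact: openT.
  by apply: Ck_mul; [exact: openT|exact: Ck_coord|exact: Ck_coord].
have ES r f : @Ck R m r setT f -> Ck r setT (fun x => E (f x)).
  move=> hf; apply: (@Ck_comp1 (fun n => eflat (eflat_poly n)) _ _ _ _ 0%N) => //.
    exact: openT.
  by move=> n t; exact: eflat_derive.
exists (fun x => E (q x) / (E (q x) + E (1 - q x))).
split.
- move=> r; have qr := qS r.
  have q1 : Ck r setT (fun x => E (1 - q x)).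
    apply: ES; apply: Ck_add; [exact: openT|exact: Ck_cst|].
    under eq_fun do rewrite -mulN1r.
    by apply: Ck_mul; [exact: openT|exact: Ck_cst|].
  apply: Ck_mul; [exact: openT|exact: ES|].
  apply: Ck_inv; [exact: openT| |].
    by move=> x _; rewrite gt_eqF.
  by apply: Ck_add; [exact: openT|exact: ES|].
(* For [|x| < e] the sum of squares is at most [m * e ^+ 2], and [2 * m <= (2 + m) ^+ 2] then gives
   [1 <= q x]. *)
- pose e := rho / (2 + m%:R).
  have m2 : 0 < (2 + m%:R : R) by rewrite ltr_wpDr.
  have e0 : 0 < e by rewrite divr_gt0.
  exists e => // x xe; suff q1 : 1 <= q x.
    by rewrite [E (1 - _)]E0 ?addr0 ?divff ?gt_eqF ?Epos //; lra.
  have : `|\sum_i x 0 i * x 0 i| <= m%:R * (e * e).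
    by apply: dot_le; rewrite ?(ltW e0) // => i; apply: le_trans (rV_norm_le _ _) (ltW xe).
  move/(le_trans (ler_norm _)) => h.
  suff : 2 / rho ^+ 2 * (\sum_i x 0 i * x 0 i) <= 1 by rewrite /q; lra.
  rewrite mulrAC ler_pdivrMr ?exprn_gt0 // mul1r.
  apply: le_trans (_ : 2 * (m%:R * (e * e)) <= _); first by rewrite ler_wpM2l.
  have -> : rho = e * (2 + m%:R) by rewrite /e divfK // gt_eqF.
  have : 0 <= (m%:R : R) by [].
  have : 0 <= e * e by rewrite mulr_ge0 // ltW.
  set k := m%:R; move=> a b; rewrite exprMn expr2.
  have -> : 2 * (k * (e * e)) = (e * e) * (2 * k) by ring.
  rewrite ler_wpM2l //; nra.
move=> x xr; rewrite [E (q x)]E0 ?mul0r //.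
have : ~ (forall i, `|x 0 i| < rho).
  by move=> /(rV_norm_lt r0); rewrite ltNge xr.
move/existsNP => [i /negP]; rewrite -leNgt => hi.
suff : rho ^+ 2 <= \sum_i x 0 i * x 0 i.
  rewrite /q => h; suff : 2 <= 2 / rho ^+ 2 * \sum_i x 0 i * x 0 i by lra.
  by rewrite mulrAC ler_pdivlMr ?exprn_gt0 // ler_wpM2l.
rewrite (bigD1 i) //= -expr2 -[leLHS]addr0 lerD //.
  by rewrite -[leRHS]real_normK ?num_real // lerXn2r ?nnegrE ?(ltW r0).
by apply: sumr_ge0 => j _; rewrite -expr2 sqr_ge0.
Qed.

End Bump.

(** * The Euler scheme *)

Section Euler.
Variable R : realType.
Implicit Types (m d k : nat).

(** Steps are halved from one scheme to the next, so that two steps of the finer scheme face one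
    step of the coarser. *)
Definition dt k : R := (2 ^+ k)^-1.

Lemma dt_gt0 k : 0 < dt k. Proof. by rewrite invr_gt0 exprn_gt0. Qed.
Lemma dt_ge0 k : 0 <= dt k. Proof. exact/ltW/dt_gt0. Qed.

Lemma dtS k : dt k = 2 * dt k.+1.
Proof. by rewrite /dt exprS invfM mulrA divff ?mul1r ?pnatr_eq0. Qed.

Lemma mul_dt k : (2 ^ k)%:R * dt k = 1.
Proof. by rewrite natrX divff // expf_neq0 // pnatr_eq0. Qed.

Lemma dt_le k l : (k <= l)%N -> dt l <= dt k.
Proof.
move=> kl; rewrite lef_pV2 ?posrE ?exprn_gt0 // ler_weXn2l //.
by rewrite -[1]/(1%:R) ler_nat.
Qed.

Lemma dt_small (e C : R) : 0 < e -> exists k, C * dt k <= e.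
Proof.
move=> e0; have [k hk] : exists k, C / e <= k%:R.
  exists (Num.truncn `|C / e|).+1; apply: le_trans (ler_norm _) _.
  exact/ltW/truncnS_gt.
exists k; rewrite /dt ler_pdivrMr ?exprn_gt0 // mulrC -ler_pdivrMr //.
apply: le_trans hk _; rewrite -natrX ler_nat; exact/ltnW/ltn_expl.
Qed.

(** Passage to the limit in an inequality whose error term is of the order of the step. *)
Lemma le_of_dt (x z C : R) K :
  (forall k, (K <= k)%N -> x <= z + C * dt k) -> x <= z.
Proof.
move=> H; rewrite leNgt; apply/negP => zx.
have [k hk] := @dt_small ((x - z) / 2) `|C| ltac:(by rewrite divr_gt0 ?subr_gt0).
have h1 := H (maxn K k) (leq_maxl _ _).
have h2 : C * dt (maxn K k) <= `|C| * dt (maxn K k).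
  by rewrite ler_wpM2r ?dt_ge0 ?ler_norm.
have h3 : `|C| * dt (maxn K k) <= `|C| * dt k.
  by rewrite ler_wpM2l // dt_le // leq_maxr.
by move: zx hk h1 h2 h3; lra.
Qed.

(** The intervals of centre [x k] and radius [2 * C * dt k] are nested, since the radius decreases
    by [C * dt k]; the limit is the supremum of their left ends. *)
Lemma dyadic_limit (x : nat -> R) C : 0 <= C ->
  (forall k, `|x k.+1 - x k| <= C * dt k) ->
  exists l, forall k, `|x k - l| <= 2 * C * dt k.
Proof.
move=> C0 H; pose lo k := x k - 2 * C * dt k; pose hi k := x k + 2 * C * dt k.
have loS k : lo k <= lo k.+1.
  have := H k; rewrite ler_norml => /andP[h _]; rewrite /lo.
  by move: h; rewrite [dt k]dtS; lra.
have hiS k : hi k.+1 <= hi k.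
  have := H k; rewrite ler_norml => /andP[_ h]; rewrite /hi.
  by move: h; rewrite [dt k]dtS; lra.
have lohi k : lo k <= hi k.
  by rewrite /lo /hi; have := mulr_ge0 C0 (dt_ge0 k); lra.
have lom k i : lo k <= lo (k + i)%N.
  by elim: i => [|i IH]; rewrite ?addn0 ?addnS //; apply: le_trans IH _.
have him k i : hi (k + i)%N <= hi k.
  by elim: i => [|i IH]; rewrite ?addn0 ?addnS //; apply: le_trans _ IH.
have lohi2 k i : lo k <= hi i.
  have := lom k i; have := him i k; rewrite addnC => a b.
  exact: le_trans b (le_trans (lohi _) a).
pose S := [set y | exists k, y = lo k].
have S0 : S !=set0 by exists (lo 0%N), 0%N.
have ub k : ubound S (hi k) by move=> _ [i ->].
exists (sup S) => k.
have h1 : lo k <= sup S by apply: ub_le_sup; [exists (hi 0%N)|exists k].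
have h2 : sup S <= hi k by apply: ge_sup.
by rewrite ler_norml; move: h1 h2; rewrite /lo /hi; lra.
Qed.

(** By induction [e j <= j * d ^+ 2 * C * (1 + d * L) ^+ j]; as [j * d <= 1], the power is at most
    [expR L] and one factor [d] is left. *)
Lemma discrete_gronwall (e : nat -> R) (L C d : R) n :
  0 <= L -> 0 <= C -> 0 <= d -> n%:R * d <= 1 -> e 0%N <= 0 ->
  (forall j, (j < n)%N -> e j.+1 <= (1 + d * L) * e j + d ^+ 2 * C) ->
  forall j, (j <= n)%N -> e j <= d * (C * expR L).
Proof.
move=> L0 C0 d0 nd e0 H j jn.
have q1 : 0 <= 1 + d * L by rewrite addr_ge0 // mulr_ge0.
have q11 : 1 <= 1 + d * L by rewrite lerDl mulr_ge0.
have dC : 0 <= d ^+ 2 * C by rewrite mulr_ge0 // exprn_ge0.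
have A i : (i <= n)%N -> e i <= i%:R * (d ^+ 2 * C) * (1 + d * L) ^+ i.
  elim: i => [|i IH] hi; first by rewrite mul0r mul0r.
  apply: le_trans (H i hi) _.
  have h := ler_wpM2l q1 (IH (ltnW hi)).
  apply: le_trans (lerD h (lexx _)) _.
  rewrite mulrCA -exprS -natr1 !mulrDl mul1r lerD2l.
  by rewrite ler_peMr // exprn_ege1.
apply: le_trans (A j jn) _.
have jd : j%:R * d <= 1.
  by apply: le_trans nd; rewrite ler_wpM2r // ler_nat.
have E : (1 + d * L) ^+ j <= expR L.
  apply: le_trans (_ : expR (d * L) ^+ j <= _).
    by rewrite lerXn2r ?nnegrE ?expR_ge0 // expR_ge1Dx.
  rewrite -expRM_natl ler_expR mulrA -[leRHS]mul1r.
  by rewrite ler_wpM2r.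
have -> : j%:R * (d ^+ 2 * C) * (1 + d * L) ^+ j =
  (j%:R * d) * (d * (C * (1 + d * L) ^+ j)) by ring.
apply: le_trans (_ : 1 * (d * (C * expR L)) <= _); last by rewrite mul1r.
apply: ler_pM => //; rewrite ?mulr_ge0 ?exprn_ge0 //.
by rewrite !ler_wpM2l.
Qed.

Lemma continuous_eps (T : topologicalType) (f : T -> R) (x : T) :
  {for x, continuous f} <->
  forall e, 0 < e -> \forall y \near x, `|f x - f y| <= e.
Proof. exact: cvgrPdist_le. Qed.

Lemma unif_cont m (f_ : nat -> 'rV[R]_m -> R) (f : 'rV[R]_m -> R)
    (y0 : 'rV[R]_m) C :
  (forall k, {for y0, continuous (f_ k)}) ->
  (\forall y \near y0, forall k, `|f_ k y - f y| <= C * dt k) ->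
  {for y0, continuous f}.
Proof.
move=> cf H; apply/continuous_eps => e e0.
have [k hk] := @dt_small (e / 3) C ltac:(by rewrite divr_gt0).
have /continuous_eps/(_ (e / 3)) := cf k; rewrite divr_gt0 // => /(_ isT) ck.
have h0 := nbhs_singleton H k.
near=> y.
have h1 : forall k, `|f_ k y - f y| <= C * dt k by near: y.
have h2 : `|f_ k y0 - f_ k y| <= e / 3 by near: y.
move: h0 (h1 k) h2; rewrite !ler_norml; move: hk; lra.
Unshelve. all: by end_near. Qed.

(** The mean value theorem is applied to each [f_ k], with bounds independent of [k], and only then
    does [k] go to infinity. *)
Lemma unif_diff m (f_ : nat -> 'rV[R]_m -> R) (f : 'rV[R]_m -> R)
    (g : 'I_m -> 'rV[R]_m -> R) y0 C e0 : 0 < e0 ->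
  (forall y, `|y - y0| < e0 -> forall k, differentiable (f_ k) y) ->
  (forall k i, {for y0, continuous (pd i (f_ k))}) ->
  (forall y, `|y - y0| < e0 -> forall k, `|f_ k y - f y| <= C * dt k) ->
  (forall y, `|y - y0| < e0 -> forall k i, `|pd i (f_ k) y - g i y| <= C * dt k) ->
  differentiable f y0 /\ forall i, pd i f y0 = g i y0.
Proof.
move=> e00 df cf hf hg.
have [|? D] := @diff_row_eps R m f y0 (\row_i g i y0); last first.
  split=> // i; rewrite /pd D /dotr (bigD1 i) //= big1 ?mxE ?eqxx ?mul1r ?addr0 //.
  by move=> j ji; rewrite [X in X * _]mxE eqxx (negbTE ji) mul0r.
move=> e ep.
(* Four errors of size [e1] arise in each of the [m] coordinates. *)
pose e1 := e / (4 * (m%:R + 1)).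
have m1 : 0 < (m%:R + 1 : R) by rewrite ltr_wpDl.
have e10 : 0 < e1 by rewrite divr_gt0 // mulr_gt0.
have [K hK] := @dt_small e1 `|C| e10.
have hKk k : (K <= k)%N -> C * dt k <= e1.
  move=> Kk; apply: le_trans (_ : `|C| * dt k <= _).
    by rewrite ler_wpM2r ?dt_ge0 ?ler_norm.
  by apply: le_trans hK; rewrite ler_wpM2l // dt_le.
have : \forall y \near y0, `|y - y0| < e0 /\
    forall i, `|pd i (f_ K) y0 - pd i (f_ K) y| <= e1.
  near=> y; split.
    near: y; apply/nbhs_ballP; exists e0 => //= z.
    by rewrite -ball_normE /= distrC.
  move=> i; move: i; near: y; apply: filter_forall => i.
  by have /continuous_eps/(_ e1 e10) := cf K i.
case/nbhs_ballP => rho rho0 Hb.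
apply/nbhs_ballP; exists rho => // y yb.
have inb t : 0 <= t <= 1 -> ball y0 rho (y0 + t *: (y - y0)).
  move=> /andP[t0 t1]; move: yb; rewrite -!ball_normE /= opprD addNKr normrN.
  rewrite distrC normrZ => h; apply: le_lt_trans h.
  by rewrite ger0_norm // ler_piMl.
(* At an intermediate point the derivative of [f_ k] is compared with [g i y0] by way of [f_ K].
   Continuity is used for the fixed index [K] only, which keeps the neighbourhood independent of
   [k]. *)
have key k : (K <= k)%N ->
    `|f_ k y - f_ k y0 - dotr (\row_i g i y0) (y - y0)| <= e * `|y - y0|.
  move=> Kk; have [t t01|t t01 ->] := @mvt_rV R m (f_ k) y0 y.
    by apply: df; have [] := Hb _ (inb t t01).
  rewrite /dotr -sumrB; under eq_bigr do rewrite mxE -mulrBr.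
  apply: le_trans (_ : m%:R * (`|y - y0| * (4 * e1)) <= _).
    apply: dot_le => [||i|i].
    - exact: normr_ge0.
    - by rewrite pmulr_rge0 // ltW.
    - exact: rV_norm_le.
    set z := y0 + _; have [z0 zK] := Hb _ (inb t t01).
    have y00 : `|y0 - y0| < e0 by rewrite subrr normr0.
    have a1 := le_trans (hg z z0 k i) (hKk k Kk).
    have a2 := le_trans (hg z z0 K i) (hKk K (leqnn _)).
    have a3 := le_trans (hg y0 y00 K i) (hKk K (leqnn _)).
    move: (zK i) a1 a2 a3; rewrite -/z !ler_norml; lra.
  rewrite mulrA [m%:R * _]mulrC -mulrA [leRHS]mulrC ler_wpM2l //.
  have : (m%:R + 1) * (4 * e1) = e.
    by rewrite /e1; field; rewrite gt_eqF.
  by move: e10; lra.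
apply: (@le_of_dt _ _ (2 * C) K) => k Kk.
have a0 := key k Kk.
have [y1 _] := Hb _ yb.
have y00 : `|y0 - y0| < e0 by rewrite subrr normr0.
move: a0 (hf y y1 k) (hf y0 y00 k); set X := dotr _ _; rewrite !ler_norml.
by move=> /andP[] a b /andP[] c dd /andP[] e' f'; apply/andP; split; lra.
Unshelve. all: by end_near. Qed.

Definition estep d (H : 'rV[R]_d -> 'rV[R]_d) (h : R) u := u + h *: H u.
Definition eul d (H : 'rV[R]_d -> 'rV[R]_d) (h : R) j u := iter j (estep H h) u.
(** The total time is 1, so these are approximations of the time-one map of [H]. *)
Definition eulk d (H : 'rV[R]_d -> 'rV[R]_d) k u := eul H (dt k) (2 ^ k) u.

Lemma eulS d (H : 'rV[R]_d -> 'rV[R]_d) h j u :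
  eul H h j.+1 u = estep H h (eul H h j u).
Proof. by []. Qed.

Definition smoothv m d (W : set 'rV[R]_m) (H : 'rV[R]_m -> 'rV[R]_d) :=
  forall b, Cinfty W (fun u => H u 0 b).

Lemma smoothv_bound m d (H : 'rV[R]_m -> 'rV[R]_d) r : smoothv setT H ->
  exists2 C, 0 <= C & forall u, `|u| <= r -> `|H u| <= C.
Proof.
move=> sH.
have [C C0 hC] : exists2 C, 0 <= C & forall b u, `|u| <= r -> `|H u 0 b| <= C.
  apply: (@finite_bound R _ (fun b C => forall u, `|u| <= r -> `|H u 0 b| <= C)).
    by move=> i C C' h CC' x /h /le_trans; exact.
  by move=> b; apply: closed_ball_bounded => x _; exact: (Cinfty_cont (sH b)).
exists C => // u ur; apply: rV_norm_leP => // b; exact: hC.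
Qed.

Lemma smoothv_lip m d (H : 'rV[R]_m -> 'rV[R]_d) r : smoothv setT H ->
  exists2 L, 0 <= L & forall u v, `|u| <= r -> `|v| <= r ->
    `|H v - H u| <= L * `|v - u|.
Proof.
move=> sH.
have [L L0 hL] : exists2 L, 0 <= L & forall b u v, `|u| <= r -> `|v| <= r ->
    `|H v 0 b - H u 0 b| <= L * `|v - u|.
  apply: (@finite_bound R _ (fun b L => forall u v, `|u| <= r -> `|v| <= r ->
    `|H v 0 b - H u 0 b| <= L * `|v - u|)).
    move=> i C C' h CC' u v ur vr; apply: le_trans (h u v ur vr) _.
    exact: ler_wpM2r.
  by move=> b; apply: lipschitz_ball => k; apply: Ck_sub (sH b k).
exists L => // u v ur vr; apply: rV_norm_leP => [|b].
  by rewrite mulr_ge0.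
by have := hL b u v ur vr; rewrite !mxE.
Qed.

(** Substitute for completeness of the field: near each initial value all iterates of all schemes
    stay in one ball. *)
Definition ebounded m d (H : 'rV[R]_d -> 'rV[R]_d) (W : set 'rV[R]_m)
    (u0 : 'rV[R]_m -> 'rV[R]_d) :=
  forall y0, W y0 -> exists r, \forall y \near y0,
    forall k j, (j <= 2 ^ k)%N -> `|eul H (dt k) j (u0 y)| <= r.

(** Two steps of size [s] and one step of size [2 * s] differ by [O (s ^+ 2)], and previous
    differences are amplified by a factor [1 + 2 * s * L] up to that order; the discrete Gronwall
    inequality sums this up. *)
Lemma eul_cauchy d (H : 'rV[R]_d -> 'rV[R]_d) r : smoothv setT H ->
  exists2 C, 0 <= C & forall u,
    (forall k j, (j <= 2 ^ k)%N -> `|eul H (dt k) j u| <= r) ->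
    forall k, `|eulk H k.+1 u - eulk H k u| <= C * dt k.
Proof.
move=> sH; have [L L0 hL] := smoothv_lip r sH.
have [C C0 hC] := smoothv_bound r sH.
exists (L * C * expR L) => [|u hu k].
  by rewrite !mulr_ge0 // expR_ge0.
pose e j := `|eul H (dt k.+1) j.*2 u - eul H (dt k) j u|.
have := @discrete_gronwall e L (L * C) (dt k) (2 ^ k) L0 (mulr_ge0 L0 C0)
  (dt_ge0 k) _ _ _ (2 ^ k)%N (leqnn _).
rewrite mul_dt lexx /e double0 subrr normr0 => /(_ isT (lexx _)).
rewrite /eulk expnS mul2n [_ * dt k]mulrC; apply => j jk {e}.
have j1 : (j.*2.+1 < 2 ^ k.+1)%N by rewrite expnS mul2n -doubleS leq_double.
have bv := hu k.+1 _ (ltnW (ltnW j1)); have bv1 := hu k.+1 _ (ltnW j1).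
have bu := hu k _ (ltnW jk).
rewrite doubleS !eulS; rewrite eulS in bv1; move: bv1.
move: bv bu; set v := eul _ _ _ _; set w := eul _ _ _ _ => bv bw bv1.
have s0 := dt_ge0 k.+1; rewrite [dt k]dtS; set s := dt k.+1 in s0 *.
set v1 := estep H s v in bv1 *.
have d1 : `|H v - H w| <= L * `|v - w| := hL _ _ bw bv.
have d2 : `|H v1 - H w| <= L * (`|v - w| + s * C).
  apply: le_trans (hL _ _ bw bv1) _; rewrite ler_wpM2l //.
  rewrite /v1 /estep addrAC; apply: le_trans (ler_normD _ _) _.
  by rewrite lerD2l normrZ ger0_norm // ler_wpM2l // hC.
have -> : estep H s v1 - estep H (2 * s) w =
    (v - w) + s *: (H v - H w) + s *: (H v1 - H w).
  by apply/rowP => i; rewrite /v1 /estep !mxE; ring.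
apply: le_trans (ler_normD _ _) _.
have := ler_normD (v - w) (s *: (H v - H w)).
rewrite !normrZ [`|s|]ger0_norm //.
have := ler_wpM2l s0 d1; have := ler_wpM2l s0 d2.
set A := `|v - w|; set B := `|H v - H w|; set D := `|H v1 - H w|.
have : 0 <= s * (s * (L * C)) by rewrite !mulr_ge0.
rewrite !mulrDr !mulrDl; nra.
Qed.

Lemma norm_row_mx d e (u : 'rV[R]_d) (v : 'rV[R]_e) r :
  `|u| <= r -> `|v| <= r -> `|row_mx u v| <= r.
Proof.
move=> ur vr; apply: rV_norm_leP => [|b]; first exact: le_trans ur.
have [b' ->|b' ->] := split_ordP b; rewrite ?row_mxEl ?row_mxEr;
  by apply: le_trans (rV_norm_le _ _) _.
Qed.

Lemma norm_rsubmx d e (u : 'rV[R]_(d + e)) : `|rsubmx u| <= `|u|.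
Proof. by apply: rV_norm_leP => // b; rewrite mxE; exact: rV_norm_le. Qed.

Lemma smoothv_row_mx m d e (W : set 'rV[R]_m) (f : 'rV[R]_m -> 'rV[R]_d)
    (g : 'rV[R]_m -> 'rV[R]_e) :
  smoothv W f -> smoothv W g -> smoothv W (fun y => row_mx (f y) (g y)).
Proof.
move=> sf sg b r; have [b' ->|b' ->] := split_ordP b.
  by under eq_fun do rewrite row_mxEl; exact: sf.
by under eq_fun do rewrite row_mxEr; exact: sg.
Qed.

Lemma smoothv_comp m d e (W : set 'rV[R]_m) (V : set 'rV[R]_d)
    (f : 'rV[R]_m -> 'rV[R]_d) (g : 'rV[R]_d -> 'rV[R]_e) :
  open W -> (forall y, W y -> V (f y)) -> smoothv W f -> smoothv V g ->
  smoothv W (fun y => g (f y)).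
Proof.
move=> oW WV sf sg b r.
by apply: (@Ck_comp R m d r W V f (fun u => g u 0 b)) => // [l|]; [exact: sf|exact: sg].
Qed.

Lemma smoothv_lsubmx d e : smoothv setT (lsubmx : 'rV[R]_(d + e) -> 'rV[R]_d).
Proof. by move=> b r; under eq_fun do rewrite mxE; exact: Ck_coord. Qed.

Lemma smoothv_rsubmx d e : smoothv setT (rsubmx : 'rV[R]_(d + e) -> 'rV[R]_e).
Proof. by move=> b r; under eq_fun do rewrite mxE; exact: Ck_coord. Qed.

Lemma smoothv_eul m d (W : set 'rV[R]_m) (H : 'rV[R]_d -> 'rV[R]_d) u0 h j :
  open W -> smoothv setT H -> smoothv W u0 ->
  smoothv W (fun y => eul H h j (u0 y)).
Proof.
move=> oW sH s0; elim: j => [|j IH] //.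
apply: (smoothv_comp (V := setT) (g := estep H h)) => // b r.
rewrite /estep; under eq_fun do rewrite mxE [X in _ + X]mxE.
apply: Ck_add; [exact: openT | exact: Ck_coord |].
by apply: Ck_mul; [exact: openT | exact: Ck_cst | exact: sH].
Qed.

(* The Euler iterates of [aug H] from [(u0, d_i u0)] are those of [H] from [u0] together with their
   [i]-th partial derivatives; hence the limit is differentiable, and smooth by induction. *)
Definition aug d (H : 'rV[R]_d -> 'rV[R]_d) (w : 'rV[R]_(d + d)) : 'rV[R]_(d + d) :=
  row_mx (H (lsubmx w))
   (\row_b \sum_l (rsubmx w) 0 l * pd l (fun u => H u 0 b) (lsubmx w)).

Lemma smoothv_aug d (H : 'rV[R]_d -> 'rV[R]_d) :
  smoothv setT H -> smoothv setT (aug H).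
Proof.
move=> sH; apply: smoothv_row_mx.
  by apply: (smoothv_comp (V := setT)) => //; [exact: openT|exact: smoothv_lsubmx].
move=> b r; under eq_fun do rewrite mxE.
apply: Ck_sum => [|l _]; first exact: openT.
apply: Ck_mul; [exact: openT | exact: smoothv_rsubmx |].
apply: (@Ck_comp R _ d r setT setT (fun w => lsubmx w)) => //; first exact: openT.
  by move=> c; exact: smoothv_lsubmx.
by move: r; apply: Cinfty_pd; exact: sH.
Qed.

Lemma aug_eul m d (W : set 'rV[R]_m) (H : 'rV[R]_d -> 'rV[R]_d) u0 i h j y :
  open W -> smoothv setT H -> smoothv W u0 -> W y ->
  eul (aug H) h j (row_mx (u0 y) (\row_b pd i (fun y => u0 y 0 b) y)) =
  row_mx (eul H h j (u0 y)) (\row_b pd i (fun y => eul H h j (u0 y) 0 b) y).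
Proof.
move=> oW sH s0 Wy; elim: j => [//|j IH].
rewrite !eulS IH {1}/estep /aug row_mxKl row_mxKr scale_row_mx add_row_mx.
congr row_mx; apply/rowP => b; rewrite !mxE.
have dfj c : differentiable (fun y => eul H h j (u0 y) 0 c) y.
  by have := Cinfty_diff (@smoothv_eul m d W H u0 h j oW sH s0 c) Wy.
have dH c : differentiable (fun u => H u 0 c) (eul H h j (u0 y)).
  exact: (Cinfty_diff (sH c)).
have dcomp : differentiable ((fun u => H u 0 b) \o (fun y => eul H h j (u0 y))) y.
  by apply: differentiable_comp => //; exact: differentiable_rV.
rewrite /pd.
have -> : (fun y => eul H h j.+1 (u0 y) 0 b) = (fun y => eul H h j (u0 y) 0 b) +
    h *: ((fun u => H u 0 b) \o (fun y => eul H h j (u0 y))).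
  by apply/funext => z; rewrite eulS /estep !mxE.
rewrite deriveD; [|exact: diff_derivable|apply: derivableZ; exact: diff_derivable].
rewrite deriveZ; last exact: diff_derivable.
congr (_ + _ *: _).
rewrite (@derive_comp R m d (fun y => eul H h j (u0 y)) (fun u => H u 0 b)) //.
by apply: eq_bigr => l _; rewrite mxE.
Qed.

(** The second component of [aug H] is linear in the derivative, with coefficients bounded along the
    bounded iterates of [H]. One step multiplies it by at most [1 + dt k * (d * L)], hence at most
    an exponential factor over unit time. *)
Lemma aug_bounded m d (W : set 'rV[R]_m) (H : 'rV[R]_d -> 'rV[R]_d) u0 i :
  open W -> smoothv setT H -> smoothv W u0 -> ebounded H W u0 ->
  ebounded (aug H) W (fun y => row_mx (u0 y) (\row_b pd i (fun y => u0 y 0 b) y)).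
Proof.
move=> oW sH s0 bH y0 Wy0.
have [r hr] := bH y0 Wy0.
have r0 : 0 <= r.
  have := nbhs_singleton hr 0%N 0%N isT; exact: le_trans.
have [L L0 hL] : exists2 L, 0 <= L & forall b, forall l u, `|u| <= r ->
    `|pd l (fun u => H u 0 b) u| <= L.
  apply: (@finite_bound R _ (fun b L => forall l u, `|u| <= r ->
    `|pd l (fun u => H u 0 b) u| <= L)).
    by move=> b C C' h CC' l u /h /le_trans; exact.
  move=> b.
  apply: (@finite_bound R _ (fun l L => forall u, `|u| <= r ->
    `|pd l (fun u => H u 0 b) u| <= L)).
    by move=> l C C' h CC' u /h /le_trans; exact.
  move=> l; apply: closed_ball_bounded => u _.
  exact: (Cinfty_cont (Cinfty_pd l (sH b))).
pose V0 y := \row_b pd i (fun y => u0 y 0 b) y : 'rV[R]_d.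
have cV : {for y0, continuous V0}.
  apply: rV_continuous => b; apply/continuous_eps => e e0.
  have /continuous_eps/(_ e e0) := Cinfty_cont (Cinfty_pd i (s0 b)) Wy0.
  by apply: filterS => y; rewrite !mxE.
pose B := `|V0 y0| + 1.
exists (r + B * expR (d%:R * L)).
have oWn : \forall y \near y0, W y by apply: open_nbhs_nbhs.
have cVn : \forall y \near y0, `|V0 y| <= B.
  have /cvgrPdist_le/(_ 1 ltr01) := cV; apply: filterS => y h.
  rewrite /B addrC -lerBlDr; apply: le_trans h.
  by rewrite distrC; apply: le_trans (ler_norm _) (ler_dist_dist _ _).
near=> y => k j jk.
have Wy : W y by near: y.
have hy : forall k j, (j <= 2 ^ k)%N -> `|eul H (dt k) j (u0 y)| <= r by near: y.
have Vy : `|V0 y| <= B by near: y.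
have B0 : 0 <= B by apply: le_trans Vy.
rewrite (aug_eul i (dt k) j oW sH s0 Wy).
have E0 : 0 <= B * expR (d%:R * L) by rewrite mulr_ge0 // expR_ge0.
apply: norm_row_mx.
  by apply: le_trans (hy k j jk) _; rewrite lerDl.
pose v j := \row_b pd i (fun y => eul H (dt k) j (u0 y) 0 b) y : 'rV[R]_d.
rewrite -/(v j).
have q0 : 0 <= 1 + dt k * (d%:R * L) by rewrite addr_ge0 // !mulr_ge0 // dt_ge0.
have vb l : (l <= 2 ^ k)%N -> `|v l| <= B * (1 + dt k * (d%:R * L)) ^+ l.
  elim: l => [|l IH] lk; first by rewrite expr0 mulr1.
  have {}IH := IH (ltnW lk).
  have : v l.+1 = v l + dt k *: \row_b \sum_c (v l) 0 c *
      pd c (fun u => H u 0 b) (eul H (dt k) l (u0 y)).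
    have := aug_eul i (dt k) l.+1 oW sH s0 Wy.
    rewrite eulS (aug_eul i (dt k) l oW sH s0 Wy) /estep /aug row_mxKl row_mxKr scale_row_mx add_row_mx.
    by case/eq_row_mx => _ E; rewrite /v -E.
  move=> ->; apply: le_trans (ler_normD _ _) _.
  rewrite exprS mulrCA mulrDl mul1r; apply: lerD => //.
  rewrite normrZ ger0_norm ?dt_ge0 // -mulrA ler_wpM2l ?dt_ge0 //.
  apply: rV_norm_leP => [|b]; first by rewrite !mulr_ge0 // exprn_ge0.
  rewrite mxE -mulrA [L * _]mulrC; apply: dot_le => //.
  - by rewrite mulr_ge0 // exprn_ge0.
  - by move=> c; apply: le_trans (rV_norm_le _ _) IH.
  by move=> c; apply: hL; exact: hy (ltnW lk).
apply: le_trans (vb j jk) _; apply: le_trans (_ : B * expR (d%:R * L) <= _); last first.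
  by rewrite lerDr.
rewrite ler_wpM2l //.
apply: le_trans (_ : expR (dt k * (d%:R * L)) ^+ j <= _).
  by rewrite lerXn2r ?nnegrE ?expR_ge0 // expR_ge1Dx.
rewrite -expRM_natl ler_expR mulrA -[leRHS]mul1r ler_wpM2r ?mulr_ge0 //.
by rewrite -[leRHS](mul_dt k) ler_wpM2r ?dt_ge0 // ler_nat.
Unshelve. all: by end_near. Qed.

Definition elimit m d (H : 'rV[R]_d -> 'rV[R]_d) (W : set 'rV[R]_m) u0
    (a : 'rV[R]_m -> 'rV[R]_d) :=
  forall y0, W y0 -> exists C, \forall y \near y0,
    forall k, `|eulk H k (u0 y) - a y| <= C * dt k.

Lemma elimit_exists m d (W : set 'rV[R]_m) (H : 'rV[R]_d -> 'rV[R]_d) u0 :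
  smoothv setT H -> ebounded H W u0 -> exists a, elimit H W u0 a.
Proof.
move=> sH bH.
(* The limit is fixed before [C]: one function must satisfy the estimate with whatever local
   constant is available near each point. If no constant exists at [y], the value 0 is a default. *)
have P y : exists l : 'rV[R]_d, forall C, 0 <= C ->
    (forall k, `|eulk H k.+1 (u0 y) - eulk H k (u0 y)| <= C * dt k) ->
    forall k, `|eulk H k (u0 y) - l| <= 2 * C * dt k.
  have [[C0 [C00 hC0]]|nh] := pselect (exists C0, 0 <= C0 /\
    forall k, `|eulk H k.+1 (u0 y) - eulk H k (u0 y)| <= C0 * dt k); last first.
    by exists 0 => C C0 h; case: nh; exists C.
  have Q b : exists l : R, forall k, `|eulk H k (u0 y) 0 b - l| <= 2 * C0 * dt k.
    apply: dyadic_limit => // k; have := hC0 k; apply: le_trans.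
    by have := rV_norm_le (eulk H k.+1 (u0 y) - eulk H k (u0 y)) b; rewrite !mxE.
  have [l hl] := boolp.choice Q.
  exists (\row_b l b) => C CC hC k.
  have Cd : 0 <= 2 * C * dt k by rewrite !mulr_ge0 // dt_ge0.
  apply: rV_norm_leP => // b; rewrite !mxE.
  have [l' hl'] : exists l' : R, forall k, `|eulk H k (u0 y) 0 b - l'| <= 2 * C * dt k.
    apply: dyadic_limit => // k'; have := hC k'; apply: le_trans.
    by have := rV_norm_le (eulk H k'.+1 (u0 y) - eulk H k' (u0 y)) b; rewrite !mxE.
  suff -> : l b = l' by [].
  have D : `|l b - l'| <= 0.
    apply: (@le_of_dt _ _ (2 * C + 2 * C0) 0%N) => k' _.
    have := hl b k'; have := hl' k'; rewrite !ler_norml; lra.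
  by apply/eqP; rewrite -subr_eq0 -normr_eq0 eq_le D normr_ge0.
have [a ha] := boolp.choice P.
exists a => y0 Wy0; have [r hr] := bH y0 Wy0.
have [C C0 hC] := eul_cauchy r sH.
exists (2 * C); apply: filterS hr => y hy k.
by apply: ha => //; exact: hC.
Qed.

(** The induction ranges over all dimensions and fields because [aug] doubles the dimension: the
    derivative of the limit is a component of the limit for [aug H], to which the previous order
    applies. *)
Lemma elimit_smooth_aux m r : forall d (W : set 'rV[R]_m)
    (H : 'rV[R]_d -> 'rV[R]_d) u0 a,
  open W -> smoothv setT H -> smoothv W u0 -> ebounded H W u0 ->
  elimit H W u0 a ->
  (forall b, Ck r W (fun y => a y 0 b)) /\
  ((0 < r)%N -> forall y i, W y -> exists C, forall b k,
     `|pd i (fun y => eulk H k (u0 y) 0 b) y - pd i (fun y => a y 0 b) y|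
     <= C * dt k).
Proof.
elim: r => [|r IH] d W H u0 a oW sH s0 bH la.
  split=> // b y0 Wy0; have [C hC] := la y0 Wy0.
  apply: (@unif_cont m (fun k y => eulk H k (u0 y) 0 b) _ _ C).
    move=> k; exact: (Cinfty_cont (smoothv_eul _ _ oW sH s0 b) Wy0).
  apply: filterS hC => y h k; apply: le_trans (h k).
  by have := rV_norm_le (eulk H k (u0 y) - a y) b; rewrite !mxE.
have K i : exists a2 : 'rV[R]_m -> 'rV[R]_(d + d),
    elimit (aug H) W (fun y => row_mx (u0 y) (\row_b pd i (fun y => u0 y 0 b) y)) a2.
  by apply: elimit_exists; [exact: smoothv_aug|exact: aug_bounded].
have [a2 ha2] := boolp.choice K.
have D y0 : W y0 -> forall b, differentiable (fun y => a y 0 b) y0 /\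
    forall i, pd i (fun y => a y 0 b) y0 = (rsubmx (a2 i y0)) 0 b.
  move=> Wy0 b; have [C hC] := la y0 Wy0.
  have [C2 C20 hC2] : exists2 C2, 0 <= C2 & forall i,
     \forall y \near y0, forall k, `|eulk (aug H) k
       (row_mx (u0 y) (\row_b pd i (fun y => u0 y 0 b) y)) - a2 i y| <= C2 * dt k.
    apply: (@finite_bound R _ (fun i C2 => \forall y \near y0, forall k, `|eulk (aug H) k
       (row_mx (u0 y) (\row_b pd i (fun y => u0 y 0 b) y)) - a2 i y| <= C2 * dt k)).
      move=> i C1 C2 h CC; apply: filterS h => y h k; apply: le_trans (h k) _.
      by rewrite ler_wpM2r // dt_ge0.
    move=> i; have [C2 hC2] := ha2 i y0 Wy0; exists `|C2| => //.
    apply: filterS hC2 => y h k; apply: le_trans (h k) _.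
    by rewrite ler_wpM2r ?dt_ge0 // ler_norm.
  have : \forall y \near y0, [/\ W y, (forall k, `|eulk H k (u0 y) - a y| <= C * dt k) &
     forall i, forall k, `|eulk (aug H) k
       (row_mx (u0 y) (\row_b pd i (fun y => u0 y 0 b) y)) - a2 i y| <= C2 * dt k].
    near=> y; split; [by near: y; apply: open_nbhs_nbhs|by near: y|].
    move=> i; move: i; near: y; exact: filter_forall.
  case/nbhs_ballP => e0 /= e00 He.
  apply: (@unif_diff m (fun k y => eulk H k (u0 y) 0 b) _
    (fun i y => (rsubmx (a2 i y)) 0 b) y0 (`|C| + C2) e0) => //.
  - move=> y; rewrite -[X in X < _]opprK distrC opprK => yy k.
    have [Wy _ _] : [/\ W y, (forall k, `|eulk H k (u0 y) - a y| <= C * dt k) &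
     forall i, forall k, `|eulk (aug H) k
       (row_mx (u0 y) (\row_b pd i (fun y => u0 y 0 b) y)) - a2 i y| <= C2 * dt k].
      by apply: He; rewrite -ball_normE.
    exact: (Cinfty_diff (smoothv_eul _ _ oW sH s0 b) Wy).
  - move=> k i; exact: (Cinfty_cont (Cinfty_pd i (smoothv_eul _ _ oW sH s0 b)) Wy0).
  - move=> y yy k; have [Wy h _] : [/\ W y, (forall k, `|eulk H k (u0 y) - a y| <= C * dt k) &
     forall i, forall k, `|eulk (aug H) k
       (row_mx (u0 y) (\row_b pd i (fun y => u0 y 0 b) y)) - a2 i y| <= C2 * dt k].
      by apply: He; rewrite -ball_normE /= distrC.
    have := rV_norm_le (eulk H k (u0 y) - a y) b; rewrite !mxE => h2.
    apply: le_trans h2 (le_trans (h k) _).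
    rewrite ler_wpM2r ?dt_ge0 //; have := ler_norm C; lra.
  move=> y yy k i; have [Wy _ h] : [/\ W y, (forall k, `|eulk H k (u0 y) - a y| <= C * dt k) &
     forall i, forall k, `|eulk (aug H) k
       (row_mx (u0 y) (\row_b pd i (fun y => u0 y 0 b) y)) - a2 i y| <= C2 * dt k].
    by apply: He; rewrite -ball_normE /= distrC.
  have := h i k; rewrite /eulk (aug_eul i (dt k) (2 ^ k) oW sH s0 Wy) => h1.
  have := norm_rsubmx (row_mx (eul H (dt k) (2 ^ k) (u0 y))
       (\row_b0 pd i (fun y0 => eul H (dt k) (2 ^ k) (u0 y0) 0 b0) y) - a2 i y).
  rewrite linearB /= row_mxKr => h2.
  set z := (\row_b0 _ - _) in h2.
  have := rV_norm_le z b; rewrite /z !mxE => h3.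
  apply: le_trans h3 (le_trans h2 (le_trans h1 _)).
  by rewrite ler_wpM2r ?dt_ge0 // lerDr.
split.
  move=> b; split=> [y Wy|i]; first by have [] := D y Wy b.
  apply: (@Ck_ext R m r W (fun y => (a2 i y) 0 (rshift d b))) => //.
    by move=> y Wy; have [_ E] := D y Wy b; rewrite -[RHS]/(pd i _ y) E mxE.
  apply: (IH _ W (aug H) _ (a2 i) oW (smoothv_aug sH) _ (aug_bounded i oW sH s0 bH) (ha2 i)).1.
  apply: smoothv_row_mx => // c n; under eq_fun do rewrite mxE.
  by move: n; apply: Cinfty_pd.
move=> _ y i Wy; have [C hC] := ha2 i y Wy.
exists C => b k; have [_ ->] := D y Wy b.
have h1 := nbhs_singleton hC k.
rewrite /eulk (aug_eul i (dt k) (2 ^ k) oW sH s0 Wy) in h1.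
have := norm_rsubmx (row_mx (eul H (dt k) (2 ^ k) (u0 y))
       (\row_b0 pd i (fun y0 => eul H (dt k) (2 ^ k) (u0 y0) 0 b0) y) - a2 i y).
rewrite linearB /= row_mxKr => h2.
set z := (\row_b0 _ - _) in h2.
have := rV_norm_le z b; rewrite /z !mxE => h3.
exact: le_trans h3 (le_trans h2 h1).
Unshelve. all: by end_near. Qed.

(** Convergence of the first derivatives is recorded as well, since the potential is identified
    through the derivatives of its approximations. *)
Theorem euler_flow m d (W : set 'rV[R]_m) (H : 'rV[R]_d -> 'rV[R]_d) u0 :
  open W -> smoothv setT H -> smoothv W u0 -> ebounded H W u0 ->
  exists a : 'rV[R]_m -> 'rV[R]_d, [/\ smoothv W a,
    (forall y, W y -> exists C, forall k, `|eulk H k (u0 y) - a y| <= C * dt k) &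
    (forall y i, W y -> exists C, forall b k,
     `|pd i (fun y => eulk H k (u0 y) 0 b) y - pd i (fun y => a y 0 b) y|
     <= C * dt k)].
Proof.
move=> oW sH s0 bH; have [a la] := elimit_exists sH bH.
exists a; split.
- by move=> b r; have [h _] := elimit_smooth_aux r oW sH s0 bH la.
- by move=> y Wy; have [C hC] := la y Wy; exists C; exact: (nbhs_singleton hC).
- by have [_ /(_ isT)] := elimit_smooth_aux 1 oW sH s0 bH la.
Qed.

End Euler.

(** * Inverse functions, Hadamard's lemma and potentials *)

Section LocalAnalysis.
Variable R : realType.
Implicit Types (m d k : nat).

Lemma smoothv_cst m d (W : set 'rV[R]_m) (v : 'rV[R]_d) : smoothv W (fun=> v).
Proof. by move=> b r; exact: Ck_cst. Qed.

Lemma smoothv_id m (W : set 'rV[R]_m) : smoothv W id.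
Proof. by move=> b r; exact: Ck_coord. Qed.

Lemma smoothv_sub m d (U W : set 'rV[R]_m) (F : 'rV[R]_m -> 'rV[R]_d) :
  W `<=` U -> smoothv U F -> smoothv W F.
Proof. by move=> WU sF b r; exact: Ck_sub (sF b r). Qed.

Lemma smoothv_cont m d (W : set 'rV[R]_m) (F : 'rV[R]_m -> 'rV[R]_d) x :
  smoothv W F -> W x -> {for x, continuous F}.
Proof.
by move=> sF Wx; apply: rV_continuous => b; exact: (Cinfty_cont (sF b)).
Qed.

Lemma open_nball m (x0 : 'rV[R]_m) e : open [set x | `|x - x0| < e].
Proof.
have -> : [set x | `|x - x0| < e] = ball x0 e.
  by rewrite -ball_normE; apply/funext => x /=; rewrite distrC.
exact: ball_open.
Qed.

Lemma nbhs_nball m (x0 : 'rV[R]_m) (P : set 'rV[R]_m) : nbhs x0 P ->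
  exists2 e, 0 < e & forall x, `|x - x0| < e -> P x.
Proof.
by case/nbhs_ballP => e /= e0 H; exists e => // x xe; apply: H;
  rewrite -ball_normE /= distrC.
Qed.

Lemma bump_at m (x0 : 'rV[R]_m) (rho : R) : 0 < rho ->
  exists chi : 'rV[R]_m -> R, [/\ Cinfty setT chi,
    \forall x \near x0, chi x = 1 &
    forall x, rho <= `|x - x0| -> chi x = 0].
Proof.
move=> r0; have [chi [sc [e e0 c1] c0]] := @bump_exists R m rho r0.
exists (fun x => chi (x - x0)); split=> [r||x /c0 //].
  apply: (@Ck_comp R m m r setT setT (fun x => x - x0)) => //; first exact: openT.
  move=> l; under eq_fun do rewrite mxE [X in _ + X]mxE.
  by apply: Ck_add; [exact: openT|exact: Ck_coord|exact: Ck_cst].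
apply/nbhs_ballP; exists e => // x; rewrite -ball_normE /= distrC; exact: c1.
Qed.

Lemma dist_continuous m (x0 z : 'rV[R]_m) :
  {for z, continuous (fun x : 'rV[R]_m => `|x - x0|)}.
Proof.
apply/continuous_eps => e e0; apply/nbhs_ballP; exists e => // y.
rewrite -ball_normE /= => /ltW; apply: le_trans.
by apply: le_trans (ler_dist_dist _ _) _; rewrite opprB addrA subrK.
Qed.

Lemma near_all m (I : finType) (P : I -> 'rV[R]_m -> Prop) (x : 'rV[R]_m) :
  (forall i, \forall y \near x, P i y) -> \forall y \near x, forall i, P i y.
Proof.
move=> H; near=> y; move=> i; move: i; near: y; exact: filter_forall.
Unshelve. all: by end_near. Qed.

Lemma cut_smooth m (U : set 'rV[R]_m) (x0 : 'rV[R]_m) rho rho' chi f :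
  (forall x, `|x - x0| < rho' -> U x) -> rho < rho' ->
  Cinfty setT chi -> (forall x, rho <= `|x - x0| -> chi x = 0) ->
  Cinfty U f -> Cinfty setT (fun x => chi x * f x).
Proof.
move=> bU rr sc c0 sf r; apply: Ck_pointwise => x _.
have [xr|xr] := ltP `|x - x0| rho'.
  exists [set x | `|x - x0| < rho'] => //.
  apply: Ck_mul; [exact: open_nball|apply: Ck_sub (sc r) => //|].
  by apply: Ck_sub (sf r) => z; exact: bU.
exists [set x | rho < `|x - x0|]; first exact: lt_le_trans xr.
apply: (@Ck_ext R m r _ (fun=> 0)); last exact: Ck_cst.
  have -> : [set x | rho < `|x - x0|] = (fun x => `|x - x0|) @^-1` [set y | y > rho].
    by [].
  apply: open_comp; last exact: open_gt.
  by move=> z _; exact: dist_continuous.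
by move=> z /= rz; rewrite c0 ?mul0r // ltW.
Qed.

(** The global bound is what keeps the Euler iterates of the resulting fields in a ball. *)
Lemma cutoff m (U : set 'rV[R]_m) (x0 : 'rV[R]_m) f :
  open U -> U x0 -> Cinfty U f ->
  exists g, [/\ Cinfty setT g, \forall x \near x0, g x = f x &
    exists2 C, 0 <= C & forall x, `|g x| <= C].
Proof.
move=> oU Ux sf; have [rho' r0 hU] := nbhs_nball (open_nbhs_nbhs (conj oU Ux)).
pose rho := rho' / 2; have rr : rho < rho' by rewrite /rho; lra.
have rp : 0 < rho by rewrite /rho; lra.
have [chi [sc c1 c0]] := bump_at x0 rp.
have sg := cut_smooth hU rr sc c0 sf.
exists (fun x => chi x * f x); split => //.
  by apply: filterS c1 => x ->; rewrite mul1r.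
have [C C0 hC] := @closed_ball_bounded R m (fun x => chi x * f x) (`|x0| + rho)
  (fun x _ => Cinfty_cont sg (I : setT x)).
exists C => // x; have [xr|xr] := leP `|x| (`|x0| + rho); first exact: hC.
rewrite c0 ?mul0r ?normr0 //.
have := ler_normD (x - x0) x0; rewrite subrK; move: xr; lra.
Qed.

Lemma cutoffv m d (U : set 'rV[R]_m) (x0 : 'rV[R]_m) (F : 'rV[R]_m -> 'rV[R]_d) :
  open U -> U x0 -> smoothv U F ->
  exists G, [/\ smoothv setT G, \forall x \near x0, G x = F x &
    exists2 C, 0 <= C & forall x, `|G x| <= C].
Proof.
move=> oU Ux sF.
have [g hg] := boolp.choice (fun b => cutoff oU Ux (sF b)).
exists (fun x => \row_b g b x); split.
- by move=> b r; under eq_fun do rewrite mxE; case: (hg b).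
- have : \forall x \near x0, forall b, g b x = F x 0 b.
    by apply: near_all => b; case: (hg b).
  by apply: filterS => x hx; apply/rowP => b; rewrite mxE.
have [C C0 hC] : exists2 C, 0 <= C & forall b x, `|g b x| <= C.
  apply: (@finite_bound R _ (fun b C => forall x, `|g b x| <= C)).
    by move=> b C C' h CC' x; apply: le_trans (h x) CC'.
  by move=> b; case: (hg b).
by exists C => // x; apply: rV_norm_leP => // b; rewrite mxE.
Qed.

Definition jacm m d (F : 'rV[R]_m -> 'rV[R]_d) (x : 'rV[R]_m) : 'M[R]_(m, d) :=
  \matrix_(i, b) pd i (fun y => F y 0 b) x.

Lemma jacm_germ m d (F G : 'rV[R]_m -> 'rV[R]_d) x :
  (\near x, F x = G x) -> jacm F x = jacm G x.
Proof.
move=> h; apply/matrixP => i b; rewrite !mxE; apply: near_eq_derive.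
by apply: filterS h => y ->.
Qed.

Lemma Ck_det m d r (U : set 'rV[R]_m) (M : 'rV[R]_m -> 'M[R]_d) : open U ->
  (forall i j, Ck r U (fun x => M x i j)) -> Ck r U (fun x => \det (M x)).
Proof.
move=> oU H; apply: Ck_sum => // s _; apply: Ck_mul => //; first exact: Ck_cst.
by apply: Ck_prod.
Qed.

Lemma Ck_invmx m d r (U : set 'rV[R]_m) (M : 'rV[R]_m -> 'M[R]_d) i j : open U ->
  (forall x, U x -> \det (M x) != 0) ->
  (forall i j, Ck r U (fun x => M x i j)) -> Ck r U (fun x => invmx (M x) i j).
Proof.
move=> oU dn H.
apply: (@Ck_ext _ _ _ _ (fun x => (\det (M x))^-1 *
   ((-1) ^+ (j + i) * \det (row' j (col' i (M x)))))) => //.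
  move=> x Ux; rewrite /invmx unitmxE unitfE dn // !mxE /cofactor.
  by [].
apply: Ck_mul => //; first by apply: Ck_inv => //; exact: Ck_det.
apply: Ck_mul => //; first exact: Ck_cst.
by apply: Ck_det => // i' j'; under eq_fun do rewrite !mxE; exact: H.
Qed.

Lemma cont_neq0_near m (f : 'rV[R]_m -> R) (x : 'rV[R]_m) :
  {for x, continuous f} -> f x != 0 -> \forall y \near x, f y != 0.
Proof.
move=> /continuous_eps cf fx.
have := cf (`|f x| / 2); rewrite divr_gt0 ?normr_gt0 // => /(_ isT).
apply: filterS => y; apply: contraTneq => ->; rewrite subr0 -ltNge.
by rewrite ltr_pdivrMr // ltr_pMr ?normr_gt0 // ltr1n.
Qed.

Lemma row_le_mul m d (y : 'rV[R]_m) (M : 'M[R]_(m, d)) C : 0 <= C ->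
  (forall i b, `|M i b| <= C) -> `|y *m M| <= m%:R * (`|y| * C).
Proof.
move=> C0 hM; apply: rV_norm_leP => [|b]; first by rewrite !mulr_ge0.
rewrite mxE; apply: dot_le => //; exact: rV_norm_le.
Qed.

(** Let [M] be the inverse of the Jacobian near 0. Along the solution of [G' = y *m M (G)] starting
    from 0 the derivative of [F (G)] is the constant [y], so that [F (G) = y] at time 1. *)
Lemma local_right_inverse m (U : set 'rV[R]_m) (F : 'rV[R]_m -> 'rV[R]_m) :
  open U -> U 0 -> smoothv U F -> F 0 = 0 -> \det (jacm F 0) != 0 ->
  exists G e C, [/\ 0 < e, 0 <= C, smoothv [set y | `|y| < e] G &
    forall y, `|y| < e -> F (G y) = y /\ `|G y| <= C * `|y|].
Proof.
move=> oU U0 sF F0 dF.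
have [F1 [sF1 nF1 _]] := cutoffv oU U0 sF.
have F10 : F1 0 = 0 by rewrite (nbhs_singleton nF1).
have dF1 : \det (jacm F1 0) != 0.
  by rewrite (@jacm_germ _ _ F1 F).
have sJ i b : Cinfty setT (fun x => jacm F1 x i b).
  by move=> r; under eq_fun do rewrite mxE; move: r; exact: (Cinfty_pd i (sF1 b)).
have dn : \forall x \near (0 : 'rV[R]_m), \det (jacm F1 x) != 0.
  apply: cont_neq0_near => //.
  have : Ck 0 setT (fun x => \det (jacm F1 x)).
    by apply: Ck_det; [exact: openT|move=> i j; exact: sJ].
  by apply.
have [rd rd0 hrd] := nbhs_nball dn.
have sI i b : Cinfty [set x : 'rV[R]_m | `|x - 0| < rd] (fun x => invmx (jacm F1 x) i b).
  move=> r; apply: Ck_invmx; [exact: open_nball|exact: hrd|].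
  by move=> i' b'; apply: Ck_sub (sJ i' b' r).
have B0 : [set x : 'rV[R]_m | `|x - 0| < rd] 0 by rewrite /= subrr normr0.
have [M' hM'] := boolp.choice (fun p : 'I_m * 'I_m => cutoff (@open_nball m 0 rd) B0 (sI p.1 p.2)).
pose M x : 'M[R]_m := \matrix_(i, b) M' (i, b) x.
have sM i b : Cinfty setT (fun x => M x i b).
  by move=> r; under eq_fun do rewrite mxE; case: (hM' (i, b)).
have [C C0 hC] : exists2 C, 0 <= C & forall p x, `|M' p x| <= C.
  apply: (@finite_bound R _ (fun p C => forall x, `|M' p x| <= C)).
    by move=> p C C' h CC' x; apply: le_trans (h x) CC'.
  by move=> p; case: (hM' p).
have MJ : \forall x \near (0 : 'rV[R]_m), M x *m jacm F1 x = 1%:M /\ F1 x = F x.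
  have h : \forall x \near (0 : 'rV[R]_m), forall p, M' p x = invmx (jacm F1 x) p.1 p.2.
    by apply: near_all => p; case: (hM' p).
  near=> x; split; last by near: x.
  have -> : M x = invmx (jacm F1 x).
    by apply/matrixP => i b; rewrite mxE; have /= := (near h x) _ (i, b); apply.
  by rewrite mulVmx // unitmxE unitfE; near: x.
have [rho r0 hrho] := nbhs_nball MJ.
pose K := m%:R * C; have K0 : 0 <= K by rewrite mulr_ge0.
(* Iterates satisfy [|G| <= K * |y|]; this choice keeps them in the ball of radius [rho], where [M]
   inverts the Jacobian. *)
pose e := Num.min 1 (rho / (K + 1)).
have K1 : 0 < K + 1 by rewrite ltr_wpDl.
have e0 : 0 < e by rewrite lt_min ltr01 divr_gt0.
(* The parameter [y] is carried along as a frozen component, so that smoothness in [y] is smoothness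
   in the initial value. *)
pose H (w : 'rV[R]_(m + m)) : 'rV[R]_(m + m) := row_mx 0 (lsubmx w *m M (rsubmx w)).
pose u0 (y : 'rV[R]_m) : 'rV[R]_(m + m) := row_mx y 0.
pose g h j (y : 'rV[R]_m) := iter j (fun G => G + h *: (y *m M G)) 0.
have gS h j y : g h j.+1 y = g h j y + h *: (y *m M (g h j y)) by [].
have gE h j y : eul H h j (u0 y) = row_mx y (g h j y).
  elim: j => [//|j IH]; rewrite eulS IH /estep /H row_mxKl row_mxKr.
  by rewrite scale_row_mx add_row_mx scaler0 addr0 gS.
have gB k j y : (j <= 2 ^ k)%N -> `|g (dt R k) j y| <= K * `|y|.
  move=> jk; apply: le_trans (_ : (j%:R * dt R k) * (K * `|y|) <= _); last first.
    rewrite -[leRHS]mul1r ler_wpM2r ?mulr_ge0 //.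
    by rewrite -[leRHS](mul_dt R k) ler_wpM2r ?dt_ge0 // ler_nat.
  elim: j jk => [|j IH] jk; first by rewrite /g /= normr0 !mul0r.
  rewrite gS; apply: le_trans (ler_normD _ _) _.
  rewrite -natr1 !mulrDl mul1r lerD ?IH ?(ltnW jk) //.
  rewrite normrZ ger0_norm ?dt_ge0 // ler_wpM2l ?dt_ge0 //.
  rewrite /K -mulrA [C * _]mulrC; apply: row_le_mul => // i b.
  by rewrite mxE; exact: hC.
pose W := [set y : 'rV[R]_m | `|y| < e].
have oW : open W by have := @open_nball m 0 e; under eq_set do rewrite subr0.
have sH : smoothv setT H.
  apply: smoothv_row_mx; first exact: smoothv_cst.
  move=> b r; under eq_fun do rewrite mxE.
  apply: Ck_sum => [|i _]; first exact: openT.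
  apply: Ck_mul; [exact: openT|exact: smoothv_lsubmx|].
  apply: (@Ck_comp R _ m r setT setT (fun w => rsubmx w) (fun x => M x i b)) => //; first exact: openT.
    by move=> c; exact: smoothv_rsubmx.
  exact: sM.
have su0 : smoothv W u0.
  by apply: smoothv_row_mx; [exact: smoothv_id|exact: smoothv_cst].
have Wle y : W y -> `|y| <= 1 by move=> /ltW /le_trans; apply; rewrite ge_min lexx.
have bH : ebounded H W u0.
  move=> y0 Wy0; exists (1 + K).
  have : \forall y \near y0, W y by apply: open_nbhs_nbhs.
  apply: filterS => y Wy k j jk; rewrite gE; apply: norm_row_mx.
    by apply: le_trans (Wle _ Wy) _; rewrite lerDl.
  apply: le_trans (gB k j y jk) _.
  by rewrite -[leLHS]add0r lerD // ler_piMr // Wle.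
have [a [sa ca _]] := euler_flow oW sH su0 bH.
pose G y := rsubmx (a y).
have GB y : W y -> `|G y| <= K * `|y|.
  move=> Wy; have [D hD] := ca y Wy.
  apply: (@le_of_dt R _ _ D 0%N) => k _.
  have h1 := norm_rsubmx (eulk H k (u0 y) - a y).
  have h2 := le_trans h1 (hD k).
  rewrite /eulk gE linearB /= row_mxKr -/(G y) in h2.
  have h3 := gB k _ y (leqnn _).
  have := ler_normD (G y - g (dt R k) (2 ^ k)%N y) (g (dt R k) (2 ^ k)%N y).
  by rewrite subrK distrC; move: h2 h3; lra.
have small (y : 'rV[R]_m) : `|y| < e -> K * `|y| < rho.
  move=> ye; have : e <= rho / (K + 1) by rewrite ge_min lexx orbT.
  rewrite ler_pdivlMr // => h.
  have := normr_ge0 y; nra.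
exists G, e, K; split => //.
  move=> b r; apply: (smoothv_comp (V := setT) (g := rsubmx)) => //.
  exact: smoothv_rsubmx.
move=> y Wy; split; last exact: GB.
have inr (z : 'rV[R]_m) : `|z| <= K * `|y| -> M z *m jacm F1 z = 1%:M /\ F1 z = F z.
  by move=> hz; apply: hrho; rewrite subr0; apply: le_lt_trans hz (small _ Wy).
rewrite -(inr _ (GB _ Wy)).2.
have [L L0 hL] := smoothv_lip K sF1.
have [T T0 hT] : exists2 T, 0 <= T & forall b x z, `|x| <= K -> `|z| <= K ->
   `|F1 z 0 b - F1 x 0 b - \sum_i (z - x) 0 i * pd i (fun y => F1 y 0 b) x|
   <= T * `|z - x| ^+ 2.
  apply: (@finite_bound R _ (fun b T => forall x z, `|x| <= K -> `|z| <= K ->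
   `|F1 z 0 b - F1 x 0 b - \sum_i (z - x) 0 i * pd i (fun y => F1 y 0 b) x|
   <= T * `|z - x| ^+ 2)).
    move=> b T T' h TT x z xr zr; apply: le_trans (h x z xr zr) _.
    by rewrite ler_wpM2r // exprn_ge0.
  by move=> b; apply: taylor2_ball => r; apply: Ck_sub (sF1 b r).
have KyK : K * `|y| <= K by rewrite ler_piMr // Wle.
(* By Taylor's formula one step changes [F1] by [dt k *: y] up to a second-order error; the errors
   of [2 ^ k] steps add up to [O (dt k)]. *)
have step k j : (j < 2 ^ k)%N ->
   `|F1 (g (dt R k) j.+1 y) - F1 (g (dt R k) j y) - dt R k *: y| <= dt R k ^+ 2 * (T * K ^+ 2).
  move=> jk; set h := dt R k.
  have h0 : 0 <= h := dt_ge0 R k.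
  have b1 := gB k _ y jk; have b0 := gB k _ y (ltnW jk).
  have dE : g h j.+1 y - g h j y = h *: (y *m M (g h j y)).
    by rewrite gS addrC addKr.
  apply: rV_norm_leP => [|b]; first by rewrite !mulr_ge0 // exprn_ge0.
  have := hT b _ _ (le_trans b0 KyK) (le_trans b1 KyK).
  have -> : \sum_i (g h j.+1 y - g h j y) 0 i * pd i (fun y => F1 y 0 b) (g h j y) =
      (h *: y) 0 b.
    have -> : \sum_i (g h j.+1 y - g h j y) 0 i * pd i (fun y => F1 y 0 b) (g h j y)
      = ((g h j.+1 y - g h j y) *m jacm F1 (g h j y)) 0 b.
      by rewrite mxE; apply: eq_bigr => i _; congr (_ * _); rewrite mxE.
    by rewrite dE -scalemxAl -mulmxA (inr _ b0).1 mulmx1.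
  rewrite !mxE => /le_trans; apply.
  rewrite [leRHS]mulrCA ler_wpM2l // -exprMn lerXn2r ?nnegrE ?mulr_ge0 //.
  rewrite dE normrZ ger0_norm // ler_wpM2l //.
  apply: le_trans KyK; rewrite /K -mulrA [C * _]mulrC; apply: row_le_mul => // i c.
  by rewrite mxE; exact: hC.
have tele k j : (j <= 2 ^ k)%N ->
   `|F1 (g (dt R k) j y) - (j%:R * dt R k) *: y| <= j%:R * (dt R k ^+ 2 * (T * K ^+ 2)).
  elim: j => [|j IH] jk; first by rewrite /g /= F10 !mul0r scale0r subr0 normr0.
  have -> : F1 (g (dt R k) j.+1 y) - (j.+1%:R * dt R k) *: y =
     (F1 (g (dt R k) j y) - (j%:R * dt R k) *: y) +
     (F1 (g (dt R k) j.+1 y) - F1 (g (dt R k) j y) - dt R k *: y).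
    by apply/rowP => i; rewrite !mxE -natr1; ring.
  apply: le_trans (ler_normD _ _) _; rewrite -[in leRHS]natr1 mulrDl mul1r.
  by rewrite lerD ?IH ?step // ltnW.
have [D hD] := ca y Wy.
have lim0 : `|F1 (G y) - y| <= 0.
  apply: (@le_of_dt R _ _ (L * D + T * K ^+ 2) 0%N) => k _.
  have h1 := norm_rsubmx (eulk H k (u0 y) - a y).
  have h2 := le_trans h1 (hD k).
  rewrite /eulk gE linearB /= row_mxKr -/(G y) in h2.
  have h3 := gB k _ y (leqnn _).
  have h4 := tele k _ (leqnn _).
  rewrite mul_dt scale1r expr2 -mulrA mulrA mul_dt mul1r in h4.
  have h5 := hL _ _ (le_trans h3 KyK) (le_trans (GB y Wy) KyK).
  rewrite distrC in h2; have h6 := ler_wpM2l L0 h2.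
  have := ler_normD (F1 (G y) - F1 (g (dt R k) (2 ^ k)%N y)) (F1 (g (dt R k) (2 ^ k)%N y) - y).
  rewrite addrA subrK; move: h4 h5 h6; lra.
by apply/eqP; rewrite -subr_eq0 -normr_eq0 eq_le lim0 normr_ge0.
Unshelve. all: by end_near. Qed.

End LocalAnalysis.

Section InverseFunction.
Variable R : realType.
Implicit Types (m d k : nat).

Lemma jacm_comp m (F G : 'rV[R]_m -> 'rV[R]_m) (U W : set 'rV[R]_m) x :
  smoothv W G -> W x -> smoothv U F -> U (G x) ->
  jacm (fun y => F (G y)) x = jacm G x *m jacm F (G x).
Proof.
move=> sG Wx sF UG; apply/matrixP => i b; rewrite !mxE /pd.
rewrite (@derive_comp R m m G (fun u => F u 0 b)).
- by apply: eq_bigr => l _; rewrite !mxE.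
- by move=> l; exact: (Cinfty_diff (sG l)).
exact: (Cinfty_diff (sF b)).
Qed.

Lemma jacm_id m (x : 'rV[R]_m) : jacm id x = 1%:M.
Proof.
apply/matrixP => i b; rewrite !mxE /pd derive_coord mxE eqxx /=.
by rewrite eq_sym.
Qed.

(* A right inverse [G] of [F] has itself a right inverse, which must be [F]. *)
Lemma inverse_function m (U : set 'rV[R]_m) (F : 'rV[R]_m -> 'rV[R]_m) :
  open U -> U 0 -> smoothv U F -> F 0 = 0 -> \det (jacm F 0) != 0 ->
  exists (A B : set 'rV[R]_m) G, [/\ open A, A 0 /\ A `<=` U, open B, smoothv B G &
    (forall x, A x -> B (F x) /\ G (F x) = x) /\
    (forall y, B y -> A (G y) /\ F (G y) = y)].
Proof.
move=> oU U0 sF F0 dF.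
have [G [e [C [e0 C0 sG hG]]]] := local_right_inverse oU U0 sF F0 dF.
pose W := [set y : 'rV[R]_m | `|y| < e].
have W0 : W 0 by rewrite /W /= normr0.
have oW : open W by have := @open_nball R m 0 e; under eq_set do rewrite subr0.
have G0 : G 0 = 0.
  by have [_] := hG 0 W0; rewrite normr0 mulr0 normr_le0 => /eqP.
have dG : \det (jacm G 0) != 0.
  have : jacm (fun y => F (G y)) 0 = 1%:M.
    rewrite -(@jacm_id m 0); apply: jacm_germ.
    by apply: near_open oW W0 _ => y Wy; have [] := hG y Wy.
  rewrite (jacm_comp sG W0 sF) ?G0 // => /(congr1 determinant).
  rewrite det_mulmx det1; apply: contra_eq_neq => ->; rewrite mul0r eq_sym.
  exact: oner_neq0.
have [F' [e' [C' [e'0 C'0 sF' hF']]]] := local_right_inverse oW W0 sG G0 dG.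
have [ru ru0 hru] := nbhs_nball (open_nbhs_nbhs (conj oU U0)).
have C'1 : 0 < C' + 1 by rewrite ltr_wpDl.
pose r := Num.min ru (Num.min e' (e / (C' + 1))).
have r0 : 0 < r by rewrite !lt_min ru0 e'0 divr_gt0.
pose A := [set x : 'rV[R]_m | `|x| < r].
have oA : open A by have := @open_nball R m 0 r; under eq_set do rewrite subr0.
have hA x : A x -> [/\ U x, `|x| < e' & `|F' x| < e].
  rewrite /A /= !lt_min => /and3P[xu xe' xe]; split => //.
    by apply: hru; rewrite subr0.
  have [_ /le_lt_trans] := hF' x xe'; apply.
  by move: xe; rewrite ltr_pdivlMr //; have := normr_ge0 x; nra.
have FF' x : A x -> F x = F' x.
  move=> Ax; have [Ux xe' Fe] := hA x Ax; have [E _] := hF' x xe'.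
  by rewrite -{1}E; have [] := hG _ Fe.
pose B := W `&` G @^-1` A.
exists A, B, G; split => //.
- by split; [rewrite /A /= normr0|move=> x /hA[]].
- rewrite openE => y [Wy Ay]; apply: filterI; first exact: open_nbhs_nbhs.
  have cG := smoothv_cont sG Wy.
  by apply: cG; exact: open_nbhs_nbhs.
- by apply: smoothv_sub sG => y [].
split=> [x Ax|y [Wy Ay]].
  have [Ux xe' Fe] := hA x Ax; have [E _] := hF' x xe'.
  by rewrite FF' // /B /W /= E; split.
by split=> //; have [] := hG y Wy.
Qed.

End InverseFunction.

(** * Riemann sums as Euler schemes, and Hadamard's lemma *)

Section Quadrature.
Variable R : realType.
Implicit Types (m d k : nat).

(** The limit is the integral of [q i (t *: y)] over [t] in [[0, 1]]: the Riemann sums are Euler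
    iterates of a field whose state is [y], the moving point [t *: y] and the accumulated sum. *)
Lemma eul_average m (q : 'I_m -> 'rV[R]_m -> R) :
  (forall i, Cinfty setT (q i)) ->
  exists a : 'rV[R]_m -> 'rV[R]_m, smoothv [set y | `|y| < 1] a /\
   forall y, `|y| < 1 -> exists C, forall k,
     `|\row_i (dt R k * \sum_(j < 2 ^ k) q i ((j%:R * dt R k) *: y)) - a y| <= C * dt R k.
Proof.
move=> sq.
pose Q (y : 'rV[R]_m) : 'rV[R]_m := \row_i q i y.
have sQ : smoothv setT Q by move=> b r; under eq_fun do rewrite mxE; exact: sq.
pose H (w : 'rV[R]_(m + (m + m))) : 'rV[R]_(m + (m + m)) :=
  row_mx 0 (row_mx (lsubmx w) (Q (lsubmx (rsubmx w)))).
pose u0 (y : 'rV[R]_m) : 'rV[R]_(m + (m + m)) := row_mx y (row_mx 0 0).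
pose W := [set y : 'rV[R]_m | `|y| < 1].
have oW : open W by have := @open_nball R m 0 1; under eq_set do rewrite subr0.
pose S h n (y : 'rV[R]_m) := \row_i (h * \sum_(j < n) q i ((j%:R * h) *: y)).
have gE h n y : eul H h n (u0 y) = row_mx y (row_mx ((n%:R * h) *: y) (S h n y)).
  elim: n => [|n IH].
    rewrite /eul /= /u0 mul0r scale0r; congr (row_mx _ (row_mx _ _)).
    by apply/rowP => i; rewrite !mxE big_ord0 mulr0.
  rewrite eulS IH /estep /H !row_mxKl !row_mxKr row_mxKl.
  rewrite !scale_row_mx !add_row_mx scaler0 addr0; congr (row_mx _ (row_mx _ _)).
    by rewrite -scalerDl -natr1 mulrDl mul1r.
  by apply/rowP => i; rewrite !mxE big_ord_recr /= mulrDr.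
have [C C0 hC] := smoothv_bound 1 sQ.
have jd k j : (j <= 2 ^ k)%N -> 0 <= j%:R * dt R k <= 1.
  move=> jk; rewrite mulr_ge0 ?dt_ge0 //= -[leRHS](mul_dt R k).
  by rewrite ler_wpM2r ?dt_ge0 // ler_nat.
have sH : smoothv setT H.
  apply: smoothv_row_mx; first exact: smoothv_cst.
  apply: smoothv_row_mx; first exact: smoothv_lsubmx.
  apply: (smoothv_comp (V := setT)) => //; first exact: openT.
  apply: (smoothv_comp (V := setT) (g := lsubmx)) => //; first exact: openT.
    exact: smoothv_rsubmx.
  exact: smoothv_lsubmx.
have su0 : smoothv W u0.
  by apply: smoothv_row_mx; [exact: smoothv_id|exact: smoothv_cst].
have bH : ebounded H W u0.
  move=> y0 Wy0; exists (1 + C).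
  have : \forall y \near y0, W y by apply: open_nbhs_nbhs.
  apply: filterS => y /ltW Wy k j jk.
  have /andP[j0 j1] := jd k j jk.
  have jy (n : nat) : (n <= 2 ^ k)%N -> `|(n%:R * dt R k) *: y| <= 1.
    move=> /jd /andP[n0 n1]; rewrite normrZ ger0_norm //.
    by rewrite -[leRHS]mulr1 ler_pM.
  have C1 : (1 : R) <= 1 + C by rewrite lerDl.
  rewrite gE; apply: norm_row_mx; first exact: le_trans C1.
  apply: norm_row_mx; first exact: le_trans (jy j jk) C1.
  apply: rV_norm_leP => [|i]; first exact: le_trans C1.
  rewrite mxE normrM ger0_norm ?dt_ge0 //.
  apply: le_trans (_ : dt R k * (j%:R * C) <= _).
    rewrite ler_wpM2l ?dt_ge0 //; apply: le_trans (ler_norm_sum _ _ _) _.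
    rewrite -[j in j%:R]card_ord mulr_natl -sumr_const; apply: ler_sum => l _.
    have := hC _ (jy l (leq_trans (ltnW (ltn_ord l)) jk)); apply: le_trans.
    by have := rV_norm_le (Q ((l%:R * dt R k) *: y)) i; rewrite mxE.
  rewrite mulrA [dt R k * _]mulrC.
  by apply: le_trans (_ : C <= _); [rewrite ler_piMl|rewrite lerDr].
have [a [sa ca _]] := euler_flow oW sH su0 bH.
exists (fun y => rsubmx (rsubmx (a y))); split.
  move=> b r; apply: (smoothv_comp (V := setT) (g := rsubmx)) => //.
    apply: (smoothv_comp (V := setT) (g := rsubmx)) => //.
    exact: smoothv_rsubmx.
  exact: smoothv_rsubmx.
move=> y Wy; have [D hD] := ca y Wy; exists D => k.
have := hD k; rewrite /eulk gE; apply: le_trans.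
apply: le_trans (norm_rsubmx _); rewrite linearB /= row_mxKr.
by apply: le_trans (norm_rsubmx _); rewrite linearB /= row_mxKr.
Qed.

(** [h i y] is the mean of [pd i f] over the segment from 0 to [y]. The identity comes from
    telescoping [f] along the subdivided segment, each piece being estimated by Taylor's formula. *)
Lemma hadamard m (U : set 'rV[R]_m) (f : 'rV[R]_m -> R) :
  open U -> U 0 -> Cinfty U f ->
  exists (W : set 'rV[R]_m) (h : 'I_m -> 'rV[R]_m -> R),
   [/\ open W, W 0, forall i, Cinfty W (h i), forall i, h i 0 = pd i f 0 &
    forall y, W y -> f y = f 0 + \sum_i y 0 i * h i y].
Proof.
move=> oU U0 sf.
have [g [sg ng _]] := cutoff oU U0 sf.
have [a [sa ca]] := @eul_average m (fun i => pd i g) (fun i => Cinfty_pd i sg).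
have [r r0 hr] := nbhs_nball ng.
pose e := Num.min 1 r.
have e0 : 0 < e by rewrite lt_min ltr01.
pose W := [set y : 'rV[R]_m | `|y| < e].
have oW : open W by have := @open_nball R m 0 e; under eq_set do rewrite subr0.
have hW y : W y -> `|y| < 1 /\ g y = f y.
  by rewrite /W /= lt_min => /andP[y1 yr]; split => //; apply: hr; rewrite subr0.
have W0 : W 0 by rewrite /W /= normr0.
exists W, (fun i y => a y 0 i); split => //.
- by move=> i k; apply: Ck_sub (sa i k) => y /hW[].
- move=> i; have [y1 _] := hW 0 W0; have [C hC] := ca 0 y1.
  have -> : pd i f 0 = pd i g 0.
    by apply: near_eq_derive; apply: filterS ng => z ->.
  have D : `|a 0 0 i - pd i g 0| <= 0.
    apply: (@le_of_dt R _ _ C 0%N) => k _; rewrite add0r.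
    apply: le_trans (hC k); rewrite distrC.
    have := rV_norm_le (\row_i (dt R k * \sum_(j < 2 ^ k) pd i g ((j%:R * dt R k) *: 0)) - a 0) i.
    rewrite !mxE; under eq_bigr do rewrite scaler0.
    rewrite sumr_const card_ord mulrnAr -mulr_natl mulrA mul_dt mul1r.
    by [].
  by apply/eqP; rewrite -subr_eq0 -normr_eq0 eq_le D normr_ge0.
move=> y Wy; have [y1 gy] := hW y Wy; have [_ g0] := hW 0 W0.
rewrite -gy -g0.
have [C hC] := ca y y1.
have [T T0 hT] := taylor2_ball (r := 1) (f := g) (fun k => Ck_sub (fun _ _ => I) (sg k)).
have y1' := ltW y1.
pose p k (j : nat) := (j%:R * dt R k) *: y.
have step k j : (j < 2 ^ k)%N ->
  `|g (p k j.+1) - g (p k j) - dt R k * \sum_i y 0 i * pd i g (p k j)| <= dt R k ^+ 2 * T.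
  move=> jk.
  have b n : (n <= 2 ^ k)%N -> `|p k n| <= 1.
    move=> nk; rewrite /p normrZ ger0_norm ?mulr_ge0 ?dt_ge0 //.
    rewrite -[leRHS]mulr1 ler_pM ?mulr_ge0 ?dt_ge0 //.
    by rewrite -[leRHS](mul_dt R k) ler_wpM2r ?dt_ge0 // ler_nat.
  have E : p k j.+1 - p k j = dt R k *: y.
    by rewrite /p -scalerBl -natr1 mulrDl mul1r addrC addKr.
  have := hT _ _ (b _ (ltnW jk)) (b _ jk); rewrite E.
  have -> : \sum_i (dt R k *: y) 0 i * pd i g (p k j) =
     dt R k * \sum_i y 0 i * pd i g (p k j).
    by rewrite mulr_sumr; apply: eq_bigr => i _; rewrite mxE mulrA.
  move=> /le_trans; apply; rewrite mulrC ler_wpM2r //.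
  rewrite normrZ ger0_norm ?dt_ge0 // lerXn2r ?nnegrE ?mulr_ge0 ?dt_ge0 //.
  by rewrite ler_piMr ?dt_ge0.
have tele k n : (n <= 2 ^ k)%N ->
  `|g (p k n) - g 0 - dt R k * \sum_(j < n) \sum_i y 0 i * pd i g (p k j)|
    <= n%:R * (dt R k ^+ 2 * T).
  elim: n => [|n IH] nk.
    by rewrite big_ord0 /p !mul0r scale0r mulr0 !subr0 subrr normr0.
  have -> : g (p k n.+1) - g 0 - dt R k * (\sum_(j < n.+1) \sum_i y 0 i * pd i g (p k j)) =
    (g (p k n) - g 0 - dt R k * \sum_(j < n) \sum_i y 0 i * pd i g (p k j)) +
    (g (p k n.+1) - g (p k n) - dt R k * \sum_i y 0 i * pd i g (p k n)).
    by rewrite big_ord_recr /=; ring.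
  apply: le_trans (ler_normD _ _) _; rewrite -natr1 mulrDl mul1r.
  by rewrite lerD ?IH ?step // ltnW.
have D : `|g y - (g 0 + \sum_i y 0 i * a y 0 i)| <= 0.
  apply: (@le_of_dt R _ _ (T + m%:R * `|C|) 0%N) => k _; rewrite add0r.
  have := tele k _ (leqnn _); rewrite /p mul_dt scale1r expr2 -mulrA mulrA mul_dt mul1r.
  rewrite exchange_big /= mulr_sumr => h1.
  have h2 : `|\sum_i y 0 i * (dt R k * (\sum_(j < 2 ^ k) pd i g ((j%:R * dt R k) *: y)) - a y 0 i)|
     <= m%:R * (1 * (`|C| * dt R k)).
    apply: dot_le => //; first by rewrite mulr_ge0 // dt_ge0.
      by move=> i; apply: le_trans (rV_norm_le _ _) y1'.
    move=> i; apply: le_trans (_ : C * dt R k <= _); last first.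
      by rewrite ler_wpM2r ?dt_ge0 ?ler_norm.
    apply: le_trans (hC k).
    by have := rV_norm_le (\row_i (dt R k * \sum_(j < 2 ^ k) pd i g ((j%:R * dt R k) *: y)) - a y) i; rewrite !mxE.
  have := ler_normD (g y - g 0 - \sum_i dt R k * \sum_(j < 2 ^ k) y 0 i * pd i g ((j%:R * dt R k) *: y))
    (\sum_i y 0 i * (dt R k * (\sum_(j < 2 ^ k) pd i g ((j%:R * dt R k) *: y)) - a y 0 i)).
  have -> : \sum_i dt R k * \sum_(j < 2 ^ k) y 0 i * pd i g ((j%:R * dt R k) *: y) =
     \sum_i y 0 i * (dt R k * (\sum_(j < 2 ^ k) pd i g ((j%:R * dt R k) *: y))).
    by apply: eq_bigr => i _; rewrite -mulr_sumr; ring.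
  move: h1.
  have -> : \sum_i dt R k * \sum_(j < 2 ^ k) y 0 i * pd i g ((j%:R * dt R k) *: y) =
     \sum_i y 0 i * (dt R k * (\sum_(j < 2 ^ k) pd i g ((j%:R * dt R k) *: y))).
    by apply: eq_bigr => i _; rewrite -mulr_sumr; ring.
  under [X in `|_ + X|]eq_bigr do rewrite mulrBr.
  rewrite sumrB addrA subrK opprD addrA => h1 h3.
  apply: le_trans h3 _; rewrite mulrDl lerD //; last by rewrite mul1r mulrA in h2.
  by rewrite mulrC.
by apply/eqP; rewrite -subr_eq0 -normr_eq0 eq_le D normr_ge0.
Qed.

End Quadrature.

(** * Potentials for commuting fields *)

Section Potential.
Variable R : realType.
Variables (m k : nat) (hk : (k <= m)%N).
Local Notation w := (widen_ord hk).
Local Notation E := 'rV[R]_m.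

Section Scheme.
Variable A : 'I_k -> 'I_m -> E -> R.

(* With [D_l = \sum_b A l b * d_b], [radial] discretizes the curve [Y' = - \sum_l y_l D_l (Y)] from [y]
   and [rsum] an integral along it.  When the [D_l] commute, [D_i Y] is [(1 - t) D_i (Y)] up to the
   step size, so that [D_i] of the integral of compatible [q] is [(1 - t) q_i (Y) - q_i y]. *)
Fixpoint radial (h : R) (j : nat) (y : E) : E :=
  if j is j'.+1 then radial h j' y -
    h *: \row_b \sum_l y 0 (w l) * A l b (radial h j' y) else y.

Definition rsum (q : 'I_k -> E -> R) (h : R) (n : nat) (y : E) : R :=
  - (h * \sum_(j < n) \sum_l y 0 (w l) * q l (radial h j y)).

Lemma rsumS q h n y : rsum q h n.+1 y =
  rsum q h n y - h * \sum_l y 0 (w l) * q l (radial h n y).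
Proof. by rewrite /rsum big_ord_recr /= mulrDr opprD. Qed.

Lemma radialE h j y b : radial h j y 0 b = y 0 b + rsum (fun l => A l b) h j y.
Proof.
elim: j => [|j IH]; first by rewrite /rsum big_ord0 mulr0 oppr0 addr0.
by rewrite rsumS addrA -IH /= !mxE.
Qed.

Hypothesis sA : forall l b, Cinfty setT (A l b).

Lemma smooth_scheme h j : smoothv setT (radial h j) /\
  forall q : 'I_k -> E -> R, (forall l, Cinfty setT (q l)) -> Cinfty setT (rsum q h j).
Proof.
elim: j => [|j [sY sP]].
  split=> [b r|q sq r]; first exact: Ck_coord.
  by rewrite /rsum; under eq_fun do rewrite big_ord0 mulr0 oppr0; exact: Ck_cst.
have sP1 q : (forall l, Cinfty setT (q l)) -> Cinfty setT (rsum q h j.+1).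
  move=> sq r; have -> : rsum q h j.+1 = fun y => rsum q h j y +
      (- h) * \sum_l y 0 (w l) * q l (radial h j y).
    by apply/funext => y; rewrite rsumS mulNr.
  apply: Ck_add; [exact: openT|exact: sP|].
  apply: Ck_mul; [exact: openT|exact: Ck_cst|].
  apply: Ck_sum => [|l _]; first exact: openT.
  apply: Ck_mul; [exact: openT|exact: Ck_coord|].
  apply: (@Ck_comp R _ m r setT setT (radial h j) (q l)) => //; first exact: openT.
    by move=> b; exact: sY.
  exact: sq.
split=> // b r; under eq_fun do rewrite radialE.
apply: Ck_add; [exact: openT|exact: Ck_coord|].
exact: sP1.
Qed.

Lemma radial_diff h j y b : differentiable (fun z => radial h j z 0 b) y.
Proof. exact: (Cinfty_diff ((smooth_scheme h j).1 b)). Qed.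

Lemma derive_rsumS q h n y v : (forall l, Cinfty setT (q l)) ->
  'D_v (rsum q h n.+1) y = 'D_v (rsum q h n) y -
   h * \sum_l (v 0 (w l) * q l (radial h n y) + y 0 (w l) *
     \sum_c 'D_v (fun z => radial h n z 0 c) y * pd c (q l) (radial h n y)).
Proof.
move=> sq.
have dP : differentiable (rsum q h n) y.
  exact: (Cinfty_diff ((smooth_scheme h n).2 q sq)).
have dq l : differentiable (fun z => q l (radial h n z)) y.
  apply: (@differentiable_comp _ _ _ _ (radial h n) (q l)).
    by apply: differentiable_rV => b; exact: radial_diff.
  exact: (Cinfty_diff (sq l)).
have dc l : differentiable (fun z : E => z 0 (w l)) y by exact: differentiable_coord.
have -> : rsum q h n.+1 = rsum q h n +
   (- h) *: (\sum_l ((fun z : E => z 0 (w l)) * (fun z => q l (radial h n z)))).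
  apply/funext => z; rewrite rsumS !fctE /GRing.scale /= mulNr; congr (_ - _ * _).
  by rewrite fct_sumE.
have dt l : derivable ((fun z : E => z 0 (w l)) * (fun z => q l (radial h n z))) y v.
  by apply: diff_derivable; exact: differentiableM.
rewrite deriveD; [|exact: diff_derivable|]; last first.
  by apply: derivableZ; exact: derivable_sum.
rewrite deriveZ; last exact: derivable_sum.
rewrite derive_sum // /GRing.scale /= mulNr; congr (_ - _ * _).
apply: eq_bigr => l _; rewrite deriveM; [|exact: diff_derivable|exact: diff_derivable].
rewrite derive_coord /GRing.scale /= addrC mulrC; congr (_ + _ * _).
rewrite (@derive_comp R m m (radial h n) (q l)) //.
  by move=> b; exact: radial_diff.
exact: (Cinfty_diff (sq l)).
Qed.

End Scheme.

Lemma dot2_le n n' (a : 'I_n -> R) (v : 'I_n' -> R) (p : 'I_n -> 'I_n' -> R) A B C :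
  0 <= A -> 0 <= B -> 0 <= C -> (forall i, `|a i| <= A) ->
  (forall i, `|v i| <= B) -> (forall i j, `|p i j| <= C) ->
  `|\sum_i a i * \sum_c v c * p i c| <= n%:R * (A * (n'%:R * (B * C))).
Proof.
move=> A0 B0 C0 ha hv hp; apply: dot_le => //; first by rewrite !mulr_ge0.
by move=> i; apply: dot_le.
Qed.

(** The radial curve lowers the first [k] coordinates linearly to 0, so it ends on the slice where
    they vanish. The potential normalized by 0 on that slice is the integral of [\sum_l y_l * g l]
    along the curve, whence the vanishing of its transverse derivatives at 0. *)
Lemma potential_global (A : 'I_k -> 'I_m -> E -> R) (g : 'I_k -> E -> R) rho CA :
  0 < rho -> 0 <= CA ->
  (forall l b, Cinfty setT (A l b)) -> (forall l, Cinfty setT (g l)) ->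
  (forall l b y, `|A l b y| <= CA) -> (forall l y, `|g l y| <= CA) ->
  (forall y, `|y| < rho -> forall l j, A l (w j) y = (l == j)%:R) ->
  (forall y, `|y| < rho -> forall i l b,
    \sum_c A i c y * pd c (A l b) y = \sum_c A l c y * pd c (A i b) y) ->
  (forall y, `|y| < rho -> forall i l,
    \sum_c A i c y * pd c (g l) y = \sum_c A l c y * pd c (g i) y) ->
  exists2 e, 0 < e & exists phi : E -> R,
    [/\ Cinfty [set y | `|y| < e] phi, phi 0 = 0,
        forall c : 'I_m, (k <= c)%N -> pd c phi 0 = 0 &
        forall y, `|y| < e -> forall i, \sum_c A i c y * pd c phi y = g i y].
Proof.
move=> rho0 CA0 sA sg bA bg hA1 hcomm hclosed.
pose K := 1 + k%:R * CA; have K1 : 1 <= K by rewrite lerDl mulr_ge0.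
have K0 : 0 < K by apply: lt_le_trans K1.
(* Every iterate is bounded by [K * |y|], hence by [rho / 2]: all of them stay where the hypotheses
   on [A] and [g] hold. *)
pose e := Num.min 1 (rho / (2 * K)).
have e0 : 0 < e by rewrite lt_min ltr01 divr_gt0 // mulr_gt0.
pose r := rho / 2; have rr : r < rho by rewrite /r; lra.
pose W := [set y : E | `|y| < e].
have oW : open W by have := @open_nball R m 0 e; under eq_set do rewrite subr0.
have W1 y : W y -> `|y| <= 1 by move=> /ltW /le_trans; apply; rewrite ge_min lexx.
have Wr y : W y -> K * `|y| <= r.
  rewrite /W /= lt_min => /andP[_]; rewrite ltr_pdivlMr ?mulr_gt0 // /r => h.
  by rewrite ler_pdivlMr //; apply/ltW; move: h; rewrite mulrA mulrC mulrA mulrAC [K * _]mulrC.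
have jd n j : (j <= 2 ^ n)%N -> 0 <= j%:R * dt R n <= 1.
  move=> jk; rewrite mulr_ge0 ?dt_ge0 //= -[leRHS](mul_dt R n).
  by rewrite ler_wpM2r ?dt_ge0 // ler_nat.
have qb (q : 'I_k -> E -> R) (y z : E) : (forall l z, `|q l z| <= CA) ->
   `|\sum_l y 0 (w l) * q l z| <= k%:R * (`|y| * CA).
  by move=> hq; apply: dot_le => // l; exact: rV_norm_le.
have rsb (q : 'I_k -> E -> R) n j (y : E) : (forall l z, `|q l z| <= CA) ->
   (j <= 2 ^ n)%N -> `|rsum A q (dt R n) j y| <= k%:R * CA * `|y|.
  move=> hq jn; rewrite /rsum normrN normrM ger0_norm ?dt_ge0 //.
  apply: le_trans (_ : dt R n * (j%:R * (k%:R * (`|y| * CA))) <= _).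
    rewrite ler_wpM2l ?dt_ge0 //; apply: le_trans (ler_norm_sum _ _ _) _.
    rewrite -[j in j%:R]card_ord mulr_natl -sumr_const.
    by apply: ler_sum => l _; exact: qb.
  have -> : dt R n * (j%:R * (k%:R * (`|y| * CA))) =
    (j%:R * dt R n) * (k%:R * CA * `|y|) by ring.
  by rewrite ler_piMl ?mulr_ge0 //; case/andP: (jd n j jn).
have radb n j y : (j <= 2 ^ n)%N -> `|radial A (dt R n) j y| <= K * `|y|.
  move=> jn; apply: rV_norm_leP => [|b]; first by rewrite mulr_ge0 // ltW.
  rewrite radialE /K mulrDl mul1r; apply: le_trans (ler_normD _ _) _.
  apply: lerD; first exact: rV_norm_le.
  by apply: rsb => // l z; exact: bA.
pose H (u : 'rV[R]_(m + (m + 1))) : 'rV[R]_(m + (m + 1)) :=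
  row_mx 0 (row_mx
    (\row_b - \sum_l (lsubmx u) 0 (w l) * A l b (lsubmx (rsubmx u)))
    (\row_(_ < 1) - \sum_l (lsubmx u) 0 (w l) * g l (lsubmx (rsubmx u)))).
pose u0 (y : E) : 'rV[R]_(m + (m + 1)) := row_mx y (row_mx y 0).
have gE h j y : eul H h j (u0 y) =
    row_mx y (row_mx (radial A h j y) (\row_(_ < 1) rsum A g h j y)).
  elim: j => [|j IH].
    rewrite /eul /= /u0; congr (row_mx _ (row_mx _ _)); apply/rowP => i.
    by rewrite !mxE /rsum big_ord0 mulr0 oppr0.
  rewrite eulS IH /estep /H !row_mxKl !row_mxKr row_mxKl.
  rewrite !scale_row_mx !add_row_mx scaler0 addr0; congr (row_mx _ (row_mx _ _)).
    by apply/rowP => b; rewrite !mxE mulrN.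
  by apply/rowP => b; rewrite !mxE rsumS mulrN.
have sq (q : 'I_k -> E -> R) : (forall l, Cinfty setT (q l)) ->
   Cinfty setT (fun u : 'rV[R]_(m + (m + 1)) =>
     - \sum_l (lsubmx u) 0 (w l) * q l (lsubmx (rsubmx u))).
  move=> hq n; under eq_fun do rewrite -mulN1r.
  apply: Ck_mul; [exact: openT|exact: Ck_cst|].
  apply: Ck_sum => [|l _]; first exact: openT.
  apply: Ck_mul; [exact: openT|exact: smoothv_lsubmx|].
  apply: (@Ck_comp R _ m n setT setT (fun u => lsubmx (rsubmx u)) (q l)) => //; first exact: openT.
    move=> b; apply: (smoothv_comp (V := setT) (g := lsubmx)) => //; first exact: openT.
      exact: smoothv_rsubmx.
    exact: smoothv_lsubmx.
  exact: hq.
have sH : smoothv setT H.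
  apply: smoothv_row_mx; first exact: smoothv_cst.
  apply: smoothv_row_mx => b n; under eq_fun do rewrite mxE.
    exact: (sq (fun l => A l b) (fun l => sA l b) n).
  exact: (sq g sg n).
have su0 : smoothv W u0.
  apply: smoothv_row_mx; first exact: smoothv_id.
  by apply: smoothv_row_mx; [exact: smoothv_id|exact: smoothv_cst].
have bH : ebounded H W u0.
  move=> y0 Wy0; exists K.
  have : \forall y \near y0, W y by apply: open_nbhs_nbhs.
  apply: filterS => y Wy n j jn; have y1 := W1 _ Wy.
  rewrite gE; apply: norm_row_mx; first exact: le_trans K1.
  apply: norm_row_mx; first by apply: le_trans (radb n j y jn) _; rewrite ler_piMr // ltW.
  apply: rV_norm_leP => [|i]; first exact: ltW.
  rewrite mxE; apply: le_trans (rsb _ n j y bg jn) _.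
  apply: le_trans (_ : k%:R * CA <= _); last by rewrite lerDr.
  by rewrite ler_piMr // mulr_ge0.
have [a [sa ca cpa]] := euler_flow oW sH su0 bH.
pose last := rshift m (rshift m (ord0 : 'I_1)).
pose phi y := - a y 0 last.
have eE n : (fun y => eulk H n (u0 y) 0 last) = rsum A g (dt R n) (2 ^ n)%N.
  by apply/funext => y; rewrite /eulk gE /last !row_mxEr mxE.
have W0 : W 0 by rewrite /W /= normr0.
have sphi : Cinfty W phi.
  move=> n; rewrite /phi; under eq_fun do rewrite -mulN1r.
  by apply: Ck_mul => //; [exact: Ck_cst|exact: sa].
have pdphi c y : W y -> pd c phi y = - pd c (fun y => a y 0 last) y.
  move=> Wy; rewrite /pd /phi (@deriveN _ _ _ (fun y => a y 0 last)) //.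
  by apply: diff_derivable; exact: (Cinfty_diff (sa last)).
have Pdiff n j y : differentiable (rsum A g (dt R n) j) y.
  exact: (Cinfty_diff ((smooth_scheme sA (dt R n) j).2 g sg)).
exists e => //; exists phi; split=> //.
- have [D hD] := ca 0 W0.
  have Z : `|phi 0| <= 0.
    apply: (@le_of_dt R _ _ D 0%N) => n _; rewrite add0r.
    apply: le_trans (hD n); rewrite /phi normrN.
    have := rV_norm_le (eulk H n (u0 0) - a 0) last; rewrite !mxE.
    have -> : eulk H n (u0 0) 0 last = 0.
      rewrite -[LHS]/((fun y => eulk H n (u0 y) 0 last) 0) eE /rsum.
      rewrite big1 ?mulr0 ?oppr0 // => j _.
      by rewrite big1 // => l _; rewrite mxE mul0r.
    by rewrite sub0r normrN.
  by apply/eqP; rewrite -normr_eq0 eq_le Z normr_ge0.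
- move=> c kc; rewrite pdphi //.
  have [D hD] := cpa 0 c W0.
  have Z : `|pd c (fun y => a y 0 last) 0| <= 0.
    apply: (@le_of_dt R _ _ D 0%N) => n _; rewrite add0r.
    apply: le_trans (hD last n); rewrite eE.
    suff -> : pd c (rsum A g (dt R n) (2 ^ n)%N) 0 = 0 by rewrite sub0r normrN.
    elim: (2 ^ n)%N => [|j IH].
      have -> : rsum A g (dt R n) 0 = cst 0.
        by apply/funext => y; rewrite /rsum big_ord0 mulr0 oppr0.
      by rewrite /pd derive_cst.
    rewrite /pd derive_rsumS // -/(pd c _ 0) IH big1 ?mulr0 ?subr0 // => l _.
    rewrite [(0 : 'rV__) 0 _]mxE mul0r addr0 mxE eqxx /=.
    have -> : (w l == c) = false.
      by apply/negbTE/eqP => /(congr1 val) /= h; move: kc; rewrite -h leqNgt ltn_ord.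
    by rewrite mul0r.
  suff -> : pd c (fun y => a y 0 last) 0 = 0 by rewrite oppr0.
  by apply/eqP; rewrite -normr_eq0 eq_le Z normr_ge0.
move=> y Wy i.
have bnd (q : 'I_k -> E -> R) : (forall l, Cinfty setT (q l)) ->
  exists2 C1, 0 <= C1 & forall l,
     (forall c z, `|z| <= r -> `|pd c (q l) z| <= C1) /\
     (forall x z, `|x| <= r -> `|z| <= r ->
       `|q l z - q l x - \sum_i (z - x) 0 i * pd i (q l) x| <= C1 * `|z - x| ^+ 2).
  move=> hq; apply: (@finite_bound R _ (fun l C1 =>
     (forall c z, `|z| <= r -> `|pd c (q l) z| <= C1) /\
     (forall x z, `|x| <= r -> `|z| <= r ->
       `|q l z - q l x - \sum_i (z - x) 0 i * pd i (q l) x| <= C1 * `|z - x| ^+ 2))).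
    move=> l C C' [h1 h2] CC'; split=> [c z zr|x z xr zr].
      exact: le_trans (h1 c z zr) CC'.
    by apply: le_trans (h2 x z xr zr) _; rewrite ler_wpM2r // exprn_ge0.
  move=> l.
  have [Ca Ca0 hCa] : exists2 C, 0 <= C & forall c z, `|z| <= r -> `|pd c (q l) z| <= C.
    apply: (@finite_bound R _ (fun c C => forall z, `|z| <= r -> `|pd c (q l) z| <= C)).
      by move=> c C C' h CC' z /h /le_trans; exact.
    move=> c; apply: closed_ball_bounded => z _.
    exact: (Cinfty_cont (Cinfty_pd c (hq l))).
  have [Cb Cb0 hCb] := taylor2_ball (r := r) (f := q l)
     (fun n => Ck_sub (fun _ _ => I) (hq l n)).
  exists (Ca + Cb); first exact: addr_ge0.
  split=> [c z zr|x z xr zr].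
    by apply: le_trans (hCa c z zr) _; rewrite lerDl.
  by apply: le_trans (hCb x z xr zr) _; rewrite ler_wpM2r ?exprn_ge0 // lerDr.
pose v := \row_c A i c y : E.
have y1 := W1 _ Wy.
have inr n j : (j <= 2 ^ n)%N -> `|radial A (dt R n) j y| <= r.
  by move=> jn; apply: le_trans (radb n j y jn) (Wr _ Wy).
have vw l : v 0 (w l) = (i == l)%:R.
  rewrite mxE hA1 //; apply: le_lt_trans rr; apply: le_trans (Wr _ Wy).
  by rewrite ler_peMl.
(* Deviations from the law [D_i (.) = (1 - t) * (.)_i] along the curve. In the exact flow [er] keeps
   its initial value [- q i y], and at time 1 the factor [1 - t] is zero. *)
pose Ec n j c := 'D_v (fun z => radial A (dt R n) j z 0 c) y -
   (1 - j%:R * dt R n) * A i c (radial A (dt R n) j y).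
pose er (q : 'I_k -> E -> R) n j := 'D_v (rsum A q (dt R n) j) y -
   (1 - j%:R * dt R n) * q i (radial A (dt R n) j y).
(* Compatibility replaces [D_i (q l)] by [D_l (q i)]; summed against the [y_l], the latter is the
   variation of [q i] along one step. What remains is the error [Ec] of the curve and terms of
   second order. *)
have step (q : 'I_k -> E -> R) C1 n j M : (forall l, Cinfty setT (q l)) -> 0 <= C1 ->
   (forall l,
     (forall c z, `|z| <= r -> `|pd c (q l) z| <= C1) /\
     (forall x z, `|x| <= r -> `|z| <= r ->
       `|q l z - q l x - \sum_i (z - x) 0 i * pd i (q l) x| <= C1 * `|z - x| ^+ 2)) ->
   (forall y, `|y| < rho -> forall i l,
    \sum_c A i c y * pd c (q l) y = \sum_c A l c y * pd c (q i) y) ->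
   (j < 2 ^ n)%N -> 0 <= M -> (forall c, `|Ec n j c| <= M) ->
   `|er q n j.+1 - er q n j| <= dt R n * (k%:R * (1 * (m%:R * (M * C1)))) +
     dt R n ^+ 2 * (k%:R * (1 * (m%:R * (CA * C1))) + C1 * (k%:R * CA) ^+ 2).
  move=> hq C10 hC1 cq jn M0 hM.
  set h := dt R n; have h0 : 0 <= h := dt_ge0 R n.
  set Y := radial A h j y; set Y' := radial A h j.+1 y.
  have Yr : `|Y| <= r := inr n j (ltnW jn).
  have Y'r : `|Y'| <= r := inr n j.+1 jn.
  have Yrho : `|Y| < rho by apply: le_lt_trans rr.
  pose t := 1 - j%:R * h.
  pose Q := \sum_l y 0 (w l) * \sum_c A i c Y * pd c (q l) Y.
  pose T := \sum_l y 0 (w l) * \sum_c Ec n j c * pd c (q l) Y.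
  pose rem := q i Y' - q i Y - \sum_c (Y' - Y) 0 c * pd c (q i) Y.
  have QE : \sum_c (Y' - Y) 0 c * pd c (q i) Y = - h * Q.
    have YE : Y' - Y = - h *: \row_b \sum_l y 0 (w l) * A l b Y.
      by rewrite /Y' /= -/Y addrC addKr scaleNr.
    rewrite YE /Q; under eq_bigr do rewrite !mxE -mulrA mulr_suml.
    rewrite -mulr_sumr exchange_big /=; congr (_ * _); apply: eq_bigr => l _.
    under eq_bigr do rewrite -mulrA.
    by rewrite -mulr_sumr cq.
  have key : er q n j.+1 - er q n j = - h * T - h ^+ 2 * Q - (t - h) * rem.
    rewrite /er derive_rsumS // -/h -/Y -/Y'.
    have -> : \sum_l (v 0 (w l) * q l Y + y 0 (w l) *
        \sum_c 'D_v (fun z => radial A h j z 0 c) y * pd c (q l) Y) =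
        q i Y + (T + t * Q).
      rewrite big_split /=; congr (_ + _).
        rewrite (bigD1 i) //= vw eqxx mul1r big1 ?addr0 // => l li.
        by rewrite vw eq_sym (negbTE li) mul0r.
      rewrite /T /Q mulr_sumr -big_split /=; apply: eq_bigr => l _.
      rewrite [t * _]mulrCA -mulrDr; congr (_ * _).
      rewrite mulr_sumr -big_split /=; apply: eq_bigr => c _.
      by rewrite /Ec -/h -/Y -/t; ring.
    have -> : q i Y' = q i Y + (- h * Q) + rem by rewrite /rem QE; ring.
    by rewrite -natr1 /t; ring.
  have bQ : `|Q| <= k%:R * (1 * (m%:R * (CA * C1))).
    apply: dot2_le => // [l|l c]; last by apply: (hC1 l).1.
    exact: le_trans (rV_norm_le _ _) y1.
  have bT : `|T| <= k%:R * (1 * (m%:R * (M * C1))).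
    apply: dot2_le => // [l|l c]; last by apply: (hC1 l).1.
    exact: le_trans (rV_norm_le _ _) y1.
  have brem : `|rem| <= h ^+ 2 * (C1 * (k%:R * CA) ^+ 2).
    apply: le_trans ((hC1 i).2 _ _ Yr Y'r) _.
    rewrite [leRHS]mulrCA ler_wpM2l // -exprMn lerXn2r ?nnegrE ?mulr_ge0 //.
    have -> : Y' - Y = - (h *: \row_b \sum_l y 0 (w l) * A l b Y).
      by rewrite /Y' /= -/Y addrC addKr.
    rewrite normrN normrZ ger0_norm // ler_wpM2l //.
    apply: rV_norm_leP => [|b]; first by rewrite mulr_ge0.
    rewrite mxE; apply: le_trans (qb _ y Y (fun l => bA l b)) _.
    by rewrite ler_wpM2l // ler_piMl.
  have th : `|t - h| <= 1.
    have := jd n j.+1 jn; rewrite -natr1 -/h mulrDl mul1r => /andP[j0 j1].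
    by rewrite /t ler_norml; lra.
  rewrite key; apply: le_trans (ler_normB _ _) _.
  have b3 : `|(t - h) * rem| <= h ^+ 2 * (C1 * (k%:R * CA) ^+ 2).
    by rewrite normrM; apply: le_trans brem; rewrite ler_piMl.
  have b1 : `|- h * T| <= h * (k%:R * (1 * (m%:R * (M * C1)))).
    by rewrite mulNr normrN normrM [`|h|]ger0_norm // ler_wpM2l.
  have b2 : `|h ^+ 2 * Q| <= h ^+ 2 * (k%:R * (1 * (m%:R * (CA * C1)))).
    by rewrite normrM [`|h ^+ 2|]ger0_norm ?exprn_ge0 // ler_wpM2l ?exprn_ge0.
  rewrite [h ^+ 2 * (_ + _)]mulrDr addrA; apply: lerD b3.
  exact: le_trans (ler_normB _ _) (lerD b1 b2).
have EcE n j c : Ec n j c = v 0 c + er (fun l => A l c) n j.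
  rewrite /Ec /er addrA; congr (_ - _).
  have -> : (fun z => radial A (dt R n) j z 0 c) = (fun z : E => z 0 c) +
     rsum A (fun l => A l c) (dt R n) j.
    by apply/funext => z; rewrite radialE.
  rewrite deriveD ?derive_coord //; apply: diff_derivable.
    exact: differentiable_coord.
  exact: (Cinfty_diff ((smooth_scheme sA (dt R n) j).2 _ (fun l => sA l c))).
have [C1 C10 hC1] : exists2 C1, 0 <= C1 & forall b l,
     (forall c z, `|z| <= r -> `|pd c (A l b) z| <= C1) /\
     (forall x z, `|x| <= r -> `|z| <= r ->
       `|A l b z - A l b x - \sum_i (z - x) 0 i * pd i (A l b) x| <= C1 * `|z - x| ^+ 2).
  apply: (@finite_bound R _ (fun b C1 => forall l,
     (forall c z, `|z| <= r -> `|pd c (A l b) z| <= C1) /\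
     (forall x z, `|x| <= r -> `|z| <= r ->
       `|A l b z - A l b x - \sum_i (z - x) 0 i * pd i (A l b) x| <= C1 * `|z - x| ^+ 2))).
    move=> b C C' h CC' l; have [h1 h2] := h l; split=> [c z zr|x z xr zr].
      exact: le_trans (h1 c z zr) CC'.
    by apply: le_trans (h2 x z xr zr) _; rewrite ler_wpM2r // exprn_ge0.
  by move=> b; apply: bnd => l; exact: sA.
pose L := k%:R * (m%:R * C1).
pose C2 := k%:R * (1 * (m%:R * (CA * C1))) + C1 * (k%:R * CA) ^+ 2.
have L0 : 0 <= L by rewrite !mulr_ge0.
have C20 : 0 <= C2 by rewrite addr_ge0 // !mulr_ge0 // mulr_ge0.
(* For the curve itself [er] equals [Ec] up to a constant, so the recursion closes on itself and the
   Gronwall inequality applies. *)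
have EB n j : (j <= 2 ^ n)%N -> `|\row_c Ec n j c| <= dt R n * (C2 * expR L).
  apply: (@discrete_gronwall R (fun j => `|\row_c Ec n j c|) L C2 (dt R n) (2 ^ n)%N) => //.
  - exact: dt_ge0.
  - by rewrite mul_dt.
  - rewrite normr_le0; apply/eqP/rowP => c.
    rewrite mxE EcE /er /=.
    have -> : rsum A (fun l => A l c) (dt R n) 0 = cst 0.
      by apply/funext => z; rewrite /rsum big_ord0 mulr0 oppr0.
    by rewrite derive_cst !mxE mul0r subr0 mul1r sub0r subrr.
  move=> {}j jn; set M := `|\row_c Ec n j c|.
  have M0 : 0 <= M by exact: normr_ge0.
  apply: rV_norm_leP => [|c].
    by rewrite addr_ge0 ?mulr_ge0 ?addr_ge0 ?mulr_ge0 ?exprn_ge0 ?dt_ge0.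
  have hM c' : `|Ec n j c'| <= M.
    by have := rV_norm_le (\row_c Ec n j c) c'; rewrite mxE.
  have := step (fun l => A l c) C1 n j M (fun l => sA l c) C10 (hC1 c)
    (fun z zr i l => hcomm z zr i l c) jn M0 hM.
  rewrite mxE -/C2.
  have -> : er (fun l => A l c) n j.+1 - er (fun l => A l c) n j = Ec n j.+1 c - Ec n j c.
    by rewrite !EcE; set a1 := er _ _ j.+1; set b1 := er _ _ j; ring.
  have := hM c; have := ler_normD (Ec n j.+1 c - Ec n j c) (Ec n j c).
  rewrite subrK /L mul1r.
  have -> : k%:R * (m%:R * (M * C1)) = (k%:R * (m%:R * C1)) * M by ring.
  by move: (k%:R * (m%:R * C1)) => L1; nra.
have [C3 C30 hC3] := bnd g sg.
pose C4 := k%:R * (1 * (m%:R * ((C2 * expR L) * C3))) +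
   (k%:R * (1 * (m%:R * (CA * C3))) + C3 * (k%:R * CA) ^+ 2).
have C2e : 0 <= C2 * expR L by rewrite mulr_ge0 // expR_ge0.
have C40 : 0 <= C4 by rewrite !addr_ge0 // !mulr_ge0 // mulr_ge0.
(* Now [Ec] is known to be [O (dt n)], so each step adds [O (dt n ^+ 2)] only, and the growth rate
   is 0. *)
have GB n : `|er g n (2 ^ n)%N - er g n 0| <= dt R n * (C4 * expR 0).
  apply: (@discrete_gronwall R (fun j => `|er g n j - er g n 0|) 0 C4 (dt R n) (2 ^ n)%N) => //.
  - exact: dt_ge0.
  - by rewrite mul_dt.
  - by rewrite subrr normr0.
  move=> j jn; rewrite mulr0 addr0 mul1r.
  have M0 : 0 <= dt R n * (C2 * expR L) by rewrite mulr_ge0 ?dt_ge0.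
  have hM c : `|Ec n j c| <= dt R n * (C2 * expR L).
    apply: le_trans (EB n j (ltnW jn)).
    by have := rV_norm_le (\row_c Ec n j c) c; rewrite mxE.
  have := step g C3 n j _ sg C30 hC3 hclosed jn M0 hM.
  have := ler_normD (er g n j.+1 - er g n j) (er g n j - er g n 0).
  rewrite addrA subrK.
  have -> : dt R n ^+ 2 * C4 = dt R n * (k%:R * (1 * (m%:R * (dt R n * (C2 * expR L) * C3)))) +
     dt R n ^+ 2 * (k%:R * (1 * (m%:R * (CA * C3))) + C3 * (k%:R * CA) ^+ 2).
    by rewrite /C4; ring.
  lra.
have e0E n : er g n 0 = - g i y.
  rewrite /er /=.
  have -> : rsum A g (dt R n) 0 = cst 0.
    by apply/funext => z; rewrite /rsum big_ord0 mulr0 oppr0.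
  by rewrite derive_cst mul0r subr0 mul1r sub0r.
have enE n : er g n (2 ^ n)%N = \sum_c A i c y * pd c (rsum A g (dt R n) (2 ^ n)%N) y.
  rewrite /er mul_dt subrr mul0r subr0 derive_row //.
  by apply: eq_bigr => c _; rewrite mxE.
have [D D0 hD] : exists2 D, 0 <= D & forall c n,
    `|pd c (rsum A g (dt R n) (2 ^ n)%N) y - pd c (fun y => a y 0 last) y| <= D * dt R n.
  apply: (@finite_bound R _ (fun c D => forall n,
    `|pd c (rsum A g (dt R n) (2 ^ n)%N) y - pd c (fun y => a y 0 last) y| <= D * dt R n)).
    move=> c C C' h CC' n; apply: le_trans (h n) _.
    by rewrite ler_wpM2r ?dt_ge0.
  move=> c; have [D hD] := cpa y c Wy; exists `|D| => // n.
  rewrite -eE; apply: le_trans (hD last n) _.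
  by rewrite ler_wpM2r ?dt_ge0 ?ler_norm.
have Z : `|\sum_c A i c y * pd c phi y - g i y| <= 0.
  apply: (@le_of_dt R _ _ (C4 + m%:R * (CA * D)) 0%N) => n _; rewrite add0r.
  have := GB n; rewrite enE e0E opprK expR0 mulr1 => h1.
  have h2 : `|\sum_c A i c y * (pd c (rsum A g (dt R n) (2 ^ n)%N) y -
      pd c (fun y => a y 0 last) y)| <= m%:R * (CA * (D * dt R n)).
    by apply: dot_le => //; rewrite mulr_ge0 ?dt_ge0.
  have E1 : \sum_c A i c y * pd c phi y = - \sum_c A i c y * pd c (fun y => a y 0 last) y.
    by rewrite -sumrN; apply: eq_bigr => c _; rewrite pdphi // mulrN.
  rewrite E1; move: h1 h2; under [X in _ -> `|X| <= _ -> _]eq_bigr do rewrite mulrBr.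
  rewrite sumrB; set S1 := \sum_c _; set S2 := \sum_c _ => h1 h2.
  have := ler_normB (S1 - S2) (S1 + g i y).
  have -> : S1 - S2 - (S1 + g i y) = - S2 - g i y by ring.
  move/le_trans; apply; rewrite mulrDl addrC lerD //; first by rewrite mulrC.
  by rewrite -!mulrA.
by apply/eqP; rewrite -subr_eq0 -normr_eq0 eq_le Z normr_ge0.
Qed.

Lemma potential (U : set E) (A : 'I_k -> 'I_m -> E -> R) (g : 'I_k -> E -> R) :
  open U -> U 0 ->
  (forall l b, Cinfty U (A l b)) -> (forall l, Cinfty U (g l)) ->
  (forall y, U y -> forall l j, A l (w j) y = (l == j)%:R) ->
  (forall y, U y -> forall i l b,
    \sum_c A i c y * pd c (A l b) y = \sum_c A l c y * pd c (A i b) y) ->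
  (forall y, U y -> forall i l,
    \sum_c A i c y * pd c (g l) y = \sum_c A l c y * pd c (g i) y) ->
  exists (W : set E) (phi : E -> R),
    [/\ open W, W 0 /\ W `<=` U, Cinfty W phi,
        phi 0 = 0 /\ (forall c : 'I_m, (k <= c)%N -> pd c phi 0 = 0) &
        forall y, W y -> forall i, \sum_c A i c y * pd c phi y = g i y].
Proof.
move=> oU U0 sA sg hA1 hcomm hclosed.
have [A' hA'] := boolp.choice (fun p : 'I_k * 'I_m => cutoff oU U0 (sA p.1 p.2)).
have [g' hg'] := boolp.choice (fun l => cutoff oU U0 (sg l)).
have [CA CA0 bA] : exists2 C, 0 <= C & forall p x, `|A' p x| <= C.
  apply: (@finite_bound R _ (fun p C => forall x, `|A' p x| <= C)).
    by move=> p C C' h CC' x; apply: le_trans (h x) CC'.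
  by move=> p; case: (hA' p).
have [Cg Cg0 bg] : exists2 C, 0 <= C & forall p x, `|g' p x| <= C.
  apply: (@finite_bound R _ (fun p C => forall x, `|g' p x| <= C)).
    by move=> p C C' h CC' x; apply: le_trans (h x) CC'.
  by move=> p; case: (hg' p).
have : \forall y \near (0 : E), [/\ U y, forall p, A' p y = A p.1 p.2 y &
    forall l, g' l y = g l y].
  have n1 : \forall y \near (0 : E), forall p, A' p y = A p.1 p.2 y.
    by apply: near_all => p; case: (hA' p).
  have n2 : \forall y \near (0 : E), forall l, g' l y = g l y.
    by apply: near_all => p; case: (hg' p).
  by near=> y; split; near: y => //; apply: open_nbhs_nbhs.
move/nbhs_nball => [rho rho0 hrho].
pose B := [set y : E | `|y| < rho].
have oB : open B by have := @open_nball R m 0 rho; under eq_set do rewrite subr0.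
have hB y : B y -> [/\ U y, forall p, A' p y = A p.1 p.2 y & forall l, g' l y = g l y].
  by move=> By; apply: hrho; rewrite subr0.
have pA y c l b : B y -> pd c (A' (l, b)) y = pd c (A l b) y.
  move=> By; apply: near_eq_derive; apply: near_open oB By _ => z /hB[_ h _].
  by rewrite h.
have pg y c l : B y -> pd c (g' l) y = pd c (g l) y.
  move=> By; apply: near_eq_derive; apply: near_open oB By _ => z /hB[_ _ h].
  by rewrite h.
have [||||||||e e0 [phi [sphi phi0 dphi hphi]]] :=
  @potential_global (fun l b => A' (l, b)) g' rho (CA + Cg) rho0.
- exact: addr_ge0.
- by move=> l b; case: (hA' (l, b)).
- by move=> l; case: (hg' l).
- by move=> l b y; apply: le_trans (bA _ y) _; rewrite lerDl.
- by move=> l y; apply: le_trans (bg _ y) _; rewrite lerDr.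
- by move=> y By l j; have [Uy -> _] := hB y By; rewrite hA1.
- move=> y By i l b; have [Uy hh _] := hB y By.
  have := hcomm y Uy i l b; under eq_bigr do rewrite -(hh (_, _)) -pA //.
  by move=> ->; apply: eq_bigr => c _; rewrite hh pA.
- move=> y By i l; have [Uy hh _] := hB y By.
  have := hclosed y Uy i l; under eq_bigr do rewrite -(hh (_, _)) -pg //.
  by move=> ->; apply: eq_bigr => c _; rewrite hh pg.
pose W := [set y : E | `|y| < Num.min e rho].
have oW : open W by have := @open_nball R m 0 (Num.min e rho); under eq_set do rewrite subr0.
have hW y : W y -> `|y| < e /\ B y by rewrite /W /= lt_min => /andP[].
exists W, phi; split => //.
- split; first by rewrite /W /= normr0 lt_min e0.
  by move=> y /hW[_ /hB[]].
- by move=> r; apply: Ck_sub (sphi r) => y /hW[].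
move=> y /hW[ye By] i; have [_ hh <-] := hB y By.
by rewrite -hphi //; apply: eq_bigr => c _; rewrite hh.
Unshelve. all: by end_near. Qed.

End Potential.

(** * Smooth functions on a manifold *)

Section Manifolds.
Context (R : realType) (m : nat) (M : manifold R m).
Implicit Types (c : chart R m M) (p q : M) (U : set M) (f g : M -> R).
Local Notation E := 'rV[R]_m.

Lemma cinvK c (x : E) : (cfun c @` cdom c) x -> cdom c (cinv c x) /\ cfun c (cinv c x) = x.
Proof. by move=> [p cp <-]; rewrite cfunK. Qed.

Lemma cimg_openI c U : open U -> open (cfun c @` (cdom c `&` U)).
Proof.
move=> oU; rewrite openE => x [p [cp Up] <-] /=.
have n1 : \forall y \near cfun c p, (cfun c @` cdom c) y.
  by apply: open_nbhs_nbhs; split; [exact: cimg_open|exists p].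
have n2 : \forall y \near cfun c p, U (cinv c y).
  apply: (@cinv_continuous _ _ _ c (cfun c p)); first by exists p.
  by rewrite cfunK //; exact: open_nbhs_nbhs.
near=> y; have cy : (cfun c @` cdom c) y by near: y.
have [cy' ey] := cinvK cy.
by exists (cinv c y) => //; split=> //; near: y.
Unshelve. all: by end_near. Qed.

Lemma cpreimage_nbhs c p (W : set E) : cdom c p -> nbhs (cfun c p) W ->
  \forall q \near p, cdom c q /\ W (cfun c q).
Proof.
move=> cp nW; near=> q; split; near: q.
  by apply: open_nbhs_nbhs; split => //; exact: cdom_open.
exact: (@cfun_continuous _ _ _ c p cp).
Unshelve. all: by end_near. Qed.

Lemma cimage_nbhs c p (P : set M) : cdom c p -> nbhs p P ->
  \forall x \near cfun c p, (cfun c @` cdom c) x /\ P (cinv c x).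
Proof.
move=> cp nP; near=> x; split; near: x.
  by apply: open_nbhs_nbhs; split; [exact: cimg_open|exists p].
apply: (@cinv_continuous _ _ _ c (cfun c p)); first by exists p.
by rewrite cfunK.
Unshelve. all: by end_near. Qed.

Lemma atlas_coords c : atlas c -> coords c.
Proof. by move=> ac c' ac'; exact: atlas_compatible. Qed.

(** Members of the maximal atlas are compared directly only with the atlas; near each point the
    transition is factored through an atlas chart. *)
Lemma coords_transition c c' : coords c -> coords c' -> smooth_transition c c'.
Proof.
move=> cc cc' i r; apply: Ck_pointwise => _ [p [cp c'p] <-].
have [a aa ap] := atlas_cover p.
exists (cfun c @` (cdom c `&` (cdom c' `&` cdom a))); first by exists p.
have oV : open (cfun c @` (cdom c `&` (cdom c' `&` cdom a))).
  by apply: cimg_openI; apply: openI; exact: cdom_open.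
apply: (@Ck_ext _ _ _ _ (fun x => cfun c' (cinv a (cfun a (cinv c x))) 0 i)) => //.
  by move=> _ [q [cq [c'q aq]] <-]; rewrite !cfunK.
apply: (@Ck_comp _ _ _ _ _ (cfun a @` (cdom a `&` cdom c')) (fun x => cfun a (cinv c x))
  (fun y => cfun c' (cinv a y) 0 i)) => //.
- by move=> _ [q [cq [c'q aq]] <-]; rewrite cfunK //; exists q.
- move=> l; apply: Ck_sub ((cc a aa).1 l r) => _ [q [cq [c'q aq]] <-].
  by exists q.
- exact: (cc' a aa).2.
Qed.

(** A condition in one chart on the germ at [p]; [smooth_near_chart] shows that any other chart
    would do. *)
Definition smooth_near p f := exists c, [/\ coords c, cdom c p &
  exists W : set E, [/\ open W, W (cfun c p) & Cinfty W (fun x => f (cinv c x))]].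

Lemma smooth_near_chart p f c : smooth_near p f -> coords c -> cdom c p ->
  exists W : set E, [/\ open W, W (cfun c p), W `<=` cfun c @` cdom c &
    Cinfty W (fun x => f (cinv c x))].
Proof.
move=> [c' [cc' c'p [W' [oW' W'p sW']]]] cc cp.
have n1 : \forall q \near p, cdom c' q /\ W' (cfun c' q).
  by apply: cpreimage_nbhs => //; exact: open_nbhs_nbhs.
have : nbhs p [set q | _ /\ _] := n1.
rewrite nbhsE /= => -[V [oV Vp] hV].
exists (cfun c @` (cdom c `&` V)); split.
- exact: cimg_openI.
- by exists p.
- by move=> _ [q [cq _] <-]; exists q.
move=> r; apply: (@Ck_ext _ _ _ _ (fun x => f (cinv c' (cfun c' (cinv c x))))).
- exact: cimg_openI.
- by move=> _ [q [cq Vq] <-]; rewrite cfunK // cfunK //; case: (hV q Vq).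
apply: (@Ck_comp _ _ _ _ _ W' (fun x => cfun c' (cinv c x)) (fun y => f (cinv c' y))) => //.
- exact: cimg_openI.
- by move=> _ [q [cq Vq] <-]; rewrite cfunK //; case: (hV q Vq).
move=> l; apply: Ck_sub (coords_transition cc cc' l r) => _ [q [cq Vq] <-].
by exists q => //; split => //; case: (hV q Vq).
Qed.

Lemma smooth_onP U f : open U ->
  smooth_on U f <-> forall p, U p -> smooth_near p f.
Proof.
move=> oU; split=> [sf p Up|sf c cc r].
  have [c ac cp] := atlas_cover p.
  exists c; split=> //; first exact: atlas_coords.
  exists (cfun c @` (cdom c `&` U)); split; [exact: cimg_openI|by exists p|].
  exact/sf/atlas_coords.
apply: Ck_pointwise => _ [p [cp Up] <-].
by have [W [_ Wp _ sW]] := smooth_near_chart (sf p Up) cc cp; exists W.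
Qed.

Lemma smoothP f : smooth f <-> forall p, smooth_near p f.
Proof.
have [h1 h2] := @smooth_onP setT f openT.
by split=> [/h1 h p|h]; [exact: h|apply: h2 => p _; exact: h].
Qed.

Lemma smooth_near_germ p f g : (\forall q \near p, f q = g q) ->
  smooth_near p f -> smooth_near p g.
Proof.
move=> fg sf; have [c ac cp] := atlas_cover p; have cc := atlas_coords ac.
have [W [oW Wp _ sW]] := smooth_near_chart sf cc cp.
have : nbhs (cfun c p) [set x | _ /\ _] := cimage_nbhs cp fg.
rewrite nbhsE /= => -[V [oV Vp] hV].
exists c; split=> //; exists (W `&` V); split=> //; first exact: openI.
move=> r; apply: Ck_ext (Ck_sub _ (sW r)); first exact: openI.
  by move=> x [_ Vx]; case: (hV x Vx).
by move=> x [].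
Qed.

Lemma smooth_near_binop p f g (op : R -> R -> R) :
  (forall r (W : set E) u v, open W -> Ck r W u -> Ck r W v -> Ck r W (fun x => op (u x) (v x))) ->
  smooth_near p f -> smooth_near p g -> smooth_near p (fun q => op (f q) (g q)).
Proof.
move=> hop sf sg; have [c ac cp] := atlas_cover p; have cc := atlas_coords ac.
have [W [oW Wp _ sW]] := smooth_near_chart sf cc cp.
have [V [oV Vp _ sV]] := smooth_near_chart sg cc cp.
exists c; split=> //; exists (W `&` V); split=> //; first exact: openI.
move=> r; apply: hop; first exact: openI.
  by apply: Ck_sub (sW r) => x [].
by apply: Ck_sub (sV r) => x [].
Qed.

Lemma smooth_near_cst p a : smooth_near p (fun=> a).
Proof.
have [c ac cp] := atlas_cover p.
exists c; split=> //; first exact: atlas_coords.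
by exists setT; split=> //; [exact: openT|move=> r; exact: Ck_cst].
Qed.

Lemma smooth_near_cont p f : smooth_near p f -> {for p, continuous f}.
Proof.
move=> sf; have [c ac cp] := atlas_cover p; have cc := atlas_coords ac.
have [W [oW Wp _ sW]] := smooth_near_chart sf cc cp.
have : {for p, continuous ((fun x => f (cinv c x)) \o cfun c)}.
  apply: continuous_comp; first exact: cfun_continuous.
  exact: Cinfty_cont sW _ Wp.
rewrite /prop_for /continuous_at /= cfunK // => h; apply: cvg_trans h.
apply: near_eq_cvg; near=> q; rewrite /= cfunK //.
by near: q; apply: open_nbhs_nbhs; split => //; exact: cdom_open.
Unshelve. all: by end_near. Qed.

Definition smfun_pred : {pred M -> R} := fun f => `[< smooth f >].

Lemma smfun_subring : subring_closed smfun_pred.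
Proof.
have sP f : reflect (forall p, smooth_near p f) (f \in smfun_pred).
  by apply: (iffP (asboolP _)) => /smoothP.
split.
- by apply/sP => p; exact: smooth_near_cst.
- move=> f g /sP sf /sP sg; apply/sP => p.
  apply: (@smooth_near_binop p f g (fun a b => a - b)) => // r W u v oW su sv.
  apply: Ck_add => //; apply: Ck_ext (Ck_mul oW (Ck_cst r W (-1)) sv) => // x _.
  by rewrite mulN1r.
- move=> f g /sP sf /sP sg; apply/sP => p.
  by apply: (@smooth_near_binop p f g (fun a b => a * b)) => // r W u v; exact: Ck_mul.
Qed.

HB.instance Definition _ := GRing.isSubringClosed.Build _ smfun_pred smfun_subring.

End Manifolds.

(** Bundling makes smooth functions a commutative ring, in which identities between brackets can be
    stated as equalities and proved by [ring]. *)
Record smfun (R : realType) (m : nat) (M : manifold R m) : Type :=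
  SmFun { sfv :> M -> R; smfunP : sfv \in @smfun_pred R m M }.
Section SmfunRing.
Context (R : realType) (m : nat) (M : manifold R m).
HB.instance Definition _ := [isSub for @sfv R m M].
HB.instance Definition _ := [Choice of smfun M by <:].
HB.instance Definition _ := GRing.SubChoice_isSubComPzRing.Build
  _ (@smfun_pred R m M) (smfun M) (@smfun_subring R m M).
End SmfunRing.

Section SmoothFunctions.
Context (R : realType) (m : nat) (M : manifold R m).
Implicit Types (c : chart R m M) (p q : M) (U : set M).
Local Notation E := 'rV[R]_m.
Local Notation V := (smfun M).

Definition mksf (f : M -> R) (sf : smooth f) : V := SmFun (asboolT sf).

Lemma sf_smooth (f : V) : smooth f.
Proof. by have /asboolP := smfunP f. Qed.

Lemma sf_near (f : V) p : smooth_near p f.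
Proof. exact: (smoothP f).1 (sf_smooth f) p. Qed.

Lemma sfext (f g : V) : (forall p, f p = g p) -> f = g.
Proof. by move=> fg; apply/val_inj/funext. Qed.

Lemma sf0 p : (0 : V) p = 0. Proof. by []. Qed.
Lemma sf1 p : (1 : V) p = 1. Proof. by []. Qed.
Lemma sfD (f g : V) p : (f + g) p = f p + g p. Proof. by []. Qed.
Lemma sfN (f : V) p : (- f) p = - f p. Proof. by []. Qed.
Lemma sfB (f g : V) p : (f - g) p = f p - g p. Proof. by []. Qed.
Lemma sfM (f g : V) p : (f * g) p = f p * g p. Proof. by []. Qed.

Lemma sfX (f : V) n p : (f ^+ n) p = f p ^+ n.
Proof. by elim: n => [|n IH]; rewrite ?expr0 ?exprS // sfM IH. Qed.

Lemma sf_sum (I : Type) (s : seq I) (P : pred I) (F : I -> V) p :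
  (\sum_(i <- s | P i) F i) p = \sum_(i <- s | P i) F i p.
Proof. by elim/big_rec2: _ => // i x y _ <-. Qed.

Lemma smooth_cst a : smooth (fun _ : M => a).
Proof. by apply/smoothP => p; exact: smooth_near_cst. Qed.

Definition csf (a : R) : V := mksf (smooth_cst a).

Lemma csfE a p : csf a p = a. Proof. by []. Qed.

Lemma csf1 : csf 1 = 1. Proof. exact: sfext. Qed.

Lemma sf_cont (f : V) p : {for p, continuous (f : M -> R)}.
Proof. exact: smooth_near_cont (sf_near f p). Qed.

Lemma sf_chart (f : V) c : coords c ->
  Cinfty (cfun c @` cdom c) (fun x => f (cinv c x)).
Proof. by move=> cc; have := sf_smooth f cc; rewrite setIT. Qed.

Definition sdom_ext (f : M -> R) c (chi : E -> R) (q : M) : R :=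
  if q \in cdom c then chi (cfun c q) * f q else 0.

(** Inside the chart domain this is a product with a cutoff. Outside, the support has to stay away:
    it lies in the image of a closed ball, which is compact, hence closed because [M] is
    Hausdorff. *)
Lemma sdom_ext_smooth c p (W : set E) (f : M -> R) rho rho' chi :
  coords c -> cdom c p -> (forall x, `|x - cfun c p| < rho' -> W x) -> rho < rho' ->
  W `<=` cfun c @` cdom c -> Cinfty W (fun x => f (cinv c x)) ->
  Cinfty setT chi -> (forall x, rho <= `|x - cfun c p| -> chi x = 0) ->
  smooth (sdom_ext f c chi).
Proof.
move=> cc cp hW rr WI sW schi chi0; apply/smoothP => q.
have [cq|ncq] := pselect (cdom c q).
  exists c; split=> //; exists (cfun c @` cdom c); split; [exact: cimg_open|by exists q|].
  move=> r; apply: (@Ck_ext _ _ _ _ (fun x => chi x * f (cinv c x))); first exact: cimg_open.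
    by move=> _ [q' cq' <-]; rewrite cfunK // /sdom_ext mem_set.
  by apply: Ck_sub (cut_smooth hW rr schi chi0 sW r).
pose K := cinv c @` [set x | `|x - cfun c p| <= rho].
have KI x : `|x - cfun c p| <= rho -> (cfun c @` cdom c) x.
  by move=> h; apply: WI; apply: hW; exact: le_lt_trans rr.
have cK : compact K.
  apply: continuous_compact.
    apply: continuous_in_subspaceT => x /set_mem /= /KI xI; exact: cinv_continuous.
  apply: bounded_closed_compact.
    exists (rho + `|cfun c p|); split; first exact: num_real.
    move=> N rN x /= xr; apply/ltW/(le_lt_trans _ rN).
    by rewrite -[x in `|x|](subrK (cfun c p)) (le_trans (ler_normD _ _)) // lerD2r.
  have -> : [set x : E | `|x - cfun c p| <= rho] =
      (fun x : E => `|x - cfun c p|) @^-1` [set y | y <= rho] by [].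
  apply: preimage_closed; last exact: closed_le.
  by move=> x _; exact: dist_continuous.
have clK : closed K by apply: compact_closed => //; exact: manifold_hausdorff.
apply: (@smooth_near_germ _ _ _ _ (fun=> 0)); last exact: smooth_near_cst.
have : \forall q' \near q, ~ K q'.
  apply: open_nbhs_nbhs; split; first exact: closed_openC.
  by move=> [x /KI [q' cq' <-]]; rewrite cfunK // => qq; apply: ncq; rewrite -qq.
apply: filterS => q' nK; rewrite /sdom_ext; case: ifP => // /set_mem cq'.
rewrite chi0 ?mul0r // leNgt; apply/negP => h; apply: nK.
by exists (cfun c q'); rewrite /= ?cfunK // ltW.
Qed.

(** Brackets act on global functions only, so coordinates and other local functions are replaced by
    global ones with the same germ. *)
Lemma sf_extend p (f : M -> R) : smooth_near p f ->
  exists g : V, \forall q \near p, g q = f q.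
Proof.
move=> sf; have [c ac cp] := atlas_cover p; have cc := atlas_coords ac.
have [W [oW Wp WI sW]] := smooth_near_chart sf cc cp.
have [e e0 he] := nbhs_nball (open_nbhs_nbhs (conj oW Wp)).
have e2 : 0 < e / 2 by rewrite divr_gt0.
have [chi [schi chi1 chi0]] := @bump_at R m (cfun c p) (e / 2) e2.
have lt2 : e / 2 < e by rewrite ltr_pdivrMr // ltr_pMr // ltr1n.
exists (mksf (sdom_ext_smooth cc cp he lt2 WI sW schi chi0)).
near=> q; have [cq h] : cdom c q /\ chi (cfun c q) = 1.
  by near: q; exact: (cpreimage_nbhs cp chi1).
by rewrite /= /sdom_ext mem_set // h mul1r.
Unshelve. all: by end_near. Qed.

Lemma dfunE c (f : M -> R) p i :
  dfun c f p 0 i = pd i (fun x => f (cinv c x)) (cfun c p).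
Proof. by rewrite mxE. Qed.

Lemma dfun_germ c (f g : M -> R) p : cdom c p -> (\forall q \near p, f q = g q) ->
  dfun c f p = dfun c g p.
Proof.
move=> cp fg; apply/rowP => i; rewrite !dfunE; apply: near_eq_derive.
by apply: filterS (cimage_nbhs cp fg) => x [].
Qed.

Lemma smooth_near_diff c (f : M -> R) p : coords c -> cdom c p -> smooth_near p f ->
  differentiable (fun x => f (cinv c x)) (cfun c p).
Proof.
move=> cc cp sf; have [W [oW Wp _ sW]] := smooth_near_chart sf cc cp.
exact: Cinfty_diff sW _ Wp.
Qed.

Lemma coord_smooth_near c i p : coords c -> cdom c p -> smooth_near p (fun q => cfun c q 0 i).
Proof.
move=> cc cp; exists c; split => //; exists (cfun c @` cdom c).
split; [exact: cimg_open|by exists p|].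
move=> r; apply: (@Ck_ext _ _ _ _ (fun x => x 0 i)); first exact: cimg_open.
  by move=> _ [q cq <-]; rewrite cfunK.
exact: Ck_coord.
Qed.

Lemma dfun_change c c' (f : M -> R) p : coords c -> coords c' -> cdom c p -> cdom c' p ->
  smooth_near p f -> dfun c f p = dfun c' f p *m transition_mx c c' p.
Proof.
move=> cc cc' cp c'p sf; apply/rowP => i; rewrite dfunE mxE.
transitivity (pd i (fun x => (fun y => f (cinv c' y)) (cfun c' (cinv c x))) (cfun c p)).
  apply: near_eq_derive.
  have n1 : \forall q \near p, cdom c' q by apply: open_nbhs_nbhs; split => //; exact: cdom_open.
  by apply: filterS (cimage_nbhs cp n1) => x [_ h]; rewrite cfunK.
rewrite /pd (@derive_comp R m m (fun x => cfun c' (cinv c x)) (fun y => f (cinv c' y))).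
- by apply: eq_bigr => a _; rewrite !mxE mulrC cfunK.
- by move=> a; apply: (@smooth_near_diff c (fun q => cfun c' q 0 a)) => //; exact: coord_smooth_near.
- by rewrite cfunK //; exact: smooth_near_diff.
Qed.

Lemma transition_comp c c' c'' p : coords c -> coords c' -> coords c'' ->
  cdom c p -> cdom c' p -> cdom c'' p ->
  transition_mx c c'' p = transition_mx c' c'' p *m transition_mx c c' p.
Proof.
move=> cc cc' cc'' cp c'p c''p; apply/row_matrixP => a; rewrite row_mul.
have rE d : row a (transition_mx d c'' p) = dfun d (fun q => cfun c'' q 0 a) p.
  by apply/rowP => i; rewrite !mxE.
by rewrite !rE; apply: dfun_change => //; exact: coord_smooth_near.
Qed.

Lemma dfun_coord c p a : cdom c p -> dfun c (fun q => cfun c q 0 a) p = delta_mx 0 a.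
Proof.
move=> cp; apply/rowP => i; rewrite dfunE.
rewrite (_ : pd i _ _ = pd i (fun x : E => x 0 a) (cfun c p)).
  by rewrite /pd derive_coord !mxE eqxx /= eq_sym.
apply: near_eq_derive; apply: (@near_open _ _ (cfun c @` cdom c)).
- exact: cimg_open.
- by exists p.
by move=> _ [q cq <-]; rewrite cfunK.
Qed.

Lemma transition_id c p : cdom c p -> transition_mx c c p = 1%:M.
Proof.
move=> cp; apply/matrixP => a i; rewrite mxE dfun_coord // !mxE eqxx /=.
by rewrite eq_sym.
Qed.

Lemma transition_unit c c' p : coords c -> coords c' -> cdom c p -> cdom c' p ->
  transition_mx c c' p \in unitmx.
Proof.
move=> cc cc' cp c'p; have := transition_comp cc' cc cc' c'p cp c'p.
by rewrite transition_id // => /esym /mulmx1_unit[].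
Qed.

Lemma dfun_cst c a p : dfun c (fun=> a) p = 0.
Proof. by apply/rowP => i; rewrite dfunE /pd derive_cst mxE. Qed.

Lemma dfunD c (f g : V) p : coords c -> cdom c p ->
  dfun c (f + g) p = dfun c f p + dfun c g p.
Proof.
move=> cc cp; apply/rowP => i; rewrite dfunE [RHS]mxE !dfunE.
by rewrite -deriveD //; apply: diff_derivable; apply: smooth_near_diff => //; exact: sf_near.
Qed.

Lemma dfunM c (f g : V) p : coords c -> cdom c p ->
  dfun c (f * g) p = f p *: dfun c g p + g p *: dfun c f p.
Proof.
move=> cc cp; apply/rowP => i; rewrite !mxE.
have df : derivable (fun x => f (cinv c x)) (cfun c p) (delta_mx 0 i).
  by apply: diff_derivable; apply: smooth_near_diff => //; exact: sf_near.
have dg : derivable (fun x => g (cinv c x)) (cfun c p) (delta_mx 0 i).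
  by apply: diff_derivable; apply: smooth_near_diff => //; exact: sf_near.
by have := deriveM df dg; rewrite cfunK.
Qed.

Lemma dfun_sum c (I : Type) (s : seq I) (P : pred I) (F : I -> V) p : coords c -> cdom c p ->
  dfun c (\sum_(i <- s | P i) F i) p = \sum_(i <- s | P i) dfun c (F i) p.
Proof.
move=> cc cp; elim/big_rec2: _ => [|i x y _ <-]; first exact: dfun_cst.
by rewrite dfunD.
Qed.

Lemma dfunZ c a (f : V) p : coords c -> cdom c p ->
  dfun c (csf a * f) p = a *: dfun c f p.
Proof. by move=> cc cp; rewrite dfunM // dfun_cst scaler0 addr0. Qed.

Lemma smoothv_shift (W : set E) (z0 : E) : open W -> smoothv W (fun x => x + z0).
Proof.
move=> oW a r; apply: (@Ck_ext _ _ _ _ (fun x => x 0 a + z0 0 a)) => //.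
  by move=> x _; rewrite mxE.
by apply: Ck_add => //; [exact: Ck_coord|exact: Ck_cst].
Qed.

Lemma diff_shift (f : E -> R) (x0 : E) i : differentiable f x0 ->
  differentiable (fun z => f (z + x0)) (0 : E) /\
  pd i (fun z => f (z + x0)) 0 = pd i f x0.
Proof.
move=> df; split.
  apply: (@differentiable_comp _ _ _ _ (fun z : E => z + x0) f); last by rewrite add0r.
  apply: differentiable_rV => b.
  rewrite (_ : (fun _ => _) = (fun x : E => x 0 b) + cst (x0 0 b)).
    by apply: differentiableD; [exact: differentiable_coord|exact: differentiable_cst].
  by apply/funext => x; rewrite mxE.
rewrite /pd /derive; set F1 := (fun h => _); set F2 := (fun h => _).
suff -> : F1 = F2 by [].
by apply/funext => h; rewrite /F1 /F2 /= addr0 add0r.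
Qed.

(** The inverse function theorem is applied to the [y a] read in [c] and centred at [p]; the shift
    is then undone so that the new coordinates are the [y a] themselves. *)
Lemma chart_of c p (O : set M) (y : 'I_m -> V) : coords c -> cdom c p -> nbhs p O ->
  \det (\matrix_(a, i) dfun c (y a) p 0 i) != 0 ->
  exists c', [/\ coords c', cdom c' p, cdom c' `<=` O `&` cdom c &
    forall q a, cfun c' q 0 a = y a q].
Proof.
move=> cc cp; rewrite nbhsE => -[Q [oQ Qp] QO] Jp.
pose x0 := cfun c p; pose y0 : E := \row_a y a p.
pose I := cfun c @` (cdom c `&` Q); have oI : open I by exact: cimg_openI.
pose U := [set x : E | I (x + x0)].
pose F (x : E) : E := \row_a (y a (cinv c (x + x0)) - y a p).
have shift_cont (z0 : E) : continuous (fun x : E => x + z0).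
  by move=> x; apply: (@smoothv_cont R m m setT (fun x => x + z0) x); [apply: smoothv_shift; exact: openT|].
have oU : open U by apply: open_comp oI => x _; exact: shift_cont.
have U0 : U 0 by rewrite /U /= add0r; exists p.
have sF : smoothv U F.
  move=> a r; apply: (@Ck_ext _ _ _ _ (fun x => y a (cinv c (x + x0)) + - y a p)) => //.
    by move=> x _; rewrite mxE.
  apply: Ck_add => //; last exact: Ck_cst.
  apply: (@Ck_comp _ _ _ _ _ I (fun x => x + x0) (fun z => y a (cinv c z))) => //.
    by move=> l; exact: smoothv_shift.
  by apply: Ck_sub (sf_chart (y a) cc r) => _ [q [cq _] <-]; exists q.
have F0 : F 0 = 0 by apply/rowP => a; rewrite !mxE add0r /x0 cfunK // subrr.
have JF : \det (jacm F 0) != 0.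
  move: Jp; rewrite -det_tr; congr (\det _ != 0); apply/matrixP => i a; rewrite !mxE.
  rewrite -/(pd i (fun z => y a (cinv c z)) (cfun c p)) -/x0.
  have dy : differentiable (fun x => y a (cinv c x)) x0.
    by apply: smooth_near_diff => //; exact: sf_near.
  rewrite (_ : (fun z => F z 0 a) = (fun z => y a (cinv c (z + x0))) - cst (y a p)); last first.
    by apply/funext => z; rewrite mxE.
  have [dz dE] := diff_shift i dy.
  rewrite /pd deriveB; [|exact: diff_derivable|exact: derivable_cst].
  by rewrite derive_cst subr0; exact: esym.
have [A [B [G [oA [A0 AU] oB sG [hAB hBA]]]]] := inverse_function oU U0 sF F0 JF.
pose D := [set q | cdom c q /\ A (cfun c q - x0)].
have yF q : D q -> \row_a y a q = F (cfun c q - x0) + y0.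
  by move=> [cq _]; apply/rowP => a; rewrite !mxE !subrK cfunK.
pose f' (q : M) : E := \row_a y a q.
pose i' (z : E) : M := cinv c (G (z - y0) + x0).
have f'K q : D q -> i' (f' q) = q.
  move=> Dq; rewrite /i' /f' yF // addrK; case: Dq => cq /hAB[_ ->].
  by rewrite subrK cfunK.
have hB z : B (z - y0) -> D (i' z) /\ f' (i' z) = z.
  move=> /hBA[AG FG]; have := AU _ AG => -[q [cq Qq] qE].
  have e1 : cinv c (G (z - y0) + x0) = q by rewrite -qE cfunK.
  have Dq : D q by split => //; rewrite qE addrK.
  rewrite /i' e1; split => //; rewrite /f' yF // qE addrK FG subrK //.
have imgE : f' @` D = [set z | B (z - y0)].
  apply/seteqP; split=> [_ [q Dq <-] /=|z Bz].
    by rewrite /f' yF // addrK; case: Dq => _ /hAB[].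
  by have [? ?] := hB z Bz; exists (i' z).
have oD : open D.
  rewrite openE => q [cq Aq].
  have nA : nbhs (cfun c q) [set x | A (x - x0)].
    apply: open_nbhs_nbhs; split => //.
    by apply: open_comp oA => x _; exact: shift_cont.
  by have := cpreimage_nbhs cq nA.
have oimg : open (f' @` D).
  by rewrite imgE; apply: open_comp oB => x _; exact: shift_cont.
have cf' q : D q -> {for q, continuous f'}.
  move=> Dq; apply: rV_continuous => a.
  rewrite (_ : (fun _ => _) = (y a : M -> R)); first exact: sf_cont.
  by apply/funext => z; rewrite mxE.
have Gi z : (f' @` D) z -> I (G (z - y0) + x0).
  by rewrite imgE => /hBA[/AU].
have ci' z : (f' @` D) z -> {for z, continuous i'}.
  move=> Dz; have c1 : {for z - y0, continuous G}.
    by apply: smoothv_cont sG _; rewrite imgE in Dz.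
  have c2 : {for G (z - y0) + x0, continuous (cinv c)}.
    by apply: cinv_continuous; have [q [cq _] <-] := Gi z Dz; exists q.
  have c3 := @continuous_comp _ _ _ _ G z (shift_cont (- y0) z) c1.
  have c4 := @continuous_comp _ _ _ _ _ z c3 (shift_cont x0 (G (z - y0))).
  exact: (@continuous_comp _ _ _ _ _ z c4 c2).
pose c' := Chart oD oimg f'K cf' ci'.
exists c'; split.
- move=> a aa; split.
    move=> l r.
    have ow : open (cfun c' @` (cdom c' `&` cdom a)) by apply: cimg_openI; exact: cdom_open.
    have Bw z : (cfun c' @` (cdom c' `&` cdom a)) z -> B (z - y0).
      by move=> [q [Dq _] <-]; have : (f' @` D) (f' q) by [exists q]; rewrite imgE.
    apply: (@Ck_comp _ _ _ _ _ (cfun c @` (cdom c `&` cdom a)) (fun z => G (z - y0) + x0)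
       (fun x => cfun a (cinv c x) 0 l)) => //.
    + move=> z hz; have [[cq _] _] := hB z (Bw z hz).
      have [q [c'q aq] qz] := hz.
      have iq : i' z = q by rewrite -qz /= f'K.
      have [q' [cq' _] q'E] := Gi z (ex_intro2 _ _ q c'q qz).
      exists q' => //; split => //.
      by rewrite -(cfunK cq') q'E -/(i' z) iq.
    + move=> b; apply: (@Ck_ext _ _ _ _ (fun z => G (z - y0) 0 b + x0 0 b)) => //.
        by move=> z _; rewrite mxE.
      apply: Ck_add => //; last exact: Ck_cst.
      apply: (@Ck_comp _ _ _ _ _ B (fun z => z - y0) (fun x => G x 0 b)) => //; last exact: sG.
      by move=> d; exact: smoothv_shift.
    exact: (cc a aa).1.
  move=> l r; apply: (@Ck_ext _ _ _ _ (fun x => y l (cinv a x))).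
  + by apply: cimg_openI; exact: cdom_open.
  + by move=> x _; rewrite /= /f' mxE.
  apply: Ck_sub (sf_chart (y l) (atlas_coords aa) r) => _ [q [aq _] <-].
  by exists q.
- by split; [exact: cp|rewrite subrr].
- move=> q [cq Aq]; split => //; have := AU _ Aq => -[q' [cq' Qq']].
  by rewrite subrK => /(congr1 (cinv c)); rewrite !cfunK // => <-; exact: QO.
- by move=> q a; rewrite /= /f' mxE.
Qed.

Lemma centered_coords c p : coords c -> cdom c p -> exists x : 'I_m -> V,
  forall i, \forall q \near p, x i q = cfun c q 0 i - cfun c p 0 i.
Proof.
move=> cc cp; have h i := sf_extend (coord_smooth_near i cc cp).
have [x hx] := boolp.choice h.
exists (fun i => x i - csf (cfun c p 0 i)) => i.
by apply: filterS (hx i) => q; rewrite sfB csfE => ->.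
Qed.

Lemma hadamard_chart c p (f : V) : coords c -> cdom c p -> exists h : 'I_m -> V,
  (forall i, h i p = dfun c f p 0 i) /\
  \forall q \near p, f q = f p + \sum_i (cfun c q 0 i - cfun c p 0 i) * h i q.
Proof.
move=> cc cp; pose x0 := cfun c p.
pose U := [set x : E | (cfun c @` cdom c) (x + x0)].
have oU : open U.
  apply: open_comp; last exact: cimg_open.
  move=> x _; apply: (@smoothv_cont R m m setT (fun x => x + x0) x) => //.
  by apply: smoothv_shift; exact: openT.
have U0 : U 0 by rewrite /U /= add0r; exists p.
have sF : Cinfty U (fun x => f (cinv c (x + x0))).
  move=> r; apply: (@Ck_comp _ _ _ _ _ _ (fun x => x + x0) (fun z => f (cinv c z)) oU _ _
    (sf_chart f cc r)) => //.
  by move=> l; exact: smoothv_shift.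
have [W [h [oW W0 sh h0 hE]]] := hadamard oU U0 sF.
pose h' i q := h i (cfun c q - x0).
have nW : nbhs x0 [set x | W (x - x0)].
  apply: open_nbhs_nbhs; split; last by rewrite /= subrr.
  apply: open_comp oW => x _.
  apply: (@smoothv_cont R m m setT (fun x => x - x0) x) => //.
  by apply: smoothv_shift; exact: openT.
have sh' i : smooth_near p (h' i).
  exists c; split => //; exists ((cfun c @` cdom c) `&` [set x | W (x - x0)]).
  have oI : open ((cfun c @` cdom c) `&` [set x | W (x - x0)]).
    apply: openI; first exact: cimg_open.
    apply: open_comp oW => x _.
    apply: (@smoothv_cont R m m setT (fun x => x - x0) x) => //.
    by apply: smoothv_shift; exact: openT.
  split => //; first by split; [exists p|rewrite /= subrr].
  move=> r; apply: (@Ck_ext _ _ _ _ (fun x => h i (x - x0))) => //.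
    by move=> _ [[q cq <-] _]; rewrite /h' cfunK.
  apply: (@Ck_comp _ _ _ _ _ W (fun x => x - x0)) => //; last exact: sh.
    by move=> x [].
  by move=> l; exact: smoothv_shift.
have [H hH] := boolp.choice (fun i => sf_extend (sh' i)).
exists H; split=> [i|].
  rewrite (nbhs_singleton (hH i)) /h' /x0 subrr h0 dfunE.
  by have [_ ->] := diff_shift i (smooth_near_diff cc cp (sf_near f p)).
have nH : \forall q \near p, forall i, H i q = h' i q.
  exact: filter_forall.
have nq : \forall q \near p, cdom c q /\ W (cfun c q - x0) := cpreimage_nbhs cp nW.
near=> q; have [cq Wq] : cdom c q /\ W (cfun c q - x0) by near: q.
have Hq : forall i, H i q = h' i q by near: q.
have := hE _ Wq; rewrite subrK cfunK // => ->.
rewrite add0r cfunK //; congr (_ + _).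
by apply: eq_bigr => i _; rewrite Hq !mxE.
Unshelve. all: by end_near. Qed.

End SmoothFunctions.

(** * Local Lie brackets have order one *)

Section Gluing.
Context (R : realType) (m : nat).
Local Notation E := 'rV[R]_m.

Definition pds (s : seq 'I_m) (f : E -> R) : E -> R := foldl (fun f i => pd i f) f s.

Lemma pd_eq0 (f : E -> R) (x1 : E) rho i :
  (forall z, rho < `|z - x1| -> f z = 0) -> forall z, rho < `|z - x1| -> pd i f z = 0.
Proof.
move=> f0 z hz; rewrite /pd (_ : 0 = 'D_(delta_mx 0 i) (cst 0) z); last by rewrite derive_cst.
have nz : nbhs z [set y : E | rho < `|y - x1|].
  exact: (@dist_continuous R m x1 z [set y | rho < y] (lt_nbhsr hz)).
by apply: near_eq_derive; apply: filterS nz => y /= hy; exact: f0.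
Qed.

Lemma pds_eq0 s (f : E -> R) (x1 : E) rho :
  (forall z, rho < `|z - x1| -> f z = 0) -> forall z, rho < `|z - x1| -> pds s f z = 0.
Proof. by elim: s f => //= i s IH f f0; apply: IH; exact: pd_eq0. Qed.

Lemma supported_bounded (f : E -> R) (x1 : E) rho : Cinfty setT f ->
  (forall z, rho < `|z - x1| -> f z = 0) -> exists2 C, 0 <= C & forall z, `|f z| <= C.
Proof.
move=> sf f0; have [C C0 hC] := @closed_ball_bounded R m f (`|rho| + `|x1|)
  (fun x _ => Cinfty_cont sf (x := x) I).
exists C => // z; have [h|h] := leP (`|z|) (`|rho| + `|x1|); first exact: hC.
rewrite f0 ?normr0 // (le_lt_trans (ler_norm rho)) //.
rewrite -(ltrD2r (`|x1|)) (lt_le_trans h) //.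
by have := ler_normD (z - x1) x1; rewrite subrK.
Qed.

Lemma pds_bounded k (f : E -> R) (x1 : E) rho : Cinfty setT f ->
  (forall z, rho < `|z - x1| -> f z = 0) ->
  exists2 C, 0 <= C & forall s, (size s <= k)%N -> forall z, `|pds s f z| <= C.
Proof.
elim: k f => [|k IH] f sf f0; have [C C0 hC] := supported_bounded sf f0.
  by exists C => // -[].
have [D D0 hD] : exists2 D, 0 <= D & forall i, forall s, (size s <= k)%N ->
    forall z, `|pds s (pd i f) z| <= D.
  apply: (@finite_bound R _ (fun i D => forall s, (size s <= k)%N ->
    forall z, `|pds s (pd i f) z| <= D)).
    by move=> i C1 C2 h C12 s sk z; apply: le_trans (h s sk z) C12.
  by move=> i; apply: IH; [exact: Cinfty_pd|exact: pd_eq0].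
exists (C + D); first exact: addr_ge0.
move=> [|i s] /= sk z; first by apply: le_trans (hC z) _; rewrite lerDl.
by apply: le_trans (hD i s sk z) _; rewrite lerDr.
Qed.

(** * Gluing functions supported in balls shrinking to the origin *)

Section Sequence.
Variable x : nat -> E.
Hypothesis x_neq0 : forall k, 0 < `|x k|.
Hypothesis x_decr : forall k, `|x k.+1| <= `|x k| / 4.

Lemma seq_decr j k : (j < k)%N -> `|x k| <= `|x j| / 4.
Proof.
elim: k => // k IH; rewrite ltnS leq_eqVlt => /orP[/eqP <- //|/IH h].
have := x_decr k; have := x_neq0 k; have := x_neq0 j; lra.
Qed.

Lemma seq_dt k : `|x k| <= `|x 0| * dt R k.
Proof.
elim: k => [|k IH]; first by rewrite /dt expr0 invr1 mulr1.
have d0 := dt_ge0 R k.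
have hdt := dtS R k.
have := x_decr k; have := x_neq0 k; have := x_neq0 0%N; nra.
Qed.

Lemma seq_small e : 0 < e -> exists K, forall k, (K <= k)%N -> `|x k| < e.
Proof.
move=> e0; have e2 : 0 < e / 2 by rewrite divr_gt0.
have [K hK] := dt_small (`|x 0|) e2; exists K => k.
have hx := seq_dt K; have xK := x_neq0 K.
rewrite leq_eqVlt => /orP[/eqP <-|/seq_decr h]; lra.
Qed.

(** On this ball the norm lies between [|x k| / 2] and [3 * |x k| / 2]; the factor 4 in [x_decr]
    makes these ranges, hence the balls, disjoint. *)
Definition in_ball k (z : E) := `|z - x k| <= `|x k| / 2.

Lemma in_ball_norm k z : in_ball k z -> `|x k| / 2 <= `|z| /\ `|z| <= `|x k| * 3 / 2.
Proof.
rewrite /in_ball => h; have := ler_normD (z - x k) (x k); rewrite subrK => h1.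
have := ler_normB z (z - x k); rewrite opprB addrC subrK => h2.
split; lra.
Qed.

Lemma in_ball_inj j k z : in_ball j z -> in_ball k z -> j = k.
Proof.
move=> /in_ball_norm[a1 a2] /in_ball_norm[b1 b2].
have xj := x_neq0 j; have xk := x_neq0 k.
by case: (ltngtP j k) => // /seq_decr h; exfalso; lra.
Qed.

Definition seqglue (h : nat -> E -> R) (z : E) : R :=
  if pselect (exists k, in_ball k z) is left ex then h (projT1 (cid ex)) z else 0.

Lemma seqglueE h k z : in_ball k z -> seqglue h z = h k z.
Proof.
move=> kz; rewrite /seqglue; case: pselect => [ex|[]]; last by exists k.
by case: (cid ex) => j jz /=; rewrite (in_ball_inj jz kz).
Qed.

Lemma seqglue0 h z : (forall k, ~ in_ball k z) -> seqglue h z = 0.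
Proof. by move=> nz; rewrite /seqglue; case: pselect => // -[k kz]; case: (nz k kz). Qed.

(** Quadratic decay makes the glued function differentiable at 0 with zero derivative. Asking it of
    all iterated derivatives makes the condition pass from [h] to [pd i h]. *)
Record glueable (h : nat -> E -> R) : Prop := Glueable {
  glue_smooth : forall k, Cinfty setT (h k);
  glue_supp : forall k z, `|x k| / 2 < `|z - x k| -> h k z = 0;
  glue_bound : forall s, exists2 C, 0 <= C &
     forall k z, `|pds s (h k) z| <= C * `|x k| ^+ 2 }.

Lemma glueable_pd h i : glueable h -> glueable (fun k => pd i (h k)).
Proof.
move=> [h1 h2 h3]; split.
- by move=> k; exact: Cinfty_pd.
- by move=> k; apply: pd_eq0; exact: h2.
- by move=> s; exact: h3 (i :: s).
Qed.

(** Only finitely many of the balls come near [z]. The bound [K] is chosen before [h], so that the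
    same finite sum represents [h] and its derivatives. *)
Lemma glueable_near (z : E) : z != 0 -> exists K, forall h, glueable h ->
  \forall y \near z, seqglue h y = \sum_(k < K) h k y.
Proof.
move=> z0; have z2 : 0 < `|z| / 2 by rewrite divr_gt0 ?normr_gt0.
have [K hK] := seq_small (divr_gt0 z2 (ltr0Sn R 1)).
exists K => h gh; have : nbhs `|z| [set t | `|z| / 2 < t].
  by apply: lt_nbhsr; rewrite ltr_pdivrMr // ltr_pMr ?normr_gt0 // ltr1n.
move=> h1; have nz : nbhs z [set y : E | `|z| / 2 < `|y|] := @norm_continuous _ _ z _ h1.
apply: filterS nz => y /= hy.
have [[k ky]|nk] := pselect (exists k, in_ball k y).
  have kK : (k < K)%N.
    rewrite ltnNge; apply/negP => /hK xk; have [_] := in_ball_norm ky; lra.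
  rewrite (seqglueE h ky) (bigD1 (Ordinal kK)) //= big1 ?addr0 // => j jk.
  apply: (glue_supp gh); rewrite ltNge; apply/negP => /in_ball_inj /(_ ky) e.
  by move: jk; rewrite -(inj_eq val_inj) /= e eqxx.
rewrite seqglue0; last by move=> k ky; apply: nk; exists k.
rewrite big1 // => j _; apply: (glue_supp gh); rewrite ltNge; apply/negP => h'.
by apply: nk; exists j.
Qed.

Lemma glue_at0 h : glueable h ->
  differentiable (seqglue h) (0 : E) /\ forall i, pd i (seqglue h) 0 = 0.
Proof.
move=> gh; have [C C0 hC] := glue_bound gh [::].
have g0 : seqglue h 0 = 0.
  apply: seqglue0 => k; rewrite /in_ball sub0r normrN; have := x_neq0 k; lra.
have [|df hd] := @diff_row_eps R m (seqglue h) 0 0; last first.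
  split=> // i; rewrite /pd hd /dotr big1 // => j _; by rewrite [X in _ * X]mxE mulr0.
move=> e e0.
have : nbhs (0 : E) [set y : E | `|y - 0| < e / (4 * C + 1)].
  apply: open_nbhs_nbhs; split; first exact: open_nball.
  by rewrite /= subrr normr0 divr_gt0 // ltr_wpDl // mulr_ge0.
apply: filterS => y; rewrite /= subr0 g0 subr0 => hy.
have -> : dotr 0 y = 0 by rewrite /dotr big1 // => j _; rewrite [X in _ * X]mxE mulr0.
rewrite subr0; have y0 := normr_ge0 y.
have [[k ky]|nk] := pselect (exists k, in_ball k y); last first.
  by rewrite seqglue0 ?normr0 ?mulr_ge0 // ?ltW // => k ky; apply: nk; exists k.
rewrite (seqglueE h ky); have := hC k y; rewrite /= => h1.
have [h2 _] := in_ball_norm ky; have xk := x_neq0 k.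
apply: le_trans h1 _; move: hy; rewrite ltr_pdivlMr; last by rewrite ltr_wpDl // mulr_ge0.
move=> h3; apply: (@le_trans _ _ (C * (4 * `|y| ^+ 2))).
  by apply: ler_wpM2l => //; nra.
nra.
Qed.

Lemma glue_Ck h r : glueable h -> Ck r setT (seqglue h).
Proof.
have diff g : glueable g -> forall z : E, differentiable (seqglue g) z /\
    forall i, pd i (seqglue g) z = seqglue (fun k => pd i (g k)) z.
  move=> gg z; have [->|z0] := eqVneq z 0.
    have [d0 p0] := glue_at0 gg; split => // i; rewrite p0 seqglue0 // => k.
    rewrite /in_ball sub0r normrN; have := x_neq0 k; lra.
  have [K hK] := glueable_near z0.
  have fs : (fun y => \sum_(k < K) g k y) = \sum_(k < K) g k.
    by apply/funext => y; rewrite fct_sumE.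
  have dg k : differentiable (g k) z by apply: Cinfty_diff (glue_smooth gg k) _ _.
  split=> [|i].
    apply: near_eq_differentiable (_ : differentiable (fun y => \sum_(k < K) g k y) z).
      by apply: filterS (hK g gg).
    by rewrite fs; exact: differentiable_sum.
  rewrite (nbhs_singleton (hK _ (glueable_pd i gg))) /pd.
  rewrite (near_eq_derive (g := fun y => \sum_(k < K) g k y)) //; last exact: hK.
  by rewrite fs derive_sum // => k; exact: diff_derivable.
elim: r h => [|r IH] h gh.
  by move=> z _; apply: differentiable_continuous; case: (diff h gh z).
split=> [z _|i]; first by case: (diff h gh z).
rewrite -/(pd i _) (_ : pd i (seqglue h) = seqglue (fun k => pd i (h k))).
  by apply: IH; exact: glueable_pd.
by apply/funext => z; case: (diff h gh z).
Qed.

(** A fixed derivative [s] is controlled by hypothesis as soon as [size s <= k]; the finitely many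
    remaining [k] are bounded by compactness of the supports. *)
Lemma glue_Cinfty h : (forall k, Cinfty setT (h k)) ->
  (forall k z, `|x k| / 2 < `|z - x k| -> h k z = 0) ->
  (forall k s, (size s <= k)%N -> forall z, `|pds s (h k) z| <= `|x k| ^+ 2) ->
  Cinfty setT (seqglue h).
Proof.
move=> sh h0 hb r; apply: glue_Ck; split => // s.
have [C C0 hC] : exists2 C, 0 <= C & forall k : 'I_(size s), forall z,
    `|pds s (h k) z| <= C * `|x k| ^+ 2.
  apply: (@finite_bound R _ (fun (k : 'I_(size s)) C => forall z, `|pds s (h k) z| <= C * `|x k| ^+ 2)).
    move=> k C C' hC CC' z; apply: le_trans (hC z) _.
    by rewrite ler_wpM2r ?exprn_ge0.
  move=> k; have [C C0 hC] := pds_bounded (size s) (sh k) (h0 k).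
  exists (C / `|x k| ^+ 2); first by rewrite divr_ge0 ?exprn_ge0.
  by move=> z; rewrite divfK ?hC // expf_neq0 // gt_eqF.
exists (C + 1); first exact: addr_ge0.
move=> k z; have [ks|sk] := ltnP k (size s).
  apply: le_trans (hC (Ordinal ks) z) _.
  by rewrite ler_wpM2r ?exprn_ge0 // lerDl.
apply: le_trans (hb k s sk z) _.
by rewrite ler_peMl ?exprn_ge0 // lerDr.
Qed.

End Sequence.

(** * Derivatives of cutoffs at a small scale *)

Section Weights.
Variables (x1 : E).

(* [h eta] and its derivatives of order [j <= r] are [O(eta ^ (w - d - j))] on the ball of
   radius [eta] around [x1], uniformly in [0 < eta <= 1]. *)
Fixpoint weight (r w d : nat) (h : R -> E -> R) : Prop :=
  (exists2 C, 0 <= C & forall eta, 0 < eta -> eta <= 1 -> forall z, `|z - x1| <= eta ->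
     `|h eta z| * eta ^+ d <= C * eta ^+ w) /\
  if r is r'.+1 then forall i, weight r' w d.+1 (fun eta => pd i (h eta)) else True.

Definition family_smooth (h : R -> E -> R) := forall eta, Cinfty setT (h eta).

Lemma weightS r w d h : weight r.+1 w d h -> weight r w d h.
Proof.
elim: r d h => [|r IH] d h [h1 h2]; split => // i; exact: IH (h2 i).
Qed.

Lemma weight_ext r w d h h' : h =2 h' -> weight r w d h -> weight r w d h'.
Proof. by move=> e; rewrite (_ : h = h') //; apply/funext => t; apply/funext => z. Qed.

Lemma weight_add r w d h g : family_smooth h -> family_smooth g ->
  weight r w d h -> weight r w d g -> weight r w d (fun eta z => h eta z + g eta z).
Proof.
elim: r d h g => [|r IH] d h g sh sg [[C C0 hC] h2] [[D D0 hD] g2].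
  split => //; exists (C + D) => [|eta e0 e1 z ze]; first exact: addr_ge0.
  rewrite mulrDl; apply: le_trans (lerD (hC eta e0 e1 z ze) (hD eta e0 e1 z ze)).
  by rewrite -mulrDl ler_wpM2r ?exprn_ge0 ?ler_normD // ltW.
split.
  exists (C + D) => [|eta e0 e1 z ze]; first exact: addr_ge0.
  rewrite mulrDl; apply: le_trans (lerD (hC eta e0 e1 z ze) (hD eta e0 e1 z ze)).
  by rewrite -mulrDl ler_wpM2r ?exprn_ge0 ?ler_normD // ltW.
move=> i; have := IH d.+1 _ _ (fun eta => Cinfty_pd i (sh eta))
  (fun eta => Cinfty_pd i (sg eta)) (h2 i) (g2 i).
apply: weight_ext => eta z; rewrite /pd -deriveD //; apply: diff_derivable.
  exact: Cinfty_diff (sh eta) _ _.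
exact: Cinfty_diff (sg eta) _ _.
Qed.

Lemma weight_mul r w d w' d' h g : family_smooth h -> family_smooth g ->
  weight r w d h -> weight r w' d' g ->
  weight r (w + w') (d + d') (fun eta z => h eta z * g eta z).
Proof.
elim: r w d w' d' h g => [|r IH] w d w' d' h g sh sg wh wg.
  case: wh => [[C C0 hC] _]; case: wg => [[D D0 hD] _].
  split => //; exists (C * D) => [|eta e0 e1 z ze]; first exact: mulr_ge0.
  rewrite normrM !exprD mulrACA [leRHS]mulrACA; apply: ler_pM (hC eta e0 e1 z ze) (hD eta e0 e1 z ze).
    by rewrite mulr_ge0 ?exprn_ge0 // ltW.
  by rewrite mulr_ge0 ?exprn_ge0 // ltW.
have [wh' wg'] := (weightS wh, weightS wg).
split; first by have := IH _ _ _ _ _ _ sh sg wh' wg'; case: (r) => [|r'] [].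
move=> i; case: wh => _ /(_ i) hi; case: wg => _ /(_ i) gi.
have sh' : family_smooth (fun eta => pd i (h eta)) by move=> eta; exact: Cinfty_pd.
have sg' : family_smooth (fun eta => pd i (g eta)) by move=> eta; exact: Cinfty_pd.
have w1 := IH _ _ _ _ _ _ sh sg' wh' gi; have w2 := IH _ _ _ _ _ _ sg sh' wg' hi.
rewrite addnS in w1; rewrite addnS [(d' + d)%N]addnC [(w' + w)%N]addnC in w2.
have sm (u v : R -> E -> R) : family_smooth u -> family_smooth v ->
    family_smooth (fun eta z => u eta z * v eta z).
  by move=> su sv eta r'; exact: Ck_mul openT (su eta r') (sv eta r').
have := weight_add (sm _ _ sh sg') (sm _ _ sg sh') w1 w2.
apply: weight_ext => eta z; rewrite [in RHS]/pd.
have dh : derivable (h eta) z (delta_mx 0 i) by apply: diff_derivable; exact: Cinfty_diff (sh eta) _ _.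
have dg : derivable (g eta) z (delta_mx 0 i) by apply: diff_derivable; exact: Cinfty_diff (sg eta) _ _.
by have := deriveM dh dg => ->.
Qed.

Lemma ball1_bounded (f : E -> R) : Cinfty setT f ->
  exists2 C, 0 <= C & forall z, `|z - x1| <= 1 -> `|f z| <= C.
Proof.
move=> sf; have [C C0 hC] := @closed_ball_bounded R m f (1 + `|x1|)
  (fun x _ => Cinfty_cont sf (x := x) I).
exists C => // z hz; apply: hC.
by have := ler_normD (z - x1) x1; rewrite subrK => /le_trans; apply; rewrite lerD2r.
Qed.

Lemma weight_const r d (f : E -> R) : Cinfty setT f -> weight r 0 d (fun=> f).
Proof.
have b g d' : Cinfty setT g -> exists2 C, 0 <= C & forall eta : R, 0 < eta -> eta <= 1 ->
    forall z, `|z - x1| <= eta -> `|g z| * eta ^+ d' <= C * eta ^+ 0.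
  move=> sg; have [C C0 hC] := ball1_bounded sg; exists C => // eta e0 e1 z ze.
  rewrite expr0 mulr1; apply: le_trans (hC z (le_trans ze e1)).
  by rewrite ler_piMr // exprn_ile1 // ltW.
by elim: r d f => [|r IH] d f sf; split => //; [exact: b|exact: b|
  move=> i; apply: IH; exact: Cinfty_pd].
Qed.

(** A zero at [x1] gains one power of [eta], and differentiating loses no more than that power. *)
Lemma weight_vanish r (f : E -> R) : Cinfty setT f -> f x1 = 0 -> weight r 1 0 (fun=> f).
Proof.
move=> sf f0.
have b0 : exists2 C, 0 <= C & forall eta : R, 0 < eta -> eta <= 1 ->
    forall z, `|z - x1| <= eta -> `|f z| * eta ^+ 0 <= C * eta ^+ 1.
  have [L L0 hL] := @lipschitz_ball R m f (1 + `|x1|) (fun r => Ck_sub (subsetT _) (sf r)).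
  exists L => // eta e0 e1 z ze; rewrite expr0 mulr1 expr1.
  have zx : `|z| <= 1 + `|x1|.
    by have := ler_normD (z - x1) x1; rewrite subrK => /le_trans; apply; rewrite lerD2r (le_trans ze).
  have := hL x1 z; rewrite f0 subr0 => /(_ _ zx) /le_trans; apply; last exact: ler_wpM2l.
  by rewrite lerDr.
have b g d' : Cinfty setT g -> exists2 C, 0 <= C & forall eta : R, 0 < eta -> eta <= 1 ->
    forall z, `|z - x1| <= eta -> `|g z| * eta ^+ d'.+1 <= C * eta ^+ 1.
  move=> sg; have [C C0 hC] := ball1_bounded sg; exists C => // eta e0 e1 z ze.
  rewrite expr1 exprS mulrCA mulrC ler_wpM2r // ?(ltW e0) //.
  apply: le_trans (hC z (le_trans ze e1)).
  by rewrite ler_piMr // exprn_ile1 // ltW.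
have H r' d' g : Cinfty setT g -> weight r' 1 d'.+1 (fun=> g).
  by elim: r' d' g => [|r' IH] d' g sg; split => //; [exact: b|exact: b|
    move=> i; apply: IH; exact: Cinfty_pd].
case: r => [|r]; split => // i; apply: H; exact: Cinfty_pd.
Qed.

Lemma weight_bound r w d h : weight r w d h -> exists2 C, 0 <= C &
  forall eta, 0 < eta -> eta <= 1 -> forall s, (size s <= r)%N -> forall z,
    `|z - x1| <= eta -> `|pds s (h eta) z| * eta ^+ (d + size s) <= C * eta ^+ w.
Proof.
elim: r d h => [|r IH] d h [[C C0 hC] h2].
  by exists C => // eta e0 e1 [|//] _ z ze; rewrite addn0; exact: hC.
have [D D0 hD] : exists2 D, 0 <= D & forall i,
  forall eta, 0 < eta -> eta <= 1 -> forall s, (size s <= r)%N -> forall z,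
    `|z - x1| <= eta -> `|pds s (pd i (h eta)) z| * eta ^+ (d.+1 + size s) <= D * eta ^+ w.
  apply: (@finite_bound R _ (fun (i : 'I_m) D => forall eta, 0 < eta -> eta <= 1 ->
     forall s, (size s <= r)%N -> forall z,
    `|z - x1| <= eta -> `|pds s (pd i (h eta)) z| * eta ^+ (d.+1 + size s) <= D * eta ^+ w)).
    move=> i C1 C2 h1 C12 eta e0 e1 s sr z ze; apply: le_trans (h1 eta e0 e1 s sr z ze) _.
    by rewrite ler_wpM2r ?exprn_ge0 // ltW.
  by move=> i; exact: IH (h2 i).
exists (C + D) => [|eta e0 e1 [|i s] /= sr z ze]; first exact: addr_ge0.
  rewrite addn0; apply: le_trans (hC eta e0 e1 z ze) _.
  by rewrite ler_wpM2r ?exprn_ge0 ?lerDl // ltW.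
rewrite addnS -addSn; apply: le_trans (hD i eta e0 e1 s sr z ze) _.
by rewrite ler_wpM2r ?exprn_ge0 ?lerDr // ltW.
Qed.

Lemma smoothv_dilate (W : set E) a : open W -> smoothv W (fun z : E => a *: (z - x1)).
Proof.
move=> oW i r; apply: (@Ck_ext _ _ _ _ (fun z => a * (z 0 i + (- x1) 0 i))) => //.
  by move=> z _; rewrite !mxE.
apply: Ck_mul => //; first exact: Ck_cst.
by apply: Ck_add => //; [exact: Ck_coord|exact: Ck_cst].
Qed.

Lemma Cinfty_dilate (f : E -> R) a : Cinfty setT f -> Cinfty setT (fun z => f (a *: (z - x1))).
Proof.
move=> sf r; apply: (@Ck_comp _ _ _ _ _ setT (fun z => a *: (z - x1)) f openT) => //.
by move=> l; exact: smoothv_dilate openT l r.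
Qed.

Lemma pd_dilate (f : E -> R) a i z : Cinfty setT f ->
  pd i (fun z => f (a *: (z - x1))) z = a * pd i f (a *: (z - x1)).
Proof.
move=> sf; rewrite /pd (@derive_comp R m m (fun z => a *: (z - x1)) f).
- have dE l : 'D_(delta_mx 0 i) (fun z : E => (a *: (z - x1)) 0 l) z =
      a * (delta_mx 0 i : E) 0 l :> R.
    rewrite (_ : (fun _ => _) = a \*: ((fun z : E => z 0 l) + cst (- x1 0 l))).
      rewrite deriveZ; last first.
        by apply: derivableD; [exact/diff_derivable/differentiable_coord|exact: derivable_cst].
      rewrite deriveD; [|exact/diff_derivable/differentiable_coord|exact: derivable_cst].
      by rewrite derive_coord derive_cst addr0.
    by apply/funext => y; rewrite !mxE.
  rewrite (bigD1 i) //= big1 ?addr0 => [|l li]; first by rewrite dE mxE !eqxx mulr1.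
  by rewrite dE mxE (negPf li) andbF mulr0 mul0r.
- by move=> l; exact: Cinfty_diff (smoothv_dilate a openT l) _ _.
- exact: Cinfty_diff sf _ _.
Qed.

(** Each derivative of a function dilated by [eta^-1] costs one factor [eta^-1]. *)
Lemma weight_dilate r j (f : E -> R) rho : Cinfty setT f ->
  (forall z, rho < `|z| -> f z = 0) ->
  weight r 0 j (fun eta z => eta^-1 ^+ j * f (eta^-1 *: (z - x1))).
Proof.
have b j' (g : E -> R) : Cinfty setT g -> (forall z, rho < `|z| -> g z = 0) ->
    exists2 C, 0 <= C & forall eta : R, 0 < eta -> eta <= 1 -> forall z : E,
  `|z - x1| <= eta -> `|eta^-1 ^+ j' * g (eta^-1 *: (z - x1))| * eta ^+ j' <= C * eta ^+ 0.
  move=> sg g0; have [C C0 hC] : exists2 C, 0 <= C & forall z, `|g z| <= C.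
    by apply: (@supported_bounded g 0 rho) => // z; rewrite subr0; exact: g0.
  exists C => // eta e0 e1 z _; rewrite normrM [`|_ ^+ j'|]ger0_norm; last first.
    by rewrite exprn_ge0 // invr_ge0 ltW.
  by rewrite mulrAC -exprMn (mulVf (lt0r_neq0 e0)) expr1n mul1r expr0 mulr1.
elim: r j f => [|r IH] j f sf f0; first by split => //; exact: b.
split=> [|i]; first exact: b.
have h := IH j.+1 (pd i f) (Cinfty_pd i sf).
have {h}h := h (fun z hz => @pd_eq0 f 0 rho i (fun y => ltac:(rewrite subr0; exact: f0)) z
  ltac:(by rewrite subr0)).
apply: weight_ext h => eta z.
rewrite [RHS](_ : _ = eta^-1 ^+ j * pd i (fun z => f (eta^-1 *: (z - x1))) z).
  by rewrite pd_dilate // exprSr mulrA.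
have df : derivable (fun z => f (eta^-1 *: (z - x1))) z (delta_mx 0 i).
  by apply: diff_derivable; exact: Cinfty_diff (Cinfty_dilate _ sf) _ _.
exact: deriveZ.
Qed.

(** Cut off at scale [eta], a product of more than [k] functions vanishing at [x1] has derivatives
    up to order [k] of size [O (eta)]. The constant depends on [t], but [eta] is chosen afterwards,
    so that a huge [t] is harmless. *)
Lemma small_bump rho k eps t (a : E -> R) (us : seq (E -> R)) : 0 < rho -> 0 < eps ->
  Cinfty setT a -> (forall u, u \in us -> Cinfty setT u /\ u x1 = 0) -> (k < size us)%N ->
  exists h : E -> R, [/\ Cinfty setT h, forall z, rho < `|z - x1| -> h z = 0,
    \forall z \near x1, h z = t * (a z * \prod_(u <- us) u z) &
    forall s, (size s <= k)%N -> forall z, `|pds s h z| <= eps].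
Proof.
move=> rho0 eps0 sa hus kus.
have [chi [schi [e e0 chi1] chi0]] := @bump_exists R m 1 ltr01.
have sf : Cinfty setT (fun z => t * a z) by move=> r; apply: Ck_mul => //; [exact: openT|exact: Ck_cst].
pose d (eta : R) (z : E) := eta^-1 ^+ 0 * chi (eta^-1 *: (z - x1)).
have sd : family_smooth d.
  move=> eta r; apply: Ck_mul => //; [exact: openT|exact: Ck_cst|exact: Cinfty_dilate].
have wd : weight k 0 0 d by apply: (@weight_dilate k 0 chi 1) => // z /ltW; exact: chi0.
have smM (u v : R -> E -> R) : family_smooth u -> family_smooth v ->
    family_smooth (fun eta z => u eta z * v eta z).
  by move=> su sv eta r'; exact: Ck_mul openT (su eta r') (sv eta r').
pose P (vs : seq (E -> R)) (eta : R) (z : E) := \prod_(u <- vs) u z.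
have [sP wP] : family_smooth (P us) /\ weight k (size us) 0 (P us).
  elim: {kus} us hus => [|u us IH] hus.
    have -> : P [::] = fun=> (fun=> 1).
      by apply/funext => eta; apply/funext => z; rewrite /P big_nil.
    split; first by move=> eta r; exact: Ck_cst.
    by apply: weight_const => r; exact: Ck_cst.
  have [v vv|sP wP] := IH; first by apply: hus; rewrite inE vv orbT.
  have [su u0] := hus u (mem_head _ _).
  have -> : P (u :: us) = fun eta z => (fun=> u) eta z * P us eta z.
    by apply/funext => eta; apply/funext => z; rewrite /P big_cons.
  split; first by apply: smM.
  by apply: (@weight_mul k 1 0 (size us) 0) => //; exact: weight_vanish.
have wh := weight_mul (smM _ _ sd (fun=> sf)) sP (weight_mul sd (fun=> sf) wd (weight_const k 0 sf)) wP.
rewrite !add0n in wh.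
have [C C0 hC] := weight_bound wh.
pose eta := Num.min (Num.min rho 1) (eps / (C + 1)).
have C1 : 0 < C + 1 by rewrite ltr_wpDl.
have eta0 : 0 < eta by rewrite !lt_min rho0 ltr01 divr_gt0.
have eta1 : eta <= 1 by rewrite !ge_min lexx orbT.
have etar : eta <= rho by rewrite !ge_min lexx.
have etaC : C * eta <= eps.
  apply: (@le_trans _ _ ((C + 1) * eta)); first by rewrite ler_wpM2r ?lerDl // ltW.
  by rewrite mulrC -ler_pdivlMr // ge_min lexx orbT.
pose h z := d eta z * (t * a z) * P us eta z.
have h0 z : eta < `|z - x1| -> h z = 0.
  move=> ez; rewrite /h /d chi0 ?mulr0 ?mul0r // normrZ gtr0_norm ?invr_gt0 //.
  by rewrite mulrC ler_pdivlMr // mul1r ltW.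
exists h; split.
- by move=> r; apply: Ck_mul (sP eta r); [exact: openT|exact: (smM _ _ sd (fun=> sf))].
- by move=> z rz; apply: h0; exact: le_lt_trans rz.
- have : nbhs x1 [set z : E | `|z - x1| < e * eta].
    apply: open_nbhs_nbhs; split; first exact: open_nball.
    by rewrite /= subrr normr0 mulr_gt0.
  apply: filterS => z /= hz; rewrite /h /d chi1; first by rewrite expr0 !mul1r mulrA.
  by rewrite normrZ gtr0_norm ?invr_gt0 // mulrC ltr_pdivrMr.
move=> s sk z; have [ze|ze] := leP (`|z - x1|) eta; last first.
  by rewrite (pds_eq0 s h0) // normr0 ltW.
have := hC eta eta0 eta1 s sk z ze; rewrite add0n.
have -> : size us = ((size us - size s).-1 + 1 + size s)%N by lia.
rewrite exprD mulrA ler_pM2r ?exprn_gt0 // => /le_trans; apply.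
apply: le_trans etaC; rewrite ler_wpM2l // exprD expr1.
by rewrite ler_piMl ?exprn_ile1 // ltW.
Qed.

(** Counterpart of [small_bump] for the second argument of the bracket, which has no zero to
    exploit: a small positive multiple of it is taken. *)
Lemma small_scale rho k eps (f : E -> R) : 0 < rho -> 0 < eps -> Cinfty setT f ->
  exists d h, [/\ 0 < d, Cinfty setT h, forall z, rho < `|z - x1| -> h z = 0,
    \forall z \near x1, h z = d * f z &
    forall s, (size s <= k)%N -> forall z, `|pds s h z| <= eps].
Proof.
move=> rho0 eps0 sf; have [chi [schi chi1 chi0]] := @bump_at R m x1 rho rho0.
have sg : Cinfty setT (fun z => chi z * f z) by move=> r; exact: Ck_mul openT (schi r) (sf r).
have g0 z : rho < `|z - x1| -> chi z * f z = 0 by move=> h; rewrite chi0 ?mul0r // ltW.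
have [C C0 hC] := pds_bounded k sg g0.
have C1 : 0 < C + 1 by rewrite ltr_wpDl.
pose d := eps / (C + 1); have d0 : 0 < d by rewrite divr_gt0.
have pdsZ s (g : E -> R) z : Cinfty setT g -> pds s (fun z => d * g z) z = d * pds s g z.
  elim: s g z => //= i s IH g z sg'; rewrite -IH; last exact: Cinfty_pd.
  congr (pds s _ z); apply/funext => y; rewrite /pd.
  by apply: (@deriveZ _ _ _ g d); apply: diff_derivable; exact: Cinfty_diff sg' _ _.
exists d, (fun z => d * (chi z * f z)); split => //.
- by move=> r; exact: Ck_mul openT (Ck_cst _ _ _) (sg r).
- by move=> z /g0 ->; rewrite mulr0.
- by apply: filterS chi1 => z ->; rewrite mul1r.
move=> s sk z; rewrite pdsZ // normrM gtr0_norm // mulrAC ler_pdivrMr //.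
by rewrite ler_wpM2l // ?(ltW eps0) // (le_trans (hC s sk z)) // lerDl.
Qed.

End Weights.

End Gluing.

(** * Peetre's argument and the order of a local Lie bracket *)

Section LocalLie.
Context (R : realType) (m : nat) (M : manifold R m).
Local Notation E := 'rV[R]_m.
Local Notation V := (smfun M).
Implicit Types (a b f g h u v : V) (p q : M) (c : chart R m M).

Lemma sf_neq0_near f p : f p != 0 -> \forall q \near p, f q != 0.
Proof.
move=> f0; have n0 : 0 < `|f p| by rewrite normr_gt0.
have h1 : nbhs `|f p| [set y : R | 0 < y] by exact: lt_nbhsr.
have h2 : {for p, continuous (fun q => `|f q|)}.
  by apply: (@continuous_comp _ _ _ f (fun y : R => `|y|)); [exact: sf_cont|exact: norm_continuous].
have h3 : nbhs p [set q | 0 < `|f q|] := h2 _ h1.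
by apply: filterS h3 => q /=; rewrite normr_gt0.
Qed.

Lemma smooth_near_pull c p (F : E -> R) (x0 : E) : coords c -> cdom c p ->
  Cinfty setT F -> smooth_near p (fun q => F (cfun c q - x0)).
Proof.
move=> cc cp sF; exists c; split => //; exists (cfun c @` cdom c).
split; [exact: cimg_open|by exists p|].
move=> r; apply: (@Ck_ext _ _ _ _ (fun x => F (x - x0))); first exact: cimg_open.
  by move=> _ [q cq <-]; rewrite cfunK.
apply: (@Ck_comp _ _ _ _ _ setT (fun x => x - x0) F) => //; first exact: cimg_open.
by move=> l; apply: smoothv_shift; exact: cimg_open.
Qed.

Lemma near_pull c q (x0 : E) (P : set E) : cdom c q -> nbhs (cfun c q - x0) P ->
  \forall q' \near q, cdom c q' /\ P (cfun c q' - x0).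
Proof.
move=> cq nP; apply: (@cpreimage_nbhs _ _ _ c q [set x | P (x - x0)]) => //.
have cs : {for cfun c q, continuous (fun x : E => x - x0)}.
  apply: (@smoothv_cont R m m setT (fun x => x - x0)) => //.
  by apply: smoothv_shift; exact: openT.
exact: cs _ nP.
Qed.

Lemma local_rep c q (x0 : E) f : coords c -> cdom c q ->
  exists F : E -> R, Cinfty setT F /\ \forall q' \near q, f q' = F (cfun c q' - x0).
Proof.
move=> cc cq.
pose U := [set x : E | (cfun c @` cdom c) (x + x0)].
have oU : open U.
  apply: open_comp; last exact: cimg_open.
  move=> x _; apply: (@smoothv_cont R m m setT (fun x => x + x0) x) => //.
  by apply: smoothv_shift; exact: openT.
have Uq : U (cfun c q - x0) by rewrite /U /= subrK; exists q.
have sF : Cinfty U (fun x => f (cinv c (x + x0))).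
  move=> r; apply: (@Ck_comp _ _ _ _ _ _ (fun x => x + x0) (fun z => f (cinv c z)) oU _ _
    (sf_chart f cc r)) => //.
  by move=> l; exact: smoothv_shift.
have [F [sF' FE _]] := cutoff oU Uq sF.
exists F; split => //.
by apply: filterS (near_pull cq FE) => q' [cq' ->]; rewrite subrK cfunK.
Qed.

Lemma local_rep_prod c q (x0 : E) (us : seq V) : coords c -> cdom c q ->
  (forall u, u \in us -> u q = 0) ->
  exists Us : seq (E -> R), [/\ size Us = size us,
   forall U, U \in Us -> Cinfty setT U /\ U (cfun c q - x0) = 0 &
   \forall q' \near q, (\prod_(u <- us) u) q' = \prod_(U <- Us) U (cfun c q' - x0)].
Proof.
move=> cc cq; elim: us => [|u us IH] hus.
  by exists [::]; split => //; apply: nearW => q'; rewrite !big_nil.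
have [v vv|Us [sz hU eU]] := IH; first by apply: hus; rewrite inE vv orbT.
have [F [sF FE]] := local_rep x0 u cc cq.
exists (F :: Us); split; first by rewrite /= sz.
  move=> U; rewrite inE => /orP[/eqP ->|/hU //]; split => //.
  by rewrite -(nbhs_singleton FE) hus ?mem_head.
near=> q'; rewrite !big_cons sfM; congr (_ * _); by near: q'.
Unshelve. all: by end_near. Qed.

Lemma extend_pull c p (F : E -> R) (x0 : E) : coords c -> cdom c p ->
  Cinfty setT F -> exists f : V, \forall q \near p, f q = F (cfun c q - x0).
Proof. by move=> cc cp sF; apply: sf_extend; exact: smooth_near_pull. Qed.

Variable beta : V -> V -> V.
Hypothesis betaD : forall a b g, beta (a + b) g = beta a g + beta b g.
Hypothesis betaZ : forall t a g, beta (csf M t * a) g = csf M t * beta a g.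
Hypothesis betaN : forall a b, beta a b = - beta b a.
Hypothesis betaJ : forall a b g,
  beta a (beta b g) = beta (beta a b) g + beta b (beta a g).
Hypothesis beta_loc : forall a b p, (\forall q \near p, a q = 0) -> beta a b p = 0.

Lemma beta0 b : beta 0 b = 0.
Proof. by apply: (addrI (beta 0 b)); rewrite -betaD !addr0. Qed.

Lemma betaB a b g : beta (a - b) g = beta a g - beta b g.
Proof. by have := betaD (a - b) b g; rewrite subrK => ->; rewrite addrK. Qed.

Lemma betaDr a b g : beta g (a + b) = beta g a + beta g b.
Proof. by rewrite betaN betaD opprD -!betaN. Qed.

Lemma betaZr t a g : beta g (csf M t * a) = csf M t * beta g a.
Proof. by rewrite betaN betaZ -mulrN -betaN. Qed.

Lemma beta_suml (I : Type) (r : seq I) (P : pred I) (F : I -> V) g :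
  beta (\sum_(i <- r | P i) F i) g = \sum_(i <- r | P i) beta (F i) g.
Proof. by apply: (big_morph (beta^~ g)) => [a b|]; [exact: betaD|exact: beta0]. Qed.

Lemma betaNl a b : beta (- a) b = - beta a b.
Proof. by rewrite -[- a]add0r betaB beta0 add0r. Qed.

Lemma beta_germ a a' b b' p : (\forall q \near p, a q = a' q) ->
  (\forall q \near p, b q = b' q) -> beta a b p = beta a' b' p.
Proof.
have h u u' w : (\forall q \near p, u q = u' q) -> beta u w p = beta u' w p.
  move=> uu; apply/eqP; rewrite -subr_eq0 -sfB -betaB; apply/eqP/beta_loc.
  by apply: filterS uu => q; rewrite sfB => ->; rewrite subrr.
by move=> /h -> /h e; rewrite betaN sfN e -sfN -betaN.
Qed.

(* Counterexamples at points [q k -> p0] of growing order [k] are rescaled and glued to [f] and [g]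
   with [beta f g (q k) = k + 1], against the continuity of [beta f g] at [p0]. *)
Lemma peetre p0 : exists n (U : set M), nbhs p0 U /\
  forall q, U q -> q != p0 -> forall a g (us : seq V), size us = n ->
    (forall u, u \in us -> u q = 0) -> beta (a * \prod_(u <- us) u) g q = 0.
Proof.
apply: contrapT => nex.
(* The tuple [d] consists of the point [q], the coefficient [a], the second argument [g] and the
   list of factors [us]. *)
have H n (U : set M) : nbhs p0 U -> exists d : M * V * V * seq V,
    [/\ U d.1.1.1, d.1.1.1 != p0, size d.2 = n, forall u, u \in d.2 -> u d.1.1.1 = 0 &
      beta (d.1.1.2 * \prod_(u <- d.2) u) d.1.2 d.1.1.1 != 0].
  move=> nU; apply: contrapT => nd; apply: nex; exists n, U; split => // q Uq qp a g us su hus.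
  by apply/eqP; apply: contrapT => /negP nz; apply: nd; exists (q, a, g, us).
have [c ac cp] := atlas_cover p0; have cc := atlas_coords ac.
pose x0 := cfun c p0.
(* Made total by a default value for non-positive radii, so that the sequence can be defined by
   recursion. *)
have H' (ke : nat * R) : exists d : M * V * V * seq V, 0 < ke.2 ->
    [/\ cdom c d.1.1.1, 0 < `|cfun c d.1.1.1 - x0| < ke.2, size d.2 = ke.1.+1,
      forall u, u \in d.2 -> u d.1.1.1 = 0 &
      beta (d.1.1.2 * \prod_(u <- d.2) u) d.1.2 d.1.1.1 != 0].
  have [e0|_] := ltP 0 ke.2; last by exists (p0, 0, 0, [::]).
  have nU : nbhs p0 [set q | cdom c q /\ `|cfun c q - x0| < ke.2].
    apply: (@cpreimage_nbhs _ _ _ c p0 [set x : E | `|x - x0| < ke.2]) => //.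
    apply: open_nbhs_nbhs; split; first exact: open_nball.
    by rewrite /= subrr normr0.
  have [d [[cd de] dp sd hd nz]] := H ke.1.+1 _ nU; exists d => _; split => //.
  rewrite de andbT normr_gt0 subr_eq0; apply: contra dp => /eqP e.
  by rewrite -(cfunK cd) e cfunK.
have [F hF] := boolp.choice H'.
(* Each counterexample is taken within a quarter of the distance of the previous one, as the gluing
   lemmas demand. *)
pose D := fix D k := F (k, if k is k'.+1 then `|cfun c (D k').1.1.1 - x0| / 4 else 1).
pose q k := (D k).1.1.1; pose x k := cfun c (q k) - x0.
have hD k : [/\ cdom c (q k), 0 < `|x k| < (if k is k'.+1 then `|x k'| / 4 else 1),
     size (D k).2 = k.+1, forall u, u \in (D k).2 -> u (q k) = 0 &
      beta ((D k).1.1.2 * \prod_(u <- (D k).2) u) (D k).1.2 (q k) != 0].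
  elim: k => [|k IH]; first exact: (hF (0%N, 1) ltr01).
  apply: (hF (k.+1, `|x k| / 4)); case: IH => _ /andP[xk _] _ _ _.
  by rewrite /= divr_gt0.
have x_pos k : 0 < `|x k| by case: (hD k) => _ /andP[].
have x_dec k : `|x k.+1| <= `|x k| / 4 by case: (hD k.+1) => _ /andP[_ /ltW].
have cq k : cdom c (q k) by case: (hD k).
have xk2 k : 0 < `|x k| / 2 by rewrite divr_gt0.
have xkk k : 0 < `|x k| ^+ 2 by rewrite exprn_gt0.
have hG k : exists dh : R * (E -> R), [/\ 0 < dh.1, Cinfty setT dh.2,
    forall z, `|x k| / 2 < `|z - x k| -> dh.2 z = 0,
    \forall q' \near q k, dh.2 (cfun c q' - x0) = dh.1 * (D k).1.2 q' &
    forall s, (size s <= k)%N -> forall z, `|pds s dh.2 z| <= `|x k| ^+ 2].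
  have [G [sG GE]] := local_rep x0 (D k).1.2 cc (cq k).
  have [d [h [d0 sh h0 hE hb]]] := @small_scale R m (x k) _ k _ G (xk2 k) (xkk k) sG.
  exists (d, h); split => //=; near=> q'.
  have [_ ->] : cdom c q' /\ h (cfun c q' - x0) = d * G (cfun c q' - x0).
    by near: q'; exact: (near_pull (cq k) hE).
  by congr (_ * _); apply/esym; near: q'; exact: GE.
have [dg hdg] := boolp.choice hG.
(* Normalization making the bracket of the two glued functions equal to [k + 1] at [q k]. *)
pose t k : R := k.+1%:R / ((dg k).1 * beta ((D k).1.1.2 * \prod_(u <- (D k).2) u) (D k).1.2 (q k)).
have hH k : exists h : (E -> R), [/\ Cinfty setT h,
    forall z, `|x k| / 2 < `|z - x k| -> h z = 0,
    \forall q' \near q k, h (cfun c q' - x0) = t k * ((D k).1.1.2 * \prod_(u <- (D k).2) u : V) q' &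
    forall s, (size s <= k)%N -> forall z, `|pds s h z| <= `|x k| ^+ 2].
  have [A [sA AE]] := local_rep x0 (D k).1.1.2 cc (cq k).
  have [_ _ szu hus _] := hD k.
  have [Us [szU hU UE]] := local_rep_prod x0 cc (cq k) hus.
  have kU : (k < size Us)%N by rewrite szU szu.
  have [h [sh h0 hE hb]] := @small_bump R m (x k) _ k _ (t k) A Us (xk2 k) (xkk k) sA hU kU.
  exists h; split => //=; near=> q'.
  have [_ ->] : cdom c q' /\ h (cfun c q' - x0) =
      t k * (A (cfun c q' - x0) * \prod_(u <- Us) u (cfun c q' - x0)).
    by near: q'; exact: (near_pull (cq k) hE).
  transitivity (t k * ((D k).1.1.2 q' * (\prod_(u <- (D k).2) u : V) q')); last by [].
  by congr (_ * (_ * _)); apply/esym; near: q'; [exact: AE|exact: UE].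
have [hh hhh] := boolp.choice hH.
have sF : Cinfty setT (seqglue x hh).
  by apply: glue_Cinfty => // k; case: (hhh k).
have sG : Cinfty setT (seqglue x (fun k => (dg k).2)).
  by apply: glue_Cinfty => // k; case: (hdg k).
have [f fE] := extend_pull x0 cc cp sF; have [g gE] := extend_pull x0 cc cp sG.
pose phi := beta f g; pose C := `|phi p0| + 1.
have nphi : \forall q' \near p0, `|phi q'| < C.
  have h1 : nbhs `|phi p0| [set y | y < C] by apply: lt_nbhsl; rewrite ltrDl.
  have h2 : {for p0, continuous (fun q' => `|phi q'|)}.
    by apply: (@continuous_comp _ _ _ phi (fun y : R => `|y|)); [exact: sf_cont|exact: norm_continuous].
  exact: h2 _ h1.
have : nbhs p0 [set q' | [/\ f q' = seqglue x hh (cfun c q' - x0),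
    g q' = seqglue x (fun k => (dg k).2) (cfun c q' - x0) & `|phi q'| < C]].
  by near=> q'; split; near: q'.
rewrite nbhsE /= => -[W0 [oO Op] hO].
have [e e0 he] := nbhs_nball (cimage_nbhs cp (open_nbhs_nbhs (conj oO Op))).
have [K hK] := seq_small x_pos x_dec e0.
(* Far enough for [q k] to lie in the neighbourhood where the bracket is below [C], and for [k + 1]
   to exceed [C]. *)
pose k := maxn K (Num.truncn C).
have xe : `|x k| < e by apply: hK; rewrite leq_maxl.
have Oq : W0 (q k) by have [_] := he _ xe; rewrite cfunK.
have nO : nbhs (q k) W0 by exact: open_nbhs_nbhs.
have nb : \forall q' \near q k, cdom c q' /\ in_ball x k (cfun c q' - x0).
  apply: (@near_pull c (q k) x0 (in_ball x k) (cq k)).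
  have : nbhs (x k) [set z : E | `|z - x k| < `|x k| / 2].
    by apply: open_nbhs_nbhs; split; [exact: open_nball|rewrite /= subrr normr0].
  by apply: filterS => z /= /ltW.
have fk : \forall q' \near q k, f q' = (csf M (t k) * ((D k).1.1.2 * \prod_(u <- (D k).2) u) : V) q'.
  have [_ _ hE _] := hhh k; near=> q'.
  have [-> _ _] : [/\ f q' = seqglue x hh (cfun c q' - x0),
    g q' = seqglue x (fun k => (dg k).2) (cfun c q' - x0) & `|phi q'| < C].
    by apply: hO; near: q'.
  have [_ ib] : cdom c q' /\ in_ball x k (cfun c q' - x0) by near: q'.
  by rewrite (seqglueE x_pos x_dec _ ib) sfM csfE; near: q'.
have gk : \forall q' \near q k, g q' = (csf M (dg k).1 * (D k).1.2 : V) q'.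
  have [_ _ _ hE _] := hdg k; near=> q'.
  have [_ -> _] : [/\ f q' = seqglue x hh (cfun c q' - x0),
    g q' = seqglue x (fun k => (dg k).2) (cfun c q' - x0) & `|phi q'| < C].
    by apply: hO; near: q'.
  have [_ ib] : cdom c q' /\ in_ball x k (cfun c q' - x0) by near: q'.
  by rewrite (seqglueE x_pos x_dec _ ib) sfM csfE; near: q'.
have [_ _ phik] := hO _ Oq.
have [_ _ _ _ nz] := hD k; have [d0 _ _ _ _] := hdg k.
have : phi (q k) = k.+1%:R.
  rewrite /phi (beta_germ fk gk) betaZ betaZr !sfM !csfE /t.
  rewrite divfK // mulf_neq0 //; exact: lt0r_neq0.
move=> e1; move: phik; rewrite e1 ger0_norm // ltNge => /negP; apply.
have C0 : 0 <= C by rewrite addr_ge0.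
have := truncnS_gt C; move=> /ltW /le_trans; apply.
by rewrite ler_nat ltnS leq_maxr.
Unshelve. all: by end_near. Qed.

(** Generators of the [n]-th power of the ideal of functions vanishing at [q], kept as explicit
    products because polarization works factor by factor. *)
Definition van n q f := exists a (us : seq V),
  [/\ size us = n, forall u, u \in us -> u q = 0 & f = a * \prod_(u <- us) u].

Lemma van0 q f : van 0 q f.
Proof. by exists f, [::]; split => //; rewrite big_nil mulr1. Qed.

Lemma van_mul n k q f g : van n q f -> van k q g -> van (n + k) q (f * g).
Proof.
move=> [a [us [sz hu ->]]] [b [vs [sz' hv ->]]].
exists (a * b), (us ++ vs); split.
- by rewrite size_cat sz sz'.
- by move=> u; rewrite mem_cat => /orP[/hu|/hv].
- by rewrite big_cat /= mulrACA.
Qed.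

Lemma van1 q u : u q = 0 -> van 1 q u.
Proof.
move=> u0; exists 1, [:: u]; split => //; last by rewrite big_seq1 mul1r.
by move=> v; rewrite inE => /eqP ->.
Qed.

Lemma vanX n q u : u q = 0 -> van n q (u ^+ n).
Proof.
move=> u0; elim: n => [|n IH]; first exact: van0.
by rewrite exprS -add1n; apply: van_mul => //; exact: van1.
Qed.

Lemma van_mulr n q f g : van n q f -> van n q (f * g).
Proof. by move=> h; rewrite -[n]addn0; apply: van_mul => //; exact: van0. Qed.

Lemma van_le n k q f : (k <= n)%N -> van n q f -> van k q f.
Proof.
move=> kn [a [us [sz hu ->]]]; exists (a * \prod_(u <- drop k us) u), (take k us); split.
- by rewrite size_take_min sz; apply/minn_idPl.
- by move=> u /mem_take /hu.
- by rewrite -mulrA [X in _ = _ * X]mulrC -big_cat cat_take_drop.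
Qed.

Section LinearOperator.
Variable L : V -> V.
Hypothesis LD : forall a b, L (a + b) = L a + L b.
Hypothesis LZ : forall t a, L (csf M t * a) = csf M t * L a.

Lemma linop0 : L 0 = 0.
Proof. by apply: (addrI (L 0)); rewrite -LD !addr0. Qed.

Lemma linop_sum (I : Type) (r : seq I) (P : pred I) (F : I -> V) :
  L (\sum_(i <- r | P i) F i) = \sum_(i <- r | P i) L (F i).
Proof. by apply: (big_morph L LD linop0). Qed.

Lemma csf_nat k : csf M k%:R = k%:R.
Proof. by apply: sfext => p; rewrite csfE; elim: k => // k IH; rewrite -!natr1 sfD IH. Qed.

Lemma csfX t k : csf M t ^+ k = csf M (t ^+ k).
Proof. by apply: sfext => p; rewrite sfX !csfE. Qed.

Lemma csfM s t : csf M s * csf M t = csf M (s * t).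
Proof. exact: sfext. Qed.

Lemma linop_bin w t u n f q : L ((w + csf M t * u) ^+ n * f) q =
  \sum_(i < n.+1) t ^+ i * ('C(n, i)%:R * L (w ^+ (n - i) * u ^+ i * f) q).
Proof.
rewrite exprDn mulr_suml linop_sum sf_sum; apply: eq_bigr => i _.
rewrite exprMn csfX -mulr_natl -csf_nat.
rewrite (_ : _ * f = csf M (t ^+ i * 'C(n, i)%:R) * (w ^+ (n - i) * u ^+ i * f)).
  by rewrite LZ sfM csfE mulrA.
by rewrite -csfM; ring.
Qed.

(** The [j]-fold commutator of [L] with multiplication by [u], applied to 1. It is a smooth function
    whose value at each [q] is [L ((u - u q) ^+ j) q], see [lsh_at]. *)
Definition lsh u j : V := \sum_(i < j.+1)
  (- u) ^+ i * (csf M 'C(j, i)%:R * L (u ^+ (j - i))).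

Lemma lsh_at u j q : lsh u j q = L ((u - csf M (u q)) ^+ j) q.
Proof.
have -> : u - csf M (u q) = u + csf M (- u q) * 1 by rewrite mulr1; exact: sfext.
rewrite -[_ ^+ j]mulr1 linop_bin sf_sum; apply: eq_bigr => i _.
by rewrite !sfM sfX sfN csfE expr1n !mulr1.
Qed.

Lemma lsh_expand u n : L (u ^+ n) =
  \sum_(i < n.+1) csf M 'C(n, i)%:R * (u ^+ i * lsh u (n - i)).
Proof.
apply: sfext => q; have {1}-> : u = (u - csf M (u q)) + csf M (u q) * 1.
  by rewrite mulr1 subrK.
rewrite -[_ ^+ n]mulr1 linop_bin sf_sum; apply: eq_bigr => i _.
by rewrite !sfM csfE sfX lsh_at expr1n !mulr1 mulrCA.
Qed.

End LinearOperator.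

Lemma poly_fun0 n (c : 'I_n -> R) : (forall t, \sum_(i < n) t ^+ i * c i = 0) ->
  forall i, c i = 0.
Proof.
move=> h i; pose P := \poly_(j < n) (if insub j is Some k then c k else 0).
have P0 : P = 0.
  have rootP t : P.[t] = 0.
    rewrite horner_poly -[RHS](h t); apply: eq_bigr => j _.
    by rewrite insubT //= => jn; rewrite mulrC; congr (_ * c _); exact: val_inj.
  apply/eqP; apply: contraT => nz.
  have := max_poly_roots nz (rs := [seq k%:R | k <- iota 0 (size P)]).
  rewrite size_map size_iota ltnn => -> //.
    by apply/allP => _ /mapP[k _ ->]; apply/eqP/rootP.
  by rewrite map_inj_uniq ?iota_uniq // => a b /eqP; rewrite eqr_nat => /eqP.
have := congr1 (fun Q : {poly R} => Q`_i) P0; rewrite coef_poly ltn_ord coef0.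
by rewrite insubT //= => jn <-; congr (c _); exact: val_inj.
Qed.

(** One factor is exchanged at a time: [L] vanishes on [(u + t v) ^+ k.+1] times the rest for every
    [t], and the coefficient of [t] is [k + 1] times the wanted value. *)
Lemma polarization L q : (forall a b, L (a + b) = L a + L b) ->
  (forall t a, L (csf M t * a) = csf M t * L a) -> forall us : seq V,
  (forall u, u q = 0 -> L (u ^+ size us) q = 0) ->
  (forall u, u \in us -> u q = 0) -> L (\prod_(u <- us) u) q = 0.
Proof.
move=> LD LZ.
suff H us k : (forall u, u q = 0 -> L (u ^+ (k + size us)) q = 0) ->
    (forall u, u \in us -> u q = 0) -> forall u, u q = 0 ->
    L (u ^+ k * \prod_(u <- us) u) q = 0.
  move=> us h hus; have := H us 0%N h hus 0 erefl; by rewrite expr0 mul1r.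
elim: us k => [|v us IH] k h hus u u0.
  by rewrite big_nil mulr1; have := h u u0; rewrite addn0.
have hv : v q = 0 by apply: hus; rewrite mem_head.
have hus' w : w \in us -> w q = 0 by move=> ws; apply: hus; rewrite inE ws orbT.
have h' (w : V) : w q = 0 -> L (w ^+ (k.+1 + size us)) q = 0 by rewrite addSnnS; exact: h.
have /poly_fun0 : forall t, \sum_(i < k.+2) t ^+ i *
    ('C(k.+1, i)%:R * L (u ^+ (k.+1 - i) * v ^+ i * \prod_(u <- us) u) q) = 0.
  move=> t; rewrite -(linop_bin LD LZ); apply: IH => //.
  by rewrite sfD sfM u0 hv mulr0 addr0.
move=> /(_ (lift ord0 ord0)) /=; rewrite /bump /= addn0 subn1 /= bin1 expr1 => /eqP.
by rewrite mulf_eq0 pnatr_eq0 /= => /eqP; rewrite big_cons mulrA.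
Qed.

Lemma van_coef r q a f : van r q f -> van r.+1 q ((a - csf M (a q)) * f).
Proof.
by move=> vf; rewrite -add1n; apply: van_mul => //; apply: van1; rewrite sfB csfE subrr.
Qed.

(** * Lowering the order through the Jacobi identity *)

Section Descent.
Variable O : set M.
Hypothesis oO : open O.

Definition order1 r := forall q, O q -> forall f g, van r q f -> beta f g q = 0.
Definition order2 r s := forall q, O q -> forall f g, van r q f -> van s q g -> beta f g q = 0.

Variables r s : nat.
Hypothesis r2 : (2 <= r)%N.
Hypothesis order1rS : order1 r.+1.
Hypothesis order2rsS : order2 r s.+1.

(** At the top order the bracket is linear over functions: the part of the coefficient vanishing at
    [q] raises the order to [r + 1]. *)
Lemma coef_left q a f g : O q -> van r q f -> beta (a * f) g q = a q * beta f g q.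
Proof.
move=> Oq vf; have -> : a * f = csf M (a q) * f + (a - csf M (a q)) * f by rewrite -mulrDl subrKC.
by rewrite betaD betaZ sfD sfM csfE (order1rS Oq g (van_coef a vf)) addr0.
Qed.

Lemma coef_right q b f g : O q -> van r q f -> van s q g ->
  beta f (b * g) q = b q * beta f g q.
Proof.
move=> Oq vf vg; have -> : b * g = csf M (b q) * g + (b - csf M (b q)) * g.
  by rewrite -mulrDl subrKC.
by rewrite betaDr betaZr sfD sfM csfE (order2rsS Oq vf (van_coef b vg)) addr0.
Qed.

Lemma lsh_beta u j g q : lsh (beta^~ g) u j q = beta ((u - csf M (u q)) ^+ j) g q.
Proof. by apply: lsh_at => [a b|t a]; [exact: betaD|exact: betaZ]. Qed.

Lemma near_O q (P : M -> Prop) : O q -> (forall q', O q' -> P q') -> \forall q' \near q, P q'.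
Proof. by move=> Oq h; apply: filterS (open_nbhs_nbhs (conj oO Oq)). Qed.

Lemma vanish_shift u q : (u - csf M (u q)) q = 0.
Proof. by rewrite sfB csfE subrr. Qed.

Lemma lsh_ord g u j q : (r < j)%N -> O q -> lsh (beta^~ g) u j q = 0.
Proof.
move=> rj Oq; rewrite lsh_beta; apply: order1rS => //.
by apply: van_le rj _; apply: vanX; exact: vanish_shift.
Qed.

(** With the exponent [2 * r - 1] only the terms [u ^+ r.-1] and [u ^+ r] survive: lower powers have
    coefficients of order above [r], higher powers lie in [van r.+1]. The two survivors have equal
    binomial coefficients, which is what allows the cancellation. *)
Let N := (r.-1 + r)%N.

(* Both sides of the Jacobi identity for [v ^ (s+1)], [u ^ (2r-1)] and [g] are expanded at [q]
   along powers of [u] and [v]; the terms other than the displayed one cancel. *)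
Lemma descent_step q u v g : O q -> u q = 0 -> v q = 0 ->
  beta (u ^+ r) (v ^+ s) q * beta (u ^+ r.-1 * v) g q = 0.
Proof.
move=> Oq u0 v0; pose f := v ^+ s.+1; pose L g := lsh (beta^~ g) u.
have rN : (r < N.+1)%N by rewrite /N; lia.
have r1N : (r.-1 < N.+1)%N by rewrite /N; lia.
have u0E : u - csf M (u q) = u by rewrite u0; apply: sfext => z; rewrite sfB csfE subr0.
have v0E : v - csf M (v q) = v by rewrite v0; apply: sfext => z; rewrite sfB csfE subr0.
have expand g' : beta (u ^+ N) g' =
    \sum_(i < N.+1) csf M 'C(N, i)%:R * (u ^+ i * L g' (N - i)%N).
  by apply: (lsh_expand (L := beta^~ g')) => [a b|t a]; [exact: betaD|exact: betaZ].
have low g' i : (i < r.-1)%N -> \forall q' \near q, (u ^+ i * L g' (N - i)%N) q' = 0.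
  move=> ir; apply: near_O Oq _ => q' Oq'; rewrite sfM /L lsh_ord ?mulr0 //.
  by rewrite /N; lia.
have expandq g' h : beta (beta (u ^+ N) g') h q =
    \sum_(i < N.+1) 'C(N, i)%:R * beta (u ^+ i * L g' (N - i)%N) h q.
  rewrite expand beta_suml sf_sum; apply: eq_bigr => i _.
  by rewrite betaZ sfM csfE.
have NrE : (N - r.-1 = r)%N by rewrite /N; lia.
have CE : 'C(N, r.-1) = 'C(N, r) by rewrite -(bin_sub (ltnSE r1N)) NrE.
have Lr g' : L g' r q = beta (u ^+ r) g' q by rewrite /L lsh_beta u0E.
have e1 : beta (beta (u ^+ N) g) f q =
    'C(N, r)%:R * (beta (u ^+ r) g q * beta (u ^+ r.-1) f q).
  rewrite expandq (bigD1 (Ordinal r1N)) //= big1 ?addr0 => [|i ir].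
    rewrite CE NrE; congr (_ * _); rewrite -Lr.
    rewrite (_ : u ^+ r.-1 * L g r = csf M (L g r q) * u ^+ r.-1 +
       (L g r - csf M (L g r q)) * u ^+ r.-1); last by rewrite -mulrDl subrKC mulrC.
    rewrite betaD betaZ sfD sfM csfE (_ : beta (_ * _) f q = 0) ?addr0 //.
    apply: (order2rsS Oq); last exact: vanX.
    by rewrite -(prednK (ltnW r2)); apply: van_coef; exact: vanX.
  have [il|] := ltnP i r.-1; first by rewrite beta_loc ?mulr0 //; exact: low.
  rewrite leq_eqVlt => /orP[/eqP e|ri].
    by case/eqP: ir; apply: val_inj.
  rewrite (order2rsS Oq) ?mulr0 //; last exact: vanX.
  by apply: van_mulr; apply: van_le (vanX i u0); lia.
have LfE : L f r = \sum_(i < s.+2) csf M 'C(s.+1, i)%:R *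
    (v ^+ i * lsh (fun w => lsh (beta^~ w) u r) v (s.+1 - i)).
  apply: (lsh_expand (L := fun w => lsh (beta^~ w) u r)) => [a b|t a]; apply: sfext => z.
    by rewrite sfD !lsh_beta betaDr.
  by rewrite sfM !lsh_beta betaZr sfM.
have lsh2 i z : lsh (fun w => lsh (beta^~ w) u r) v i z =
    beta ((u - csf M (u z)) ^+ r) ((v - csf M (v z)) ^+ i) z.
  rewrite lsh_at ?lsh_beta // => [a b|t a]; apply: sfext => y.
    by rewrite sfD !lsh_beta betaDr.
  by rewrite sfM !lsh_beta betaZr sfM.
(* Only the power [v ^+ 1] contributes: the coefficient of [v ^+ 0] vanishes on [O] by [order2rsS],
   and higher powers put the product in [van r.+1]. *)
have e3 : beta (u ^+ r.-1 * L f r) g q =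
    s.+1%:R * (beta (u ^+ r) (v ^+ s) q * beta (u ^+ r.-1 * v) g q).
  rewrite LfE mulr_sumr beta_suml sf_sum (bigD1 (lift ord0 ord0)) //= big1 ?addr0 => [|i i1].
    rewrite /bump /= addn0 subn1 /= bin1 expr1.
    rewrite (_ : _ * _ = csf M s.+1%:R * (lsh (fun w => lsh (beta^~ w) u r) v s * (u ^+ r.-1 * v))).
      rewrite betaZ sfM csfE; congr (_ * _); rewrite coef_left // ?lsh2 ?u0E ?v0E //.
      by have := van_mul (vanX r.-1 u0) (van1 v0); rewrite addn1 prednK // ltnW.
    by ring.
  rewrite mulrCA betaZ sfM csfE.
  case: (ltnP i 1) => [i0|].
    rewrite beta_loc ?mulr0 //; apply: near_O Oq _ => q' Oq'.
    rewrite !sfM lsh2 (order2rsS Oq') ?mulr0 //; last first.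
      by apply: van_le (vanX _ (vanish_shift v q')); lia.
    exact: vanX (vanish_shift u q').
  rewrite leq_eqVlt => /orP[/eqP e|ri]; first by case/eqP: i1; exact: val_inj.
  rewrite (order1rS Oq) ?mulr0 // mulrA; apply: van_mulr.
  by apply: (@van_le (r.-1 + i)); [lia|apply: van_mul; exact: vanX].
have e2 : beta (beta (u ^+ N) f) g q =
    'C(N, r)%:R * (beta (u ^+ r.-1) f q * beta (u ^+ r) g q) +
    'C(N, r)%:R * (s.+1%:R * (beta (u ^+ r) (v ^+ s) q * beta (u ^+ r.-1 * v) g q)).
  rewrite expandq (bigD1 (Ordinal rN)) //= (bigD1 (Ordinal r1N)) /=; last first.
    by apply/eqP => /(congr1 val) /=; lia.
  rewrite big1 ?addr0 => [|i /andP[ir ir1]].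
    rewrite CE NrE e3; congr (_ * _ + _).
    have -> : (N - r = r.-1)%N by rewrite /N; lia.
    by rewrite mulrC coef_left //; [rewrite /L lsh_beta u0E|exact: vanX].
  have [il|] := ltnP i r.-1; first by rewrite beta_loc ?mulr0 //; exact: low.
  move=> ri; have ri' : (r < i)%N.
    have n1 : (i : nat) != r by apply: contra ir => /eqP e; apply/eqP/val_inj.
    have n2 : (i : nat) != r.-1 by apply: contra ir1 => /eqP e; apply/eqP/val_inj.
    by move: n1 n2 ri; lia.
  rewrite (order1rS Oq) ?mulr0 //; apply: van_mulr; exact: van_le ri' (vanX i u0).
(* By skew-symmetry the left side is [- e1] and the first term on the right is [- e2]; their
   difference is the claimed product times a non-zero integer. *)
have : beta f (beta (u ^+ N) g) q = (beta (beta f (u ^+ N)) g + beta (u ^+ N) (beta f g)) q.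
  by rewrite -betaJ.
rewrite sfD [beta f (beta _ _)]betaN [beta f (u ^+ N)]betaN betaNl !sfN.
(* Here [2 <= r] enters: [2 * r - 1] is then larger than [r]. *)
have z : beta (u ^+ N) (beta f g) q = 0.
  by apply: (order1rS Oq); apply: van_le (vanX N u0); rewrite /N; lia.
rewrite e1 e2 z addr0.
move=> /eqP; rewrite eqr_opp [beta (u ^+ r) g q * _]mulrC -subr_eq0 opprD addrA subrr sub0r.
rewrite oppr_eq0 !mulf_eq0 !pnatr_eq0 /=.
have -> : ('C(N, r) == 0%N) = false by apply/negbTE; rewrite -lt0n bin_gt0 ltnSE.
by rewrite -mulf_eq0 => /eqP.
Qed.

End Descent.

(* [descent_step] for [v + t u] instead of [v] gives a polynomial identity in [t], whose coefficients vanish. *)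
Lemma order1_descent O r : open O -> (2 <= r)%N -> order1 O r.+1 -> order1 O r.
Proof.
move=> oO r2 H1; apply: contrapT => nH.
(* A switching index exists: [order2 O r 0] contains the failing claim, while [order2 O r r.+1]
   holds by skew-symmetry. *)
have [s [Hs1 nHs]] : exists s, order2 O r s.+1 /\ ~ order2 O r s.
  apply: contrapT => ns; have H s : ~ order2 O r s.
    elim: s => [h|s IH h]; last by apply: ns; exists s.
    by apply: nH => q Oq f g vf; apply: (h q Oq f g vf); exact: van0.
  apply: (H r.+1) => q Oq f g _ vg; rewrite betaN sfN (H1 q Oq _ _ vg) ?oppr0 //.
apply: nHs => q Oq _ _ [a [us [szu hu ->]]] [b [vs [szv hv ->]]].
have vu : van r q (\prod_(u <- us) u) by exists 1, us; rewrite mul1r.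
have vv : van s q (\prod_(v <- vs) v) by exists 1, vs; rewrite mul1r.
rewrite (coef_left H1) // (coef_right Hs1) //.
suff -> : beta (\prod_(u <- us) u) (\prod_(u <- vs) u) q = 0 by rewrite !mulr0.
apply: (polarization (L := beta^~ _)) hu => [x y|t x|u u0]; [exact: betaD|exact: betaZ|].
rewrite szu; apply: (polarization (L := beta _)) hv => [x y|t x|v v0].
  exact: betaDr.
  exact: betaZr.
rewrite szv {us vs szu szv vu vv a b}.
pose c (i : 'I_s.+1) := 'C(s, i)%:R * beta (u ^+ r) (v ^+ (s - i) * u ^+ i) q.
have Pt t : beta (u ^+ r) ((v + csf M t * u) ^+ s) q = \sum_(i < s.+1) t ^+ i * c i.
  rewrite -[_ ^+ s]mulr1 (linop_bin (L := beta (u ^+ r))) => [|x y|t' x].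
  - by apply: eq_bigr => i _; rewrite mulr1.
  - exact: betaDr.
  - exact: betaZr.
have vt t : (v + csf M t * u) q = 0 by rewrite sfD sfM u0 v0 mulr0 addr0.
pose sg := beta (u ^+ r) (v ^+ s) q.
(* With [v ^+ s] as the free argument, the second factor given by [descent_step] for [v + t u]
   reduces to [t * sg] when [sg] is not 0. *)
have key t : (\sum_(i < s.+1) t ^+ i * c i) * (t * sg) = 0.
  have h0 := descent_step oO r2 H1 Hs1 (v ^+ s) Oq u0 v0.
  have := descent_step oO r2 H1 Hs1 (v ^+ s) Oq u0 (vt t).
  rewrite Pt mulrDr betaD sfD.
  rewrite (_ : u ^+ r.-1 * (csf M t * u) = csf M t * u ^+ r).
    rewrite betaZ sfM csfE -/sg => e.
    have [sg0|sg0] := eqVneq sg 0; first by rewrite sg0 !mulr0.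
    move/eqP: h0; rewrite -/sg mulf_eq0 (negPf sg0) /= => /eqP h0.
    by rewrite -[RHS]e h0 add0r.
  by rewrite mulrCA -exprSr prednK // ltnW.
have [//|sg0] := eqVneq sg 0.
(* The coefficients are shifted by one index to absorb the factor [t]. *)
have /poly_fun0 c0 : forall t, \sum_(i < s.+2) t ^+ i *
    (if unlift ord0 i is Some j then c j else 0) = 0.
  move=> t; rewrite big_ord_recl unlift_none mulr0 add0r.
  apply: (mulIf sg0); rewrite mul0r -[RHS](key t) mulrA; congr (_ * _).
  rewrite mulr_suml; apply: eq_bigr => i _; rewrite liftK lift0 exprSr; ring.
have := Pt 0; rewrite (_ : csf M 0 = 0) ?mul0r ?addr0; last exact: sfext.
move=> ->; apply: big1 => i _; have := c0 (lift ord0 i); rewrite liftK => ->.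
by rewrite mulr0.
Qed.

Lemma order1_two O n : open O -> order1 O n -> order1 O 2.
Proof.
move=> oO; elim: n => [|n IH] h.
  by move=> q Oq f g vf; apply: h => //; exact: van0.
have [n2|n2] := leqP 2 n; first by apply: IH; exact: order1_descent.
by move=> q Oq f g vf; apply: h => //; apply: van_le vf.
Qed.

(** For [q] in the punctured neighbourhood [O] the product [(a - a q) * (b - b q)] is killed by the
    bracket, which is the formula at [q]. A non-zero defect at [p0] would persist nearby and force
    [p0] to be isolated. *)
Theorem first_order a b g : beta (a * b) g = a * beta b g + b * beta a g - a * b * beta 1 g.
Proof.
apply: sfext => p0; apply/eqP; rewrite -subr_eq0 -sfB; apply/eqP.
set D := beta (a * b) g - _.
have [n [U [nU hU]]] := peetre p0.
have : nbhs p0 U by []; rewrite nbhsE /= => -[W [oW Wp WU]].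
pose O := W `&` ~` [set p0].
have oO : open O.
  apply: openI => //; apply: closed_openC.
  apply: accessible_closed_set1; apply: hausdorff_accessible; exact: manifold_hausdorff.
have H : order1 O 2.
  apply: (@order1_two _ n) => // q [Wq /= qp] f h [c [us [su hu ->]]].
  by apply: hU => //; [exact: WU|exact/eqP].
have DO q : O q -> D q = 0.
  move=> Oq; pose a' := a - csf M (a q); pose b' := b - csf M (b q).
  have : van 2 q (a' * b').
    by apply: (@van_mul 1 1); apply: van1; exact: vanish_shift.
  move=> /(H q Oq _ g).
  have -> : a' * b' = a * b - csf M (a q) * b - csf M (b q) * a + csf M (a q * b q) * 1.
    by rewrite /a' /b' -csfM; ring.
  rewrite betaD !betaB !betaZ !sfD !sfN !sfM !csfE => e.
  by rewrite /D !sfB sfD !sfM -[RHS]e; ring.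
(* At an isolated point every function has the germ of a constant, and the formula is a computation
   with constants. *)
have [ex|nex] := pselect (exists2 W', nbhs p0 W' & forall q, W' q -> q = p0).
  have [W' nW' hW'] := ex.
  have near1 (h : V) : \forall q \near p0, h q = (csf M (h p0) * 1) q.
    by apply: filterS nW' => q /hW' ->; rewrite sfM csfE mulr1.
  have E h : beta h g p0 = h p0 * beta 1 g p0.
    by rewrite (beta_germ (b' := g) (near1 h)) ?betaZ ?sfM ?csfE //; exact: nearW.
  transitivity (beta (a * b) g p0 - (a p0 * beta b g p0 + b p0 * beta a g p0 -
    a p0 * b p0 * beta 1 g p0)); first by [].
  by rewrite [beta (a * b) g p0]E [beta a g p0]E [beta b g p0]E sfM; ring.
apply/eqP; apply: contraT => D0; exfalso; apply: nex.
exists (W `&` [set q | D q != 0]).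
  apply: filterI; first exact: open_nbhs_nbhs.
  exact: sf_neq0_near.
by move=> q [Wq Dq]; apply: contrapT => qp; case/eqP: Dq; apply: DO.
Qed.

End LocalLie.

(** * Decomposable forms *)

Definition upd (T : Type) (k : nat) (x : 'I_k -> T) (i : 'I_k) (u : T) : 'I_k -> T :=
  [eta x with i |-> u].

Section Update.
Variables (T : Type) (k : nat).
Implicit Types (x : 'I_k -> T) (i j : 'I_k) (u v : T).

Lemma updE x i u j : upd x i u j = if j == i then u else x j.
Proof. by []. Qed.

Lemma upd_same x i u : upd x i u i = u.
Proof. by rewrite updE eqxx. Qed.

Lemma upd_other x i u j : j != i -> upd x i u j = x j.
Proof. by rewrite updE => /negPf ->. Qed.

Lemma upd_id x i : upd x i (x i) = x.
Proof. by apply/funext => j; rewrite updE; case: eqP => // ->. Qed.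

Lemma updC x i j u v : i != j -> upd (upd x i u) j v = upd (upd x j v) i u.
Proof.
move=> ij; apply/funext => l; rewrite !updE; case: eqP => // ->.
by rewrite eq_sym (negPf ij).
Qed.

Lemma upd_idem x i u v : upd (upd x i u) i v = upd x i v.
Proof. by apply/funext => l; rewrite !updE; case: eqP. Qed.

End Update.

Section Forms.
Local Close Scope classical_set_scope.
Context (R : realType) (V : lmodType R) (k : nat).
Implicit Types (x y f g : 'I_k -> V) (i j : 'I_k) (u v w : V) (b : ('I_k -> V) -> R).

(** Expressed through linear forms, because this is how multilinear expressions are reduced to
    generators slot by slot. *)
Definition spanning (bas : V -> Prop) := forall l : V -> R,
  (forall a u v, l (a *: u + v) = a * l u + l v) -> (forall e, bas e -> l e = 0) ->
  forall v, l v = 0.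

(** The slots in [S] keep their entries; in the others, where [b] is linear, entries may be taken
    among the generators. *)
Lemma multilinear_expand b (bas : V -> Prop) (S : pred 'I_k) y0 :
  (forall i, ~~ S i -> forall y a u v,
    b (upd y i (a *: u + v)) = a * b (upd y i u) + b (upd y i v)) ->
  spanning bas ->
  (forall y, (forall j, S j -> y j = y0 j) -> (forall j, ~~ S j -> bas (y j)) -> b y = 0) ->
  b y0 = 0.
Proof.
move=> mb sp h.
suff H (s : seq 'I_k) y : (forall j, S j -> y j = y0 j) ->
    (forall j, ~~ S j -> j \notin s -> bas (y j)) -> b y = 0.
  by apply: (H (enum 'I_k)) => // j _; rewrite mem_enum.
elim: s y => [|i s IH] y hS hb; first by apply: h => // j Sj; exact: hb.
case Si: (S i).
  apply: IH => // j Sj js; apply: hb => //; rewrite inE (negPf js) orbF.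
  by apply: contra Sj => /eqP ->; rewrite Si.
rewrite -(upd_id y i).
apply: (sp (fun v => b (upd y i v))) => [a u v|e be]; first by apply: mb; rewrite Si.
apply: IH => j Sj.
  by rewrite upd_other ?hS //; apply: contraTneq Sj => ->; rewrite Si.
move=> js; have [->|ji] := eqVneq j i; first by rewrite upd_same.
by rewrite upd_other //; apply: hb => //; rewrite inE negb_or ji.
Qed.

Section OneForm.
Variable b : ('I_k -> V) -> R.
Hypothesis mb : multilinear_form b.
Hypothesis sb : skew_form b.

Lemma form_lin x i a u v : b (upd x i (a *: u + v)) = a * b (upd x i u) + b (upd x i v).
Proof. exact: mb. Qed.

Lemma form0 x i : b (upd x i 0) = 0.
Proof. by have := form_lin x i 1 0 0; rewrite scaler0 addr0 mul1r => h; lra. Qed.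

Lemma multiformD x i u v : b (upd x i (u + v)) = b (upd x i u) + b (upd x i v).
Proof. by have := form_lin x i 1 u v; rewrite scale1r mul1r. Qed.

Lemma multiformZ x i a u : b (upd x i (a *: u)) = a * b (upd x i u).
Proof. by have := form_lin x i a u 0; rewrite addr0 form0 addr0. Qed.

Lemma multiformB x i u v : b (upd x i (u - v)) = b (upd x i u) - b (upd x i v).
Proof. by rewrite multiformD -scaleN1r multiformZ mulN1r. Qed.

Lemma form_sum x i (I : Type) (r : seq I) (P : pred I) (F : I -> V) :
  b (upd x i (\sum_(j <- r | P j) F j)) = \sum_(j <- r | P j) b (upd x i (F j)).
Proof. by apply: (big_morph (fun v => b (upd x i v))) => [u v|]; [exact: multiformD|exact: form0]. Qed.

Lemma form_rep x i j : i != j -> x i = x j -> b x = 0.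
Proof.
move=> ij e; have := sb (tperm i j) x; rewrite odd_tperm ij expr1 mulN1r.
rewrite (_ : (fun l => x _) = x) => [h|]; first by lra.
by apply/funext => l; case: tpermP => // ->.
Qed.

Lemma form_swap x i j u v : i != j ->
  b (upd (upd x i u) j v) = - b (upd (upd x i v) j u).
Proof.
move=> ij; have := sb (tperm i j) (upd (upd x i v) j u).
rewrite odd_tperm ij expr1 mulN1r => <-; congr b; apply/funext => l.
rewrite !updE; case: tpermP => [->|->|/eqP li /eqP lj]; first by rewrite (negPf ij) !eqxx.
  by rewrite eqxx (negPf ij) eqxx.
by rewrite (negPf li) (negPf lj).
Qed.

Lemma form_exchange_rep (f : 'I_k -> V) (X : V -> V) g i j : i != j -> g i = g j ->
  b (upd g i (X (g i))) + b (upd g j (X (g j))) = 0.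
Proof.
move=> ij e.
have -> : upd g i (X (g i)) = upd (upd g i (X (g i))) j (g i).
  apply/funext => l; rewrite !updE; have [->|//] := eqVneq l j.
  by rewrite eq_sym (negPf ij) e.
have -> : upd g j (X (g j)) = upd (upd g i (g i)) j (X (g i)) by rewrite upd_id -e.
by rewrite form_swap // addNr.
Qed.

(** The exchange form of the Grassmann-Pluecker relations, which characterize decomposable skew
    forms. *)
Definition pluecker := forall f i g,
  b f * b g = \sum_j b (upd f i (g j)) * b (upd g j (f i)).

Section Basis.
Variable F : 'I_k -> V.
Hypothesis bF : b F != 0.

(** For a decomposable [b] this is the kernel of [b]. In general it only means that [v] is invisible
    next to entries of [F]. *)
Definition form_kernel v := forall i, b (upd F i v) = 0.
Definition basic v := (exists j, v = F j) \/ form_kernel v.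

Lemma form_kernel_lin a u v : form_kernel u -> form_kernel v -> form_kernel (a *: u + v).
Proof. by move=> hu hv i; rewrite form_lin hu hv mulr0 addr0. Qed.

Lemma coef_basis i j : b (upd F i (F j)) = if i == j then b F else 0.
Proof.
case: eqVneq => [->|ij]; first by rewrite upd_id.
by apply: (form_rep ij); rewrite upd_same upd_other // eq_sym.
Qed.

(** Cramer's rule with respect to [F] gives the coefficients [c]; what remains of [v] lies in
    [form_kernel]. *)
Lemma basic_spanning : spanning basic.
Proof.
move=> l ll h v; pose c j := b (upd F j v) / b F.
have lD u w : l (u + w) = l u + l w by have := ll 1 u w; rewrite scale1r mul1r.
have l0 : l 0 = 0 by have := lD 0 0; rewrite addr0 => e; lra.
have lZ a u : l (a *: u) = a * l u by have := ll a u 0; rewrite !addr0 l0 addr0.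
have kv : form_kernel (v - \sum_j c j *: F j).
  move=> i; rewrite multiformB form_sum (bigD1 i) //= big1 ?addr0 => [|j ji].
    by rewrite multiformZ coef_basis eqxx divfK // subrr.
  by rewrite multiformZ coef_basis eq_sym (negPf ji) mulr0.
rewrite -(subrK (\sum_j c j *: F j) v) lD (h _ (or_intror kv)) add0r.
rewrite (big_morph l lD l0) big1 // => j _.
by rewrite lZ (h (F j)) ?mulr0 //; left; exists j.
Qed.

Hypothesis kill : forall y i, form_kernel (y i) -> b y = 0.

(** Entries of [g] may be taken in [F] or in the kernel. A kernel entry makes both sides zero, a
    repeated entry makes two terms cancel, and otherwise [g] permutes [F] and the relation is the
    expansion of [f i] over [F]. *)
Lemma kill_pluecker : pluecker.
Proof.
move=> f i g; apply/eqP; rewrite -subr_eq0; apply/eqP.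
pose D g := b f * b g - \sum_j b (upd f i (g j)) * b (upd g j (f i)).
rewrite -/(D g).
have mD : multilinear_form D.
  move=> l xi a u v; rewrite -/(upd _ _ _) -/(upd xi l u) -/(upd xi l v) /D.
  rewrite form_lin (bigD1 l) //= [in X in _ = a * X + _](bigD1 l) //=.
  rewrite [in X in _ = _ + X](bigD1 l) //=.
  rewrite !upd_same !upd_idem form_lin.
  rewrite (eq_bigr (fun j => a * (b (upd f i (upd xi l u j)) * b (upd (upd xi l u) j (f i))) +
     b (upd f i (upd xi l v j)) * b (upd (upd xi l v) j (f i)))) => [|j jl].
    by rewrite big_split -mulr_sumr /=; ring.
  rewrite !upd_other // ![upd (upd xi l _) j _]updC 1?eq_sym // form_lin; ring.
apply: (multilinear_expand (S := pred0) (y0 := g) (fun i _ => mD i) basic_spanning) => y _ hy.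
have {}hy j : basic (y j) by apply: hy.
have [[c kc]|nk] := pselect (exists c, form_kernel (y c)).
  rewrite /D (kill kc) mulr0 big1 ?subr0 // => j _.
  have [->|jc] := eqVneq j c.
    by rewrite (@kill _ i) ?mul0r // upd_same.
  by rewrite (@kill (upd y j _) c) ?mulr0 // upd_other // eq_sym.
have [[a [c [ac yac]]]|inj] := pselect (exists a c, a != c /\ y a = y c).
  rewrite /D (form_rep ac yac) mulr0 sub0r (bigD1 a) //= (bigD1 c) 1?eq_sym //=.
  rewrite big1 => [|j /andP[ja jc]]; last first.
    by rewrite (@form_rep (upd y j _) a c) ?mulr0 // !upd_other // eq_sym.
  rewrite addr0 yac -mulrDr -{1}yac.
  by rewrite (@form_exchange_rep f (fun=> f i) y a c) ?mulr0 ?oppr0.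
have [t ht] : exists t : 'I_k -> 'I_k, forall j, y j = F (t j).
  have hF j : exists l, y j = F l by case: (hy j) => // kj; case: nk; exists j.
  by exists (fun j => projT1 (cid (hF j))) => j; exact: (projT2 (cid (hF j))).
have tinj : injective t.
  move=> a c tac; apply/eqP; apply: contrapT => /negP ac; apply: inj.
  by exists a, c; split => //; rewrite !ht tac.
have [t' tK t'K] := injF_bij tinj.
have lin : forall v, b (upd f i v) * b y - \sum_j b (upd f i (y j)) * b (upd y j v) = 0.
  apply: basic_spanning => [a u v|e].
    rewrite form_lin (eq_bigr (fun j => a * (b (upd f i (y j)) * b (upd y j u)) +
      b (upd f i (y j)) * b (upd y j v))) => [|j _].
      by rewrite big_split -mulr_sumr /=; ring.
    by rewrite form_lin; ring.
  case=> [[j ->]|ke]; last first.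
    rewrite (@kill _ i) ?upd_same // mul0r big1 ?subr0 // => j _.
    by rewrite (@kill (upd y j e) j) ?upd_same ?mulr0.
  have -> : F j = y (t' j) by rewrite ht t'K.
  rewrite (bigD1 (t' j)) //= upd_id big1 ?addr0 ?subrr // => l lj.
  by rewrite (@form_rep (upd y l _) l (t' j)) ?mulr0 // upd_same upd_other // eq_sym.
by have := lin (f i); rewrite upd_id.
Qed.

End Basis.

Lemma pluecker_kill F y i : pluecker -> b F != 0 -> form_kernel F (y i) -> b y = 0.
Proof.
move=> pl bF ky; have := pl y i F; rewrite big1 => [/eqP|j _]; last by rewrite ky mulr0.
by rewrite mulf_eq0 (negPf bF) orbF => /eqP.
Qed.

(** * Decomposability from the quadratic relations *)

Section LinearCase.
Variable ev : V -> R.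
Hypothesis ev_lin : forall a u v, ev (a *: u + v) = a * ev u + ev v.
Hypothesis k3 : (2 < k)%N.
Hypothesis quad : forall x i l g, l != i -> ev (x l) = 0 ->
  \sum_j b (upd x i (g j)) * b (upd g j (x l)) = 0.
Variable F : 'I_k -> V.
Hypothesis evF : forall i, ev (F i) = 0.
Hypothesis bF : b F != 0.

Lemma other_index (i j : 'I_k) : exists l, (l != i) && (l != j).
Proof.
apply: contrapT => nex; have : (#|'I_k| <= 2)%N.
  have sub : [set: 'I_k] \subset [set i; j].
    apply/fintype.subsetP => l _; rewrite !inE; apply: contrapT => /negP.
    by rewrite negb_or => h; apply: nex; exists l.
  have := subset_leq_card sub; rewrite cardsT cards2 => /leq_trans; apply.
  by case: (i != j).
by rewrite card_ord leqNgt k3.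
Qed.

(** In the relation for [F], with [g] equal to [y] except for [F i] in slot [a], only the term of
    slot [a] survives, and it is [b F * b y]. *)
Lemma missing_index_zero y a l i : y a = F l -> i != l ->
  (forall s, s != a -> b (upd F i (y s)) = 0) -> b y = 0.
Proof.
move=> ya il h; have := @quad F i l (upd y a (F i)); rewrite eq_sym => /(_ il (evF l)).
rewrite (bigD1 a) //= big1 ?addr0 => [|s sa]; last by rewrite upd_other // h // mul0r.
rewrite upd_same upd_id upd_idem -ya upd_id => /eqP.
by rewrite mulf_eq0 (negPf bF) /= => /eqP.
Qed.

Lemma basis_kernel_zero y a c l : a != c -> y a = F l -> form_kernel F (y c) -> b y = 0.
Proof.
move=> ac ya kc.
apply: (multilinear_expand (S := pred2 a c) (y0 := y) (fun i _ => mb i) (basic_spanning bF)) => z hz bz.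
have za : z a = F l by rewrite hz //= eqxx.
have zc : form_kernel F (z c) by rewrite hz //= eqxx orbT.
have hs s : exists t, ~~ pred2 a c s -> z s = F t \/ form_kernel F (z s).
  case h: (~~ pred2 a c s); last by exists l.
  by case: (bz s h) => [[t e]|e]; [exists t => _; left|exists l => _; right].
pose t s := projT1 (cid (hs s)).
have ht s : s != a -> s != c -> z s = F (t s) \/ form_kernel F (z s).
  by move=> sa sc; apply: (projT2 (cid (hs s))); rewrite /= negb_or sa sc.
have [i il] : exists i, i \notin l |: [set t s | s in [set~ a] :\ c].
  apply: contrapT => nex.
  have sub : [set: 'I_k] \subset l |: [set t s | s in [set~ a] :\ c].
    by apply/fintype.subsetP => i _; apply: contrapT => /negP ni; apply: nex; exists i.
  have := subset_leq_card sub; rewrite cardsT card_ord cardsU1.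
  apply/negP; rewrite -ltnNge.
  apply: leq_ltn_trans (leq_add (leq_b1 _) (leq_imset_card t ([set~ a] :\ c))) _.
  have := cardsD1 c [set~ a]; rewrite cardsC1 card_ord !inE eq_sym ac /= => <-.
  by rewrite ltn_predL; exact: leq_ltn_trans k3.
move: il; rewrite !inE negb_or => /andP[il it].
apply: (missing_index_zero za il) => s sa.
have [->|sc] := eqVneq s c; first exact: zc.
case: (ht s sa sc) => [e|]; last exact.
rewrite e coef_basis; case: eqP => // e'; case/negP: it.
by apply/imsetP; exists s => //; rewrite !inE sa sc.
Qed.

Lemma all_kernel_zero y : (forall i, form_kernel F (y i)) -> b y = 0.
Proof.
(* Subtracting from one entry a multiple of another leaves [b] unchanged and arranges that one entry
   has [ev] equal to 0. *)
suff H z l : (forall i, form_kernel F (z i)) -> ev (z l) = 0 -> b z = 0.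
  move=> hy; have k0 : (0 < k)%N by exact: leq_ltn_trans k3.
  have k1 : (1 < k)%N by exact: ltnW.
  pose i0 := Ordinal k0; pose i1 := Ordinal k1.
  have [e0|e0] := eqVneq (ev (y i0)) 0; first exact: (H y i0).
  pose v := (- (ev (y i1) / ev (y i0))) *: y i0 + y i1.
  have -> : b y = b (upd y i1 v).
    have z01 : b (upd y i1 (y i0)) = 0.
      by apply: (@form_rep _ i1 i0) => //; rewrite upd_same upd_other.
    by rewrite form_lin upd_id z01 mulr0 add0r.
  apply: (H _ i1) => [i|]; last by rewrite upd_same ev_lin mulNr divfK ?addNr.
  by rewrite updE; case: ifP => _; [exact: form_kernel_lin|exact: hy].
move=> hz el; have [i /andP[il _]] := other_index l l.
have [r /andP[rl ri]] := other_index l i.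
(* In the relation for [u], the term of slot [l] is [b z * b F]; all other terms contain both a
   basis vector or [u] and a kernel vector, and vanish by [basis_kernel_zero]. *)
pose u := F l + z l.
have eu : ev (upd z l u l) = 0.
  by rewrite upd_same /u -[F l]scale1r ev_lin evF el mulr0 addr0.
have := @quad (upd z l u) i l (upd F l (z i)); rewrite eq_sym => /(_ il eu).
rewrite (bigD1 l) //= !upd_same upd_idem big1 ?addr0 => [|s sl].
  rewrite updC 1?eq_sym // upd_id /u !multiformD upd_id.
  rewrite (@basis_kernel_zero (upd z l (F l)) l i l) ?upd_same 1?eq_sym //; last first.
    by rewrite upd_other // hz.
  rewrite add0r upd_id (hz l l) addr0 => /eqP.
  by rewrite mulf_eq0 (negPf bF) orbF => /eqP.
rewrite upd_other // (@basis_kernel_zero _ i r s) ?mul0r ?upd_same 1?eq_sym //.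
by rewrite !upd_other.
Qed.

Lemma linear_case : pluecker.
Proof.
apply: (kill_pluecker bF) => y i ki.
apply: (multilinear_expand (S := pred1 i) (y0 := y) (fun i _ => mb i) (basic_spanning bF)) => z hz bz.
have zi : form_kernel F (z i) by rewrite hz //= eqxx.
have [[j [l [ji e]]]|nex] := pselect (exists j l, j != i /\ z j = F l).
  exact: basis_kernel_zero ji e zi.
apply: all_kernel_zero => j; have [->|ji] := eqVneq j i; first exact: zi.
by case: (bz j ji) => // -[l e]; case: nex; exists j, l.
Qed.

End LinearCase.

End OneForm.
End Forms.

(** * Local brackets *)

Section SmfunModule.
Context (R : realType) (m : nat) (M : manifold R m).
Local Notation V := (smfun M).
Implicit Types (a t : R) (u v : V).

Definition smfun_scale t u : V := csf M t * u.

Fact smfun_scaleA a t u : smfun_scale a (smfun_scale t u) = smfun_scale (a * t) u.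
Proof. by rewrite /smfun_scale mulrA csfM. Qed.

Fact smfun_scale1 : left_id 1 smfun_scale.
Proof. by move=> u; rewrite /smfun_scale csf1 mul1r. Qed.

Fact smfun_scaleDr : right_distributive smfun_scale +%R.
Proof. by move=> t u v; exact: mulrDr. Qed.

Fact smfun_scaleDl u : {morph smfun_scale^~ u : a t / a + t}.
Proof. by move=> a t; rewrite /smfun_scale -mulrDl; congr (_ * _); exact: sfext. Qed.

HB.instance Definition _ := GRing.Zmodule_isLmodule.Build R V
  smfun_scaleA smfun_scale1 smfun_scaleDr smfun_scaleDl.

Lemma sfZ t u p : (t *: u) p = t * u p.
Proof. by []. Qed.

Lemma csf_scale t u : csf M t * u = t *: u.
Proof. by []. Qed.

End SmfunModule.

Section BracketAlgebra.
Context (R : realType) (m : nat) (M : manifold R m) (k : nat).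
Local Notation V := (smfun M).
Implicit Types (x y f g : 'I_k -> V) (i j l s : 'I_k) (a b u v w h : V) (p q : M).
Variable B : ('I_k -> V) -> V.

(** Slot [i] of [x] is a placeholder. With it both groups of arguments have length [k], and
    skew-symmetry acts on them in the same way. *)
Definition jac x i g : V :=
  B (upd x i (B g)) - \sum_s B (upd g s (B (upd x i (g s)))).

Hypothesis k3 : (2 < k)%N.
Hypothesis Blin : forall x i (t : R) u v,
  B (upd x i (t *: u + v)) = t *: B (upd x i u) + B (upd x i v).
Hypothesis Bskew : forall (s : 'S_k) x, B (fun j => x (s j)) = (-1) ^+ s *: B x.
Hypothesis Bloc : forall x i p, (\forall q \near p, x i q = 0) -> B x p = 0.
(** This is what the Jacobi identities of all contractions amount to, by [jac_contraction] and
    permutation of slots. *)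
Hypothesis Bjac : forall x i g l s, l != i -> x l = g s -> jac x i g = 0.

Definition bform p x : R := B x p.

Lemma bform_multilinear p : multilinear_form (bform p).
Proof. by move=> i x t u v; rewrite -/(upd _ _ _) /bform Blin sfD sfZ. Qed.

Lemma bform_skew p : skew_form (bform p).
Proof. by move=> s x; rewrite /bform Bskew sfZ. Qed.

Lemma Brep x i j : i != j -> x i = x j -> B x = 0.
Proof. by move=> ij e; apply: sfext => p; exact: (form_rep (bform_skew p) ij e). Qed.

Lemma Bswap x i j u v : i != j -> B (upd (upd x i u) j v) = - B (upd (upd x i v) j u).
Proof. by move=> ij; apply: sfext => p; exact: (form_swap (bform_skew p) x u v ij). Qed.

Lemma B0 x i : B (upd x i 0) = 0.
Proof. by apply: sfext => p; exact: (form0 (bform_multilinear p)). Qed.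

Lemma BD x i u v : B (upd x i (u + v)) = B (upd x i u) + B (upd x i v).
Proof. by have := Blin x i 1 u v; rewrite !scale1r. Qed.

Lemma BN x i u : B (upd x i (- u)) = - B (upd x i u).
Proof. by have := Blin x i (-1) u 0; rewrite addr0 !scaleN1r B0 addr0. Qed.

Lemma Bsum x i (I : Type) (r : seq I) (P : pred I) (F : I -> V) :
  B (upd x i (\sum_(j <- r | P j) F j)) = \sum_(j <- r | P j) B (upd x i (F j)).
Proof. by apply: (big_morph (fun v => B (upd x i v))) => [u v|]; [exact: BD|exact: B0]. Qed.

Lemma Bgerm x i u v p : (\forall q \near p, u q = v q) -> B (upd x i u) p = B (upd x i v) p.
Proof.
move=> uv; apply/eqP; rewrite -subr_eq0 -sfB -BN -BD; apply/eqP.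
by apply: (@Bloc _ i); rewrite upd_same; apply: filterS uv => q; rewrite sfB => ->; rewrite subrr.
Qed.

(** A third slot [r], holding the same entry in both groups, makes the restricted identity
    available; the terms of the slots other than [i] and [j] repeat an entry. *)
Lemma Blie x i j a b h : i != j ->
  let beta u v := B (upd (upd x i u) j v) in
  beta a (beta b h) = beta (beta a b) h + beta b (beta a h).
Proof.
move=> ij beta; have [r /andP[ri rj]] := other_index k3 i j.
have : jac (upd x i a) j (upd (upd x i b) j h) = 0.
  by apply: (@Bjac _ _ _ r r) => //; rewrite !upd_other.
move/eqP; rewrite subr_eq0 => /eqP; rewrite -/(beta b h) -/(beta a (beta b h)) => ->.
rewrite (bigD1 i) //= (bigD1 j) 1?eq_sym //= big1 ?addr0 => [|s /andP[si sj]].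
  rewrite upd_same upd_other // upd_same; congr (_ + _).
    by rewrite updC 1?eq_sym // upd_idem.
  by rewrite upd_idem.
rewrite upd_other // upd_other //.
by rewrite (@Brep (upd _ j (x s)) s j) ?B0 // upd_same !upd_other.
Qed.

Lemma Bfirst x i a b : B (upd x i (a * b)) =
  a * B (upd x i b) + b * B (upd x i a) - a * b * B (upd x i 1).
Proof.
have [j /andP[ji _]] := other_index k3 i i.
have E u : B (upd x i u) = B (upd (upd x i u) j (x j)).
  by rewrite -[in RHS](upd_other x u ji) upd_id.
rewrite !E; apply: (first_order (beta := fun u v => B (upd (upd x i u) j v))).
- by move=> u v w; rewrite updC 1?eq_sym // BD !(updC _ _ _ ji).
- by move=> t u w; rewrite updC 1?eq_sym // csf_scale -[t *: u]addr0 Blin B0 addr0 (updC _ _ _ ji).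
- by move=> u v; rewrite Bswap // eq_sym.
- by move=> u v w; apply: Blie; rewrite eq_sym.
- move=> u v p u0; apply: (@Bloc _ i); rewrite upd_other 1?eq_sym // upd_same.
  exact: u0.
Qed.

Lemma Bsquare x i u : B (upd x i (u * u)) =
  u * (2%:R *: B (upd x i u) - u * B (upd x i 1)).
Proof.
rewrite Bfirst; apply: sfext => p.
by rewrite !(sfB, sfD, sfM, sfZ); ring.
Qed.

Lemma half_at u v w p : u p = 0 -> (2%:R *: v - u * w) p = 2%:R * v p.
Proof. by move=> u0; rewrite sfB sfZ sfM u0 mul0r subr0. Qed.

Lemma Bvanish x i u v p : u p = 0 -> B (upd x i (u * v)) p = v p * B (upd x i u) p.
Proof. by move=> u0; rewrite Bfirst sfB sfD !sfM u0; ring. Qed.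

Lemma jac_linx x i g l t u v : l != i ->
  jac (upd x l (t *: u + v)) i g = t *: jac (upd x l u) i g + jac (upd x l v) i g.
Proof.
move=> li; have X w h : B (upd (upd x l w) i h) = B (upd (upd x i h) l w) by rewrite updC.
rewrite /jac X Blin -!X scalerBr scaler_sumr.
under eq_bigr => s _ do rewrite X Blin -!X Blin.
by rewrite big_split /=; apply: sfext => p; rewrite !(sfD, sfN, sfB, sfZ); ring.
Qed.

Lemma jac_ling x i g l t u v :
  jac x i (upd g l (t *: u + v)) = t *: jac x i (upd g l u) + jac x i (upd g l v).
Proof.
rewrite /jac !Blin scalerBr scaler_sumr.
rewrite (eq_bigr (fun s => t *: B (upd (upd g l u) s (B (upd x i (upd g l u s)))) +
   B (upd (upd g l v) s (B (upd x i (upd g l v s)))))) => [|s _].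
  by rewrite big_split /=; apply: sfext => p; rewrite !(sfD, sfN, sfB, sfZ); ring.
have [->|sl] := eqVneq s l; first by rewrite !upd_same !upd_idem !Blin.
by rewrite !upd_other // !(@updC _ _ g l s) 1?eq_sym // Blin.
Qed.

Lemma jacDx x i g l u v : l != i ->
  jac (upd x l (u + v)) i g = jac (upd x l u) i g + jac (upd x l v) i g.
Proof. by move=> li; have := jac_linx x g 1 u v li; rewrite !scale1r. Qed.

Lemma jacDg x i g l u v :
  jac x i (upd g l (u + v)) = jac x i (upd g l u) + jac x i (upd g l v).
Proof. by have := jac_ling x i g l 1 u v; rewrite !scale1r. Qed.

(** Polarization of the vanishing on common entries: the defect is alternating across the two
    groups. *)
Lemma jac_swap x i g l s u v : l != i ->
  jac (upd x l u) i (upd g s v) = - jac (upd x l v) i (upd g s u).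
Proof.
move=> li; have z w : jac (upd x l w) i (upd g s w) = 0.
  by apply: (@Bjac _ _ _ l s) => //; rewrite !upd_same.
have := z (u + v); rewrite jacDx // !jacDg !z add0r addr0 => /eqP.
by rewrite addr_eq0 => /eqP.
Qed.

(* The Jacobi identity with [u * u], [u p = 0], in slot [l] of [x]; exchanging it with [g i] puts it
   where all its terms vanish at [p]. *)
Lemma Bquad p x i l g : l != i -> x l p = 0 ->
  \sum_j B (upd x i (g j)) p * B (upd g j (x l)) p = 0.
Proof.
move=> li; set u := x l => u0.
have xl h : upd (upd x i h) l u = upd x i h.
  by rewrite -[RHS](upd_id _ l) upd_other.
have X2 h : B (upd (upd x l (u * u)) i h) =
    u * (2%:R *: B (upd x i h) - u * B (upd (upd x i h) l 1)).
  by rewrite updC // Bsquare xl.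
have e1 : jac (upd x l (u * u)) i g p =
    - (2%:R * \sum_j B (upd x i (g j)) p * B (upd g j u) p).
  rewrite /jac sfB X2 sfM u0 mul0r sub0r sf_sum mulr_sumr; congr (- _).
  apply: eq_bigr => j _; by rewrite X2 Bvanish // half_at //; ring.
have e2 : jac (upd x l (g i)) i (upd g i (u * u)) p = 0.
  rewrite /jac sfB Bsquare Bvanish // sf_sum (bigD1 i) // big1 ?Monoid.mulm1 => [|s /andP[_ si]].
    rewrite upd_same upd_idem Bsquare Bvanish //.
    by rewrite !half_at //; ring.
  by rewrite (@updC _ _ g i s) 1?eq_sym // Bsquare sfM u0 mul0r.
have := jac_swap x g i (u * u) (g i) li; rewrite upd_id => /(congr1 (fun h : V => h p)).
rewrite sfN e1 e2 oppr0 => /eqP; rewrite oppr_eq0 mulf_eq0 pnatr_eq0 /=.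
by move/eqP.
Qed.

Lemma jac_rep x i g s j : s != j -> g s = g j -> jac x i g = 0.
Proof.
move=> sj e; rewrite /jac (Brep sj e) B0 sub0r (bigD1 s) //= (bigD1 j) 1?eq_sym //=.
rewrite big1 => [|l /andP[ls lj]]; last first.
  by rewrite (@Brep (upd g l _) s j) // !upd_other // eq_sym.
rewrite addr0; apply: sfext => p; rewrite sfN sfD.
have h := form_exchange_rep (bform_skew p) g (fun h => B (upd x i h)) sj e.
by rewrite /bform in h; rewrite h oppr0.
Qed.

(* The alternative to [linear_case]: the bracket has no principal part. *)
Definition vanishing q := forall f, (forall i, f i q = 0) -> B f q = 0.

(** * Brackets without principal part *)

Section SecondCase.
Variable p : M.
Hypothesis vp : \forall q \near p, vanishing q.

Lemma ev_lin q (t : R) u v : (t *: u + v) q = t * u q + v q.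
Proof. by []. Qed.

Lemma one_spanning q : spanning (fun u : V => u = 1 \/ u q = 0).
Proof.
move=> l ll h v; have -> : v = v q *: (1 : V) + (v - v q *: (1 : V)) by rewrite subrKC.
rewrite ll !h ?mulr0 ?addr0 //; last by left.
by right; rewrite sfB sfZ sf1 mulr1 subrr.
Qed.

(** Entries may be taken equal to 1 or zero at [q]. With no entry 1 both sides vanish by hypothesis,
    with two they vanish by repetition, and with one the sum has a single term. *)
Lemma second_expand q f : vanishing q -> B f q = \sum_i f i q * B (upd f i 1) q.
Proof.
move=> vq; apply/eqP; rewrite -subr_eq0; apply/eqP.
pose D f := bform q f - \sum_i f i q * bform q (upd f i 1).
rewrite -/(bform q f) -/(D f); have ml := bform_multilinear q; have sk := bform_skew q.
have mD : multilinear_form D.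
  move=> l y t u v; rewrite -/(upd _ _ _) -/(upd y l u) -/(upd y l v) /D.
  rewrite (form_lin ml) (eq_bigr (fun i => t * (upd y l u i q * bform q (upd (upd y l u) i 1)) +
     upd y l v i q * bform q (upd (upd y l v) i 1))) => [|i _].
    by rewrite big_split -mulr_sumr /=; ring.
  have [->|il] := eqVneq i l; first by rewrite !upd_same !upd_idem sfD sfZ; ring.
  rewrite !upd_other // !(@updC _ _ y l i) 1?eq_sym // (form_lin ml); ring.
apply: (multilinear_expand (S := pred0) (y0 := f) (fun i _ => mD i) (@one_spanning q)) => y _ hy.
have {}hy j : y j = 1 \/ y j q = 0 by exact: hy.
have [[c yc]|n1] := pselect (exists c, y c = 1); last first.
  have y0 i : y i q = 0 by case: (hy i) => // yi; case: n1; exists i.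
  by rewrite /D /bform vq // big1 ?subr0 // => i _; rewrite y0 mul0r.
have [[d [dc yd]]|n2] := pselect (exists d, d != c /\ y d = 1).
  have cd : c != d by rewrite eq_sym.
  rewrite /D (form_rep sk dc) ?yc // big1 ?subr0 // => i _.
  have [->|ic] := eqVneq i c.
    by rewrite (@form_rep _ _ _ _ sk _ c d) ?mulr0 // upd_same upd_other.
  have [->|id] := eqVneq i d.
    by rewrite (@form_rep _ _ _ _ sk _ c d) ?mulr0 // upd_same upd_other.
  by rewrite (@form_rep _ _ _ _ sk _ c d) ?mulr0 // !upd_other 1?eq_sym // yc.
rewrite /D (bigD1 c) //= yc sf1 mul1r big1 ?addr0 => [|i ic].
  by rewrite -yc upd_id subrr.
by case: (hy i) => [yi|->]; [case: n2; exists i|rewrite mul0r].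
Qed.

(** For a family with one entry 1 and the others zero at [q], [second_expand] takes [a] out of the
    slot of 1, and [Bvanish] takes it out of each other slot. *)
Lemma second_homogeneous q a y : vanishing q -> B (fun j => a * y j) q = a q ^+ k * B y q.
Proof.
move=> vq; apply/eqP; rewrite -subr_eq0; apply/eqP.
have ml := bform_multilinear q; have sk := bform_skew q.
pose D y := bform q (fun j => a * y j) - a q ^+ k * bform q y.
rewrite -/(D y).
have aupd z l u : (fun j => a * upd z l u j) = upd (fun j => a * z j) l (a * u).
  by apply/funext => j; rewrite !updE; case: ifP.
have mD : multilinear_form D.
  move=> l z t u v; rewrite -/(upd _ _ _) -/(upd z l u) -/(upd z l v) /D !aupd.
  rewrite (form_lin ml) (_ : a * (t *: u + v) = t *: (a * u) + a * v).
    by rewrite (form_lin ml); ring.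
  by rewrite mulrDr -!csf_scale mulrCA.
apply: (multilinear_expand (S := pred0) (y0 := y) (fun i _ => mD i) (@one_spanning q)) => z _ hz.
have {}hz j : z j = 1 \/ z j q = 0 by exact: hz.
have [[c zc]|n1] := pselect (exists c, z c = 1); last first.
  have z0 i : z i q = 0 by case: (hz i) => // zi; case: n1; exists i.
  by rewrite /D /bform !vq ?mulr0 ?subr0 // => i; rewrite sfM z0 mulr0.
have [[d [dc zd]]|n2] := pselect (exists d, d != c /\ z d = 1).
  by rewrite /D !(form_rep sk dc) ?mulr0 ?subr0 // ?zc ?zd.
have z0 i : i != c -> z i q = 0.
  by move=> ic; case: (hz i) => // zi; case: n2; exists i.
rewrite /D /bform second_expand // (bigD1 c) //= big1 ?addr0 => [|i ic]; last first.
  transitivity ((a * z i) q * B (upd (fun j => a * z j) i 1) q) => //.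
  by rewrite sfM z0 // mulr0 mul0r.
rewrite zc mulr1.
have H (s : seq 'I_k) : uniq s -> c \notin s ->
    B (fun j => if j \in s then a * z j else z j) q = a q ^+ size s * B z q.
  elim: s => [|i s IH] /=; first by rewrite mul1r.
  move=> /andP[si us]; rewrite inE negb_or => /andP[ci cs].
  rewrite (_ : (fun j => _) = upd (fun j => if j \in s then a * z j else z j) i (a * z i)).
    rewrite mulrC Bvanish ?z0 1?eq_sym // exprS -mulrA -IH //; congr (_ * B _ q).
    apply/funext => j; rewrite updE; case: eqP => // ->; by rewrite (negPf si).
  by apply/funext => j; rewrite updE inE; case: eqP => // ->.
have := H (rem c (enum 'I_k)) (rem_uniq _ (enum_uniq _)).
rewrite mem_rem_uniq ?enum_uniq // inE eqxx /= => /(_ isT).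
rewrite size_rem ?mem_enum // size_enum_ord => e.
rewrite (_ : upd _ c 1 = fun j => if j \in rem c (enum 'I_k) then a * z j else z j).
  by rewrite e mulrA -exprS prednK ?subrr //; exact: leq_ltn_trans k3.
apply/funext => j; rewrite updE mem_rem_uniq ?enum_uniq // inE mem_enum andbT.
by case: eqP => // ->.
Qed.

Lemma near_vanishing u v : (forall q, vanishing q -> u q = v q) -> \forall q \near p, u q = v q.
Proof. by move=> h; apply: filterS vp => q; exact: h. Qed.

Lemma Bpower x i w a n : w * B (upd x i 1) = 0 ->
  w * B (upd x i (a ^+ n.+1)) = csf M n.+1%:R * a ^+ n * (w * B (upd x i a)).
Proof.
move=> w1; elim: n => [|n IH]; first by rewrite csf1 mul1r expr0 mul1r expr1.
rewrite exprS Bfirst; apply: sfext => q; move/(congr1 (fun h : V => h q)): IH.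
move/(congr1 (fun h : V => h q)): w1; rewrite !sfM sf0 !csfE !sfX => e1 e2.
rewrite sfB sfD !sfM !sfX mulrBr mulrDr.
rewrite (_ : w q * (a q * a q ^+ n.+1 * _) = a q * a q ^+ n.+1 * (w q * B (upd x i 1) q)); last by ring.
rewrite e1 mulr0 subr0 mulrCA e2 -[n.+2]addn1 natrD !exprS; ring.
Qed.

(** Multiplying all arguments by [a] preserves the presence of a common entry, so the Jacobi
    identity holds for both families; their comparison leaves only the terms in which [a] is
    differentiated. *)
Lemma second_pluecker1 x i g l s : l != i -> x l = 1 -> g s = 1 ->
  B x p * B g p = \sum_j B (upd x i (g j)) p * B (upd g j (x i)) p.
Proof.
move=> li xl gs; pose c j := B (upd x i (g j)).
have x1 : B (upd x i 1) = 0 by apply: (@Brep _ i l); rewrite 1?eq_sym // upd_same upd_other.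
have cj j : c j * B (upd g j 1) = 0.
  have [->|js] := eqVneq j s; first by rewrite /c gs x1 mul0r.
  by rewrite (@Brep (upd g j 1) j s) ?mulr0 // upd_same upd_other // eq_sym.
have vp0 : vanishing p by exact: nbhs_singleton vp.
have aupd a z t u : upd (fun j => a * z j) t (a * u) = fun j => a * upd z t u j.
  by apply/funext => j; rewrite !updE; case: ifP.
have kE : k = k.-1.+1 by rewrite prednK //; exact: leq_ltn_trans k3.
have kE' : k.-1 = k.-2.+1 by move: k3; case: (k) => [|[|]].
(* The comparison produces the relation with [a ^+ k.-1] in place of [a], and the power rule
   [Bpower] reduces it to [a]. *)
have H a : a p != 0 -> B (upd x i a) p * B g p = \sum_j c j p * B (upd g j a) p.
  move=> ap; pose phi := a ^+ k.-1.
  have homB z : \forall q \near p, B (fun j => a * z j) q = (a * (phi * B z)) q.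
    apply: near_vanishing => q vq.
    by rewrite second_homogeneous // mulrA -exprS -kE sfM sfX.
  have := @Bjac (fun j => a * x j) i (fun j => a * g j) l s li; rewrite xl gs => /(_ erefl).
  move/(congr1 (fun h : V => h p)); rewrite /jac sfB sf0 sf_sum.
  rewrite (Bgerm _ _ (homB g)) aupd second_homogeneous //.
  rewrite (eq_bigr (fun j => a p ^+ k * B (upd g j (phi * c j)) p)) => [|j _]; last first.
    rewrite (Bgerm _ _ (_ : \forall q \near p, _ = (a * (phi * c j)) q)).
      by rewrite aupd second_homogeneous.
    by rewrite aupd; exact: homB.
  rewrite -mulr_sumr -mulrBr => /eqP; rewrite mulf_eq0 expf_eq0 (negPf ap) andbF /=.
  rewrite subr_eq0 Bfirst x1 mulr0 subr0 sfD !sfM => /eqP.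
  rewrite (eq_bigr (fun j => phi p * B (upd g j (c j)) p + c j p * B (upd g j phi) p)); last first.
    move=> j _; rewrite Bfirst sfB sfD !sfM.
    have := congr1 (fun h : V => h p) (cj j); rewrite sfM sf0 => e.
    by rewrite -[_ * _ * B (upd g j 1) p]mulrA e mulr0 subr0.
  rewrite big_split -mulr_sumr /=.
  have /(congr1 (fun h : V => h p)) := @Bjac x i g l s li (etrans xl (esym gs)).
  rewrite /jac sfB sf0 sf_sum => /eqP; rewrite subr_eq0 => /eqP -> /addrI.
  rewrite -[X in X = _]sfM /phi kE' Bpower ?x1 ?mulr0 // sfM => e.
  have nz : (csf M k.-2.+1%:R * a ^+ k.-2) p != 0.
    by rewrite sfM csfE sfX mulf_neq0 ?pnatr_eq0 // expf_neq0.
  apply: (mulfI nz); rewrite [X in _ * X = _]mulrC -[X in _ * X = _]sfM e mulr_sumr.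
  by apply: eq_bigr => j _; rewrite -sfM (Bpower a _ (cj j)) !sfM.
(* If [x i] is zero at [p], the relation is used for [x i + 1]; the constant contributes nothing to
   either side. *)
rewrite -{1}(upd_id x i); have [xi|xi] := eqVneq (x i p) 0; last exact: H.
have := H (x i + 1); rewrite sfD sf1 xi add0r oner_eq0 => /(_ isT).
rewrite BD x1 addr0 => ->; apply: eq_bigr => j _; rewrite BD sfD mulrDr.
have := congr1 (fun h : V => h p) (cj j); rewrite sfM sf0 => ->.
by rewrite addr0.
Qed.

(** By [second_expand] a non-zero value is attained on some [F] containing the entry 1. Relative to
    it, families with a kernel entry and an entry 1 are killed by [second_pluecker1], and every
    family with a kernel entry expands into those. *)
Lemma second_pluecker : pluecker (bform p).
Proof.
have ml := bform_multilinear p; have sk := bform_skew p.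
have vp0 : vanishing p by exact: nbhs_singleton vp.
have [[F0 bF0]|nF] := pselect (exists F0, bform p F0 != 0); last first.
  have z x : bform p x = 0 by apply/eqP; apply: contrapT => /negP nz; apply: nF; exists x.
  by move=> f i g; rewrite z mul0r big1 // => j _; rewrite z mul0r.
have [s bF] : exists s, bform p (upd F0 s 1) != 0.
  apply: contrapT => ns; move: bF0; rewrite /bform second_expand // big1 ?eqxx // => s _.
  apply/eqP; rewrite mulf_eq0 orbC; apply/orP; left; apply: contrapT => /negP nz.
  by apply: ns; exists s.
set F := upd F0 s 1 in bF; have Fs : F s = 1 by exact: upd_same.
apply: (kill_pluecker ml sk bF) => y i ky.
have y1 z l : l != i -> z l = 1 -> z i = y i -> bform p z = 0.
  move=> li zl zi; have := second_pluecker1 li zl Fs; rewrite big1 => [|j _].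
    by move/eqP; rewrite mulf_eq0 (negPf bF) orbF => /eqP.
  by rewrite zi -[B (upd F j _) p]/(bform p _) (ky j) mulr0.
have yi0 : y i p = 0.
  have := ky s; rewrite /bform second_expand // (bigD1 s) //= upd_same upd_idem big1 ?addr0.
    by rewrite -Fs upd_id => /eqP; rewrite mulf_eq0 (negPf bF) orbF => /eqP.
  move=> j js; have := ky j; rewrite /bform.
  have -> : upd F j (y i) = upd (upd F s 1) j (y i) by rewrite /F upd_idem.
  rewrite Bswap 1?eq_sym // sfN => /eqP; rewrite oppr_eq0 => /eqP ->.
  by rewrite mulr0.
rewrite /bform second_expand // (bigD1 i) //= yi0 mul0r add0r big1 // => j ji.
by rewrite -[B _ p]/(bform p _) (y1 _ j) ?mulr0 // ?upd_same // upd_other // eq_sym.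
Qed.

End SecondCase.

(** A defect at [p] would be non-zero at all nearby [q], where [linear_case] then excludes families
    vanishing at [q] with non-zero bracket. So the second case applies at [p] and the defect is zero
    after all. *)
Lemma bracket_pluecker p : pluecker (bform p).
Proof.
move=> f i g; apply: contrapT => nD.
pose D := B f * B g - \sum_j B (upd f i (g j)) * B (upd g j (f i)).
have DE q : D q = bform q f * bform q g - \sum_j bform q (upd f i (g j)) * bform q (upd g j (f i)).
  by rewrite /D sfB sfM sf_sum; congr (_ - _); apply: eq_bigr => j _; rewrite sfM.
have Dp : D p != 0 by rewrite DE subr_eq0; apply/eqP.
apply: nD; apply: second_pluecker.
apply: filterS (sf_neq0_near Dp) => q Dq F F0; apply/eqP; apply: contraNT Dq => bF.
rewrite DE subr_eq0; apply/eqP.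
apply: (linear_case (bform_multilinear q) (bform_skew q) (@ev_lin q) k3 _ F0 bF).
by move=> x i' l g'; exact: Bquad.
Qed.

Lemma bracket_plueckerV f i g :
  B f * B g = \sum_j B (upd f i (g j)) * B (upd g j (f i)).
Proof.
apply: sfext => p; rewrite sfM sf_sum (bracket_pluecker p f i g).
by apply: eq_bigr => j _; rewrite sfM.
Qed.

(** * The Jacobi identity from decomposability *)

Section JacobiAt.
Variables (p : M) (F : 'I_k -> V).
Hypothesis bF : bform p F != 0.
Let ml := bform_multilinear p.
Let sk := bform_skew p.

(** All functions [B (upd x i h)] are zero at [p], but their first derivatives matter too, as they
    are inserted in [B] again. *)
Lemma jacobi_kernel x i g : (forall j, j != i -> form_kernel (bform p) F (x j)) -> jac x i g p = 0.
Proof.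
move=> kx; have k0 : (0 < k)%N by exact: leq_ltn_trans k3.
have kill y l : form_kernel (bform p) F (y l) -> B y p = 0.
  exact: (pluecker_kill (bracket_pluecker p) bF).
have [l /andP[li _]] := other_index k3 i i; have [r /andP[rl ri]] := other_index k3 l i.
have X0 h : B (upd x i h) p = 0 by apply: (kill _ l); rewrite upd_other //; exact: kx.
rewrite /jac sfB X0 sub0r sf_sum big1 ?oppr0 // => s _.
(* By two exchanges [phi * w] is a sum of products with two factors zero at [p], one by a kernel
   entry in the remaining slot [r], the other by the kernel entry [x l] next to [F]. A first-order
   operator kills such products. *)
pose w := B (upd x i (g s)); pose phi := B F * B F.
have phi0 : phi p != 0 by rewrite sfM mulf_neq0.
apply: (mulfI phi0); rewrite mulr0.
have -> : phi p * B (upd g s w) p = B (upd g s (phi * w)) p.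
  by rewrite (mulrC phi w) Bvanish ?X0.
have -> : phi * w = \sum_j \sum_t B (upd (upd x i (F j)) l (F t)) *
    (B (upd F t (x l)) * B (upd F j (g s))).
  rewrite /phi mulrC mulrA /w (bracket_plueckerV (upd x i (g s)) i F) mulr_suml.
  apply: eq_bigr => j _; rewrite upd_idem upd_same mulrAC.
  rewrite (bracket_plueckerV (upd x i (F j)) l F) mulr_suml.
  by apply: eq_bigr => t _; rewrite (upd_other _ _ li) mulrA.
rewrite Bsum sf_sum big1 // => j _; rewrite Bsum sf_sum big1 // => t _.
rewrite Bvanish; last by apply: (kill _ r); rewrite !upd_other //; exact: kx.
by rewrite sfM -[B (upd F t _) p]/(bform p _) (kx l li t) !mul0r.
Qed.

(** Induction on the number of non-kernel entries of [x]. A kernel entry of [g] can be swapped into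
    [x]; otherwise [g] consists of vectors of [F], and it either repeats one or contains all of
    them, including one of [x]. *)
Lemma jacobi_basic x i g n : (forall j, j != i -> basic (bform p) F (x j)) ->
  (forall j, basic (bform p) F (g j)) ->
  (#|[pred l | (l != i) && ~~ `[< form_kernel (bform p) F (x l) >]]| <= n)%N -> jac x i g p = 0.
Proof.
elim: n x g => [|n IH] x g bx bg.
  rewrite leqn0 => /eqP/card0_eq h; apply: jacobi_kernel => j ji.
  by have := h j; rewrite !inE ji /= => /negbFE/asboolP.
have [[l [li nl]]|nex] := pselect (exists l, l != i /\ ~ form_kernel (bform p) F (x l)); last first.
  move=> _; apply: jacobi_kernel => j ji; apply: contrapT => nj; apply: nex; by exists j.
have [s xs] : exists s, x l = F s by case: (bx l li).
move=> cn; have [[t kt]|nt] := pselect (exists t, form_kernel (bform p) F (g t)).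
  rewrite -(upd_id x l) -(upd_id g t) jac_swap // sfN IH ?oppr0 //.
  - move=> j ji; rewrite updE; case: ifP => _; last exact: bx.
    by right.
  - move=> j; rewrite updE; case: ifP => _; [exact: bx|exact: bg].
  rewrite -ltnS; apply: leq_trans cn; apply: proper_card; apply/properP; split.
    apply/fintype.subsetP => j; rewrite !inE updE => /andP[-> /=].
    by case: ifP => // _; have /asboolP -> := kt.
  exists l; rewrite !inE li /=; first by apply/asboolP.
  by rewrite upd_same negbK; apply/asboolP.
have hF j : exists t, g j = F t by case: (bg j) => // kj; case: nt; exists j.
pose t j := projT1 (cid (hF j)); have ht j : g j = F (t j) by exact: (projT2 (cid (hF j))).
have [tinj|ntinj] := pselect (injective t).
  have [t' tK t'K] := injF_bij tinj.
  by rewrite (@Bjac _ _ _ l (t' s)) // ht t'K.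
have [a [c [ac tac]]] : exists a c : 'I_k, a != c /\ t a = t c.
  apply: contrapT => n1; apply: ntinj => a c tac; apply/eqP; apply: contrapT => /negP ac.
  by apply: n1; exists a, c.
by rewrite (@jac_rep _ _ _ a c) // !ht tac.
Qed.

Lemma jacobi_at x i g : jac x i g p = 0.
Proof.
have sp := basic_spanning ml sk bF.
apply: (@multilinear_expand _ _ _ (fun x => jac x i g p) _ (pred1 i) x _ sp) => [l li z t u v|y _ hy].
  by rewrite jac_linx // sfD sfZ.
apply: (@multilinear_expand _ _ _ (fun g => jac y i g p) _ pred0 g _ sp) => [l _ z t u v|h _ hh].
  by rewrite jac_ling sfD sfZ.
by apply: (jacobi_basic (n := #|'I_k|)) => [j ji|j|]; [exact: hy|exact: hh|exact: max_card].
Qed.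

End JacobiAt.

Lemma bracket_jacobi x i g : jac x i g = 0.
Proof.
apply: sfext => p; have [[F bF]|nF] := pselect (exists F, bform p F != 0).
  exact: jacobi_at bF x i g.
have z y : B y p = 0 by apply/eqP; apply: contrapT => /negP nz; apply: nF; exists y.
by rewrite /jac sfB z sf_sum big1 ?subr0.
Qed.

End BracketAlgebra.

(** * Multiderivations and their normal form *)

Section Multiderivations.
Context (R : realType) (m : nat) (M : manifold R m).
Local Notation V := (smfun M).
Local Notation E := 'rV[R]_m.
Implicit Types (p q : M) (c : chart R m M) (u v w : V).

Record derivation (D : V -> V) : Prop := Derivation {
  der_lin : forall (t : R) u v, D (t *: u + v) = t *: D u + D v;
  der_leib : forall a b : V, D (a * b) = a * D b + b * D a;
  der_loc : forall u p, (\forall q \near p, u q = 0) -> D u p = 0 }.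

Section Derivation.
Variable D : V -> V.
Hypothesis dD : derivation D.

Lemma der0 : D 0 = 0.
Proof. by apply: sfext => p; apply: der_loc => //; exact: nearW. Qed.

Lemma derD u v : D (u + v) = D u + D v.
Proof. by have := der_lin dD 1 u v; rewrite !scale1r. Qed.

Lemma derZ (t : R) u : D (t *: u) = t *: D u.
Proof. by have := der_lin dD t u 0; rewrite !addr0 der0 addr0. Qed.

Lemma derB u v : D (u - v) = D u - D v.
Proof. by rewrite derD -scaleN1r derZ scaleN1r. Qed.

Lemma der_sum (I : Type) (r : seq I) (P : pred I) (F : I -> V) :
  D (\sum_(i <- r | P i) F i) = \sum_(i <- r | P i) D (F i).
Proof. by apply: (big_morph D derD der0). Qed.

Lemma der1 : D 1 = 0.
Proof.
have := der_leib dD 1 1; rewrite !mul1r => /eqP.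
by rewrite -subr_eq0 opprD addrA subrr sub0r oppr_eq0 => /eqP.
Qed.

Lemma der_cst t : D (csf M t) = 0.
Proof. by rewrite -[csf M t]mulr1 csf_scale derZ der1 scaler0. Qed.

Lemma der_germ u v p : (\forall q \near p, u q = v q) -> D u p = D v p.
Proof.
move=> uv; apply/eqP; rewrite -subr_eq0 -sfB -derB; apply/eqP; apply: der_loc => //.
by apply: filterS uv => q; rewrite sfB => ->; rewrite subrr.
Qed.

Lemma derE c p (y : 'I_m -> V) u : coords c -> cdom c p ->
  (forall a, \forall q \near p, y a q = cfun c q 0 a) ->
  D u p = \sum_a dfun c u p 0 a * D (y a) p.
Proof.
move=> cc cp hy; have [h [hE uE]] := hadamard_chart u cc cp.
pose z a : V := y a - csf M (cfun c p 0 a).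
have z0 a : z a p = 0 by rewrite sfB csfE (nbhs_singleton (hy a)) subrr.
have ny : \forall q \near p, forall a, y a q = cfun c q 0 a by exact: filter_forall.
have -> : D u p = D (csf M (u p) + \sum_a z a * h a) p.
  apply: der_germ; near=> q; rewrite sfD csfE sf_sum.
  have -> : u q = u p + \sum_i (cfun c q 0 i - cfun c p 0 i) * h i q by near: q.
  congr (_ + _); apply: eq_bigr => a _; rewrite sfM sfB csfE.
  by congr ((_ - _) * _); apply/esym; move: a; near: q.
rewrite derD der_cst sfD add0r der_sum sf_sum; apply: eq_bigr => a _.
by rewrite der_leib // sfD !sfM z0 mul0r add0r hE derB der_cst subr0.
Unshelve. all: by end_near. Qed.

Lemma der_dfun c p u v : coords c -> cdom c p -> dfun c u p = dfun c v p -> D u p = D v p.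
Proof.
move=> cc cp e; have h i := sf_extend (coord_smooth_near i cc cp).
have [y hy] := boolp.choice h.
by rewrite (derE _ cc cp hy) e -derE.
Qed.

End Derivation.

Lemma covector_exists c p (xi : E) :
  exists f : V, coords c -> cdom c p -> dfun c f p = xi.
Proof.
have [[cc cp]|n] := pselect (coords c /\ cdom c p); last by exists 0 => cc cp; case: n.
have h i := sf_extend (coord_smooth_near i cc cp).
have [y hy] := boolp.choice h.
exists (\sum_i csf M (xi 0 i) * y i) => _ _.
rewrite dfun_sum // [RHS]row_sum_delta; apply: eq_bigr => i _.
by rewrite dfunZ // (dfun_germ cp (hy i)) dfun_coord.
Qed.

Definition covector c p (xi : E) : V := projT1 (cid (covector_exists c p xi)).

Lemma covectorE c p xi : coords c -> cdom c p -> dfun c (covector c p xi) p = xi.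
Proof. exact: (projT2 (cid (covector_exists c p xi))). Qed.

Section Field.
Variable k : nat.
Implicit Types (x f g : 'I_k -> V) (i j : 'I_k).

Record mderivation (C : ('I_k -> V) -> V) : Prop := Mderivation {
  md_lin : forall x i (t : R) u v, C (upd x i (t *: u + v)) = t *: C (upd x i u) + C (upd x i v);
  md_skew : forall (s : 'S_k) x, C (fun j => x (s j)) = (-1) ^+ s *: C x;
  md_leib : forall x i a b, C (upd x i (a * b)) = a * C (upd x i b) + b * C (upd x i a);
  md_loc : forall x i p, (\forall q \near p, x i q = 0) -> C x p = 0 }.

Variable C : ('I_k -> V) -> V.
Hypothesis mC : mderivation C.

Lemma md_der x i : derivation (fun h => C (upd x i h)).
Proof.
split=> [t u v|a b|u p u0]; [exact: md_lin|exact: md_leib|].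
by apply: (md_loc mC (i := i)); rewrite upd_same.
Qed.

Lemma md_form_multilinear p : multilinear_form (fun x => C x p).
Proof. by move=> i x t u v; rewrite -/(upd _ _ _) md_lin // sfD sfZ. Qed.

Lemma md_form_skew p : skew_form (fun x => C x p).
Proof. by move=> s x; rewrite md_skew // sfZ. Qed.

Lemma md_dfun c p f g : coords c -> cdom c p ->
  (forall j, dfun c (f j) p = dfun c (g j) p) -> C f p = C g p.
Proof.
move=> cc cp e.
suff H (s : seq 'I_k) : C (fun j => if j \in s then g j else f j) p = C f p.
  rewrite -(H (enum 'I_k)); congr (C _ p); apply/funext => j; by rewrite mem_enum.
elim: s => [|i s <-] //; pose x j := if j \in s then g j else f j; rewrite -/x.
rewrite -[in RHS](upd_id x i) [in RHS](der_dfun (md_der x i) (v := g i) cc cp).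
  congr (C _ p); apply/funext => j; rewrite updE inE; by case: eqP => // ->.
by rewrite /x; case: ifP.
Qed.

(** Covectors are realized as differentials of global functions, on which [C] can be evaluated; the
    value 0 outside the chart domain is a default. *)
Definition mvval c p (xi : 'I_k -> E) : R :=
  if pselect (coords c /\ cdom c p) then C (fun j => covector c p (xi j)) p else 0.

Lemma mvvalE c p xi f : coords c -> cdom c p -> (forall j, dfun c (f j) p = xi j) ->
  mvval c p xi = C f p.
Proof.
move=> cc cp e; rewrite /mvval; case: pselect => [ok|[]//] /=.
by apply: (md_dfun cc cp) => j; rewrite covectorE.
Qed.

Lemma mvval_linear c p : coords c -> cdom c p -> multilinear_form (mvval c p).
Proof.
move=> cc cp i xi t u v; rewrite -/(upd _ _ _) -/(upd xi i u) -/(upd xi i v).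
pose f j := covector c p (xi j).
have fE j : dfun c (f j) p = xi j by exact: covectorE.
have E1 w (w' : E) : dfun c w p = w' -> mvval c p (upd xi i w') = C (upd f i w) p.
  by move=> e; apply: mvvalE => // j; rewrite !updE; case: ifP.
rewrite (E1 _ _ (covectorE u cc cp)) (E1 _ _ (covectorE v cc cp)).
rewrite (E1 (t *: covector c p u + covector c p v)); first by rewrite md_lin // sfD sfZ.
by rewrite dfunD // -csf_scale dfunZ // !covectorE.
Qed.

Lemma mvval_skew c p : coords c -> cdom c p -> skew_form (mvval c p).
Proof.
move=> cc cp s xi; pose f j := covector c p (xi j).
have fE j : dfun c (f j) p = xi j by exact: covectorE.
rewrite (mvvalE cc cp fE) (@mvvalE c p _ (fun j => f (s j))) // ?md_skew //.
Qed.

Lemma mvval_change c c' p : coords c -> coords c' -> cdom c p -> cdom c' p ->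
  forall xi, mvval c' p xi = mvval c p (fun j => xi j *m transition_mx c c' p).
Proof.
move=> cc cc' cp c'p xi; pose f j := covector c' p (xi j).
have fE j : dfun c' (f j) p = xi j by exact: covectorE.
rewrite (mvvalE cc' c'p fE); apply/esym; apply: mvvalE => // j.
by rewrite (dfun_change cc cc' cp c'p (sf_near _ p)) fE.
Qed.

(** A covector with constant components is the differential, at all points near [p], of one linear
    combination of coordinates, so the component of the field is locally a value of [C]. *)
Lemma mvval_smooth c : coords c -> forall xi : 'I_k -> E,
  smooth_on (cdom c) (fun p => mvval c p xi).
Proof.
move=> cc xi; apply/smooth_onP; first exact: cdom_open.
move=> p cp; have h (l : 'I_m) := sf_extend (coord_smooth_near l cc cp).
have [y hy] := boolp.choice h.
pose f j : V := \sum_l csf M (xi j 0 l) * y l.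
apply: (@smooth_near_germ _ _ _ _ (C f)); last exact: sf_near.
have ny : \forall q \near p, forall l, \forall q' \near q, y l q' = cfun c q' 0 l.
  by apply: filter_forall => l; apply: filterS (nbhs_interior (hy l)) => q.
near=> q; have cq : cdom c q.
  by near: q; apply: open_nbhs_nbhs; split => //; exact: cdom_open.
apply/esym; apply: mvvalE => // j.
rewrite dfun_sum // [RHS]row_sum_delta; apply: eq_bigr => l _.
by rewrite dfunZ // (@dfun_germ _ _ _ c _ (fun q => cfun c q 0 l)) ?dfun_coord //; move: l; near: q.
Unshelve. all: by end_near. Qed.

Definition mvf_of : mvfield M k := @MvField R m M k mvval
  mvval_linear mvval_skew mvval_change mvval_smooth.

Lemma chart_atP p : coords (chart_at p) /\ cdom (chart_at p) p.
Proof.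
by rewrite /chart_at; case: cid2 => c ac cp /=; split => //; exact: atlas_coords.
Qed.

Lemma mv_contractE f p : mv_contract mvf_of (fun j => f j : M -> R) p = C f p.
Proof. by have [cc cp] := chart_atP p; exact: mvvalE. Qed.

Lemma vanishes_atP p : vanishes_at mvf_of p <-> forall f, C f p = 0.
Proof.
have [cc cp] := chart_atP p; split=> [h f|h xi].
  by rewrite -(@mvvalE (chart_at p) p (fun j => dfun (chart_at p) (f j) p)) //; exact: h.
rewrite /= (@mvvalE _ _ _ (fun j => covector (chart_at p) p (xi j))) //.
by move=> j; exact: covectorE.
Qed.

End Field.
End Multiderivations.

(** On entries from [F] a skew form is zero if one repeats, and otherwise determined by the value at
    [F] up to the sign of a permutation. *)
Lemma form_unique (R : realType) (W : lmodType R) k (Phi Psi : ('I_k -> W) -> R)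
    (F : 'I_k -> W) (K : W -> Prop) :
  multilinear_form Phi -> skew_form Phi -> multilinear_form Psi -> skew_form Psi ->
  spanning (fun v => (exists j, v = F j) \/ K v) ->
  (forall y i, K (y i) -> Phi y = 0) -> (forall y i, K (y i) -> Psi y = 0) ->
  Phi F = Psi F -> forall y, Phi y = Psi y.
Proof.
move=> m1 s1 m2 s2 sp k1 k2 e y; apply/eqP; rewrite -subr_eq0; apply/eqP.
apply: (@multilinear_expand _ _ _ (fun y => Phi y - Psi y) _ pred0 y _ sp) => [i _ z a u v|z _ hz].
  by rewrite !form_lin //; ring.
have {}hz j : (exists l, z j = F l) \/ K (z j) by exact: hz.
have [[j kj]|nk] := pselect (exists j, K (z j)).
  by rewrite (k1 _ _ kj) (k2 _ _ kj) subrr.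
have hF j : exists l, z j = F l by case: (hz j) => // kj; case: nk; exists j.
pose t j := projT1 (cid (hF j)); have ht j : z j = F (t j) := projT2 (cid (hF j)).
have [tinj|ntinj] := pselect (injective t).
  have -> : z = fun j => F (perm tinj j) by apply/funext => j; rewrite permE ht.
  by rewrite s1 s2 e subrr.
have [a [c [ac tac]]] : exists a c : 'I_k, a != c /\ t a = t c.
  apply: contrapT => n1; apply: ntinj => a c tac; apply/eqP; apply: contrapT => /negP ac.
  by apply: n1; exists a, c.
have zac : z a = z c by rewrite !ht tac.
by rewrite (form_rep s1 ac zac) (form_rep s2 ac zac) subrr.
Qed.

(** The list [L] enumerates the image of [phi] first and the other indices after it; its [a]-th
    entry is the image of [a]. *)
Lemma extend_injection k m (phi : 'I_k -> 'I_m) (hk : (k <= m)%N) : injective phi ->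
  exists s : 'S_m, forall j, s (widen_ord hk j) = phi j.
Proof.
move=> iphi; pose L := codom phi ++ [seq a <- enum 'I_m | a \notin codom phi].
have uL : uniq L.
  rewrite cat_uniq filter_uniq ?enum_uniq // andbT map_inj_uniq ?enum_uniq //=.
  by apply/hasPn => a; rewrite mem_filter => /andP[].
have mL a : a \in L.
  by rewrite mem_cat mem_filter mem_enum andbT; case: (a \in codom phi).
have sL : size L = m.
  rewrite -[RHS]card_ord -(card_uniqP uL); apply: eq_card => a; by rewrite mL.
pose t (a : 'I_m) := nth a L a.
have tinj : injective t.
  move=> a b; rewrite /t (set_nth_default a b) ?sL // => /eqP.
  by rewrite nth_uniq ?sL // => /eqP /val_inj.
exists (perm tinj) => j.
have jk : (widen_ord hk j < size (codom phi))%N by rewrite size_codom card_ord /=.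
rewrite permE /t nth_cat jk (set_nth_default (phi j)) //.
rewrite -[nat_of_ord (widen_ord hk j)]/(nat_of_ord j).
by rewrite (nth_map j) ?size_enum_ord // nth_ord_enum.
Qed.

Section CoordWedge.
Context (R : realType) (m k : nat) (hk : (k <= m)%N).
Local Notation E := 'rV[R]_m.
Local Notation w := (widen_ord hk).

Lemma coord_wedge_multilinear : multilinear_form (@coord_wedge R m k hk).
Proof.
move=> i xi a u v; rewrite -/(upd _ _ _) -/(upd xi i u) -/(upd xi i v) /coord_wedge.
rewrite -[X in _ = _ + X]mul1r; apply: (@determinant_multilinear _ _ _ _ _ i).
- by apply/rowP => b; rewrite !mxE !upd_same !mxE mul1r.
- by apply/matrixP => l b; rewrite !mxE !upd_other // eq_sym neq_lift.
- by apply/matrixP => l b; rewrite !mxE !upd_other // eq_sym neq_lift.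
Qed.

Lemma coord_wedge_skew : skew_form (@coord_wedge R m k hk).
Proof.
move=> s xi; rewrite /coord_wedge -det_perm -det_mulmx -row_permE; congr (\det _).
by apply/matrixP => a b; rewrite !mxE.
Qed.

Lemma coord_wedge_kill (xi : 'I_k -> E) i : (forall b, xi i 0 (w b) = 0) ->
  coord_wedge hk xi = 0.
Proof.
move=> h; have := coord_wedge_multilinear i xi 0 0 0.
rewrite -/(upd _ _ _) scale0r addr0 mul0r add0r => e.
have mr := @form0 _ _ _ _ coord_wedge_multilinear xi i.
rewrite /coord_wedge -[RHS]mr /coord_wedge; congr (\det _); apply/matrixP => a b.
by rewrite !mxE updE; case: eqP => // ->; rewrite h mxE.
Qed.

Lemma coord_wedge_basis : coord_wedge hk (fun j => delta_mx 0 (w j) : E) = 1.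
Proof.
rewrite /coord_wedge -[RHS](det1 R k); congr (\det _); apply/matrixP => a b.
by rewrite !mxE eqxx /= -(inj_eq val_inj) /= eq_sym.
Qed.

Lemma coord_spanning :
  spanning (fun v : E => (exists j, v = delta_mx 0 (w j)) \/ forall b, v 0 (w b) = 0).
Proof.
move=> l ll h v.
have lD u t : l (u + t) = l u + l t by have := ll 1 u t; rewrite scale1r mul1r.
have l0 : l 0 = 0 by have := lD 0 0; rewrite addr0 => e; lra.
rewrite [v]row_sum_delta (big_morph l lD l0) big1 // => a _.
have lZ t u : l (t *: u) = t * l u by have := ll t u 0; rewrite !addr0 l0 addr0.
rewrite lZ h ?mulr0 //; have [ak|ka] := ltnP a k.
  by left; exists (Ordinal ak); congr (delta_mx 0 _); exact: val_inj.
right => b; rewrite mxE eqxx /=; case: eqP => // e.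
by move: ka; rewrite -e /= leqNgt ltn_ord.
Qed.

End CoordWedge.

Lemma mul1_neq0 (R : realType) (a b : R) : a * b = 1 -> a != 0 /\ b != 0.
Proof. by move=> ab; apply/andP; rewrite -negb_or -mulf_eq0 ab oner_eq0. Qed.

(** * Straightening a decomposable multivector field *)

Section NormalForm.
Context (R : realType) (m : nat) (M : manifold R m).
Local Notation V := (smfun M).
Local Notation E := 'rV[R]_m.
Implicit Types (p q : M) (c : chart R m M) (u v : V).

(** Both forms kill the differentials of the coordinates of index at least [k] and take the value 1
    on the first [k]; [form_unique] concludes. *)
Lemma wedge_of_kernel k (C : ('I_k -> V) -> V) (mC : mderivation C) (hk : (k <= m)%N) c
    (y : 'I_m -> V) : coords c -> (forall q a, cdom c q -> cfun c q 0 a = y a q) ->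
  (forall q, cdom c q -> [/\ pluecker (fun x => C x q),
     C (fun j => y (widen_ord hk j)) q = 1 &
     forall a : 'I_m, (k <= a)%N -> forall i, C (upd (fun j => y (widen_ord hk j)) i (y a)) q = 0]) ->
  equals_coord_wedge (mvf_of mC) hk c.
Proof.
move=> cc hy hC p cp xi; have [pl C1 C0] := hC p cp.
have ny a : \forall q \near p, y a q = cfun c q 0 a.
  have : \forall q \near p, cdom c q by apply: open_nbhs_nbhs; split => //; exact: cdom_open.
  by apply: filterS => q cq; rewrite hy.
apply: (form_unique (F := fun j => delta_mx 0 (widen_ord hk j))
  (K := fun v : E => forall b, v 0 (widen_ord hk b) = 0)).
- exact: mvval_linear.
- exact: mvval_skew.
- exact: coord_wedge_multilinear.
- exact: coord_wedge_skew.
- exact: coord_spanning.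
- move=> z i zi; rewrite -[mvf_of mC c p z]/(mvval C c p z) (@mvvalE _ _ _ _ _ mC c p z (fun j => covector c p (z j))) //; last first.
    by move=> j; exact: covectorE.
  apply: (pluecker_kill pl (F := fun j => y (widen_ord hk j)) (i := i)); first by rewrite C1 oner_eq0.
  move=> j; rewrite (derE (md_der mC _ j) _ cc cp ny) covectorE // big1 // => a _.
  have [ak|ka] := ltnP a k; last by rewrite C0 // mulr0.
  rewrite (_ : a = widen_ord hk (Ordinal ak)) ?zi ?mul0r //; exact: val_inj.
- by move=> z i zi; exact: coord_wedge_kill zi.
rewrite coord_wedge_basis -[mvf_of mC c p _]/(mvval C c p _) (@mvvalE _ _ _ _ _ mC c p _ (fun j => y (widen_ord hk j))) //.
by move=> j; rewrite (dfun_germ cp (ny _)) dfun_coord.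
Qed.

Lemma manifold_potential k (hk : (k <= m)%N) c p (y : 'I_m -> V) (D : 'I_k -> V -> V)
    (G : 'I_k -> V) : coords c -> cdom c p -> cfun c p = 0 ->
  (forall q a, cdom c q -> cfun c q 0 a = y a q) -> (forall i, derivation (D i)) ->
  (\forall q \near p, [/\ forall i j, D i (y (widen_ord hk j)) q = (i == j)%:R,
     forall i l b, D i (D l (y b)) q = D l (D i (y b)) q &
     forall i l, D i (G l) q = D l (G i) q]) ->
  exists Phi : V, [/\ Phi p = 0, forall a : 'I_m, (k <= a)%N -> dfun c Phi p 0 a = 0 &
    \forall q \near p, forall i, D i Phi q = G i q].
Proof.
move=> cc cp c0 hy dD hD; have : nbhs p [set q | [/\ _, _ & _]] := hD.
rewrite nbhsE /= => -[N [oN Np] hN].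
have ny q a : cdom c q -> \forall q' \near q, y a q' = cfun c q' 0 a.
  move=> cq; have : \forall q' \near q, cdom c q'.
    by apply: open_nbhs_nbhs; split => //; exact: cdom_open.
  by apply: filterS => q' cq'; rewrite hy.
pose U := cfun c @` (cdom c `&` N).
pose A l b (x : E) := D l (y b) (cinv c x).
pose g l (x : E) := G l (cinv c x).
have oU : open U by exact: cimg_openI.
have U0 : U 0 by exists p.
have sub (u : V) : Cinfty U (fun x => u (cinv c x)).
  by move=> r; apply: Ck_sub (sf_chart u cc r) => _ [q [cq _] <-]; exists q.
have dE i u q : cdom c q ->
    \sum_a A i a (cfun c q) * pd a (fun x => u (cinv c x)) (cfun c q) = D i u q.
  move=> cq; rewrite (derE (dD i) u cc cq (fun a => ny q a cq)).
  by apply: eq_bigr => a _; rewrite mulrC dfunE /A cfunK.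
have [|||W [phi [oW [W0 WU] sphi [phi0 dphi] hphi]]] :=
    @potential R m k hk U A g oU U0 (fun l b => sub _) (fun l => sub _).
- by move=> _ [q [cq Nq] <-] l j; rewrite /A cfunK //; case: (hN q Nq).
- by move=> _ [q [cq Nq] <-] i l b; rewrite !dE //; case: (hN q Nq).
- by move=> _ [q [cq Nq] <-] i l; rewrite !dE //; case: (hN q Nq).
have sP : smooth_near p (fun q => phi (cfun c q)).
  exists c; split => //; exists W; split => //; first by rewrite c0.
  move=> r; apply: (@Ck_ext _ _ _ _ phi) => // x Wx.
  by have [q [cq _] <-] := WU x Wx; rewrite cfunK.
have [Phi hPhi] := sf_extend sP; exists Phi.
have dPhi q a : cdom c q -> W (cfun c q) -> (\forall q' \near q, Phi q' = phi (cfun c q')) ->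
    dfun c Phi q 0 a = pd a phi (cfun c q).
  move=> cq Wq nq; rewrite (dfun_germ cq nq) dfunE; apply: near_eq_derive.
  apply: near_open oW Wq _ => x Wx.
  by have [q' [cq' _] <-] := WU x Wx; rewrite cfunK.
split=> [|a ka|].
- by rewrite (nbhs_singleton hPhi) c0.
- by rewrite dPhi ?c0 // dphi.
have nW : \forall q \near p, cdom c q /\ W (cfun c q).
  by apply: cpreimage_nbhs => //; rewrite c0; exact: open_nbhs_nbhs.
near=> q => i; have [cq Wq] : cdom c q /\ W (cfun c q) by near: q.
have nq : \forall q' \near q, Phi q' = phi (cfun c q') by near: q; exact: nbhs_interior hPhi.
rewrite (derE (dD i) Phi cc cq (fun a => ny q a cq)).
rewrite -[RHS]/(G i q) -(cfunK cq) -/(g i _) -(hphi _ Wq i) cfunK //.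
by apply: eq_bigr => a _; rewrite dPhi // mulrC /A cfunK.
Unshelve. all: by end_near. Qed.

Lemma local_inverse p u : u p != 0 -> exists e : V, \forall q \near p, e q * u q = 1.
Proof.
move=> u0; have [c ac cp] := atlas_cover p; have cc := atlas_coords ac.
have sN : smooth_near p (fun q => (u q)^-1).
  have : nbhs p [set q | u q != 0] := sf_neq0_near u0.
  rewrite nbhsE /= => -[N [oN Np] hN].
  exists c; split => //; exists (cfun c @` (cdom c `&` N)).
  split; [exact: cimg_openI|by exists p|].
  move=> r; apply: Ck_inv; first exact: cimg_openI.
    by move=> _ [q [cq Nq] <-]; rewrite cfunK //; exact: hN.
  by apply: Ck_sub (sf_chart u cc r) => _ [q [cq _] <-]; exists q.
have [e he] := sf_extend sN; exists e.
have nu := sf_neq0_near u0; near=> q.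
have -> : e q = (u q)^-1 by near: q.
by rewrite mulVf //; near: q.
Unshelve. all: by end_near. Qed.

Section Straighten.
Variables (k : nat) (C : ('I_k -> V) -> V).
Hypothesis mC : mderivation C.
Hypothesis k0 : (0 < k)%N.
Hypothesis plC : forall q, pluecker (fun x => C x q).

(** Expanding [f0] over coordinates centred at [p], some [k] of these have a non-zero value under
    [C], and a permutation brings them to the front. *)
Lemma independent_coords p f0 : C f0 p != 0 -> exists c (hk : (k <= m)%N) (y : 'I_m -> V),
  [/\ coords c, cdom c p, cfun c p = 0, forall q a, cdom c q -> cfun c q 0 a = y a q &
    C (fun j => y (widen_ord hk j)) p != 0].
Proof.
move=> Cf0; have [c ac cp] := atlas_cover p; have cc := atlas_coords ac.
have [x hx] := centered_coords cc cp.
have x0 a : x a p = 0 by rewrite (nbhs_singleton (hx a)) subrr.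
have dx a : dfun c (x a) p = delta_mx 0 a.
  rewrite (dfun_germ cp (hx a)) -(dfun_coord a cp); apply/rowP => i; rewrite !dfunE.
  rewrite /pd deriveB; [|apply: diff_derivable|exact: derivable_cst].
    by rewrite derive_cst subr0.
  exact: (@smooth_near_diff _ _ _ c (fun q => cfun c q 0 a) p cc cp (coord_smooth_near a cc cp)).
have sp : spanning (fun v : V => (exists a, v = x a) \/ dfun c v p = 0).
  move=> l ll h v.
  have lD u t : l (u + t) = l u + l t by have := ll 1 u t; rewrite !scale1r mul1r.
  have l0 : l 0 = 0 by have := lD 0 0; rewrite addr0 => e; lra.
  have lZ t u : l (t *: u) = t * l u by have := ll t u 0; rewrite !addr0 l0 addr0.
  pose s := \sum_a (dfun c v p 0 a) *: x a.
  have ds : dfun c s p = dfun c v p.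
    rewrite dfun_sum // [RHS]row_sum_delta; apply: eq_bigr => a _.
    by rewrite -csf_scale dfunZ // dx.
  rewrite -(subrK s v) lD (h (v - s)) ?add0r; last first.
    by right; rewrite -scaleN1r dfunD // -csf_scale dfunZ // ds scaleN1r subrr.
  rewrite (big_morph l lD l0) big1 // => a _; rewrite lZ (h (x a)) ?mulr0 //.
  by left; exists a.
have [phi Cphi] : exists phi : 'I_k -> 'I_m, C (fun j => x (phi j)) p != 0.
  apply: contrapT => nphi; move: Cf0; rewrite (_ : C f0 p = 0) ?eqxx //.
  apply: (@multilinear_expand _ _ _ (fun y => C y p) _ pred0 f0 _ sp) => [i _ z t u v|z _ hz].
    exact: (md_form_multilinear mC).
  have {}hz j : (exists a, z j = x a) \/ dfun c (z j) p = 0 by exact: hz.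
  have [[j dz]|nz] := pselect (exists j, dfun c (z j) p = 0).
    rewrite -(upd_id z j) (der_dfun (md_der mC z j) (v := 0) cc cp) ?(der0 (md_der mC z j)) //.
    by rewrite dz dfun_cst.
  have hF j : exists a, z j = x a by case: (hz j) => // dj; case: nz; exists j.
  apply/eqP; apply: contrapT => /negP nC; apply: nphi.
  exists (fun j => projT1 (cid (hF j))); move: nC; congr (C _ p != 0).
  by apply/funext => j; exact: (projT2 (cid (hF j))).
have iphi : injective phi.
  move=> i j e; apply/eqP; apply: contrapT => /negP ij; move: Cphi.
  by rewrite (form_rep (md_form_skew mC p) ij) ?eqxx // e.
have hk : (k <= m)%N by have := leq_card phi iphi; rewrite !card_ord.
have [s hs] := extend_injection hk iphi.
have [|c' [cc' c'p _ hc']] := @chart_of _ _ _ c p setT (fun a => x (s a)) cc cp (filterT).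
  rewrite (_ : \matrix_(a, i) _ = perm_mx s) ?det_perm ?signr_eq0 //.
  apply/matrixP => a i; rewrite mxE dx !mxE eqxx /=; by rewrite eq_sym.
exists c', hk, (fun a => x (s a)); split => //.
- by apply/rowP => a; rewrite hc' x0 mxE.
- by move: Cphi; congr (C _ p != 0); apply/funext => j; rewrite hs.
Qed.

Variable p : M.
Hypothesis jacC : \forall q \near p, forall x i g,
  C (upd x i (C g)) q = \sum_s C (upd g s (C (upd x i (g s)))) q.

(** The Jacobi identity reduces the commutator of two Hamiltonian fields to the value of [C] at [f]
    with [u] in slot [j] and [C f] in slot [i]; exchanging with [f] expresses it through the fields
    themselves. Thus the fields divided by [C f] commute. *)
Lemma hamiltonian_commutator q f i j u : i != j ->
  (forall x i g, C (upd x i (C g)) q = \sum_s C (upd g s (C (upd x i (g s)))) q) ->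
  C f q * (C (upd f i (C (upd f j u))) q - C (upd f j (C (upd f i u))) q) =
  C (upd f j u) q * C (upd f i (C f)) q - C (upd f i u) q * C (upd f j (C f)) q.
Proof.
move=> ij hj; have sk := md_form_skew mC q.
have fi l : C (upd f i (f l)) = if l == i then C f else 0.
  case: eqVneq => [->|li]; first by rewrite upd_id.
  by apply: sfext => z; rewrite (form_rep (md_form_skew mC z) li) // upd_same upd_other.
have z0 x l : C (upd x l 0) = 0 by exact: (der0 (md_der mC x l)).
have -> : C (upd f i (C (upd f j u))) q = C (upd f j (C (upd f i u))) q +
    C (upd (upd f j u) i (C f)) q.
  rewrite hj (bigD1 j) //= (bigD1 i) //= big1 ?addr0 => [|l /andP[lj li]].
    by rewrite upd_same upd_idem upd_other // fi eqxx.
  by rewrite upd_other // fi (negPf li) z0.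
rewrite [X in X - _]addrC addrK mulrC.
have -> := plC q (upd (upd f j u) i (C f)) i f.
rewrite (bigD1 i) //= (bigD1 j) 1?eq_sym //= big1 ?addr0 => [|l /andP[li lj]].
  rewrite !upd_same !upd_idem.
  rewrite (_ : upd (upd f j u) i (f i) = upd f j u); last first.
    by rewrite -[RHS](upd_id _ i) upd_other.
  have ji : j != i by rewrite eq_sym.
  by have := form_swap sk f u (f j) ji; rewrite upd_id => ->; rewrite mulNr.
rewrite upd_same upd_idem (form_rep sk (x := upd (upd f j u) i (f l)) li) ?mul0r //.
by rewrite upd_same !upd_other.
Qed.

(** The fields [D i] commute and are dual to the first coordinates. Coordinates of index at least
    [k] are corrected by potentials so as to be constant along them, and the first coordinate is
    rescaled so that [C] takes the value 1. *)
Lemma normal_form f0 (O : set M) : C f0 p != 0 -> nbhs p O ->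
  exists c (hk : (k <= m)%N) (y : 'I_m -> V),
  [/\ coords c, cdom c p, cdom c `<=` O, forall q a, cdom c q -> cfun c q 0 a = y a q &
   forall q, cdom c q -> C (fun j => y (widen_ord hk j)) q = 1 /\
     forall a : 'I_m, (k <= a)%N -> forall i, C (upd (fun j => y (widen_ord hk j)) i (y a)) q = 0].
Proof.
move=> Cf0 nO; have [c [hk [y0 [cc cp c0 hy0 Cy]]]] := independent_coords Cf0.
pose w := widen_ord hk; pose f j := y0 (w j); pose h := C f.
have [e he] := local_inverse Cy; rewrite -/f -/h in he.
pose D i u := e * C (upd f i u).
have dD i : derivation (D i).
  have dX := md_der mC f i; split=> [t u v|a b|u q u0].
  - by rewrite /D (der_lin dX) mulrDr -!csf_scale mulrCA.
  - by rewrite /D (der_leib dX) mulrDr; congr (_ + _); rewrite mulrCA.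
  - by rewrite /D sfM (der_loc dX u0) mulr0.
have sk q := md_form_skew mC q.
have Df q i j : e q * h q = 1 -> D i (f j) q = (i == j)%:R.
  move=> eh; rewrite /D sfM; case: eqVneq => [->|ij]; first by rewrite upd_id.
  by rewrite (form_rep (sk q) ij) ?mulr0 // upd_same upd_other // eq_sym.
have comm : \forall q \near p, forall i j u, D i (D j u) q = D j (D i u) q.
  have n1 : \forall q \near p, \forall q' \near q, e q' * h q' = 1 := nbhs_interior he.
  near=> q => i j u; have [->//|ij] := eqVneq i j.
  have hq : \forall q' \near q, e q' * h q' = 1 by near: q.
  have eh := nbhs_singleton hq.
  have Xe l : C (upd f l e) q = - (e q) ^+ 2 * C (upd f l h) q.
    have dX := md_der mC f l.
    have := der_germ dX (u := e * h) (v := 1) hq.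
    rewrite (der1 dX) (der_leib dX) sf0 sfD !sfM => E0.
    have : e q * (e q * C (upd f l h) q + h q * C (upd f l e) q) = 0 by rewrite E0 mulr0.
    rewrite mulrDr mulrA -expr2 [e q * (h q * _)]mulrA eh mul1r addrC => /eqP.
    by rewrite addr_eq0 mulNr => /eqP.
  have DD l l' : D l (D l' u) q = e q * (e q * C (upd f l (C (upd f l' u))) q +
      C (upd f l' u) q * (- (e q) ^+ 2 * C (upd f l h) q)).
    by rewrite {1}/D sfM (der_leib (md_der mC f l)) sfD !sfM Xe.
  rewrite !DD; have hj : forall x i g, C (upd x i (C g)) q =
    \sum_s C (upd g s (C (upd x i (g s)))) q by near: q.
  have := hamiltonian_commutator f u ij hj; rewrite -/h.
  move: (C (upd f i (C (upd f j u))) q) (C (upd f j (C (upd f i u))) q) => A1 A2.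
  move: (C (upd f i u) q) (C (upd f j u) q) (C (upd f i h) q) (C (upd f j h) q) => B1 B2 B3 B4.
  move=> E1; have E2 : A1 - A2 = e q * (B2 * B3 - B1 * B4).
    by rewrite -E1 mulrA eh mul1r.
  have -> : A1 = A2 + e q * (B2 * B3 - B1 * B4) by rewrite -E2 addrC subrK.
  ring.
have pot1 (a : 'I_m) : exists Phi : V, [/\ Phi p = 0,
    forall b : 'I_m, (k <= b)%N -> dfun c Phi p 0 b = 0 &
    \forall q \near p, forall i, D i Phi q = D i (y0 a) q].
  apply: (manifold_potential (hk := hk) (y := y0) (G := fun i => D i (y0 a))) => //.
  near=> q; have eh : e q * h q = 1 by near: q.
  have cm : forall i j u, D i (D j u) q = D j (D i u) q by near: q.
  by split=> [i j|i l b|i l]; [exact: Df|exact: cm|exact: cm].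
have [Phi hPhi] := boolp.choice pot1.
pose i0 : 'I_k := Ordinal k0; have m1 : (1 <= m)%N by exact: leq_trans k0 hk.
have w0 j : widen_ord m1 j = w i0 by apply: val_inj; rewrite /= (ord1 j).
(* A potential for the single field [D i0], for which compatibility is automatic; [D i0 Psi = e]
   says that [C] with [Psi] in slot [i0] is 1. *)
have [Psi [Psi0 dPsi DPsi]] : exists Psi : V, [/\ Psi p = 0,
    forall b : 'I_m, (1 <= b)%N -> dfun c Psi p 0 b = 0 &
    \forall q \near p, forall i : 'I_1, D i0 Psi q = e q].
  apply: (manifold_potential (hk := m1) (y := y0) (D := fun=> D i0) (G := fun=> e)) => //.
  near=> q; have eh : e q * h q = 1 by near: q.
  split=> [i j|i l b|i l] //; by rewrite w0 Df // !ord1 eqxx.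
(* The Jacobian at [p] is lower triangular: [Psi] depends to first order on coordinate 0 only, and
   the corrections [Phi a] on the first [k] only. *)
pose y (a : 'I_m) : V := if a == 0%N :> nat then Psi else if (a < k)%N then y0 a else y0 a - Phi a.
have ny a : \forall q \near p, y0 a q = cfun c q 0 a.
  have : \forall q \near p, cdom c q by apply: open_nbhs_nbhs; split => //; exact: cdom_open.
  by apply: filterS => q cq; rewrite hy0.
have dy0 a : dfun c (y0 a) p = delta_mx 0 a by rewrite (dfun_germ cp (ny a)) dfun_coord.
have dB a b : dfun c (y0 a - Phi a) p 0 b = (a == b)%:R - dfun c (Phi a) p 0 b.
  rewrite -scaleN1r dfunD // -csf_scale dfunZ // scaleN1r mxE [X in _ + X]mxE dy0.
  by rewrite mxE eqxx /= eq_sym.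
have J : \det (\matrix_(a, i) dfun c (y a) p 0 i) != 0.
  rewrite det_trig; last first.
    apply/is_trig_mxP => a b ab; rewrite mxE /y; case: ifP => [/eqP a0|_].
      by rewrite dPsi // -a0.
    case: ifP => ak; first by rewrite dy0 mxE eqxx /= -(inj_eq val_inj) /= gtn_eqF.
    rewrite dB; case: (hPhi a) => _ -> //; last first.
      by apply: leq_trans (ltnW ab); rewrite leqNgt ak.
    by rewrite subr0 -(inj_eq val_inj) /= ltn_eqF.
  apply/prodf_neq0 => a _; rewrite mxE /y; case: ifP => [/eqP a0|_].
    have eh := nbhs_singleton he.
    have := nbhs_singleton DPsi ord0; rewrite (derE (dD i0) Psi cc cp ny).
    rewrite (bigD1 (w i0)) // big1 ?Monoid.mulm1 => [|b /andP[_ bw]]; last first.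
      rewrite dPsi ?mul0r // lt0n; apply: contra bw => /eqP b0; apply/eqP/val_inj.
      by rewrite /= b0.
    have -> : D i0 (y0 (w i0)) p = 1 by have := Df p i0 i0 eh; rewrite eqxx.
    rewrite mulr1 (_ : w i0 = a) => [->|]; last exact: val_inj.
    by case: (mul1_neq0 eh).
  case: ifP => ak; first by rewrite dy0 mxE !eqxx oner_eq0.
  by rewrite dB eqxx; case: (hPhi a) => _ -> //; rewrite ?subr0 ?oner_eq0 // leqNgt ak.
have nN : \forall q \near p, [/\ O q, e q * h q = 1, forall i : 'I_1, D i0 Psi q = e q &
    forall a i, D i (Phi a) q = D i (y0 a) q].
  have nP : \forall q \near p, forall a i, D i (Phi a) q = D i (y0 a) q.
    by apply: filter_forall => a; case: (hPhi a).
  by near=> q; split; near: q.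
have [c' [cc' c'p c'O hy']] := chart_of cc cp nN J.
exists c', hk, y; split => //.
- by move=> q /c'O[[]].
move=> q /c'O[[_ eh DP DPhi] _].
have [e0 h0] := mul1_neq0 eh.
have yE : (fun j => y (w j)) = upd f i0 Psi.
  apply/funext => j; rewrite updE /y /= -(inj_eq val_inj) /=.
  by case: ifP => // _; rewrite ltn_ord.
rewrite -/w yE; split=> [|a ka i].
  have := DP ord0; rewrite /D sfM => E1; apply: (mulfI e0); by rewrite E1 mulr1.
apply: (pluecker_kill (plC q) (F := f) (i := i) h0) => j; rewrite upd_same.
apply: (mulfI e0); rewrite mulr0 -sfM -/(D j _) /y.
have a0 : (a == 0%N :> nat) = false by rewrite gtn_eqF // (leq_trans k0 ka).
have ak : (a < k)%N = false by rewrite ltnNge ka.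
by rewrite a0 ak (derB (dD j)) sfB DPhi subrr.
Unshelve. all: by end_near. Qed.

End Straighten.

End NormalForm.

(** * The two tensors of a bracket *)

Section Cons.
Variables (T : Type) (n : nat).
Implicit Types (f : 'I_n -> T) (h u : T).

Lemma fcons0 h f : fcons h f ord0 = h.
Proof. by rewrite /fcons unlift_none. Qed.

Lemma fcons_lift h f i : fcons h f (lift ord0 i) = f i.
Proof. by rewrite /fcons liftK. Qed.

Lemma fcons_upd h f i u : fcons h (upd f i u) = upd (fcons h f) (lift ord0 i) u.
Proof.
apply/funext => j; rewrite updE; case: (unliftP ord0 j) => [l ->|->].
  by rewrite !fcons_lift updE (inj_eq lift_inj).
by rewrite !fcons0 (negPf (neq_lift _ _)).
Qed.

End Cons.

Section Decomposition.
Context (R : realType) (m : nat) (M : manifold R m) (n : nat).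
Local Notation V := (smfun M).
Implicit Types (x y f g : 'I_n.+1 -> V) (u v w : V) (p q : M).
Variable B : ('I_n.+1 -> V) -> V.
Hypothesis n2 : (2 < n.+1)%N.
Hypothesis Blin : forall x i (t : R) u v,
  B (upd x i (t *: u + v)) = t *: B (upd x i u) + B (upd x i v).
Hypothesis Bskew : forall (s : 'S_n.+1) x, B (fun j => x (s j)) = (-1) ^+ s *: B x.
Hypothesis Bloc : forall x i p, (\forall q \near p, x i q = 0) -> B x p = 0.
Hypothesis Bjac : forall x i g l s, l != i -> x l = g s -> jac B x i g = 0.

Let Bfirst := Bfirst n2 Blin Bskew Bloc Bjac.
Let Bpl := bracket_pluecker n2 Blin Bskew Bloc Bjac.
Let Bjacobi := bracket_jacobi n2 Blin Bskew Bloc Bjac.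
Let ml q : multilinear_form (bform B q) := bform_multilinear Blin q.
Let sk q : skew_form (bform B q) := bform_skew Bskew q.

Definition Gam (f : 'I_n -> V) : V := B (fcons 1 f).
(** The subtracted sum is [s (Gamma)], the signs being hidden in the position of the entry 1, see
    [B_front]. *)
Definition Del x : V := B x - \sum_i x i * B (upd x i 1).

Lemma Brep1 x i j : i != j -> x j = 1 -> B (upd x i 1) = 0.
Proof. by move=> ij xj; apply: (Brep Bskew ij); rewrite upd_same upd_other // eq_sym. Qed.

Lemma upd_perm (T : Type) k (x : 'I_k -> T) (s : 'S_k) j (u : T) :
  upd (fun l => x (s l)) j u = fun l => upd x (s j) u (s l).
Proof. by apply/funext => l; rewrite !updE (inj_eq perm_inj). Qed.

Lemma Gam_md : mderivation Gam.
Proof.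
split=> [f i t u v|s f|f i a b|f i p f0].
- by rewrite /Gam !fcons_upd Blin.
- have e : lift_perm ord0 ord0 s = s :> bool by rewrite odd_lift_perm.
  rewrite /Gam -[in RHS]e -Bskew.
  congr B; apply/funext => j; case: (unliftP ord0 j) => [l ->|->].
    by rewrite lift_perm_lift !fcons_lift.
  by rewrite lift_perm_id !fcons0.
- rewrite /Gam !fcons_upd Bfirst (@Brep1 _ _ ord0) ?mulr0 ?subr0 ?fcons0 //.
- by apply: (Bloc (i := lift ord0 i)); rewrite fcons_lift.
Qed.

Lemma B_front x i : B (upd x i 1) = (-1) ^+ i *: Gam (fun j => x (lift i j)).
Proof.
have -> : Gam (fun j => x (lift i j)) = (-1) ^+ i *: B (upd x i 1).
  rewrite /Gam -[in RHS]signr_odd.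
  have -> : odd i = lift_perm ord0 i (1%g : 'S_n) by rewrite odd_lift_perm odd_perm1 addbF.
  rewrite -Bskew; congr B; apply/funext => j; case: (unliftP ord0 j) => [l ->|->].
    by rewrite lift_perm_lift perm1 fcons_lift upd_other // eq_sym neq_lift.
  by rewrite lift_perm_id fcons0 upd_same.
by rewrite scalerA -expr2 sqrr_sign scale1r.
Qed.

Lemma B_decomposition x : B x = Del x + \sum_i x i * ((-1) ^+ i *: Gam (fun j => x (lift i j))).
Proof.
rewrite [X in _ = _ + X](eq_bigr (fun i => x i * B (upd x i 1))) => [|i _].
  by rewrite /Del addrNK.
by rewrite B_front.
Qed.

(** The product rule of [B] has the extra term [- a * b * B (upd x i 1)]; the same terms in the
    subtracted sum compensate it. *)
Lemma Del_md : mderivation Del.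
Proof.
split=> [x i t u v|s x|x i a b|x i p x0].
- rewrite /Del Blin scalerBr scaler_sumr.
  rewrite (eq_bigr (fun j => t *: (upd x i u j * B (upd (upd x i u) j 1)) +
     upd x i v j * B (upd (upd x i v) j 1))) => [|j _].
    by rewrite big_split opprD addrACA.
  have [->|ji] := eqVneq j i.
    by rewrite !upd_same !upd_idem mulrDl -!csf_scale mulrA.
  rewrite !upd_other // !(@updC _ _ x i j) 1?eq_sym // Blin mulrDr.
  by rewrite -!csf_scale mulrCA.
- rewrite /Del Bskew scalerBr scaler_sumr; congr (_ - _).
  rewrite [RHS](reindex_inj (@perm_inj _ s)) /=; apply: eq_bigr => j _.
  by rewrite upd_perm Bskew -!csf_scale mulrCA.
- rewrite /Del Bfirst !mulrBr.
  rewrite (bigD1 i) //= [in X in _ = (_ - a * X) + _](bigD1 i) //=.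
  rewrite [in X in _ = _ + (_ - b * X)](bigD1 i) //= !upd_same !upd_idem.
  rewrite (eq_bigr (fun j => a * (upd x i b j * B (upd (upd x i b) j 1)) +
     b * (upd x i a j * B (upd (upd x i a) j 1)))) => [|j ji].
    by rewrite big_split /= -!mulr_sumr; ring.
  rewrite !upd_other // !(@updC _ _ x i j) 1?eq_sym // Bfirst.
  by rewrite (@Brep1 _ _ j) ?upd_same 1?eq_sym //; ring.
- rewrite /Del sfB (Bloc (i := i)) // sf_sum big1 ?subr0 // => j _; rewrite sfM.
  have [->|ji] := eqVneq j i; first by rewrite (nbhs_singleton x0) mul0r.
  by rewrite (Bloc (i := i)) ?mulr0 // upd_other // eq_sym.
Qed.

Definition centered q x : 'I_n.+1 -> V := fun j => x j - csf M (x j q).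

Lemma centered_upd q x i u : centered q (upd x i u) = upd (centered q x) i (u - csf M (u q)).
Proof. by apply/funext => j; rewrite /centered !updE; case: ifP. Qed.

Lemma dfun_centered c u p : coords c -> cdom c p ->
  dfun c (u - csf M (u p)) p = dfun c u p.
Proof.
move=> cc cp; rewrite -scaleN1r dfunD // -csf_scale dfunZ // dfun_cst scaler0 addr0 //.
Qed.

(** [Del] only sees differentials, so constants may be subtracted; after centring at [q] the terms
    with an entry 1 vanish. Relations of [B] at [q] thus pass to [Del]. *)
Lemma Del_centered q x : Del x q = B (centered q x) q.
Proof.
have [cc cq] := chart_atP q.
rewrite (md_dfun Del_md (g := centered q x) cc cq) => [|j]; last by rewrite dfun_centered.
rewrite /Del sfB sf_sum big1 ?subr0 // => j _.
by rewrite sfM /centered sfB csfE subrr mul0r.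
Qed.

Lemma Del_pl q : pluecker (fun x => Del x q).
Proof.
move=> f i g; rewrite !Del_centered (Bpl q (centered q f) i (centered q g)).
by apply: eq_bigr => j _; rewrite !Del_centered !centered_upd.
Qed.

(** In the exchange relation of [B] for two families starting with 1, the term exchanging into slot
    0 repeats the entry 1. *)
Lemma Gam_pl q : pluecker (fun x : 'I_n -> V => Gam x q).
Proof.
move=> f i g; rewrite /Gam (Bpl q (fcons 1 f) (lift ord0 i) (fcons 1 g)) big_ord_recl.
rewrite fcons0 /bform (@Brep1 _ _ ord0) ?fcons0 // 1?eq_sym ?neq_lift //.
rewrite sf0 mul0r add0r; apply: eq_bigr => j _.
by rewrite !fcons_lift -!fcons_upd.
Qed.

Lemma Gam_jacobi (x : 'I_n -> V) i (g : 'I_n -> V) :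
  Gam (upd x i (Gam g)) = \sum_s Gam (upd g s (Gam (upd x i (g s)))).
Proof.
have := Bjacobi (fcons 1 x) (lift ord0 i) (fcons 1 g) => /eqP; rewrite subr_eq0 => /eqP.
rewrite big_ord_recl fcons0 (@Brep1 _ _ ord0) ?fcons0 // 1?eq_sym ?neq_lift //.
rewrite (B0 Blin) add0r /Gam fcons_upd => ->; apply: eq_bigr => j _.
by rewrite fcons_lift !fcons_upd.
Qed.

Lemma Del_jacobi_near (U : set M) : open U -> (forall q, U q -> forall f : 'I_n -> V, Gam f q = 0) ->
  forall q, U q -> forall x i g,
  Del (upd x i (Del g)) q = \sum_s Del (upd g s (Del (upd x i (g s)))) q.
Proof.
move=> oU G0; have DB q x : U q -> Del x q = B x q.
  move=> Uq; rewrite B_decomposition sfD sf_sum big1 ?addr0 // => j _.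
  by rewrite sfM sfZ G0 // !mulr0.
have nDB q x : U q -> \forall q' \near q, Del x q' = B x q'.
  by move=> Uq; apply: filterS (open_nbhs_nbhs (conj oU Uq)) => q'; exact: DB.
move=> q Uq x i g; have := congr1 (fun h : V => h q) (Bjacobi x i g).
rewrite /jac sfB sf_sum sf0 => /eqP; rewrite subr_eq0 => /eqP E.
rewrite DB // (Bgerm Blin Bloc x i (nDB q g Uq)) E; apply: eq_bigr => s _.
by rewrite DB // (Bgerm Blin Bloc g s (nDB q _ Uq)).
Qed.

(** * Straightening both tensors at once *)

Section Transverse.
Variables (c : chart R m M) (hk : (n <= m)%N) (y : 'I_m -> V).
Hypothesis cc : coords c.
Hypothesis hy : forall q a, cdom c q -> cfun c q 0 a = y a q.
Hypothesis hG : forall q, cdom c q -> Gam (fun j => y (widen_ord hk j)) q = 1 /\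
  forall a : 'I_m, (n <= a)%N -> forall i, Gam (upd (fun j => y (widen_ord hk j)) i (y a)) q = 0.
Let x (j : 'I_n) : V := y (widen_ord hk j).
(** The last entry is a placeholder, replaced by the argument of [Z]. *)
Let t : 'I_n.+1 -> V := fun j => oapp x 0 (unlift ord_max j).
Let dX i := md_der Gam_md x i.
Let X i u : V := Gam (upd x i u).
Let Z u : V := Del (upd t ord_max u).
Let dZ : derivation Z := md_der Del_md t ord_max.

Let t_lift j : t (lift ord_max j) = x j.
Proof. by rewrite /t liftK. Qed.

Let tmax u j : upd t ord_max u (lift ord_max j) = x j.
Proof. by rewrite upd_other ?t_lift // eq_sym neq_lift. Qed.

Let near_cdom q (P : M -> Prop) : cdom c q -> (forall q', cdom c q' -> P q') ->
  \forall q' \near q, P q'.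
Proof.
by move=> cq h; apply: filterS (open_nbhs_nbhs (conj (@cdom_open _ _ _ c) cq)).
Qed.

Let ny q a : cdom c q -> \forall q' \near q, y a q' = cfun c q' 0 a.
Proof. by move=> cq; apply: near_cdom cq _ => q' cq'; rewrite hy. Qed.

Lemma X_coord q i j : cdom c q -> X i (x j) q = (i == j)%:R.
Proof.
move=> cq; case: eqVneq => [->|ij]; first by rewrite /X upd_id; case: (hG cq).
by rewrite /X (form_rep (md_form_skew Gam_md q) ij) // upd_same upd_other // eq_sym.
Qed.

Lemma Z_coord j : Z (x j) = 0.
Proof.
apply: sfext => q; apply: (form_rep (md_form_skew Del_md q) (i := ord_max) (j := lift ord_max j)).
  exact: neq_lift.
by rewrite upd_same tmax.
Qed.

Lemma X_comm q i j u : cdom c q -> X i (X j u) q = X j (X i u) q.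
Proof.
move=> cq; have [->//|ij] := eqVneq i j.
have jq (z : 'I_n -> V) l (g : 'I_n -> V) :
  Gam (upd z l (Gam g)) q = \sum_s Gam (upd g s (Gam (upd z l (g s)))) q.
  by rewrite Gam_jacobi sf_sum.
have := hamiltonian_commutator Gam_md Gam_pl x u ij jq.
have Xh l : Gam (upd x l (Gam x)) q = 0.
  rewrite (der_germ (dX l) (u := Gam x) (v := 1)) ?(der1 (dX l)) //.
  by apply: near_cdom cq _ => q' cq'; case: (hG cq').
rewrite !Xh !mulr0 subrr; case: (hG cq) => -> _; rewrite mul1r => /eqP.
by rewrite subr_eq0 => /eqP.
Qed.

Lemma front_max u : B (upd (upd t ord_max u) ord_max 1) = (-1) ^+ n *: Gam x.
Proof.
by rewrite B_front; congr (_ *: Gam _); apply/funext => j; rewrite tmax.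
Qed.

Lemma front_other j u : B (upd (upd t ord_max u) (lift ord_max j) 1) = - ((-1) ^+ n *: X j u).
Proof.
rewrite Bswap ?neq_lift //; congr (- _).
rewrite updC ?neq_lift // B_front; congr (_ *: Gam _).
by apply/funext => l; rewrite !updE (inj_eq lift_inj) t_lift.
Qed.

Lemma Z_expand u : B (upd t ord_max u) = Z u +
  (\sum_j x j * - ((-1) ^+ n *: X j u) + u * ((-1) ^+ n *: Gam x)).
Proof.
have wl j : widen_ord (leqnSn n) j = lift ord_max j.
  by apply: val_inj; rewrite /= /bump leqNgt ltn_ord.
rewrite /Z /Del big_ord_recr upd_same front_max.
rewrite (eq_bigr (fun j => x j * - ((-1) ^+ n *: X j u))) ?addrNK // => j _.
by rewrite wl tmax front_other.
Qed.

(** Jacobi identity for the groups [(1, x)] and [(x, u)]: the functions [X i (x l)] are constant, so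
    few terms remain. Writing [B] as [Z] plus the terms of [Z_expand], the latter agree on both
    sides because the [X j] commute. *)
Lemma XZ_comm q i u : cdom c q -> X i (Z u) q = Z (X i u) q.
Proof.
move=> cq; pose g := upd t ord_max u.
have XB v : X i v = B (upd (fcons 1 x) (lift ord0 i) v) by rewrite /X /Gam fcons_upd.
have E := congr1 (fun h : V => h q) (Bjacobi (fcons 1 x) (lift ord0 i) g).
move: E; rewrite /jac sfB sf0 sf_sum => /eqP; rewrite subr_eq0 => /eqP.
rewrite -XB (bigD1 ord_max) // (bigD1 (lift ord_max i)) 1?eq_sym ?neq_lift // big1; last first.
  move=> s /andP[/andP[_ sm] si]; case: (unliftP ord_max s) sm si => [l -> _ li|-> /eqP //].
  have e0 : \forall q' \near q, X i (x l) q' = (0 : V) q'.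
    apply: near_cdom cq _ => q' cq'; rewrite X_coord // sf0.
    have il : i != l by apply: contra li => /eqP ->.
    by rewrite (negPf il).
  by rewrite -XB /g tmax (Bgerm Blin Bloc _ _ e0) (B0 Blin).
rewrite !Monoid.mulm1 -!XB /g upd_same upd_idem tmax.
have e1 : \forall q' \near q, X i (x i) q' = (1 : V) q'.
  by apply: near_cdom cq _ => q' cq'; rewrite X_coord // eqxx.
rewrite (Bgerm Blin Bloc _ _ e1).
have dXi : derivation (X i) := dX i.
have G1 : Gam x q = 1 by case: (hG cq).
have XG : X i (Gam x) q = 0.
  rewrite (der_germ dXi (v := 1)) ?(der1 dXi) //.
  by apply: near_cdom cq _ => q' cq'; case: (hG cq').
have lhs : X i (B (upd t ord_max u)) q = X i (Z u) q +
    (\sum_j (x j q * - ((-1) ^+ n * X i (X j u) q)) - (-1) ^+ n * X i u q +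
     (-1) ^+ n * X i u q).
  rewrite Z_expand (derD dXi) sfD; congr (_ + _); rewrite (derD dXi) sfD; congr (_ + _).
    rewrite (der_sum dXi) sf_sum.
    rewrite (eq_bigr (fun j => x j q * - ((-1) ^+ n * X i (X j u) q) +
      - ((-1) ^+ n * X j u q) * (i == j)%:R)) => [|j _].
      rewrite big_split /=; congr (_ + _).
      rewrite (bigD1 i) //= eqxx mulr1 big1 ?addr0 // => j ji.
      by rewrite eq_sym (negPf ji) mulr0.
    rewrite (der_leib dXi) sfD !sfM X_coord // sfN sfZ; congr (_ * _ + _).
    by rewrite -scaleN1r (derZ dXi) (derZ dXi) !sfZ mulN1r.
  by rewrite (der_leib dXi) sfD !sfM (derZ dXi) !sfZ G1 XG ?mulr0 ?mulr1 ?add0r ?addr0.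
have rhs : B (upd t ord_max (X i u)) q = Z (X i u) q +
    (\sum_j (x j q * - ((-1) ^+ n * X j (X i u) q)) + (-1) ^+ n * X i u q).
  rewrite Z_expand sfD; congr (_ + _); rewrite sfD sf_sum; congr (_ + _).
  by rewrite sfM sfZ G1 mulr1 mulrC.
rewrite lhs rhs front_other sfN sfZ.
rewrite (eq_bigr (fun j => x j q * - ((-1) ^+ n * X j (X i u) q))) => [|j _]; last first.
  by rewrite X_comm.
set S := \sum_j _; set a := _ * X i u q => E.
have : X i (Z u) q + (S - a + a) = Z (X i u) q + (S + a) - a by exact: E.
lra.
Qed.

Lemma Gam_centered q : cdom c q -> Gam (fun j => centered q t (lift ord_max j)) q = 1.
Proof.
move=> cq; case: (hG cq) => <- _; apply: (md_dfun Gam_md cc cq) => j.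
by rewrite /centered t_lift dfun_centered.
Qed.

(** Exchange relation of [B] between the centred [x] completed by 1, whose value is plus or minus 1,
    and the centred [g]. It factors [Delta] through [Z] and [Gamma]. *)
Lemma Del_expand q g : cdom c q ->
  (-1) ^+ n * Del g q = \sum_j Z (g j) q * B (upd (centered q g) j 1) q.
Proof.
move=> cq; have := Bpl q (upd (centered q t) ord_max 1) ord_max (centered q g).
rewrite /bform -Del_centered {1}B_front sfZ.
rewrite (_ : (fun j => _) = fun j => centered q t (lift ord_max j)) // Gam_centered // mulr1 => ->.
by apply: eq_bigr => j _; rewrite upd_same upd_idem /Z Del_centered centered_upd.
Qed.

(** In [Del_expand] the term of slot [j] contains [Z u], and every other term contains [Gamma] with
    [u], a kernel vector, among its arguments. *)
Lemma Del_kill q u : cdom c q -> Z u q = 0 -> (forall i, X i u q = 0) ->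
  forall g j, Del (upd g j u) q = 0.
Proof.
move=> cq Zu Xu g j; have s0 : (-1) ^+ n != 0 :> R by rewrite signr_eq0.
apply: (mulfI s0).
rewrite mulr0 Del_expand // big1 // => s _; have [->|sj] := eqVneq s j.
  by rewrite upd_same Zu mul0r.
rewrite (B_front _ s) sfZ; case: (unliftP s j) => [i ji|js]; last by rewrite js eqxx in sj.
rewrite (pluecker_kill (Gam_pl q) (F := x) (i := i)) ?mulr0 //.
  by case: (hG cq) => ->; rewrite oner_eq0.
move=> l; rewrite -ji centered_upd upd_same.
by rewrite (der_dfun (dX l) (v := u) cc cq (dfun_centered u cc cq)) -/(X l u) Xu.
Qed.

Lemma Z_neq0 p g : cdom c p -> Del g p != 0 -> exists a : 'I_m, (n <= a)%N /\ Z (y a) p != 0.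
Proof.
move=> cp Dg; apply: contrapT => na; move: Dg.
have Z0 a : Z (y a) p = 0.
  have [an|an] := ltnP a n.
    by rewrite (_ : y a = x (Ordinal an)) ?Z_coord //; congr y; exact: val_inj.
  by apply/eqP; apply: contrapT => /negP Za; apply: na; exists a.
have Z1 u : Z u p = 0.
  rewrite (derE dZ u cc cp (fun a => ny a cp)) big1 // => a _.
  by rewrite Z0 mulr0.
have s0 : (-1) ^+ n != 0 :> R by rewrite signr_eq0.
rewrite -(inj_eq (mulfI s0)) mulr0 Del_expand // big1 ?eqxx // => j _.
by rewrite Z1 mul0r.
Qed.

(** The fields [X i] together with a multiple of [Z] commute and are dual to [n + 1] coordinates.
    The first [n] coordinates are kept and the new ones stay constant along the [X i], which
    preserves the form of [Gamma]. *)
Lemma transverse_form p g : cdom c p -> Del g p != 0 ->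
  exists c' (h1 : (n.+1 <= m)%N) (y' : 'I_m -> V),
  [/\ coords c', cdom c' p, forall q a, cdom c' q -> cfun c' q 0 a = y' a q,
   forall q, cdom c' q -> Gam (fun j => y' (widen_ord hk j)) q = 1 /\
     forall a : 'I_m, (n <= a)%N -> forall i, Gam (upd (fun j => y' (widen_ord hk j)) i (y' a)) q = 0 &
   forall q, cdom c' q -> Del (fun j => y' (widen_ord h1 j)) q = 1 /\
     forall a : 'I_m, (n.+1 <= a)%N -> forall i, Del (upd (fun j => y' (widen_ord h1 j)) i (y' a)) q = 0].
Proof.
move=> cp Dg; have [a [na Za]] := Z_neq0 cp Dg.
have h1 : (n.+1 <= m)%N by exact: leq_ltn_trans na (ltn_ord a).
(* A coordinate moved by [Z] at [p] is brought to position [n]; the first [n] positions are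
   untouched. *)
pose b0 : 'I_m := Ordinal h1; pose s := tperm a b0.
have sw j : s (widen_ord hk j) = widen_ord hk j.
  rewrite tpermD // -(inj_eq val_inj) /= gtn_eqF //.
  exact: leq_trans (ltn_ord j) na.
have sb0 : s b0 = a by rewrite tpermR.
pose y1 b : V := y (s b) - csf M (y (s b) p).
have dy b : dfun c (y b) p = delta_mx 0 b by rewrite (dfun_germ cp (ny b cp)) dfun_coord.
have [|c1 [cc1 c1p c1c hy1]] := @chart_of _ _ _ c p setT y1 cc cp (filterT).
  rewrite (_ : \matrix_(b, i) _ = perm_mx s) ?det_perm ?signr_eq0 //.
  by apply/matrixP => b i; rewrite mxE dfun_centered // dy !mxE eqxx /= eq_sym.
have c10 : cfun c1 p = 0.
  by apply/rowP => b; rewrite hy1 // mxE /y1 sfB csfE subrr.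
have cd1 q : cdom c1 q -> cdom c q by move=> /c1c[].
have [e he] := local_inverse Za.
pose D (l : 'I_n.+1) u : V := oapp (fun i => X i u) (e * Z u) (unlift ord_max l).
have Dlift i u : D (lift ord_max i) u = X i u by rewrite /D liftK.
have Dmax u : D ord_max u = e * Z u by rewrite /D unlift_none.
have dD l : derivation (D l).
  case: (unliftP ord_max l) => [i ->|->].
    by rewrite (_ : D _ = X i); [exact: dX|apply/funext => u; exact: Dlift].
  rewrite (_ : D _ = fun u => e * Z u); last by apply/funext => u; exact: Dmax.
  split=> [r u v|u v|u q u0].
  - by rewrite (der_lin dZ) mulrDr -!csf_scale mulrCA.
  - by rewrite (der_leib dZ) mulrDr; congr (_ + _); rewrite mulrCA.
  - by rewrite sfM (der_loc dZ u0) mulr0.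
pose w1 := widen_ord h1.
have w1l j : w1 (lift ord_max j) = widen_ord hk j.
  by apply: val_inj; rewrite /= /bump leqNgt ltn_ord.
have w1m : w1 ord_max = b0 by exact: val_inj.
have XC i u b : X i (u - csf M b) = X i u.
  have dXi : derivation (X i) := dX i.
  by rewrite (derB dXi) (der_cst dXi) subr0.
have ZC u b : Z (u - csf M b) = Z u by rewrite (derB dZ) (der_cst dZ) subr0.
have X_a i q : cdom c q -> X i (y a) q = 0 by move=> cq; case: (hG cq) => _; exact.
have Dy l l' q : cdom c q -> e q * Z (y a) q = 1 -> D l (y1 (w1 l')) q = (l == l')%:R.
  move=> cq eq1; case: (unliftP ord_max l) => [i ->|->]; case: (unliftP ord_max l') => [j ->|->].
  - by rewrite Dlift w1l /y1 sw XC X_coord // (inj_eq lift_inj).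
  - by rewrite Dlift w1m /y1 sb0 XC X_a // eq_sym (negPf (neq_lift _ _)).
  - by rewrite Dmax w1l /y1 sw ZC Z_coord mulr0 sf0 (negPf (neq_lift _ _)).
  - by rewrite Dmax w1m /y1 sb0 ZC sfM eq1 eqxx.
have nc : \forall q \near p, cdom c q.
  by apply: open_nbhs_nbhs; split => //; exact: cdom_open.
(* [e] inverts [Z (y a)], and [X i (Z (y a)) = Z (X i (y a)) = 0] as [y a] is in the kernel of
   [Gamma]. *)
have Xe : \forall q \near p, forall i, X i e q = 0.
  have n1 : \forall q \near p, \forall q' \near q, e q' * Z (y a) q' = 1 := nbhs_interior he.
  near=> q => i; have cq : cdom c q by near: q.
  have hq : \forall q' \near q, e q' * Z (y a) q' = 1 by near: q.
  have [_ z0] := mul1_neq0 (nbhs_singleton hq).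
  have := der_germ (dX i) (u := e * Z (y a)) (v := 1) hq.
  rewrite (der1 (dX i)) (der_leib (dX i)) sf0 sfD !sfM XZ_comm //.
  rewrite (der_germ dZ (v := 0)) ?(der0 dZ) ?sf0; last first.
    by apply: near_cdom cq _ => q' cq'; rewrite X_a.
  by rewrite mulr0 add0r => /eqP; rewrite mulf_eq0 (negPf z0) => /eqP.
have comm : \forall q \near p, forall l l' u, D l (D l' u) q = D l' (D l u) q.
  near=> q => l l' u; have cq : cdom c q by near: q.
  have Xeq : forall i, X i e q = 0 by near: q.
  have XD i : X i (e * Z u) q = e q * Z (X i u) q.
    have dXi : derivation (X i) := dX i.
    by rewrite (der_leib dXi) sfD !sfM XZ_comm // Xeq mulr0 addr0.
  case: (unliftP ord_max l) => [i ->|->]; case: (unliftP ord_max l') => [j ->|->] //.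
  - by rewrite !Dlift X_comm.
  - by rewrite !Dlift !Dmax XD sfM.
  - by rewrite !Dlift !Dmax XD sfM.
have pot1 (b : 'I_m) : exists Phi : V, [/\ Phi p = 0,
    forall b' : 'I_m, (n.+1 <= b')%N -> dfun c1 Phi p 0 b' = 0 &
    \forall q \near p, forall l, D l Phi q = D l (y1 b) q].
  apply: (manifold_potential (hk := h1) (y := y1) (G := fun l => D l (y1 b))) => //.
  near=> q; have eh : e q * Z (y a) q = 1 by near: q.
  have cm : forall i j u, D i (D j u) q = D j (D i u) q by near: q.
  have cq : cdom c q by near: q.
  by split=> [i j|i l b'|i l]; [exact: Dy|exact: cm|exact: cm].
have [Phi hPhi] := boolp.choice pot1.
(* Prescribes [X i Psi = 0] and [e * Z Psi = e], that is [Z Psi = 1]; compatibility of these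
   equations is [Xe]. *)
pose G (l : 'I_n.+1) : V := if l == ord_max then e else 0.
have [Psi [_ dPsi DPsi]] : exists Psi : V, [/\ Psi p = 0,
    forall b : 'I_m, (n.+1 <= b)%N -> dfun c1 Psi p 0 b = 0 &
    \forall q \near p, forall l, D l Psi q = G l q].
  apply: (manifold_potential (hk := h1) (y := y1) (G := G)) => //.
  near=> q; have eh : e q * Z (y a) q = 1 by near: q.
  have cm : forall i j u, D i (D j u) q = D j (D i u) q by near: q.
  have cq : cdom c q by near: q.
  have Xeq : forall i, X i e q = 0 by near: q.
  split=> [i j|i l b'|i l]; [exact: Dy|exact: cm|].
  have G0 j : G (lift ord_max j) = 0 by rewrite /G eq_sym (negPf (neq_lift _ _)).
  have Gm : G ord_max = e by rewrite /G eqxx.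
  case: (unliftP ord_max i) => [i' ->|->]; case: (unliftP ord_max l) => [l' ->|->] //.
  - by rewrite !G0 !(der0 (dD _)).
  - by rewrite G0 Gm (der0 (dD _)) Dlift Xeq sf0.
  - by rewrite G0 Gm (der0 (dD _)) Dlift Xeq sf0.
(* Only coordinate [n] and the following ones change; the Jacobian is again lower triangular, with
   entry [e p] at position [n]. *)
pose y2 (b : 'I_m) : V := if (b < n)%N then y b else if b == n :> nat then Psi else y1 b - Phi b.
have dy1 b : dfun c1 (y1 b) p = delta_mx 0 b.
  rewrite -(dfun_coord b c1p) //; apply: dfun_germ => //.
  have : \forall q \near p, cdom c1 q by apply: open_nbhs_nbhs; split => //; exact: cdom_open.
  by apply: filterS => q cq; rewrite hy1.
have ny1 b : \forall q \near p, y1 b q = cfun c1 q 0 b.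
  have : \forall q \near p, cdom c1 q by apply: open_nbhs_nbhs; split => //; exact: cdom_open.
  by apply: filterS => q cq; rewrite hy1.
have dylt (b : 'I_m) : (b < n)%N -> dfun c1 (y b) p = delta_mx 0 b.
  move=> bn; rewrite -dy1 /y1 (_ : s b = b) ?dfun_centered //.
  by rewrite (_ : b = widen_ord hk (Ordinal bn)) ?sw //; exact: val_inj.
have dB b b' : dfun c1 (y1 b - Phi b) p 0 b' = (b == b')%:R - dfun c1 (Phi b) p 0 b'.
  rewrite -scaleN1r dfunD // -csf_scale dfunZ // scaleN1r mxE [X in _ + X]mxE dy1.
  by rewrite mxE eqxx /= eq_sym.
have J : \det (\matrix_(b, i) dfun c1 (y2 b) p 0 i) != 0.
  rewrite det_trig; last first.
    apply/is_trig_mxP => b b' bb; rewrite mxE /y2; case: ifP => bn.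
      by rewrite dylt // mxE eqxx /= -(inj_eq val_inj) /= gtn_eqF.
    case: ifP => [/eqP bn'|bn']; first by rewrite dPsi // -bn'.
    rewrite dB; case: (hPhi b) => _ -> //.
      by rewrite subr0 -(inj_eq val_inj) /= ltn_eqF.
    apply: leq_trans bb; rewrite ltnS leqNgt bn //.
  apply/prodf_neq0 => b _; rewrite mxE /y2; case: ifP => bn.
    by rewrite dylt // mxE !eqxx oner_eq0.
  case: ifP => [/eqP bn'|bn'].
    have eh := nbhs_singleton he; have cq := nbhs_singleton nc.
    have bb : b = b0 by exact: val_inj.
    have := nbhs_singleton DPsi ord_max; rewrite (derE (dD _) Psi cc1 c1p ny1).
    rewrite (bigD1 b0) // big1 ?Monoid.mulm1 => [|b' /andP[_ bw]]; last first.
      have [b'n|b'n] := ltnP b' n.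
        have -> : b' = w1 (lift ord_max (Ordinal b'n)) by rewrite w1l; exact: val_inj.
        by rewrite Dy // (negPf (neq_lift _ _)) mulr0.
      rewrite dPsi ?mul0r // ltn_neqAle b'n andbT; apply: contra bw => /eqP nb.
      by apply/eqP; exact: val_inj.
    rewrite -w1m Dy // eqxx mulr1 w1m -bb /G eqxx => ->.
    by case: (mul1_neq0 eh).
  rewrite dB eqxx; case: (hPhi b) => _ -> //; rewrite ?subr0 ?oner_eq0 //.
  by rewrite ltn_neqAle eq_sym bn' leqNgt bn.
have nN : \forall q \near p, [/\ e q * Z (y a) q = 1, forall l, D l Psi q = G l q &
    forall b l, D l (Phi b) q = D l (y1 b) q].
  have nP : \forall q \near p, forall b l, D l (Phi b) q = D l (y1 b) q.
    by apply: filter_forall => b; case: (hPhi b).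
  by near=> q; split; near: q.
have [c' [cc' c'p c'O hy']] := chart_of cc1 c1p nN J.
exists c', h1, y2.
have y2w j : y2 (widen_ord hk j) = x j by rewrite /y2 /= ltn_ord.
have y2b : y2 b0 = Psi by rewrite /y2 ltnn eqxx.
have y2x : (fun j => y2 (widen_ord hk j)) = x by apply/funext => j.
have y2u : (fun j => y2 (w1 j)) = upd t ord_max Psi.
  apply/funext => l; case: (unliftP ord_max l) => [i ->|->].
    by rewrite w1l y2w tmax.
  by rewrite w1m y2b upd_same.
have gen q : cdom c' q -> [/\ cdom c q, e q != 0, Z Psi q = 1, forall (b : 'I_m) i, (n <= b)%N -> X i (y2 b) q = 0 &
    forall (b : 'I_m), (n < b)%N -> Z (y2 b) q = 0].
  move=> /c'O[[eh DP DPhi] /cd1 cq]; have [e0 z0] := mul1_neq0 eh.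
  split=> // [|b i nb|b nb].
  - have := DP ord_max; rewrite Dmax sfM /G eqxx => E1; apply: (mulfI e0).
    by rewrite E1 mulr1.
  - rewrite /y2 ltnNge nb /=; case: ifP => [_|_].
      by rewrite -Dlift DP /G eq_sym (negPf (neq_lift _ _)) sf0.
    by rewrite -Dlift (derB (dD _)) sfB DPhi subrr.
  - have -> : y2 b = y1 b - Phi b by rewrite /y2 ltnNge (ltnW nb) /= gtn_eqF.
    have E1 : D ord_max (y1 b - Phi b) q = 0 by rewrite (derB (dD _)) sfB DPhi subrr.
    by move: E1; rewrite Dmax sfM => E1; apply: (mulfI e0); rewrite E1 mulr0.
split => // q c'q; have [cq e0 Z1 X0 Z0] := gen q c'q.
  rewrite y2x; split=> [|b nb i]; [by case: (hG cq)|exact: X0].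
rewrite y2u; split=> // b nb i; apply: Del_kill => //; first exact: Z0.
by move=> l; apply: X0; exact: ltnW.
Unshelve. all: by end_near. Qed.

End Transverse.

End Decomposition.

(** * Brackets on functions and on [smfun] *)

Section Snoc.
Variables (T : Type) (k : nat) (k0 : (0 < k)%N).

Definition slast : 'I_k := Ordinal (etrans (ltn_predL k) k0).

Lemma upd_slast (x : 'I_k -> T) h :
  upd x slast h = snoc (fun j : 'I_k.-1 => x (widen_ord (leq_pred k) j)) h.
Proof.
apply/funext => j; rewrite updE /snoc; case: insubP => [l lj e|nj] /=.
  have -> : (j == slast) = false by rewrite -(inj_eq val_inj) /= ltn_eqF.
  by congr x; apply: val_inj; rewrite /= e.
case: eqP => // /eqP; rewrite -(inj_eq val_inj) /= => jk.
by have := ltn_ord j; lia.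
Qed.

Lemma snocE (f : 'I_k.-1 -> T) h h' : snoc f h = upd (snoc f h') slast h.
Proof.
rewrite upd_slast; congr snoc; apply/funext => j; rewrite /snoc /=.
by rewrite insubT //= => jk; congr f; exact: val_inj.
Qed.

End Snoc.

Lemma fcons_eta (T : Type) n (y : 'I_n.+1 -> T) : y = fcons (y ord0) (fun j => y (lift ord0 j)).
Proof. by apply/funext => j; case: (unliftP ord0 j) => [l ->|->]; rewrite ?fcons_lift ?fcons0. Qed.

Section BracketOperations.
Context (R : realType) (m : nat) (M : manifold R m).
Local Notation V := (smfun M).

Section JacobiPermutation.
Variables (k : nat) (B : ('I_k -> V) -> V).
Hypothesis Blin : forall (x : 'I_k -> V) i (t : R) u v,
  B (upd x i (t *: u + v)) = t *: B (upd x i u) + B (upd x i v).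
Hypothesis Bskew : forall (s : 'S_k) (x : 'I_k -> V), B (fun j => x (s j)) = (-1) ^+ s *: B x.
Implicit Types x g : 'I_k -> V.

Lemma BZ x i t u : B (upd x i (t *: u)) = t *: B (upd x i u).
Proof. by rewrite -[t *: u]addr0 Blin (B0 Blin) addr0. Qed.

Lemma jac_permx (s : 'S_k) x i g : jac B (fun j => x (s j)) i g = (-1) ^+ s *: jac B x (s i) g.
Proof.
rewrite /jac scalerBr upd_perm Bskew scaler_sumr; congr (_ - _).
by apply: eq_bigr => j _; rewrite upd_perm Bskew BZ.
Qed.

Lemma jac_permg (s : 'S_k) x i g : jac B x i (fun j => g (s j)) = (-1) ^+ s *: jac B x i g.
Proof.
rewrite /jac scalerBr Bskew BZ scaler_sumr; congr (_ - _).
rewrite [RHS](reindex_inj (@perm_inj _ s)) /=.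
by apply: eq_bigr => j _; rewrite upd_perm Bskew.
Qed.

Lemma jac_slot i' : (forall x g, jac B x i' g = 0) -> forall x i g, jac B x i g = 0.
Proof.
move=> h x i g; have := h (fun j => x (tperm i i' j)) g.
rewrite jac_permx tpermR => /(congr1 (fun v => (-1) ^+ tperm i i' *: v)).
by rewrite scalerA -expr2 sqrr_sign scale1r scaler0.
Qed.

(** Permuting each group moves the common entries to prescribed slots and changes the defect by
    signs only. *)
Lemma jac_common i' s' : (forall x i g, i' != i -> x i' = g s' -> jac B x i g = 0) ->
  forall x i g l s, l != i -> x l = g s -> jac B x i g = 0.
Proof.
move=> h x i g l s li xg.
have := h (fun j => x (tperm l i' j)) (tperm l i' i) (fun j => g (tperm s s' j)).
rewrite jac_permx jac_permg tpermK !tpermR.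
have -> : i' != tperm l i' i.
  by apply: contra li => /eqP e; rewrite -(inj_eq (@perm_inj _ (tperm l i'))) tpermL -e.
move=> /(_ isT xg) /(congr1 (fun v => (-1) ^+ tperm s s' *: ((-1) ^+ tperm l i' *: v))).
have sg (b : bool) (v : V) : (-1) ^+ b *: ((-1) ^+ b *: v) = v.
  by rewrite scalerA -expr2 sqrr_sign scale1r.
by rewrite !scaler0 !sg.
Qed.

End JacobiPermutation.

(** The identity of the bracket has one more term, in which the bracket replacing the common entry
    [f] itself contains [f] twice. *)
Lemma jac_contraction n (B : ('I_n.+1 -> V) -> V) f (x : 'I_n -> V) i g :
  (forall (x : 'I_n.+1 -> V) i (t : R) u v,
    B (upd x i (t *: u + v)) = t *: B (upd x i u) + B (upd x i v)) ->
  (forall (s : 'S_n.+1) (x : 'I_n.+1 -> V), B (fun j => x (s j)) = (-1) ^+ s *: B x) ->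
  jac (fun x => B (fcons f x)) x i g = jac B (fcons f x) (lift ord0 i) (fcons f g).
Proof.
move=> Blin Bskew; rewrite /jac fcons_upd big_ord_recl fcons0; congr (_ - _).
rewrite (Brep Bskew (x := upd (fcons f x) (lift ord0 i) f) (neq_lift ord0 i)); last first.
  by rewrite upd_same upd_other ?neq_lift // fcons0.
rewrite (B0 Blin) add0r; apply: eq_bigr => j _.
by rewrite fcons_lift !fcons_upd.
Qed.

Section Bridge.
Variables (k : nat) (B : bracket M k).
Hypothesis hB : is_bracket B.

Definition sfbr (x : 'I_k -> V) : V := mksf (bracket_smooth hB (fun i => sf_smooth (x i))).

Lemma sfbrE x p : sfbr x p = B (fun j => x j) p.
Proof. by []. Qed.

Lemma sfv_upd (x : 'I_k -> V) i (u : V) (h : M -> R) : (forall p, u p = h p) ->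
  (fun j => upd x i u j : M -> R) = [eta (fun j => x j : M -> R) with i |-> h].
Proof.
move=> uh; apply/funext => j; rewrite updE /=; case: ifP => // _; exact/funext.
Qed.

Lemma sfbr_lin x i (t : R) u v :
  sfbr (upd x i (t *: u + v)) = t *: sfbr (upd x i u) + sfbr (upd x i v).
Proof.
apply: sfext => p; rewrite sfD sfZ !sfbrE (@sfv_upd x i (t *: u + v) (fun q => t * u q + v q)); last first.
  by move=> q; rewrite sfD sfZ.
rewrite (bracket_linear hB) => [|j||]; try exact: sf_smooth.
by rewrite -(@sfv_upd x i u) // -(@sfv_upd x i v).
Qed.

Lemma sfbr_skew (s : 'S_k) x : sfbr (fun j => x (s j)) = (-1) ^+ s *: sfbr x.
Proof.
apply: sfext => p; rewrite sfZ !sfbrE -(bracket_skew hB) // => j; exact: sf_smooth.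
Qed.

Lemma not_supp (f : M -> R) p : ~ supp f p <-> \forall q \near p, f q = 0.
Proof.
split=> [ns|n0 sp].
  have : \forall q \near p, (~` supp f) q.
    by apply: open_nbhs_nbhs; split => //; apply: closed_openC; exact: closed_closure.
  apply: filterS => q nq; apply/eqP; apply: contrapT => /negP fq.
  by apply: nq; exact: subset_closure.
by have [q [/= /eqP]] := sp _ n0.
Qed.

Lemma is_localP : is_local B <->
  forall (x : 'I_k -> V) i p, (\forall q \near p, x i q = 0) -> sfbr x p = 0.
Proof.
split=> [loc x i p n0|loc f hf i p].
  apply/eqP; apply: contrapT => /negP Bp; apply: ((not_supp (x i) p).2 n0).
  apply: (loc (fun j => x j)) => [j|]; [exact: sf_smooth|exact: subset_closure].
move=> sB; apply: contrapT => /not_supp n0; apply: (_ : ~ supp (B f) p) sB; apply/not_supp.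
apply: filterS (nbhs_interior n0) => q nq.
exact: (loc (fun j => mksf (hf j)) i q).
Qed.

Lemma sfv_snoc (f : 'I_k.-1 -> V) (u : V) (h : M -> R) : (forall p, u p = h p) ->
  (fun j => snoc f u j : M -> R) = snoc (fun j => f j : M -> R) h.
Proof. by move=> uh; apply/funext => j; rewrite /snoc; case: insub => //=; exact/funext. Qed.

(** Passes between [k - 1] outer arguments with an appended last one and [k] arguments with a
    placeholder; skew-symmetry extends the identity from the last slot to every slot. *)
Lemma jacobiP : (0 < k)%N -> jacobi_on setT B <-> forall x i g, jac sfbr x i g = 0.
Proof.
move=> k0.
have key (f : 'I_k.-1 -> V) (g : 'I_k -> V) p x : (forall h, upd x (slast k0) h = snoc f h) ->
    jac sfbr x (slast k0) g p = B (snoc (fun j => f j : M -> R) (B (fun j => g j : M -> R))) p -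
    \sum_(i < k) B [eta (fun j => g j : M -> R) with i |-> B (snoc (fun j => f j : M -> R) (g i))] p.
  move=> hx; rewrite /jac sfB sf_sum !hx sfbrE (@sfv_snoc _ _ (B (fun j => g j : M -> R))) //.
  congr (_ - _); apply: eq_bigr => i _; rewrite sfbrE.
  rewrite (@sfv_upd _ _ _ (B (snoc (fun j => f j : M -> R) (g i)))) // => q.
  by rewrite hx sfbrE (@sfv_snoc _ _ (g i)).
split=> [jac0|jac0 f g hf hg p _].
  apply: (jac_slot sfbr_lin sfbr_skew (i' := slast k0)) => x g; apply: sfext => p.
  rewrite (key _ _ _ _ (upd_slast k0 x)) jac0 ?subrr // => j; exact: sf_smooth.
have := key (fun j => mksf (hf j)) (fun j => mksf (hg j)) p (snoc (fun j => mksf (hf j)) 0).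
move=> /(_ (fun h => esym (snocE k0 _ h 0))); rewrite jac0 => /esym/eqP.
by rewrite subr_eq0 => /eqP.
Qed.

End Bridge.

Lemma mv_contract_germ k (L : mvfield M k) (f g : 'I_k -> M -> R) (p : M) :
  (forall j, \forall q \near p, f j q = g j q) ->
  \forall q \near p, mv_contract L f q = mv_contract L g q.
Proof.
move=> fg; have n1 : \forall q \near p, forall j, \forall q' \near q, f j q' = g j q'.
  by apply: filter_forall => j; apply: filterS (nbhs_interior (fg j)) => q.
apply: filterS n1 => q nq; rewrite /mv_contract; congr (L _ _ _); apply/funext => j.
by have [cc cq] := chart_atP q; exact: dfun_germ.
Qed.

Section MultiderivationField.
Variables (k : nat) (C : ('I_k -> V) -> V).
Hypothesis mC : mderivation C.
Hypothesis k0 : (0 < k)%N.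
Variable U : set M.
Hypothesis oU : open U.
Hypothesis jacC : forall q, U q -> forall x i g,
  C (upd x i (C g)) q = \sum_s C (upd g s (C (upd x i (g s)))) q.

Lemma mvf_contract_germ (f : 'I_k -> M -> R) (g : 'I_k -> V) (p : M) :
  (forall j, \forall q \near p, f j q = g j q) ->
  \forall q \near p, mv_contract (mvf_of mC) f q = C g q.
Proof.
move=> fg; apply: filterS (mv_contract_germ (mvf_of mC) fg) => q ->.
by rewrite mv_contractE.
Qed.

(** The functions are smooth on [U] only, so at each point they are replaced by global functions
    with the same germs. *)
Lemma mvf_jacobi : jacobi_on U (mv_contract (mvf_of mC)).
Proof.
move=> f g hf hg p Up.
have ef j := sf_extend ((smooth_onP (f j) oU).1 (hf j) _ Up).
have eg j := sf_extend ((smooth_onP (g j) oU).1 (hg j) _ Up).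
have [f' hf'] := boolp.choice ef; have [g' hg'] := boolp.choice eg.
have nE (h h' : M -> R) : (\forall q \near p, h q = h' q) -> \forall q \near p, h' q = h q.
  by apply: filterS.
have ns (h : M -> R) (h' : V) : (\forall q \near p, h q = h' q) ->
    \forall q \near p, mv_contract (mvf_of mC) (snoc f h) q = C (snoc f' h') q.
  move=> hh; apply: mvf_contract_germ => j; rewrite /snoc; case: insub => //= l.
  exact/nE/hf'.
rewrite (nbhs_singleton (ns _ (C g') _)); last by apply: mvf_contract_germ => j; exact/nE.
rewrite (snocE k0 _ _ 0) jacC //; apply: eq_bigr => i _.
rewrite (nbhs_singleton (mvf_contract_germ (g := upd g' i (C (snoc f' (g' i)))) _)).
  by rewrite (snocE k0 _ (g' i) 0).
move=> j; rewrite updE /=; case: ifP => _; last exact/nE.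
by apply: ns; exact/nE.
Qed.

Lemma mvf_locally_wedge : (forall q, pluecker (fun x => C x q)) ->
  locally_coord_wedge_on U (mvf_of mC).
Proof.
move=> pl p Up nv; have [f0 Cf0] : exists f0, C f0 p != 0.
  apply: contrapT => nf; apply: nv; apply/vanishes_atP => f.
  by apply/eqP; apply: contrapT => /negP Cf; apply: nf; exists f.
have nU : nbhs p U by exact: open_nbhs_nbhs.
have [|c [hk [y [cc cp cU hy hC]]]] := normal_form mC k0 pl _ Cf0 nU.
  by apply: filterS nU => q; exact: jacC.
exists c; split=> //; exists hk; apply: wedge_of_kernel cc hy _ => q cq.
by case: (hC q cq).
Qed.

End MultiderivationField.

(** The matrix factors as [W^T *m J *m W], with [J] the standard symplectic matrix of size 2 and [W]
    two rows of an invertible transition matrix. *)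
Lemma wedge_rank k (L : mvfield M k) (hk : (k <= m)%N) c p : k = 2%N -> coords c -> cdom c p ->
  equals_coord_wedge L hk c -> bivector_rank L p = 2%N.
Proof.
move=> k2; move: L hk; rewrite k2 => L hk cc cp hL.
have [cc' c'p] := chart_atP p; set T := transition_mx c (chart_at p) p.
have uT : T \in unitmx by exact: transition_unit.
pose w := widen_ord hk; pose W : 'M[R]_(2, m) := rowsub w T^T.
pose J : 'M[R]_2 := \matrix_(a, b) (if a == b then 0 else (-1) ^+ a).
have fW : row_free W.
  apply/row_freeP; exists (colsub w (invmx T^T)); rewrite mul_rowsub_mx mulmx_colsub.
  rewrite mulmxV ?unitmx_tr //; apply/matrixP => a b; rewrite !mxE.
  by rewrite -(inj_eq val_inj).
have fJ : row_free J.
  apply/row_freeP; exists J^T; apply/matrixP => a b; rewrite !mxE !big_ord_recl big_ord0 !mxE.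
  case: a b => [[|[|a]] // ia] [[|[|b]] // ib]; rewrite -!(inj_eq val_inj) /=;
    by rewrite ?expr0 ?expr1; ring.
rewrite /bivector_rank (_ : \matrix_(i, j) _ = W^T *m (J *m W)).
  rewrite mulmxA mxrankMfree // mxrankMfree // mxrank_tr; exact/eqP.
apply/matrixP => i j; rewrite mxE (mv_change _ cc cc' cp c'p) hL // /coord_wedge.
rewrite (_ : \matrix_(a, b) _ = \matrix_(a < 2, b < 2) T (if a == 0%N :> nat then i else j) (w b)).
  rewrite (expand_det_row _ ord0) !big_ord_recl big_ord0 /cofactor !det_mx11 !mxE.
  rewrite !big_ord_recl !big_ord0 !mxE !big_ord_recl !big_ord0 !mxE -!(inj_eq val_inj) /=.
  by rewrite ?expr0 ?expr1; ring.
by apply/matrixP => a b; rewrite mxE [RHS]mxE -/T; case: ifP => _; rewrite -rowE mxE.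
Qed.

(** * Brackets and their contractions *)

Section Contraction.
Variables (n : nat) (B : bracket M n.+1).
Hypothesis hB : is_bracket B.

Definition bracket_contraction (f : M -> R) : bracket M n := fun g => B (fcons f g).

Lemma smooth_fcons (f : M -> R) (g : 'I_n -> M -> R) : smooth f ->
  (forall i, smooth (g i)) -> forall i, smooth (fcons f g i).
Proof. by move=> sf sg i; case: (unliftP ord0 i) => [l ->|->]; rewrite ?fcons_lift ?fcons0. Qed.

Lemma is_bracket_contraction f : smooth f -> is_bracket (bracket_contraction f).
Proof.
move=> sf; split=> [g sg|i g t u v sg su sv p|s g sg p].
- by apply: (bracket_smooth hB); exact: smooth_fcons.
- rewrite /bracket_contraction -!/(upd _ _ _) !fcons_upd.
  by apply: (bracket_linear hB) => //; exact: smooth_fcons.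
- have e : lift_perm ord0 ord0 s = s :> bool by rewrite odd_lift_perm.
  rewrite /bracket_contraction -[in RHS]e -(bracket_skew hB); last exact: smooth_fcons.
  congr (B _ p); apply/funext => j; case: (unliftP ord0 j) => [l ->|->].
    by rewrite lift_perm_lift !fcons_lift.
  by rewrite lift_perm_id !fcons0.
Qed.

Lemma sfbr_contraction (f : V) (hf : is_bracket (bracket_contraction f)) x :
  sfbr hf x = sfbr hB (fcons f x).
Proof.
apply: sfext => p; rewrite !sfbrE /bracket_contraction; congr (B _ p); apply/funext => j.
by case: (unliftP ord0 j) => [l ->|->]; rewrite ?fcons_lift ?fcons0.
Qed.

Lemma jac_sfbr_contraction (f : V) (hf : is_bracket (bracket_contraction f)) x i g :
  jac (sfbr hf) x i g = jac (sfbr hB) (fcons f x) (lift ord0 i) (fcons f g).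
Proof.
rewrite -(jac_contraction _ _ _ _ (sfbr_lin hB) (sfbr_skew hB)).
by congr (jac _ x i g); apply/funext => y; exact: sfbr_contraction.
Qed.

(** The converse is the substantial direction: the identities of the contractions give the Jacobi
    identity for groups with a common entry, and [bracket_jacobi] removes that restriction. *)
Lemma nambu_jacobi_contraction : (2 < n.+1)%N ->
  nambu_jacobi B <-> forall f : M -> R, smooth f -> nambu_jacobi (bracket_contraction f).
Proof.
move=> n2; have n0 : (0 < n)%N by exact: ltnW.
split=> [[_ _ /(jacobiP hB (ltn0Sn n)) jB /(is_localP hB) lB] f sf|h].
  have bf := is_bracket_contraction sf; split=> //.
    apply/(jacobiP bf n0) => x i g.
    by rewrite (@jac_sfbr_contraction (mksf sf)) jB.
  apply/(is_localP bf) => x i p n1; rewrite (@sfbr_contraction (mksf sf)).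
  by apply: (lB _ (lift ord0 i)); rewrite fcons_lift.
have hf (f : V) : nambu_jacobi (bracket_contraction f) by apply: h; exact: sf_smooth.
(* The locally vanishing entry is first moved by a transposition to a slot which the contraction
   keeps. *)
have lB (x : 'I_n.+1 -> V) i p : (\forall q \near p, x i q = 0) -> sfbr hB x p = 0.
  move=> n1; pose i1 : 'I_n := Ordinal n0; pose s := tperm i (lift ord0 i1).
  have Bs : sfbr hB (fun j => x (s j)) p = 0.
    rewrite [X in sfbr hB X]fcons_eta -sfbr_contraction; first exact: nj_bracket (hf _).
    move=> bf; have /(is_localP bf) lf := nj_local (hf (x (s ord0))).
    by apply: (lf _ i1); rewrite /s tpermR.
  have : (-1) ^+ s *: sfbr hB (fun j => x (s j)) = sfbr hB x.
    by rewrite sfbr_skew scalerA -expr2 sqrr_sign scale1r.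
  by move=> <-; rewrite sfZ Bs mulr0.
have jB x i g : jac (sfbr hB) x i g = 0.
  apply: (bracket_jacobi n2 (sfbr_lin hB) (sfbr_skew hB) lB) => {x i g}.
  apply: (jac_common (sfbr_lin hB) (sfbr_skew hB) (i' := ord0) (s' := ord0)) => x i g.
  case: (unliftP ord0 i) => [l ->|->]; last by rewrite eqxx.
  move=> _ xg; rewrite (fcons_eta x) (fcons_eta g) -xg.
  have bf := nj_bracket (hf (x ord0)).
  by rewrite -(jac_sfbr_contraction bf) (jacobiP bf n0).1 //; exact: nj_jacobi (hf _).
by split; [exact: ltnW| |exact/(jacobiP hB (ltn0Sn n))|exact/(is_localP hB)].
Qed.

End Contraction.

(** * The structure theorem *)

Section Structure.
Variables (n : nat) (B : bracket M n.+1).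
Hypothesis n2 : (2 < n.+1)%N.
Hypothesis hB : is_bracket B.
Hypothesis nB : nambu_jacobi B.

Let b := sfbr hB.
Let Blin := sfbr_lin hB.
Let Bskew := sfbr_skew hB.
Let Bloc := (is_localP hB).1 (nj_local nB).
Let Bjac x i g (l s : 'I_n.+1) (_ : l != i) (_ : x l = g s) :=
  (jacobiP hB (ltn0Sn n)).1 (nj_jacobi nB) x i g.
Let mG := Gam_md n2 Blin Bskew Bloc Bjac.
Let mD := Del_md n2 Blin Bskew Bloc Bjac.
Let plG := Gam_pl n2 Blin Bskew Bloc Bjac.
Let plD := Del_pl n2 Blin Bskew Bloc Bjac.

Lemma nambu_jacobi_structure : exists (Delta : mvfield M n.+1) (Gamma : mvfield M n),
   [/\ forall f : 'I_n.+1 -> M -> R, (forall i, smooth (f i)) ->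
         forall p, B f p = mv_contract Delta f p + s_op Gamma f p,
       forall p, ~ vanishes_at Delta p -> ~ vanishes_at Gamma p ->
         exists c : chart R m M, [/\ coords c, cdom c p &
           exists (h1 : (n.+1 <= m)%N) (h2 : (n <= m)%N),
             equals_coord_wedge Delta h1 c /\ equals_coord_wedge Gamma h2 c],
       forall U : set M, open U -> (forall p, U p -> vanishes_at Gamma p) ->
         nambu_poisson_on U Delta /\ locally_coord_wedge_on U Delta
     & forall U : set M, open U -> (forall p, U p -> vanishes_at Delta p) ->
         [/\ nambu_poisson_on U Gamma,
             n.+1 = 3%N -> forall p, U p -> ~ vanishes_at Gamma p ->
               bivector_rank Gamma p = 2%N
           & locally_coord_wedge_on U Gamma]].
Proof.
have n0 : (0 < n)%N by exact: ltnW.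
have nv k (C : ('I_k -> V) -> V) (mC : mderivation C) p : ~ vanishes_at (mvf_of mC) p ->
    exists f, C f p != 0.
  move=> h; apply: contrapT => nf; apply: h; apply/vanishes_atP => f.
  by apply/eqP; apply: contrapT => /negP Cf; apply: nf; exists f.
have jacG q (x : 'I_n -> V) i (g : 'I_n -> V) :
    Gam b (upd x i (Gam b g)) q = \sum_s Gam b (upd g s (Gam b (upd x i (g s)))) q.
  by rewrite (Gam_jacobi n2 Blin Bskew Bloc Bjac) sf_sum.
exists (mvf_of mD), (mvf_of mG); split.
- move=> f hf p; pose x j := mksf (hf j); rewrite -[LHS]/(sfbr hB x p).
  rewrite (B_decomposition Bskew) sfD sf_sum -(mv_contractE mD); congr (_ + _).
  apply: eq_bigr => i _; rewrite sfM sfZ -(mv_contractE mG).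
  by rewrite mulrA [x i p * _]mulrC.
- move=> p /nv[g Dg] /nv[f Gf].
  (* [Gamma] is straightened first because it satisfies the Jacobi identity everywhere; for [Delta]
     this is known only where [Gamma] vanishes. *)
  have [|c [hk [y [cc cp _ hy hC]]]] := normal_form mG n0 plG _ Gf (@filterT _ (nbhs p) _).
    by apply: nearW => q; exact: jacG.
  have [c' [h1 [y' [cc' c'p hy' hG' hD']]]] :=
    transverse_form n2 Blin Bskew Bloc Bjac cc hy hC cp Dg.
  exists c'; split=> //; exists h1, hk; split.
    by apply: wedge_of_kernel cc' hy' _ => q cq; case: (hD' q cq).
  by apply: wedge_of_kernel cc' hy' _ => q cq; case: (hG' q cq).
- move=> U oU G0; have jacD q : U q -> forall x i (g : 'I_n.+1 -> V),
      Del b (upd x i (Del b g)) q = \sum_s Del b (upd g s (Del b (upd x i (g s)))) q.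
    apply: (Del_jacobi_near n2 Blin Bskew Bloc Bjac oU) => q' Uq'.
    by apply/(vanishes_atP mG); exact: G0.
  split; last exact: mvf_locally_wedge.
  by split; [exact: ltnW|exact: mvf_jacobi].
- move=> U oU D0; have lw : locally_coord_wedge_on U (mvf_of mG) by apply: mvf_locally_wedge.
  split=> //; first by split; [|exact: mvf_jacobi].
  move=> [n_2] p Up np; have [c [cc cp _ [hk hc]]] := lw p Up np.
  exact: wedge_rank cc cp hc.
Qed.

End Structure.

End BracketOperations.

Theorem theorem2 (R : realType) (m : nat) (M : manifold R m) (n : nat)
    (hn : (2 < n.+1)%N) (B : bracket M n.+1) (hB : is_bracket B) :
  (nambu_jacobi B <->
   forall f : M -> R, smooth f ->
     nambu_jacobi ((fun g => B (fcons f g)) : bracket M n))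
  /\
  (nambu_jacobi B ->
   exists (Delta : mvfield M n.+1) (Gamma : mvfield M n),
   [/\ forall f : 'I_n.+1 -> M -> R, (forall i, smooth (f i)) ->
         forall p, B f p = mv_contract Delta f p + s_op Gamma f p,
       forall p, ~ vanishes_at Delta p -> ~ vanishes_at Gamma p ->
         exists c : chart R m M, [/\ coords c, cdom c p &
           exists (h1 : (n.+1 <= m)%N) (h2 : (n <= m)%N),
             equals_coord_wedge Delta h1 c /\ equals_coord_wedge Gamma h2 c],
       forall U : set M, open U -> (forall p, U p -> vanishes_at Gamma p) ->
         nambu_poisson_on U Delta /\ locally_coord_wedge_on U Delta
     & forall U : set M, open U -> (forall p, U p -> vanishes_at Delta p) ->
         [/\ nambu_poisson_on U Gamma,
             n.+1 = 3%N -> forall p, U p -> ~ vanishes_at Gamma p ->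
               bivector_rank Gamma p = 2%N
           & locally_coord_wedge_on U Gamma]]).
Proof.
split; first exact: nambu_jacobi_contraction.
by move=> nB; exact: nambu_jacobi_structure.
Qed.
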